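(* Let $d\ge 1$, $0<\beta\le 1$, $p>1$, and let $f:\mathbb{R}\to\mathbb{R}$ satisfy $f(0)=0$ and, for some constants $C>0$, $\lambda>0$, $$|f(u)-f(v)|\le C|u-v|\left(e^{\lambda|u|^p}+e^{\lambda|v|^p}\right)\qquad\text{for all }u,v\in\mathbb{R}.$$ Let $u_0\in \exp L^p_0(\mathbb{R}^d)$. Then there exist $T=T(u_0)>0$ and a unique mild solution $u\in C([0,T],\exp L^p_0(\mathbb{R}^d))$ of the Cauchy problem $$\partial_t u+(-\Delta+|x|^2)^\beta u=f(u),\qquad u(x,0)=u_0(x).$$
   Context: $H=-\Delta+|x|^2$ is the Hermite operator on $\mathbb{R}^d$, with spectral decomposition $H=\sum_{k\ge0}(2k+d)P_k$, where $P_k$ is the orthogonal projection of $L^2(\mathbb{R}^d)$ onto the eigenspace of eigenvalue $2k+d$, i.e. $P_kg=\sum_{|\alpha|=k}\langle g,\Phi_\alpha\rangle\Phi_\alpha$ with $\Phi_\alpha$, $\alpha\in\mathbb{N}^d$, the normalized Hermite functions ($H\Phi_\alpha=(2|\alpha|+d)\Phi_\alpha$). The heat propagator of $H^\beta=(-\Delta+|x|^2)^\beta$ is $e^{-tH^\beta}g=\sum_{k\ge0}e^{-t(2k+d)^\beta}P_kg$. For $1\le p<\infty$, $\exp L^p(\mathbb{R}^d)$ is the space of $u\in L^1_{loc}(\mathbb{R}^d)$ with $\int_{\mathbb{R}^d}(e^{|u(x)|^p/\mu^p}-1)\,dx<\infty$ for some $\mu>0$, with the Luxemburg norm $\|u\|_{\exp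 L^p}=\inf\{\mu>0:\int_{\mathbb{R}^d}(e^{|u(x)|^p/\mu^p}-1)\,dx\le1\}$. The subspace $\exp L^p_0(\mathbb{R}^d)$ consists of those $u\in L^1_{loc}(\mathbb{R}^d)$ with $\int_{\mathbb{R}^d}(e^{a|u(x)|^p}-1)\,dx<\infty$ for every $a>0$, with the same norm. A mild solution on $[0,T]$ with $u_0\in\exp L^p_0(\mathbb{R}^d)$ is a function $u\in C([0,T],\exp L^p_0(\mathbb{R}^d))$ satisfying $u(t)=e^{-tH^\beta}u_0+\int_0^te^{-(t-s)H^\beta}f(u(s))\,ds$ for $t\in[0,T]$. *)

(* Defs.v *)
From HB Require Import structures.
From mathcomp Require Import all_boot all_order all_algebra.
From mathcomp Require Import all_classical all_reals all_analysis.

Set Implicit Arguments.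
Unset Strict Implicit.
Unset Printing Implicit Defensive.

Import Order.TTheory GRing.Theory Num.Theory.
Import numFieldNormedType.Exports.

Local Open Scope classical_set_scope.
Local Open Scope ring_scope.

Section lebesgue_on_tuples.
Context {R : realType}.

Definition tuple_cons n
    (xs : measurableTypeR R * n.-tuple (measurableTypeR R)) :
  n.+1.-tuple (measurableTypeR R) := [tuple of xs.1 :: xs.2].

Lemma measurable_tuple_cons n : measurable_fun setT (@tuple_cons n).
Proof. exact: measurable_cons. Qed.

HB.instance Definition _ n := isMeasurableFun.Build _ _ _ _
  (@tuple_cons n) (@measurable_tuple_cons n).

Section step.
Variables (n : nat)
  (m : {sigma_finite_measure set (n.-tuple (measurableTypeR R)) -> \bar R}).

Definition lebesgue_cons : set (n.+1.-tuple (measurableTypeR R)) -> \bar R :=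
  pushforward (@lebesgue_measure R \x m)%E (@tuple_cons n).

Let lebesgue_cons0 : lebesgue_cons set0 = 0%E.
Proof. exact: measure0. Qed.

Let lebesgue_cons_ge0 A : (0 <= lebesgue_cons A)%E.
Proof. exact: measure_ge0. Qed.

Let lebesgue_cons_sigma_additive : semi_sigma_additive lebesgue_cons.
Proof. exact: measure_semi_sigma_additive. Qed.

HB.instance Definition _ := isMeasure.Build _ _ _ lebesgue_cons
  lebesgue_cons0 lebesgue_cons_ge0 lebesgue_cons_sigma_additive.

Let lebesgue_cons_sigma_finite : sigma_finite setT lebesgue_cons.
Proof.
have /sigma_finiteP[F [TF ndF Foo]] := sigma_finiteT (@lebesgue_measure R).
have /sigma_finiteP[G [TG ndG Goo]] := sigma_finiteT m.
pose split_tuple (x : n.+1.-tuple (measurableTypeR R)) :=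
  (thead x, [tuple of behead x]).
have msplit : measurable_fun setT split_tuple.
  apply/measurable_fun_pairP; split; first exact: measurable_tnth.
  exact: measurable_behead.
have splitK : split_tuple \o @tuple_cons n = id.
  by apply/funext => -[x s] /=; congr pair; exact/val_inj.
exists (fun k => split_tuple @^-1` (F k `*` G k)).
  apply/esym; rewrite -subTset => x _.
  have [i _ Fi] : (\bigcup_k F k) (thead x) by rewrite -TF.
  have [j _ Gj] : (\bigcup_k G k) [tuple of behead x] by rewrite -TG.
  exists (maxn i j) => //; split.
  - exact: (subsetPset _ _ (ndF _ _ (leq_maxl i j))).
  - exact: (subsetPset _ _ (ndG _ _ (leq_maxr i j))).
move=> k; have [mF Fk] := Foo k; have [mG Gk] := Goo k; split.
  by rewrite -[X in measurable X]setTI; apply: msplit => //; exact: measurableX.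
rewrite /lebesgue_cons /pushforward -comp_preimage splitK preimage_id.
by rewrite product_measure1E// lte_mul_pinfty// ge0_fin_numE.
Qed.

HB.instance Definition _ := Measure_isSigmaFinite.Build _ _ _ lebesgue_cons
  lebesgue_cons_sigma_finite.

End step.

Fixpoint lebesgue_tuple (n : nat) :
    {sigma_finite_measure set (n.-tuple (measurableTypeR R)) -> \bar R} :=
  if n is n'.+1 then lebesgue_cons (lebesgue_tuple n')
  else \d_([tuple] : 0.-tuple (measurableTypeR R)).

(* The defining property of Lebesgue measure: boxes have the expected volume. *)
Lemma lebesgue_tuple_box n (A : 'I_n -> set (measurableTypeR R)) :
  (forall i, measurable (A i)) ->
  lebesgue_tuple n [set x | forall i, A i (tnth x i)] =
  (\prod_(i < n) lebesgue_measure (A i))%E.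
Proof.
elim: n A => [|n IHn] A mA.
  rewrite big_ord0 /= diracE mem_set//; by case.
rewrite big_ord_recl -(IHn (fun i => A (lift ord0 i)))//.
rewrite /= /lebesgue_cons /pushforward.
rewrite [X in product_measure1 _ _ X](_ : _ = A ord0 `*`
    [set x | forall i, A (lift ord0 i) (tnth x i)]).
  rewrite product_measure1E//.
  rewrite (_ : mkset _ = \bigcap_(i in [set: 'I_n])
      (fun x : n.-tuple (measurableTypeR R) => tnth x i) @^-1` A (lift ord0 i)).
    apply: fin_bigcap_measurable => // i _; rewrite -[X in measurable X]setTI.
    exact: measurable_tnth.
  by apply/seteqP; split => x /= h i; [move=> _|]; exact: h.
apply/seteqP; split => [[y x] /= h|[y x] /= [hy hx] i].
  split; first by have := h ord0; rewrite tnth0.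
  by move=> i; have := h (lift ord0 i); rewrite tnthS.
by case: (unliftP ord0 i) => [j|] ->; rewrite ?tnthS ?tnth0.
Qed.

End lebesgue_on_tuples.

Section hermite.
Context {R : realType}.

Fixpoint hermite_poly (n : nat) : {poly R} :=
  if n is n'.+1 then 'X * hermite_poly n' *+ 2 - (hermite_poly n')^`() else 1.

Definition hermite_fun (n : nat) (x : R) : R :=
  (Num.sqrt (2 ^+ n * n`!%:R * Num.sqrt pi))^-1
  * (hermite_poly n).[x] * expR (- (x ^+ 2 / 2)).

Context {d : nat}.
Local Notation Rd := (d.-tuple (measurableTypeR R)).
Local Notation mu := (@lebesgue_tuple R d).
Implicit Types (g : Rd -> R) (x : Rd).

Definition hermite_Phi (alpha : 'I_d -> nat) x : R :=
  \prod_(i < d) hermite_fun (alpha i) (tnth x i).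

Definition hermite_coef g (alpha : 'I_d -> nat) : R :=
  (\int[mu]_x (g x * hermite_Phi alpha x))%R.

(* The entries of a multi-index of length k are at most k, hence the finite
   index type {ffun 'I_d -> 'I_k.+1}. *)
Definition hermite_proj (k : nat) g x : R :=
  \sum_(alpha : {ffun 'I_d -> 'I_k.+1} | (\sum_(i < d) alpha i == k)%N)
    hermite_coef g (fun i => alpha i) * hermite_Phi (fun i => alpha i) x.

(* For t > 0 the series converges absolutely at every point for every g in some
   L^q, 1 <= q <= oo, since every L^r norm of Phi_alpha grows at most
   polynomially in |alpha|; this gives a meaning to e^{-tH^beta} g when g
   is not in L^2. At t = 0 the spectral sum is the identity operator, but its
   pointwise convergence may fail, so that case is set apart. *)
Definition hermite_heat (beta t : R) g x : R :=
  if t == 0 then g x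
  else limn (series (fun k =>
    expR (- (t * (2 * k + d)%:R `^ beta)) * hermite_proj k g x)).

End hermite.

Section exp_Lebesgue.
Context {R : realType} {d : nat}.
Local Notation Rd := (d.-tuple (measurableTypeR R)).
Local Notation mu := (@lebesgue_tuple R d).
Implicit Types (p : R) (u : Rd -> R).

(* Tuples carry no topology in the library: compactness is that of 'rV[R]_d. *)
Definition L1loc u := measurable_fun setT u /\
  forall K : set Rd, compact [set \row_(i < d) (tnth x i : R) | x in K] ->
    mu.-integrable K (EFin \o u).

Definition expLp0 p u := L1loc u /\
  forall a : R, 0 < a ->
    (\int[mu]_x (expR (a * (`|u x| `^ p)) - 1)%:E < +oo)%E.

Definition luxemburg_norm p u : \bar R :=
  ereal_inf [set m%:E | m in [set m : R | 0 < m /\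
    (\int[mu]_x (expR ((`|u x| `^ p) / (m `^ p)) - 1)%:E <= 1)%E]].

(* u t is a representative of an a.e. class; values for t outside [0, T] are
   irrelevant. *)
Definition continuous_expLp0 p (T : R) (u : R -> Rd -> R) :=
  (forall t, t \in `[0, T] -> expLp0 p (u t)) /\
  (forall t, t \in `[0, T] ->
    luxemburg_norm p (u s \- u t) @[s --> within `[0, T] (nbhs t)] --> 0%E).

(* The time integral is taken pointwise in x. For s < t the integrand at x
   depends only on the a.e. class of u s. *)
Definition mild_solution (beta p : R) (f : R -> R) (u0 : Rd -> R) (T : R)
    (u : R -> Rd -> R) :=
  continuous_expLp0 p T u /\
  forall t, t \in `[0, T] ->
    {ae mu, forall x,
      (@lebesgue_measure R).-integrable `[0, t]
        (fun s => (hermite_heat beta (t - s) (f \o u s) x)%:E) /\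
      u t x = hermite_heat beta t u0 x +
        (\int[@lebesgue_measure R]_(s in `[0, t])
           hermite_heat beta (t - s) (f \o u s) x)%R}.

End exp_Lebesgue.

(* Main.v *)
(* By Mehler's formula the kernel of e^{-hH} is an explicit Gaussian product; it
   is positive, has mass at most 1, is an approximate identity as h -> 0, and
   bounds the kernels of the P_k by a polynomial in k times an integrable weight
   D(x) D(y). Hence e^{-tH^beta} has a kernel K_t <= C t^{-A} D(x) D(y) to which
   the spectral series converges absolutely. For 0 < beta <= 1 the function
   z |-> exp(-t z^beta), z = 2k + d, is a uniform limit of polynomials with
   nonnegative coefficients in exp(-h z) (binomial series of (1 - X)^beta), so
   K_t is again positive with mass at most 1, and e^{-tH^beta} is strongly
   continuous on L^1.

   By Jensen's inequality such a K_t contracts every integral of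
   exp(a |u|^p) - 1. With U(t) = e^{-tH^beta} u_0, the difference w = u - U
   solves w(t) = int_0^t e^{-(t-s)H^beta} f(U(s) + w(s)) ds. For w bounded by 1,
   |f(U + w)| is at most a constant times 1 + G with G = exp(a |U|^p) - 1, which
   lies in every L^q because u_0 is in exp L^p_0; high powers q turn the
   singularity t^{-A} into the integrable t^{-1/2}, and Picard iteration
   converges in the sup norm on a short time interval. For uniqueness,
   continuity in exp L^p bounds the relevant exponential integrals uniformly in
   time, so the difference of two mild solutions is bounded, and in the sup norm
   with weight e^{-gamma t} the Duhamel map is a contraction. *)
Require Import Defs.
From HB Require Import structures.
From mathcomp Require Import all_boot all_order all_algebra.
From mathcomp Require Import all_classical all_reals all_analysis.
From mathcomp Require Import measurable_realfun ring lra zify.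
Import Order.TTheory GRing.Theory Num.Theory.
Import numFieldNormedType.Exports.
Local Open Scope classical_set_scope.
Local Open Scope ring_scope.
Set Implicit Arguments.
Unset Strict Implicit.
Unset Printing Implicit Defensive.

(** * Hermite functions and Mehler's formula *)

(** The data are not in L^2 and the nonlinearity is exponential, so Hilbert-space spectral calculus
    says little: every linear estimate is read off pointwise bounds on the kernels of the spectral
    projections. Mehler's formula itself is proved as an identity of power series in r: the
    three-term recurrence makes the series solve a first-order linear equation in r. Perturbing
    around U is forced: the Lipschitz constant of f along an unbounded u is unbounded, whereas |w|
    <= 1 lets U alone carry the exponential. Since w must also be continuous in exp L^p over a space
    of infinite measure, the iteration carries a second invariant, a bound on the integral of |w|^p;
    for bounded functions this integral controls every exponential one. Weight escaping to large
    times in the polynomial approximation would spoil L^1 continuity at t = 0; the lowest eigenvalue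
    detects it. The kernel (t-s)^(-3/4) replaces (t-s)^(-1/2): it is still integrable, and the spare
    power 1/4 becomes the factor gamma^(-1/4) that makes the weighted Duhamel map contract. *)

Section power_series.
Context {R : realType}.
Implicit Types (c : R^nat) (r x : R).

(** Radius of convergence at least 1, in Abel's form: bounded terms are easier to verify than
    convergence, and comparison with a geometric series at a slightly larger radius gives the
    convergence back. *)
Definition unit_disc c :=
  forall r, 0 <= r < 1 -> exists M, forall n, `|c n| * r ^+ n <= M.

Lemma unit_disc_normed_cvg c r : unit_disc c -> `|r| < 1 ->
  cvgn (pseries (fun n => `|c n|) r).
Proof.
move=> hc r1.
pose s := (`|r| + 1) / 2.
have s01 : 0 <= s < 1 by rewrite /s; have := normr_ge0 r; lra.
have [M hM] := hc s s01.
have rs : `|r| < s by rewrite /s; lra.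
have s0 : 0 < s by apply: le_lt_trans rs.
apply: normed_cvg.
apply: (@series_le_cvg _ _ (geometric M (`|r| / s))).
- by move=> n /=.
- move=> n /=; apply: mulr_ge0; last by rewrite exprn_ge0// divr_ge0// ltW.
  by apply: le_trans (hM 0%N); rewrite mulr_ge0// exprn_ge0// ltW.
- move=> n /=; rewrite normrM normr_id normrX exprMn exprVn.
  rewrite mulrA ler_pdivlMr ?exprn_gt0// mulrAC ler_wpM2r ?exprn_ge0//.
- apply: is_cvg_geometric_series; rewrite ger0_norm ?divr_ge0// ?ltW//.
  by rewrite ltr_pdivrMr// mul1r.
Qed.

Lemma unit_disc_cvg c r : unit_disc c -> `|r| < 1 -> cvgn (pseries c r).
Proof.
move=> hc r1; apply: normed_cvg; rewrite /normed_series_of /=.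
have := @unit_disc_normed_cvg c `|r| hc; rewrite normr_id => /(_ r1).
rewrite (_ : (fun n => `|c n * r ^+ n|) = (fun n => `|c n| * `|r| ^+ n))//.
by apply/funext => n; rewrite normrM normrX.
Qed.

(** The factor n produced by termwise differentiation is paid for by enlarging the radius from [r]
    to [s]. *)
Lemma natmul_expr_le (r s : R) n : 0 <= r -> r <= s ->
  n%:R * (s - r) * r ^+ n <= r * s ^+ n.
Proof.
move=> r0 rs; have s0 : 0 <= s := le_trans r0 rs.
elim: n => [|n IH]; first by rewrite !mul0r mulr_ge0.
have h1 : r ^+ n <= s ^+ n by rewrite lerXn2r.
have h2 : (s - r) * r * r ^+ n <= (s - r) * r * s ^+ n.
  by rewrite ler_wpM2l// mulr_ge0// subr_ge0.
have h3 := ler_wpM2l r0 IH.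
rewrite -natr1 !exprS.
lra.
Qed.

Lemma unit_disc_diffs c : unit_disc c -> unit_disc (pseries_diffs c).
Proof.
move=> hc r /andP[r0 r1].
have [r00|rn0] := eqVneq r 0.
  exists (`|pseries_diffs c 0|) => -[|n]; rewrite r00 ?expr0 ?mulr1//.
  by rewrite expr0n/= mulr0.
have rp : 0 < r by rewrite lt_def rn0.
pose s := (r + 1) / 2.
have s01 : 0 <= s < 1 by rewrite /s; lra.
have s0 : 0 < s by rewrite /s; lra.
have rs : 0 < s - r by rewrite /s; lra.
have [M hM] := hc s s01.
exists (M / (s - r)) => n; rewrite ler_pdivlMr// /pseries_diffs.
rewrite normrM normr_nat; apply: le_trans (hM n.+1).
have h : n.+1%:R * (s - r) * r ^+ n <= s ^+ n.+1.
  rewrite -(ler_pM2l rp); apply: le_trans (@natmul_expr_le r s n.+1 r0 _).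
    by rewrite exprS; lra.
  by rewrite -subr_ge0 ltW.
have := ler_wpM2l (normr_ge0 (c n.+1)) h.
lra.
Qed.

Definition psum c r : R := limn (pseries c r).

Lemma is_derive_psum c r : unit_disc c -> `|r| < 1 ->
  is_derive r (1 : R) (psum c) (psum (pseries_diffs c) r).
Proof.
move=> hc r1.
pose s := (`|r| + 1) / 2.
have s1 : `|s| < 1 by rewrite ger0_norm /s; have := normr_ge0 r; lra.
have rs : `|r| < `|s|.
  by rewrite [ltRHS]ger0_norm /s; have := normr_ge0 r; lra.
apply: (@pseries_snd_diffs _ c s) => //; apply: unit_disc_cvg => //.
  exact: unit_disc_diffs.
exact/unit_disc_diffs/unit_disc_diffs.
Qed.

Lemma psum0 c : psum c 0 = c 0%N.
Proof.
apply: (@lim_near_cst R^o) => //; near=> n.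
rewrite /pseries /series /= -[n]prednK; last by near: n; exists 1%N.
rewrite big_nat_recl//= expr0 mulr1 big1 ?addr0// => i _.
by rewrite exprS mul0r mulr0.
Unshelve. all: by end_near. Qed.

(** Multiplication by the variable, on coefficients. It turns a recurrence with shifted indices into
    a linear identity between sums of series. *)
Definition pshift c : R^nat := fun n => if n is m.+1 then c m else 0.

Lemma cvg_pshift c r : cvgn (pseries c r) ->
  pseries (pshift c) r @ \oo --> r * psum c r.
Proof.
move=> cc; rewrite -cvg_shiftS/=.
rewrite (_ : (fun n => _) = (fun n => r * pseries c r n)).
  by apply: cvgMl_tmp.
apply/funext => n; rewrite /pseries /series /=.
rewrite big_nat_recl//= mul0r add0r mulr_sumr; apply: eq_bigr => i _.
by rewrite exprS; ring.
Qed.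

Lemma pshiftE c r : cvgn (pseries c r) ->
  psum (pshift c) r = r * psum c r.
Proof. by move=> /cvg_pshift/cvg_lim; apply. Qed.

Lemma is_cvg_pshift c r : cvgn (pseries c r) -> cvgn (pseries (pshift c) r).
Proof. by move=> /cvg_pshift/cvgP. Qed.

(* An integrating factor h determines the sum of a power series satisfying
   F' = g F. *)
Lemma pseries_ode c (g h : R -> R) r : unit_disc c -> 0 <= r < 1 ->
  (forall x, 0 <= x < 1 -> psum (pseries_diffs c) x =
     g x * psum c x) ->
  (forall x, 0 <= x < 1 -> is_derive x (1 : R) h (- g x * h x)) ->
  psum c r * h r = c 0%N * h 0.
Proof.
move=> hc /andP[r0 r1] hg hh.
pose F := fun x => psum c x * h x.
have dF x : 0 <= x < 1 -> is_derive x (1 : R) F 0.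
  move=> /[dup] x01 /andP[x0 x1].
  have d1 : is_derive x (1 : R) _ _ := @is_derive_psum c x hc ltac:(by rewrite ger0_norm).
  have d2 := hh _ x01.
  have -> : F = psum c * h by [].
  apply: is_derive_eq.
  rewrite /GRing.scale /= hg//; ring.
have -> : c 0%N * h 0 = F 0 by rewrite /F psum0.
have [] := @MVT_segment R F (cst 0) 0 r r0.
- move=> x; rewrite in_itv/= => /andP[x0 xr]; apply: dF.
  by rewrite ltW//=; exact: lt_trans r1.
- apply: derivable_within_continuous => x; rewrite in_itv/= => /andP[x0 xr].
  have [] // : is_derive x (1 : R) F 0.
  by apply: dF; rewrite x0 (le_lt_trans xr r1).
- by move=> x _; rewrite /= mul0r => /eqP; rewrite subr_eq0 => /eqP.
Qed.

End power_series.

(** * Hermite polynomials and the sum of the one-dimensional Mehler series *)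

Section hermite_1d.
Context {R : realType}.
Implicit Types (x y r : R) (n : nat).

(** Eliminates the derivative from the defining recurrence. The three-term recurrence that results
    carries both the growth bound and the Mehler identity. *)
Lemma deriv_hermite_poly n :
  (@hermite_poly R n.+1)^`() = (2 * n.+1%:R) * hermite_poly n.
Proof.
have D m : (@hermite_poly R m)^`() = 2 * 'X * hermite_poly m - hermite_poly m.+1.
  by rewrite /=; ring.
elim: n => [|n IH].
  by rewrite /= derivB derivMn derivM derivX !derivC !mulr0 !mul1r mulr1 addr0 subr0 mulr1.
rewrite [hermite_poly n.+2]/= -/(hermite_poly n.+1).
rewrite derivB derivMn derivM derivX mul1r IH.
have -> : (2 * n.+1%:R * @hermite_poly R n)^`() = 2 * n.+1%:R * (@hermite_poly R n)^`().
  by rewrite -natrM !mulr_natl derivMn.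
by rewrite D -[n.+2%:R]natr1; ring.
Qed.

Lemma horner_hermite2 n x : (hermite_poly n.+2).[x] =
  2 * x * (hermite_poly n.+1).[x] - 2 * n.+1%:R * (hermite_poly n).[x].
Proof.
rewrite [hermite_poly n.+2]/= -/(hermite_poly n.+1) deriv_hermite_poly.
rewrite -natrM mulr_natl !(hornerE, hornerMn) -mulr_natl natrM; ring.
Qed.

Lemma horner_hermite0 x : (hermite_poly 0).[x] = 1 :> R.
Proof. by rewrite /= hornerE. Qed.

Lemma horner_hermite1 x : (hermite_poly 1).[x] = 2 * x :> R.
Proof. by rewrite /= derivC subr0 mulr1 mulr2n !hornerE; ring. Qed.

(** The Mehler coefficients stripped of the Gaussian factors and of sqrt(pi), so that identities
    between them are polynomial in [x] and [y] and within reach of [field]. *)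
Definition nherm n x y : R :=
  (hermite_poly n).[x] * (hermite_poly n).[y] / (2 ^+ n * n`!%:R).

Lemma nherm_diag_ge0 n x : 0 <= nherm n x x.
Proof.
by rewrite /nherm -expr2 divr_ge0 ?sqr_ge0// mulr_ge0// exprn_ge0.
Qed.

(** Young's inequality reduces growth estimates to the diagonal, where the coefficients are
    nonnegative. *)
Lemma nherm_le n x y : `|nherm n x y| <= (nherm n x x + nherm n y y) / 2.
Proof.
rewrite /nherm; set a := _.[x]; set b := _.[y].
set w := (2 ^+ n * _)^-1; have w0 : 0 <= w by rewrite invr_ge0 mulr_ge0// exprn_ge0.
rewrite normrM (ger0_norm w0).
have -> : (a * a * w + b * b * w) / 2 = (a * a + b * b) / 2 * w by ring.
rewrite ler_wpM2r// ler_norml.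
have := sqr_ge0 (a + b); have := sqr_ge0 (a - b).
by rewrite !expr2 => h1 h2; apply/andP; split; lra.
Qed.

Lemma eventually_bounded (u : R^nat) N M : (forall n, (N <= n)%N -> u n <= M) ->
  exists M', forall n, u n <= M'.
Proof.
move=> h; exists (`|M| + \sum_(i < N) `|u i|) => n.
have [Nn|nN] := leqP N n.
  apply: le_trans (h _ Nn) _; apply: le_trans (ler_norm _) _.
  by rewrite lerDl sumr_ge0.
apply: le_trans (ler_norm _) _; rewrite (bigD1 (Ordinal nN))//= addrCA lerDl.
by rewrite addr_ge0// sumr_ge0.
Qed.

(* In the recurrence the cross term is absorbed by Young's inequality
   (u - v)^2 <= u^2/(1-r) + v^2/r. *)
Lemma nherm_diag_bounded x r : 0 < r < 1 ->
  exists M, forall n, nherm n x x * r ^+ n <= M.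
Proof.
move=> /andP[r0 r1].
have r1' : 0 < 1 - r by rewrite subr_gt0.
pose b n := nherm n x x * r ^+ n.
have b0 n : 0 <= b n by rewrite mulr_ge0 ?nherm_diag_ge0// exprn_ge0// ltW.
have young (u v : R) : (u - v) ^+ 2 <= u ^+ 2 / (1 - r) + v ^+ 2 / r.
  rewrite -subr_ge0.
  have -> : u ^+ 2 / (1 - r) + v ^+ 2 / r - (u - v) ^+ 2 =
      (r * u + (1 - r) * v) ^+ 2 / (r * (1 - r)).
    by field; rewrite !gt_eqF.
  by rewrite divr_ge0 ?sqr_ge0// mulr_ge0// ltW.
have rec n : b n.+2 <= 2 * x ^+ 2 * r / ((1 - r) * n.+2%:R) * b n.+1 + r * b n.
  rewrite /b /nherm horner_hermite2 !factS !natrM !exprS.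
  set U := _.[x]; set V := _.[x].
  have f0 : 0 < n`!%:R :> R by rewrite ltr0n fact_gt0.
  have t0 : 0 < 2 ^+ n :> R by rewrite exprn_gt0.
  have rn : 0 < r ^+ n by rewrite exprn_gt0.
  have n0 : 0 <= n%:R :> R by [].
  have y := young (2 * x * U) (2 * n.+1%:R * V).
  pose q := r * (r * r ^+ n) / (2 * (2 * 2 ^+ n) * (n.+2%:R * (n.+1%:R * n`!%:R))).
  have q0 : 0 <= q.
    by rewrite divr_ge0// !mulr_ge0// ltW.
  have -> : (2 * x * U - 2 * n.+1%:R * V) * (2 * x * U - 2 * n.+1%:R * V) /
    (2 * (2 * 2 ^+ n) * (n.+2%:R * (n.+1%:R * n`!%:R))) * (r * (r * r ^+ n)) =
    q * (2 * x * U - 2 * n.+1%:R * V) ^+ 2.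
    by rewrite /q; ring.
  apply: le_trans (ler_wpM2l q0 y) _.
  rewrite -subr_ge0; set E := (X in 0 <= X).
  have -> : E = r * V ^+ 2 * r ^+ n / (n.+2%:R * n`!%:R * 2 ^+ n).
    rewrite /E /q -![_.+2%:R]natr1 -![_.+1%:R]natr1; field.
    rewrite !gt_eqF//; lra.
  have r0' := ltW r0; have t0' := ltW t0; have rn' := ltW rn.
  by rewrite divr_ge0// mulr_ge0// mulr_ge0// sqr_ge0.
(* Beyond N the first coefficient of [rec] is at most 1 - r, so each new term is bounded by a convex
   combination of bounds on the two previous ones. *)
pose N := Num.bound (2 * x ^+ 2 * r / (1 - r) ^+ 2).
have NP n : (N <= n)%N -> 2 * x ^+ 2 * r / ((1 - r) * n.+2%:R) <= 1 - r.
  move=> Nn; rewrite invfM mulrA ler_pdivrMr//.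
  have : 2 * x ^+ 2 * r / (1 - r) ^+ 2 <= n.+2%:R.
    apply: le_trans (ltW (archi_boundP _)) _.
      apply: divr_ge0; last exact: sqr_ge0.
      by apply: mulr_ge0; [apply: mulr_ge0 => //; exact: sqr_ge0|exact: ltW].
    by rewrite ler_nat; apply: leq_trans Nn _; lia.
  have e0 : 0 < (1 - r) ^+ 2 by rewrite exprn_gt0.
  rewrite (ler_pdivrMr _ _ e0) (ler_pdivrMr _ _ r1') expr2; lra.
apply: (@eventually_bounded _ N (b N + b N.+1)) => n /subnK <-.
(* The recurrence has order two, so two consecutive terms go through the induction together. *)
have : b (n - N + N)%N <= b N + b N.+1 /\ b (n - N + N).+1 <= b N + b N.+1.
  elim: (n - N)%N => [|k [IH1 IH2]]; first by rewrite add0n lerDl lerDr !b0.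
  rewrite addSn; split=> //; apply: le_trans (rec _) _.
  have h1 := NP (k + N)%N (leq_addl _ _).
  have h2 : 2 * x ^+ 2 * r / ((1 - r) * (k + N).+2%:R) * b (k + N).+1 <= (1 - r) * (b N + b N.+1).
    by apply: le_trans (ler_wpM2r (b0 _) h1) _; rewrite ler_wpM2l// ltW.
  have h3 := ler_wpM2l (ltW r0) IH1.
  by apply: le_trans (lerD h2 h3) _; rewrite -mulrDl subrK mul1r.
by case.
Qed.

Lemma unit_disc_nherm x y : unit_disc (fun n => nherm n x y).
Proof.
move=> r /andP[r0 r1].
have [r00|rn0] := eqVneq r 0.
  exists (`|nherm 0 x y|) => -[|n]; rewrite r00 ?expr0 ?mulr1//.
  by rewrite expr0n/= mulr0.
have rp : 0 < r by rewrite lt_def rn0.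
have r01 : 0 < r < 1 by apply/andP.
have [Mx hx] := @nherm_diag_bounded x r r01.
have [My hy] := @nherm_diag_bounded y r r01.
exists ((Mx + My) / 2) => n.
have := ler_wpM2r (exprn_ge0 n r0) (nherm_le n x y).
have := hx n; have := hy n; lra.
Qed.

Definition mehler_exponent x y r : R :=
  (2 * x * y * r - (x ^+ 2 + y ^+ 2) * r ^+ 2) / (1 - r ^+ 2).

(** The derivative in r of the logarithm of (1 - r^2)^(-1/2) exp([mehler_exponent]), that is, of the
    logarithm of the expected sum. *)
Definition mehler_drift x y r : R :=
  (r * (1 - r ^+ 2) + 2 * x * y * (1 + r ^+ 2) - 2 * (x ^+ 2 + y ^+ 2) * r)
  / (1 - r ^+ 2) ^+ 2.

Lemma cvg_eq_lim (u v : R^nat) (a b : R) : (forall n, u n = v n) ->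
  u @ \oo --> a -> v @ \oo --> b -> a = b.
Proof. by move=> /funext -> ua; exact: cvg_unique. Qed.

(** Multiplying by (1 - r^2)^2 clears the denominator of the drift. The equation is then equivalent
    to a finite recurrence between coefficients, a consequence of the three-term recurrences in [x]
    and in [y]. *)
Lemma nherm_ode x y r : 0 <= r < 1 ->
  psum (pseries_diffs (fun n => nherm n x y)) r =
  mehler_drift x y r * psum (fun n => nherm n x y) r.
Proof.
move=> /andP[r0 r1].
pose a n := nherm n x y; rewrite -/a.
have r1n : `|r| < 1 by rewrite ger0_norm.
have ud : unit_disc a by exact: unit_disc_nherm.
have ca0 : cvgn (pseries a r) by exact: unit_disc_cvg.
have ca1 := is_cvg_pshift ca0.
have ca2 := is_cvg_pshift ca1.
have ca3 := is_cvg_pshift ca2.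
pose b := pseries_diffs a.
have cb0 : cvgn (pseries b r) by apply: unit_disc_cvg => //; exact: unit_disc_diffs.
have cb1 := is_cvg_pshift cb0.
have cb2 := is_cvg_pshift cb1.
have cb3 := is_cvg_pshift cb2.
have cb4 := is_cvg_pshift cb3.
(* Coefficient of r^n in (1 - r^2)^2 F' = (2xy + (1 - 2(x^2 + y^2)) r + 2xy r^2 - r^3) F. The
   indices below 4 are checked separately, since there some shifts take the default value 0. *)
have coef n : b n - 2 * pshift (pshift b) n + pshift (pshift (pshift (pshift b))) n =
    2 * x * y * a n + (1 - 2 * (x ^+ 2 + y ^+ 2)) * pshift a n
    + 2 * x * y * pshift (pshift a) n - pshift (pshift (pshift a)) n.
  case: n => [|[|[|[|n]]]]; rewrite /pshift /b /a /pseries_diffs /nherm.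
  1-4: by rewrite !(horner_hermite2, horner_hermite1, horner_hermite0) !factS fact0 !natrM; field.
  rewrite !horner_hermite2.
  set P := (hermite_poly n.+2).[x]; set P' := (hermite_poly n.+1).[x].
  set Q := (hermite_poly n.+2).[y]; set Q' := (hermite_poly n.+1).[y].
  have f0 : n`!%:R != 0 :> R by rewrite pnatr_eq0 -lt0n fact_gt0.
  have t0 : 2 ^+ n != 0 :> R by rewrite expf_eq0/= pnatr_eq0 andbF.
  have n0 : 0 <= n%:R :> R by [].
  rewrite !factS !natrM !exprS -![_.+4%:R]natr1 -![_.+3%:R]natr1 -![_.+2%:R]natr1 -![_.+1%:R]natr1.
  field; rewrite f0 /= ; do ?[apply/andP; split]; rewrite ?gt_eqF//; lra.
pose B := psum b r; pose F := psum a r.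
have [u0 u1 u2 u3] : [/\ pseries a r @ \oo --> F, pseries (pshift a) r @ \oo --> r * F,
    pseries (pshift (pshift a)) r @ \oo --> r * (r * F) &
    pseries (pshift (pshift (pshift a))) r @ \oo --> r * (r * (r * F))].
  by rewrite /F/psum -!pshiftE.
have [v0 v2 v4] : [/\ pseries b r @ \oo --> B,
    pseries (pshift (pshift b)) r @ \oo --> r * (r * B) &
    pseries (pshift (pshift (pshift (pshift b)))) r @ \oo --> r * (r * (r * (r * B)))].
  by rewrite /B/psum -!pshiftE.
have L1 : (fun n => pseries b r n - 2 * pseries (pshift (pshift b)) r n +
    pseries (pshift (pshift (pshift (pshift b)))) r n) @ \oo -->
    B - 2 * (r * (r * B)) + r * (r * (r * (r * B))).
  by apply: cvgD => //; apply: cvgB => //; exact: cvgMl_tmp.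
have L2 : (fun n => 2 * x * y * pseries a r n
    + (1 - 2 * (x ^+ 2 + y ^+ 2)) * pseries (pshift a) r n
    + 2 * x * y * pseries (pshift (pshift a)) r n
    - pseries (pshift (pshift (pshift a))) r n) @ \oo -->
    2 * x * y * F + (1 - 2 * (x ^+ 2 + y ^+ 2)) * (r * F)
    + 2 * x * y * (r * (r * F)) - r * (r * (r * F)).
  apply: cvgB => //; apply: cvgD; last exact: cvgMl_tmp.
  by apply: cvgD; exact: cvgMl_tmp.
have E : B - 2 * (r * (r * B)) + r * (r * (r * (r * B))) =
    2 * x * y * F + (1 - 2 * (x ^+ 2 + y ^+ 2)) * (r * F)
    + 2 * x * y * (r * (r * F)) - r * (r * (r * F)).
  apply: (cvg_eq_lim _ L1 L2) => n; rewrite /pseries /series /=.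
  rewrite !mulr_sumr -!sumrB -!big_split/= -sumrB; apply: eq_bigr => i _.
  have := congr1 (fun z => z * r ^+ i) (coef i); lra.
have r21 : 1 - r ^+ 2 != 0 by rewrite gt_eqF// subr_gt0 expr_lt1.
rewrite -/F -/B /mehler_drift.
apply: (mulfI (expf_neq0 2 r21)).
have -> : (1 - r ^+ 2) ^+ 2 * B = B - 2 * (r * (r * B)) + r * (r * (r * (r * B))) by ring.
by rewrite E; field.
Qed.

Definition mehler_log x y r : R := mehler_exponent x y r - ln (1 - r ^+ 2) / 2.

Lemma is_derive_mehler_log x y r : 0 <= r < 1 ->
  is_derive r (1 : R) (mehler_log x y) (mehler_drift x y r).
Proof.
move=> /andP[r0 r1].
have r21 : 0 < 1 - r ^+ 2 by rewrite subr_gt0 expr_lt1.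
have r21n : 1 - r ^+ 2 != 0 by rewrite gt_eqF.
have r21s : (1 - r ^+ 2) ^+ 2 != 0 by rewrite expf_neq0.
rewrite /mehler_log /mehler_exponent.
have d1 : is_derive r (1 : R) (fun r => 1 - r ^+ 2) (- (2 * r)).
  by apply: is_derive_eq; rewrite /GRing.scale/=; ring.
have d2 : is_derive r (1 : R) (fun r => ln (1 - r ^+ 2)) (- (2 * r) / (1 - r ^+ 2)).
  have d := is_derive1_ln r21.
  have -> : (fun r => ln (1 - r ^+ 2)) = (@ln R) \o (fun r => 1 - r ^+ 2) by [].
  have := @is_derive1_comp _ (@ln R) (fun r => 1 - r ^+ 2) r _ _ d d1.
  by move=> d'; apply: is_derive_eq; rewrite mulrC.
have d3 : is_derive r (1 : R) (fun r => (1 - r ^+ 2)^-1) ((2 * r) / (1 - r ^+ 2) ^+ 2).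
  have d := @is_deriveV _ (fun r : R => 1 - r ^+ 2) r _ 1 r21n d1.
  by apply: is_derive_eq; rewrite /GRing.scale/=; field.
have d4 : is_derive r (1 : R) (fun r => 2 * x * y * r - (x ^+ 2 + y ^+ 2) * r ^+ 2)
    (2 * x * y - (x ^+ 2 + y ^+ 2) * (2 * r)).
  by apply: is_derive_eq; rewrite /GRing.scale/=; ring.
have d5 : is_derive r (1 : R) (fun r => (2 * x * y * r - (x ^+ 2 + y ^+ 2) * r ^+ 2) / (1 - r ^+ 2))
   ((2 * x * y - (x ^+ 2 + y ^+ 2) * (2 * r)) / (1 - r ^+ 2) +
    (2 * x * y * r - (x ^+ 2 + y ^+ 2) * r ^+ 2) * ((2 * r) / (1 - r ^+ 2) ^+ 2)).
  have := is_deriveM d4 d3.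
  by move=> d'; apply: is_derive_eq; rewrite /GRing.scale/=; ring.
have d6 := is_deriveM d2 (is_derive_cst (2^-1 : R) r 1).
have d7 := is_deriveB d5 d6.
apply: is_derive_eq; rewrite /GRing.scale/= /mehler_drift; field.
by [].
Qed.

(** Both sides solve the same linear equation in r and equal 1 at r = 0; the inverse of the
    right-hand side is the integrating factor. *)
Lemma psum_nherm x y r : 0 <= r < 1 ->
  psum (fun n => nherm n x y) r = expR (mehler_log x y r).
Proof.
move=> r01.
have := @pseries_ode _ (fun n => nherm n x y) (mehler_drift x y)
  (fun s => expR (- mehler_log x y s)) r (@unit_disc_nherm x y) r01
  (@nherm_ode x y).
have d0 (s : R) : 0 <= s < 1 -> is_derive s (1 : R) (fun s => expR (- mehler_log x y s))
    (- mehler_drift x y s * expR (- mehler_log x y s)).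
  move=> s01; have d1 := is_deriveN (is_derive_mehler_log x y s01).
  have := @is_derive1_comp _ (@expR R) (- mehler_log x y) s _ _ (is_derive_expR _) d1.
  by move=> d2; apply: is_derive_eq; rewrite mulrC.
move=> /(_ d0).
have -> : nherm 0 x y = 1 by rewrite /nherm !horner_hermite0 fact0 expr0 !mulr1 divr1.
have -> : mehler_log x y 0 = 0.
  by rewrite /mehler_log /mehler_exponent !expr0n/= !mulr0 !subr0 ln1 !mul0r subr0.
rewrite oppr0 expR0 mulr1 expRN.
by move=> /(canRL (mulfVK (lt0r_neq0 (expR_gt0 _)))) ->; rewrite mul1r.
Qed.

End hermite_1d.

(** * Cauchy products of d absolutely convergent series *)

Section multi_series.
Context {R : realType} {d : nat}.
Implicit Types (P : pred ('I_d -> nat)) (F : ('I_d -> nat) -> R).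

(** The predicate and the summand live on functions into nat, so that the side N of the finite box
    can change without touching them. *)
Definition boxsum N P F : R :=
  \sum_(a : {ffun 'I_d -> 'I_N} | P (fun i => a i)) F (fun i => a i).

Lemma boxsum_widen M N P F : (M <= N)%N ->
  (forall a : 'I_d -> nat, P a -> forall i, (a i <= M)%N) ->
  boxsum N.+1 P F = boxsum M.+1 P F.
Proof.
move=> MN hP; rewrite /boxsum.
pose h (a : {ffun 'I_d -> 'I_M.+1}) : {ffun 'I_d -> 'I_N.+1} :=
  [ffun i => inord (a i)].
pose h' (a : {ffun 'I_d -> 'I_N.+1}) : {ffun 'I_d -> 'I_M.+1} :=
  [ffun i => inord (a i)].
have hE a : (fun i => h a i : nat) = (fun i => a i : nat).
  apply/funext => i; rewrite /h ffunE inordK//.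
  by apply: leq_trans (ltn_ord _) _; rewrite ltnS.
rewrite (reindex_onto h h'); last first.
  move=> a Pa; apply/ffunP => i; apply/val_inj; rewrite /h /h' !ffunE/=.
  have ai := hP _ Pa i.
  by rewrite !inordK// ltnS// (leq_trans ai).
apply: eq_big => [a|a _]; rewrite ?hE// andb_idr// => _.
apply/eqP/ffunP => i; apply/val_inj; rewrite /h' ffunE/=.
by rewrite (congr1 (fun f => f i) (hE a)) inord_val.
Qed.

Definition msum (a : 'I_d -> nat) := (\sum_(i < d) a i)%N.

Lemma le_msum a (i : 'I_d) : (a i <= msum a)%N.
Proof. by rewrite /msum (bigD1 i)//= leq_addr. Qed.

(** For [F = mprod b] this is the k-th term of the Cauchy product of the d series [b i]. *)
Definition mcoef F k : R := boxsum k.+1 (fun a => msum a == k) F.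

Lemma series_mcoef F N :
  series (mcoef F) N.+1 = boxsum N.+1 (fun a => (msum a <= N)%N) F.
Proof.
rewrite /series /= big_mkord /boxsum.
pose p (a : {ffun 'I_d -> 'I_N.+1}) : 'I_N.+1 := inord (msum (fun i => a i)).
rewrite [RHS](partition_big p predT)//=; apply: eq_bigr => k _.
have kN : (k <= N)%N by rewrite -ltnS.
rewrite /mcoef -(boxsum_widen _ kN); last by move=> a /eqP <- i; exact: le_msum.
rewrite /boxsum; apply: eq_bigl => a; rewrite /p.
apply/eqP/andP => [ak|[ak /eqP <-]]; last by rewrite inordK// ltnS.
by rewrite ak; split => //; apply/eqP/val_inj; rewrite /= inordK.
Qed.

Definition mprod (b : 'I_d -> R^nat) (a : 'I_d -> nat) : R := \prod_(i < d) b i (a i).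

Lemma boxsum_mprod (b : 'I_d -> R^nat) N :
  boxsum N predT (mprod b) = \prod_(i < d) series (b i) N.
Proof.
rewrite /boxsum /mprod /series/=.
under [RHS]eq_bigr do rewrite big_mkord.
by rewrite bigA_distr_bigA.
Qed.

Lemma cvgD0 (u v w : R^nat) (a : R) : u @ \oo --> 0 -> v @ \oo --> a ->
  (forall n, w n = u n + v n) -> w @ \oo --> a.
Proof. by move=> u0 va /funext ->; rewrite -[a]add0r; exact: cvgD. Qed.

Lemma cvg_prod_ord (u : 'I_d -> R^nat) (l : 'I_d -> R) :
  (forall i, u i @ \oo --> l i) ->
  (fun n => \prod_(i < d) u i n) @ \oo --> \prod_(i < d) l i.
Proof.
move=> h; apply: (@cvg_big R 'I_d ( *%R ) 1 predT (@mul_continuous R)).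
by move=> i _; exact: h.
Qed.

(** Partial sums of the Cauchy product run over a simplex, products of partial sums over a box. The
    simplex contains a smaller box whose side still tends to infinity, so their distance is at most
    the difference of two box sums of absolute values, both with the same limit. *)
Lemma cvg_series_mcoef (b : 'I_d -> R^nat) :
  (forall i, cvgn [normed series (b i)]) ->
  series (mcoef (mprod b)) @ \oo --> \prod_(i < d) limn (series (b i)).
Proof.
move=> hb.
pose b' : 'I_d -> R^nat := fun i n => `|b i n|.
have cb i : series (b i) @ \oo --> limn (series (b i)) by exact: normed_cvg.
have cb' i : series (b' i) @ \oo --> limn (series (b' i)) by exact: hb.
have S := cvg_prod_ord cb; have S' := cvg_prod_ord cb'.
(* A box with entries at most [D N] fits in the simplex because d * D N <= N; dividing by d + 1 also
   covers d = 0. *)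
pose D N := (N %/ d.+1)%N.
have Doo : D @ \oo --> \oo.
  apply/cvgnyPge => A; near=> n; rewrite /D leq_divRL//.
  by near: n; exact: nbhs_infty_ge.
have b'0 a : 0 <= mprod b' a by apply: prodr_ge0 => i _; exact: normr_ge0.
have low N : \prod_(i < d) series (b' i) (D N).+1 <= series (mcoef (mprod b')) N.+1.
  have DN : (D N <= N)%N by exact: leq_div.
  pose P (a : 'I_d -> nat) := [forall i, (a i <= D N)%N].
  rewrite series_mcoef -boxsum_mprod.
  have -> : boxsum (D N).+1 predT (mprod b') = boxsum (D N).+1 P (mprod b').
    by apply: eq_bigl => a; apply/esym/forallP => i; rewrite -ltnS.
  rewrite -(boxsum_widen _ DN); last by move=> a /forallP.
  rewrite /boxsum [leLHS]big_mkcond [leRHS]big_mkcond; apply: ler_sum => a _.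
  case: ifPn => [/forallP ha|_]; last by case: ifP.
  rewrite ifT//; apply: (@leq_trans (\sum_(i < d) D N)%N).
    by apply: leq_sum => i _; exact: ha.
  rewrite sum_nat_const card_ord /D; apply: leq_trans (leq_divM N d.+1).
  by rewrite mulnC leq_mul.
have dist N : `|series (mcoef (mprod b)) N.+1 - \prod_(i < d) series (b i) N.+1| <=
    \prod_(i < d) series (b' i) N.+1 - \prod_(i < d) series (b' i) (D N).+1.
  apply: le_trans (lerB (lexx _) (low N)).
  rewrite !series_mcoef -!boxsum_mprod /boxsum.
  rewrite (bigID (fun a : {ffun 'I_d -> 'I_N.+1} => (msum (fun i => a i) <= N)%N) predT)/=.
  rewrite opprD addrA subrr sub0r normrN.
  rewrite [in leRHS](bigID (fun a : {ffun 'I_d -> 'I_N.+1} => (msum (fun i => a i) <= N)%N) predT)/=.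
  rewrite addrAC subrr add0r; apply: le_trans (ler_norm_sum _ _ _) _.
  by apply: ler_sum => a _; rewrite /mprod normr_prod.
rewrite -cvg_shiftS.
have S1 : (fun n => \prod_(i < d) series (b i) n.+1) @ \oo --> \prod_(i < d) limn (series (b i)).
  by rewrite -(cvg_shiftS (fun n => \prod_(i < d) series (b i) n)) in S.
have S1' : (fun n => \prod_(i < d) series (b' i) n.+1) @ \oo --> \prod_(i < d) limn (series (b' i)).
  by rewrite -(cvg_shiftS (fun n => \prod_(i < d) series (b' i) n)) in S'.
have S2' : (fun n => \prod_(i < d) series (b' i) (D n).+1) @ \oo --> \prod_(i < d) limn (series (b' i)).
  exact: (cvg_comp _ _ Doo S1').

have W : (fun N => series (mcoef (mprod b)) N.+1 - \prod_(i < d) series (b i) N.+1) @ \oo --> 0.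
  apply/norm_cvg0P; apply: (@squeeze_cvgr _ _ _ _ (cst 0)); last 2 first.
  - exact: cvg_cst.
  - by rewrite -(subrr (\prod_(i < d) limn (series (b' i)))); exact: (cvgB S1' S2').
  by near=> n; rewrite normr_ge0 dist.
by apply: (cvgD0 W S1) => n; rewrite subrK.
Unshelve. all: by end_near. Qed.

End multi_series.

(** * The one-dimensional Mehler kernel *)

Section mehler_1d.
Context {R : realType}.
Implicit Types (x y r : R) (n : nat).

(** Mehler's formula with the exponent diagonalized in x - y and x + y, so that both quadratic terms
    are nonpositive for 0 <= r < 1. The logarithm stands for the factor (1 - r^2)^(-1/2). *)
Definition mehler r x y : R := (Num.sqrt pi)^-1 *
  expR (- (ln (1 - r ^+ 2) / 2) - (1 + r) / (1 - r) * (x - y) ^+ 2 / 4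
        - (1 - r) / (1 + r) * (x + y) ^+ 2 / 4).

Lemma mehler_gt0 r x y : 0 < mehler r x y.
Proof. by rewrite mulr_gt0 ?expR_gt0// invr_gt0 sqrtr_gt0 pi_gt0. Qed.

Lemma hermite_fun_mul n x y : hermite_fun n x * hermite_fun n y =
  (Num.sqrt pi)^-1 * expR (- (x ^+ 2 + y ^+ 2) / 2) * nherm n x y.
Proof.
rewrite /hermite_fun /nherm.
have -> : - (x ^+ 2 + y ^+ 2) / 2 = - (x ^+ 2 / 2) + - (y ^+ 2 / 2) by field.
rewrite expRD; set w := _ * Num.sqrt pi.
have w0 : 0 <= w by rewrite !mulr_ge0 ?sqrtr_ge0// exprn_ge0.
have -> : (2 ^+ n * n`!%:R)^-1 = (Num.sqrt pi) * w^-1 :> R.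
  rewrite /w [X in _ = _ * X]invfM mulrCA mulfV ?mulr1//.
  by rewrite gt_eqF// sqrtr_gt0 pi_gt0.
have -> : w^-1 = (Num.sqrt w)^-1 * (Num.sqrt w)^-1 by rewrite -invfM -expr2 sqr_sqrtr.
have sp : Num.sqrt pi != 0 :> R by rewrite gt_eqF// sqrtr_gt0 pi_gt0.
set s := (Num.sqrt w)^-1.
rewrite [RHS](_ : _ = ((Num.sqrt pi)^-1 * Num.sqrt pi) * (s * (hermite_poly n).[x] * expR (- (x ^+ 2 / 2)) * (s * (hermite_poly n).[y] * expR (- (y ^+ 2 / 2))))); last by ring.
by rewrite mulVf// mul1r.
Qed.

Lemma mehlerE r x y : 0 <= r < 1 -> mehler r x y =
  (Num.sqrt pi)^-1 * expR (- (x ^+ 2 + y ^+ 2) / 2) * expR (mehler_log x y r).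
Proof.
move=> /andP[r0 r1]; rewrite /mehler -[RHS]mulrA -expRD; congr (_ * expR _).
rewrite /mehler_log /mehler_exponent.
have -> : 1 - r ^+ 2 = (1 - r) * (1 + r) by ring.
by field; rewrite !gt_eqF//; lra.
Qed.

Lemma cvg_mehler r x y : 0 <= r < 1 ->
  pseries (fun n => hermite_fun n x * hermite_fun n y) r @ \oo --> mehler r x y.
Proof.
move=> r01; have r1 : `|r| < 1 by case/andP: r01 => r0 r1; rewrite ger0_norm.
rewrite mehlerE// -psum_nherm//.
have := unit_disc_cvg (@unit_disc_nherm _ x y) r1 => h.
pose c := (Num.sqrt pi)^-1 * expR (- (x ^+ 2 + y ^+ 2) / 2).
have -> : pseries (fun n => hermite_fun n x * hermite_fun n y) r =
    (fun n => c * pseries (fun n => nherm n x y) r n); last exact: cvgMl_tmp.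
apply/funext => n.
rewrite /pseries /series /= mulr_sumr; apply: eq_bigr => i _.
by rewrite hermite_fun_mul /c; ring.
Qed.

Lemma unit_disc_hermite x y : unit_disc (fun n => hermite_fun n x * hermite_fun n y).
Proof.
move=> r r01; have [M hM] := @unit_disc_nherm _ x y r r01.
exists ((Num.sqrt pi)^-1 * expR (- (x ^+ 2 + y ^+ 2) / 2) * M) => n.
have c0 : 0 <= (Num.sqrt pi)^-1 * expR (- (x ^+ 2 + y ^+ 2) / 2).
  by rewrite mulr_ge0 ?expR_ge0// invr_ge0 sqrtr_ge0.
by rewrite hermite_fun_mul normrM (ger0_norm c0) -[leLHS]mulrA ler_wpM2l.
Qed.

(** At this radius 1 - r = 1/(k+2), and the diagonal is a Gaussian of width about sqrt(k+2). It is
    traded for a power of k times the square of an integrable weight; the square leaves one factor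
    for each variable off the diagonal. *)
Lemma mehler_diag_le k x : mehler (k.+1%:R / k.+2%:R) x x <=
  16 * k.+2%:R ^+ 3 * ((1 + x ^+ 2)^-1) ^+ 2.
Proof.
set r := _ / _.
have k0 : 0 <= k%:R :> R by [].
have k2 : 0 < k.+2%:R :> R by [].
have e1 : 1 - r = k.+2%:R^-1.
  by rewrite /r -![_.+2%:R]natr1 -![_.+1%:R]natr1; field; rewrite gt_eqF//; lra.
have r0 : 0 < r by rewrite divr_gt0.
have i2 : 0 < k.+2%:R^-1 :> R by rewrite invr_gt0.
have r1 : r < 1 by rewrite -subr_gt0 e1.
rewrite /mehler subrr expr0n/= mulr0 mul0r subr0.
have sp : (Num.sqrt pi)^-1 <= 1 :> R.
  rewrite invf_le1 ?sqrtr_gt0 ?pi_gt0//; rewrite -[leLHS]sqrtr1 ler_sqrt ?pi_gt0//.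
  1,2: by have := pi_ge2 R; lra.
apply: le_trans (ler_wpM2r (expR_ge0 _) sp) _; rewrite mul1r expRD.
have z0 : 0 < 1 - r ^+ 2 by rewrite subr_gt0 expr_lt1// ltW.
have zr : 1 - r <= 1 - r ^+ 2 by rewrite lerB// expr2 ger_pMl// ltW.
have lnz : ln (1 - r ^+ 2) <= 0 by rewrite ln_le0// gerBl sqr_ge0.
have A : expR (- (ln (1 - r ^+ 2) / 2)) <= k.+2%:R.
  apply: (@le_trans _ _ (expR (- ln (1 - r ^+ 2)))); first by rewrite ler_expR; lra.
  rewrite expRN lnK ?posrE// -[leRHS]invrK lef_pV2 ?posrE//.
  by rewrite -e1.
have B : expR (- ((1 - r) / (1 + r) * (x + x) ^+ 2 / 4)) <=
    16 * k.+2%:R ^+ 2 * ((1 + x ^+ 2)^-1) ^+ 2.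
  (* The exponent is at most -2z, and e^(-z) <= 1/(1+z) is used once for each of the two powers of
     the weight. *)
  pose z := x ^+ 2 / (4 * k.+2%:R).
  have x2 : 0 <= x ^+ 2 by exact: sqr_ge0.
  have z0' : 0 <= z by rewrite divr_ge0// mulr_ge0.
  apply: (@le_trans _ _ (expR (- (z + z)))).
    rewrite ler_expR lerN2 e1 /z.
    have -> : k.+2%:R^-1 / (1 + r) * (x + x) ^+ 2 / 4 = k.+2%:R^-1 * x ^+ 2 * (1 + r)^-1.
      by field; rewrite !gt_eqF//; lra.
    have -> : x ^+ 2 / (4 * k.+2%:R) + x ^+ 2 / (4 * k.+2%:R) = k.+2%:R^-1 * x ^+ 2 * 2^-1.
      by field; rewrite gt_eqF//; lra.
    apply: ler_wpM2l; first by apply: mulr_ge0 => //; exact: ltW.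
    by rewrite lef_pV2 ?posrE//; lra.
  rewrite expRN expRD invfM.
  have h : (expR z)^-1 <= 4 * k.+2%:R * (1 + x ^+ 2)^-1.
    have -> : 4 * k.+2%:R * (1 + x ^+ 2)^-1 = ((1 + x ^+ 2) / (4 * k.+2%:R))^-1.
      by rewrite invfM invrK mulrC.
    rewrite lef_pV2 ?posrE ?expR_gt0//; last by rewrite divr_gt0//; lra.
    apply: le_trans (expR_ge1Dx z); rewrite mulrDl lerD2r mul1r.
    rewrite invf_le1//; rewrite -[k.+2%:R]natr1 -[k.+1%:R]natr1; lra.
  have -> : 16 * k.+2%:R ^+ 2 * ((1 + x ^+ 2)^-1) ^+ 2 =
    (4 * k.+2%:R * (1 + x ^+ 2)^-1) * (4 * k.+2%:R * (1 + x ^+ 2)^-1) :> R by ring.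
  by rewrite ler_pM ?invr_ge0 ?expR_ge0.
have -> : 16 * k.+2%:R ^+ 3 * ((1 + x ^+ 2)^-1) ^+ 2 =
  k.+2%:R * (16 * k.+2%:R ^+ 2 * ((1 + x ^+ 2)^-1) ^+ 2) :> R by ring.
by rewrite ler_pM ?expR_ge0.
Qed.

End mehler_1d.

(** * Kernels of the spectral projections *)

Section hermite_kernel.
Context {R : realType} {d : nat}.
Local Notation Rd := (d.-tuple (measurableTypeR R)).
Implicit Types (x y : Rd) (r : R).

Definition hker k x y : R :=
  \sum_(alpha : {ffun 'I_d -> 'I_k.+1} | (\sum_(i < d) alpha i == k)%N)
    hermite_Phi (fun i => alpha i) x * hermite_Phi (fun i => alpha i) y.

Definition mehlerd r x y : R := \prod_(i < d) mehler r (tnth x i) (tnth y i).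

Definition decay x : R := \prod_(i < d) (1 + (tnth x i : R) ^+ 2)^-1.

(** The factor e pays for r^(-k) at r = (k+1)/(k+2); the rest is the product over the coordinates of
    the constant in [mehler_diag_le]. *)
Definition kbound k : R := expR 1 * (16 * k.+2%:R ^+ 3) ^+ d.

Lemma hkerE k x y r : hker k x y * r ^+ k =
  mcoef (mprod (fun i n => hermite_fun n (tnth x i) * hermite_fun n (tnth y i) * r ^+ n)) k.
Proof.
rewrite /hker /mcoef /boxsum /msum mulr_suml; apply: eq_bigr => a /eqP ak.
rewrite /mprod /hermite_Phi -big_split/= [RHS]big_split/=; congr (_ * _).
by rewrite prodrXr ak.
Qed.

Lemma cvg_mehlerd x y r : 0 <= r < 1 ->
  series (fun k => hker k x y * r ^+ k) @ \oo --> mehlerd r x y.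
Proof.
move=> r01; have r1 : `|r| < 1 by case/andP: r01 => r0 r1; rewrite ger0_norm.
have r0 : 0 <= r by case/andP: r01.
rewrite (_ : (fun k => _) = mcoef (mprod (fun i n =>
  hermite_fun n (tnth x i) * hermite_fun n (tnth y i) * r ^+ n))); last first.
  by apply/funext => k; exact: hkerE.
pose b (i : 'I_d) n := hermite_fun n (tnth x i) * hermite_fun n (tnth y i) * r ^+ n.
have <- : \prod_(i < d) limn (series (b i)) = mehlerd r x y.
  by apply: eq_bigr => i _; apply: cvg_lim => //; exact: cvg_mehler.
apply: cvg_series_mcoef => i.
have := @unit_disc_normed_cvg _ _ r (@unit_disc_hermite _ (tnth x i) (tnth y i)) r1.
rewrite /normed_series_of/= (_ : (fun n => `|b i n|) = (fun n =>
  `|hermite_fun n (tnth x i) * hermite_fun n (tnth y i)| * r ^+ n))//.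
by apply/funext => n; rewrite normrM (ger0_norm (exprn_ge0 _ r0)).
Qed.

Lemma hker_diag_ge0 k x : 0 <= hker k x x.
Proof. by apply: sumr_ge0 => a _; rewrite -expr2 sqr_ge0. Qed.

Lemma decay_gt0 x : 0 < decay x.
Proof.
apply: prodr_gt0 => i _; rewrite invr_gt0.
by have := sqr_ge0 (tnth x i : R); lra.
Qed.

Lemma decay_le1 x : decay x <= 1.
Proof.
have -> : 1 = \prod_(i < d) (1 : R) by rewrite big1_eq.
apply: ler_prod => i _; have h := sqr_ge0 (tnth x i : R).
by rewrite invr_ge0 invf_le1 ?addr_ge0//=; lra.
Qed.

Lemma kbound_gt0 k : 0 < kbound k.
Proof. by rewrite mulr_gt0 ?expR_gt0// exprn_gt0// mulr_gt0// exprn_gt0. Qed.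

(* Since the Mehler series at x = y has nonnegative terms, each of them is at
   most the sum; r = (k+1)/(k+2) keeps r^k >= 1/e. *)
Lemma hker_diag_le k x : hker k x x <= kbound k * decay x ^+ 2.
Proof.
pose r : R := k.+1%:R / k.+2%:R.
have k1 : 0 < k.+1%:R :> R by [].
have k2 : 0 < k.+2%:R :> R by [].
have r0 : 0 < r by rewrite divr_gt0.
have r1 : r < 1 by rewrite ltr_pdivrMr// mul1r ltr_nat.
have r01 : 0 <= r < 1 by rewrite ltW.
have h1 : hker k x x * r ^+ k <= mehlerd r x x.
  have c := @cvg_mehlerd x x r r01.
  rewrite -(cvg_lim (@Rhausdorff R) c).
  apply: le_trans (nondecreasing_cvgn_le _ _ k.+1); last 2 first.
  - apply: nondecreasing_series => n _ _.
    by rewrite mulr_ge0 ?hker_diag_ge0// exprn_ge0// ltW.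
  - by apply/cvg_ex; eexists; exact: c.
  rewrite seriesSr lerDr; apply: sumr_ge0 => n _.
  by rewrite mulr_ge0 ?hker_diag_ge0// exprn_ge0// ltW.
have h2 : mehlerd r x x <= (16 * k.+2%:R ^+ 3) ^+ d * decay x ^+ 2.
  have -> : (16 * k.+2%:R ^+ 3) ^+ d = \prod_(i < d) (16 * k.+2%:R ^+ 3) :> R.
    by rewrite prodr_const card_ord.
  rewrite /mehlerd /decay -prodrXl -big_split/=.
  by apply: ler_prod => i _; rewrite (ltW (mehler_gt0 _ _ _)) mehler_diag_le.
have h3 : (r ^+ k)^-1 <= expR 1.
  have -> : (r ^+ k)^-1 = (1 + k.+1%:R^-1) ^+ k.
    rewrite -exprVn invf_div; congr (_ ^+ k).
    by rewrite -[k.+2%:R]natr1; field; rewrite gt_eqF//; lra.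
  apply: (@le_trans _ _ (expR (k.+1%:R^-1) ^+ k)).
    by rewrite lerXn2r ?nnegrE ?expR_ge0 ?expR_ge1Dx.
  by rewrite -expRM_natr ler_expR mulrC ler_pdivrMr// mul1r ler_nat.
have rk : 0 < r ^+ k by rewrite exprn_gt0.
have -> : hker k x x = (r ^+ k)^-1 * (hker k x x * r ^+ k).
  by rewrite mulrCA mulVf ?mulr1// gt_eqF.
rewrite /kbound -mulrA; apply: ler_pM => //.
- by rewrite invr_ge0 ltW.
- by rewrite mulr_ge0 ?hker_diag_ge0// ltW.
- exact: le_trans h2.
Qed.

Lemma hermite_Phi_sqr_le k (a : {ffun 'I_d -> 'I_k.+1}) x :
  (\sum_(i < d) a i == k)%N ->
  hermite_Phi (fun i => a i) x ^+ 2 <= hker k x x.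
Proof.
move=> ak; rewrite /hker (bigD1 a)//= -expr2 lerDl.
by apply: sumr_ge0 => b _; rewrite -expr2 sqr_ge0.
Qed.

(** A Cauchy-Schwarz bound for the positive semidefinite kernel, obtained termwise from Young's
    inequality; the ratio [decay x / decay y] balances the two diagonal bounds. *)
Lemma hker_le k x y : `|hker k x y| <= kbound k * (decay x * decay y).
Proof.
have dx := decay_gt0 x; have dy := decay_gt0 y.
have q0 : 0 < decay x / decay y by rewrite divr_gt0.
pose q := decay x / decay y; rewrite -/q in q0.
have h : `|hker k x y| <= (q^-1 * hker k x x + q * hker k y y) / 2.
  apply: le_trans (ler_norm_sum _ _ _) _.
  rewrite /hker !mulr_sumr -big_split/= mulr_suml; apply: ler_sum => a _.
  set u := hermite_Phi _ x; set v := hermite_Phi _ y.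
  have qn : q != 0 by rewrite gt_eqF.
  rewrite ler_norml -subr_ge0 opprK -[X in _ && X]subr_ge0.
  have -> : u * v + (q^-1 * (u * u) + q * (v * v)) / 2 = (u + q * v) ^+ 2 / (2 * q).
    by field.
  have -> : (q^-1 * (u * u) + q * (v * v)) / 2 - u * v = (u - q * v) ^+ 2 / (2 * q).
    by field.
  by rewrite !divr_ge0 ?sqr_ge0// mulr_ge0// ltW.
apply: le_trans h _.
have hx := hker_diag_le k x; have hy := hker_diag_le k y.
have h1 : q^-1 * hker k x x <= kbound k * (decay x * decay y).
  apply: le_trans (ler_wpM2l _ hx) _; first by rewrite invr_ge0 ltW.
  rewrite /q le_eqVlt; apply/orP; left; apply/eqP.
  by field; rewrite !gt_eqF.
have h2 : q * hker k y y <= kbound k * (decay x * decay y).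
  apply: le_trans (ler_wpM2l (ltW q0) hy) _.
  rewrite /q le_eqVlt; apply/orP; left; apply/eqP.
  by field; rewrite gt_eqF.
lra.
Qed.

End hermite_kernel.

(** * Fractional powers of exponentials *)

Section fractional_exponential.
Context {R : realType}.
Implicit Types (beta z c : R) (n : nat).

Fixpoint fbin_sum beta n : R :=
  if n is n'.+1 then fbin_sum beta n' * (1 - beta / n%:R) else 1.

(** The coefficient (-1)^n binom(beta, n) of (1 - X)^beta, factored through the partial sum
    [fbin_sum]: that these sums lie in [0, 1] gives both the sign and the size of the
    coefficients. *)
Definition fbin beta n : R :=
  if n is n'.+1 then - beta / n%:R * fbin_sum beta n' else 1.

Lemma series_fbin beta n : series (fbin beta) n.+1 = fbin_sum beta n.
Proof.
elim: n => [|n IH]; first by rewrite /series/= big_nat1.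
by rewrite seriesSr IH /=; ring.
Qed.

Lemma fbin_sum_itv beta n : 0 < beta <= 1 -> 0 <= fbin_sum beta n <= 1.
Proof.
move=> /andP[b0 b1]; elim: n => [|n /andP[p0 p1]] /=; first by rewrite ler01 lexx.
have h : 0 <= beta / n.+1%:R <= 1.
  by rewrite divr_ge0 ?(ltW b0)//= ler_pdivrMr// mul1r (le_trans b1)// ler1n.
case/andP: h => h0 h1.
have [q0 q1] : 0 <= 1 - beta / n.+1%:R /\ 1 - beta / n.+1%:R <= 1.
  by rewrite subr_ge0 gerBl.
by rewrite mulr_ge0// mulr_ile1.
Qed.

(** The source of positivity of the fractional semigroup, and the place where beta <= 1 enters: the
    partial sums below index n are then nonnegative. *)
Lemma fbin_le0 beta n : 0 < beta <= 1 -> fbin beta n.+1 <= 0.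
Proof.
move=> /[dup] /andP[b0 _] hb; rewrite /fbin -oppr_ge0 mulNr mulNr opprK.
have /andP[p0 _] := fbin_sum_itv n hb.
by rewrite mulr_ge0// divr_ge0// ltW.
Qed.

Lemma unit_disc_fbin beta : 0 < beta <= 1 -> unit_disc (fbin beta).
Proof.
move=> hb r /andP[r0 r1]; exists 1 => -[|n]; first by rewrite expr0 mulr1 normr1.
have rn : r ^+ n.+1 <= 1 by rewrite exprn_ile1// ltW.
apply: mulr_ile1 => //; first by rewrite exprn_ge0.
have /andP[p0 p1] := fbin_sum_itv n hb; have /andP[b0 b1] := hb.
rewrite /fbin normrM (ger0_norm p0) mulr_ile1//.
rewrite normrM normrN !ger0_norm ?invr_ge0 ?(ltW b0)//.
by rewrite ler_pdivrMr// mul1r (le_trans b1)// ler1n.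
Qed.

(** The binomial series F solves (1 - x) F' = - beta F; the integrating factor is (1 - x)^(-beta),
    written with [expR] and [ln]. *)
Lemma psum_fbin beta z : 0 < beta <= 1 -> 0 <= z < 1 ->
  psum (fbin beta) z = (1 - z) `^ beta.
Proof.
move=> hb z01; have ud := unit_disc_fbin hb.
have := @pseries_ode _ (fbin beta) (fun x => - beta / (1 - x))
  (fun x => expR (- (beta * ln (1 - x)))) z ud z01.
have ode x : 0 <= x < 1 ->
    psum (pseries_diffs (fbin beta)) x = - beta / (1 - x) * psum (fbin beta) x.
  move=> /andP[x0 x1]; have x1n : `|x| < 1 by rewrite ger0_norm.
  have c0 := unit_disc_cvg ud x1n.
  have c1 := unit_disc_cvg (unit_disc_diffs ud) x1n.
  have c2 := cvg_pshift c1.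
  have E : psum (pseries_diffs (fbin beta)) x - x * psum (pseries_diffs (fbin beta)) x =
      - beta * psum (fbin beta) x.
    have L1 : (fun n => pseries (pseries_diffs (fbin beta)) x n -
        pseries (pshift (pseries_diffs (fbin beta))) x n) @ \oo -->
        psum (pseries_diffs (fbin beta)) x - x * psum (pseries_diffs (fbin beta)) x.
      exact: cvgB.
    have L2 : (fun n => - beta * pseries (fbin beta) x n) @ \oo --> - beta * psum (fbin beta) x.
      exact: cvgMl_tmp.
    apply: (cvg_eq_lim _ L1 L2) => n; rewrite /pseries /series /=.
    rewrite mulr_sumr -sumrB; apply: eq_bigr => -[|[|i]] _; rewrite /pshift /pseries_diffs /=.
    - by field.
    - by field.
    have i0 : 0 <= i%:R :> R by [].
    rewrite -![_.+3%:R]natr1 -![_.+2%:R]natr1 -![_.+1%:R]natr1; field.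
    by rewrite !gt_eqF//; lra.
  have x1' : 1 - x != 0 by rewrite gt_eqF// subr_gt0.
  apply: (mulfI x1').
  have -> : (1 - x) * psum (pseries_diffs (fbin beta)) x = psum (pseries_diffs (fbin beta)) x - x * psum (pseries_diffs (fbin beta)) x by ring.
  by rewrite E; field.
have dh (x : R) : 0 <= x < 1 -> is_derive x (1 : R) (fun x => expR (- (beta * ln (1 - x))))
   (- (- beta / (1 - x)) * expR (- (beta * ln (1 - x)))).
  move=> /andP[x0 x1]; have x1' : 0 < 1 - x by rewrite subr_gt0.
  have d1 : is_derive x (1 : R) (fun x => 1 - x) (-1).
    by apply: is_derive_eq; rewrite /GRing.scale/=; ring.
  have d2 := @is_derive1_comp _ (@ln R) (fun x => 1 - x) x _ _ (is_derive1_ln x1') d1.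
  have d3 := is_deriveN (@is_deriveZ _ _ _ _ beta _ _ _ d2).
  have d4 := @is_derive1_comp _ (@expR R) (- (beta *: ((@ln R) \o (fun x => 1 - x)))) x _ _ (is_derive_expR _) d3.
  have -> : (fun x => expR (- (beta * ln (1 - x)))) =
    (@expR R) \o (- (beta *: ((@ln R) \o (fun x => 1 - x)))) by [].
  apply: is_derive_eq; rewrite /GRing.scale/=.
  rewrite -[(- (beta *: _)) x]/(- (beta * ln (1 - x))).
  by field; rewrite gt_eqF.
move=> /(_ ode dh); rewrite subr0 ln1 mulr0 oppr0 expR0 mulr1 expRN.
move=> /(canRL (mulfVK (lt0r_neq0 (expR_gt0 _)))) ->; rewrite mul1r.
by rewrite /powR; case: ifPn => // /eqP; case/andP: z01 => z0 z1; lra.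
Qed.

(* A = c (1 - sum_{n<M} s_n X^n) has nonnegative coefficients and A(1) <= c *)
Definition fbin_poly c beta M : {poly R} := \poly_(n < M) (if n is 0 then 0 else - c * fbin beta n).

(** A Taylor polynomial of exp(A - c). Keeping e^(-c) outside the sum preserves nonnegative
    coefficients, and A(1) <= c makes the value at 1 at most 1. *)
Definition exp_poly (A : {poly R}) c J : {poly R} :=
  \sum_(j < J) (expR (- c) / j`!%:R) *: A ^+ j.

Lemma fbin_poly_coef_ge0 c beta M n : 0 < beta <= 1 -> 0 <= c -> 0 <= (fbin_poly c beta M)`_n.
Proof.
move=> hb c0; rewrite coef_poly; case: ifP => // _; case: n => // n.
by rewrite mulNr -mulrN mulr_ge0// oppr_ge0 fbin_le0.
Qed.

Lemma horner_fbin_poly c beta M z :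
  (fbin_poly c beta M.+1).[z] = c * (1 - pseries (fbin beta) z M.+1).
Proof.
rewrite horner_poly big_ord_recl/= mul0r add0r /pseries /series/=.
rewrite big_mkord big_ord_recl/= expr0 mulr1 opprD addrA subrr sub0r mulrN mulr_sumr.
rewrite -sumrN; apply: eq_bigr => i _; rewrite /bump/= add1n; ring.
Qed.

Lemma poly_coef_ge0M (A B : {poly R}) : (forall n, 0 <= A`_n) -> (forall n, 0 <= B`_n) ->
  forall n, 0 <= (A * B)`_n.
Proof. by move=> hA hB n; rewrite coefM sumr_ge0// => i _; rewrite mulr_ge0. Qed.

Lemma exp_poly_coef_ge0 (A : {poly R}) c J : (forall n, 0 <= A`_n) ->
  forall n, 0 <= (exp_poly A c J)`_n.
Proof.
move=> hA n; rewrite coef_sum sumr_ge0// => j _; rewrite coefZ; apply: mulr_ge0.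
  by rewrite divr_ge0 ?expR_ge0.
elim: (nat_of_ord j) n => [|m IH] n; first by rewrite expr0 coef1 ler0n.
by rewrite exprS poly_coef_ge0M.
Qed.

Lemma horner_exp_poly (A : {poly R}) c J z :
  (exp_poly A c J).[z] = expR (- c) * series (exp_coeff A.[z]) J.
Proof.
rewrite horner_sum /series/= big_mkord mulr_sumr; apply: eq_bigr => j _.
by rewrite hornerZ horner_exp /exp_coeff /=; ring.
Qed.

Lemma exp_poly_le1 (A : {poly R}) c J : 0 <= A.[1] <= c -> (exp_poly A c J).[1] <= 1.
Proof.
move=> /andP[A0 Ac]; rewrite horner_exp_poly.
have h : series (exp_coeff A.[1]) J <= expR A.[1].
  apply: nondecreasing_cvgn_le; last exact: is_cvg_series_exp_coeff.
  by apply: nondecreasing_series => n _ _; exact: exp_coeff_ge0.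
apply: le_trans (ler_wpM2l (expR_ge0 _) h) _.
by rewrite -expRD -[leRHS]expR0 ler_expR; lra.
Qed.

Lemma cvg_fin_close {T : Type} (F : set_system T) {FF : ProperFilter F} N
    (u : 'I_N -> T -> R) (l : 'I_N -> R) e : 0 < e ->
  (forall i, u i x @[x --> F] --> l i) -> \forall x \near F, forall i, `|l i - u i x| < e.
Proof.
move=> e0 h; apply: filter_forall => i.
by have /cvgrPdist_lt/(_ _ e0) := h i.
Qed.

(** Replaces the eigenvalue by a function of exp(-h lam) that lies in the range of the binomial
    series. *)
Lemma cvg_expR_slope (lam : R) : 0 < lam ->
  (1 - expR (- (h * lam))) / h @[h --> 0^'+] --> lam.
Proof.
move=> lam0; apply: (@squeeze_cvgr _ _ _ _ (fun h => lam / (1 + h * lam)) (cst lam)).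
- near=> h.
  have h0 : 0 < h by near: h; exact: nbhs_right_gt.
  have hl : 0 < h * lam by rewrite mulr_gt0.
  have e1 := expR_ge1Dx (- (h * lam)); have e2 := expR_ge1Dx (h * lam).
  have e3 : expR (- (h * lam)) <= (1 + h * lam)^-1.
    by rewrite expRN lef_pV2 ?posrE ?expR_gt0//; lra.
  apply/andP; split; last by rewrite ler_pdivrMr// /cst; lra.
  rewrite -[leRHS]/((1 - expR (- (h * lam))) / h) (ler_pdivlMr _ _ h0).
  have e4 : 1 - (1 + h * lam)^-1 = lam / (1 + h * lam) * h by field; rewrite gt_eqF//; lra.
  by rewrite -e4 lerB.
- rewrite -[X in _ --> X]mulr1 -[X in _ * X]invr1.
  apply: cvgMl_tmp; apply: cvgV; first by rewrite oner_neq0.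
  rewrite -[X in _ --> X]addr0; apply: cvgD; first exact: cvg_cst.
  rewrite -[X in _ --> X](mul0r lam); apply: cvgMr_tmp.
  exact: cvg_at_right_filter.
- exact: cvg_cst.
Unshelve. all: by end_near. Qed.

(** Three replacements, each costing e/3: lam by (1 - X)/h with X = exp(-h lam), the power (1 -
    X)^beta by a partial sum of its series, and the outer exponential by a Taylor polynomial.
    Finitely many eigenvalues suffice because the remaining modes will be handled by domination. *)
Lemma frac_exp_approx beta t N (lam : 'I_N -> R) e : 0 < beta <= 1 -> 0 <= t ->
  (forall i, 0 < lam i) -> 0 < e ->
  exists h (P : {poly R}), [/\ 0 < h, forall n, 0 <= P`_n, P.[1] <= 1 &
    forall i, `|expR (- (t * lam i `^ beta)) - P.[expR (- (h * lam i))]| < e].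
Proof.
move=> hb t0 lam0 e0.
have b0 : 0 < beta by case/andP: hb.
pose C h := t / h `^ beta.
have step1 : \forall h \near 0^'+, forall i, `|expR (- (t * lam i `^ beta)) -
    expR (- (t * ((1 - expR (- (h * lam i))) / h) `^ beta))| < e / 3.
  apply: cvg_fin_close; first by rewrite divr_gt0.
  move=> i; apply: (cvg_comp _ (@expR R)); last exact: continuous_expR.
  apply: cvgN; apply: cvgMl_tmp.
  have c1 : {for lam i, continuous (fun x => x `^ beta)}.
    by apply/differentiable_continuous/derivable1_diffP/derivable_powR; rewrite in_itv/= lam0.
  exact: (cvg_comp _ _ (cvg_expR_slope (lam0 i)) c1).
have [h [h0 hh]] : exists h, 0 < h /\ forall i, `|expR (- (t * lam i `^ beta)) -
    expR (- (C h * (1 - expR (- (h * lam i))) `^ beta))| < e / 3.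
  have [h [hA h0]] := filter_ex (filterI step1 (nbhs_right_gt (0 : R))).
  exists h; split; [exact: h0|move=> i]; move: (hA i).
  have w0 : 0 <= 1 - expR (- (h * lam i)).
    by rewrite subr_ge0 expR_le1 oppr_le0 mulr_ge0// ltW.
  have hV0 : 0 <= h^-1 by rewrite invr_ge0 ltW.
  rewrite (powRM beta w0 hV0).
  have -> : h^-1 `^ beta = (h `^ beta)^-1 by rewrite -powR_inv1 ?(ltW h0)// powRAC powR_inv1 ?powR_ge0.
  have -> // : C h * (1 - expR (- (h * lam i))) `^ beta =
    t * ((1 - expR (- (h * lam i))) `^ beta / h `^ beta) by rewrite /C; ring.
have C0 : 0 <= C h by rewrite divr_ge0// powR_ge0.
pose z i := expR (- (h * lam i)).
have z01 i : 0 <= z i < 1.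
  by rewrite expR_ge0/= expR_lt1 oppr_lt0 mulr_gt0.
have step2 : \forall M \near \oo, forall i, `|expR (- (C h * (1 - z i) `^ beta)) -
    expR (- C h + (fbin_poly (C h) beta M.+1).[z i])| < e / 3.
  apply: cvg_fin_close; first by rewrite divr_gt0.
  move=> i; apply: (cvg_comp _ (@expR R)); last exact: continuous_expR.
  have E M : - C h + (fbin_poly (C h) beta M.+1).[z i] =
      - (C h * pseries (fbin beta) (z i) M.+1).
    by rewrite horner_fbin_poly; ring.
  under eq_cvg do rewrite E.
  apply: cvgN; apply: cvgMl_tmp; rewrite -psum_fbin//.
  have zz : `|z i| < 1 by case/andP: (z01 i) => z0 z1; rewrite ger0_norm.
  have := unit_disc_cvg (unit_disc_fbin hb) zz.
  by rewrite -(cvg_shiftS (pseries (fbin beta) (z i))).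
have [M hM] := filter_ex step2.
set A := fbin_poly _ _ _ in hM.
have step3 : \forall J \near \oo, forall i,
    `|expR (- C h + A.[z i]) - (exp_poly A (C h) J).[z i]| < e / 3.
  apply: cvg_fin_close; first by rewrite divr_gt0.
  move=> i; rewrite expRD; under eq_cvg do rewrite horner_exp_poly.
  apply: cvgMl_tmp; exact: is_cvg_series_exp_coeff.
have [J hJ] := filter_ex step3.
exists h, (exp_poly A (C h) J); split=> //.
- by apply: exp_poly_coef_ge0 => n; exact: fbin_poly_coef_ge0.
- apply: exp_poly_le1; rewrite horner_fbin_poly.
  have -> : pseries (fbin beta) 1 M.+1 = fbin_sum beta M.
    rewrite -series_fbin /pseries /series/=; apply: eq_bigr => i _.
    by rewrite expr1n mulr1.
  have := fbin_sum_itv M hb; nra.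
- move=> i; move: (hh i) (hM i) (hJ i); rewrite -/(z i).
  set a := expR (- (t * _)); set b := expR (- (C h * _)).
  set c := expR (- C h + _); set v := (exp_poly _ _ _).[_].
  move: a b c v => a b c v.
  rewrite !ltr_norml => /andP[? ?] /andP[? ?] /andP[? ?]; apply/andP; split; lra.
Unshelve. all: by end_near. Qed.

End fractional_exponential.

(** * The Gaussian heat kernel as an approximate identity *)

Section tuple_integral.
Context {R : realType}.
Local Notation mR := (measurableTypeR R).
Local Notation leb := (@lebesgue_measure R).
Local Notation mu := (@lebesgue_tuple R).
Local Open Scope ereal_scope.

Lemma integral_tuple0 (F : 0.-tuple mR -> \bar R) : measurable_fun setT F ->
  \int[mu 0]_x F x = F [tuple].
Proof. by move=> mF; rewrite /= integral_dirac// diracT mul1e. Qed.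

Lemma measurable_tuple_consl n (F : n.+1.-tuple mR -> \bar R) :
  measurable_fun setT F -> measurable_fun setT (F \o @tuple_cons R n).
Proof. by move=> mF; apply: measurableT_comp => //; exact: measurable_tuple_cons. Qed.

Lemma ge0_integral_tupleS n (F : n.+1.-tuple mR -> \bar R) :
  measurable_fun setT F -> (forall x, 0 <= F x) ->
  \int[mu n.+1]_x F x = \int[leb]_x \int[mu n]_xs F (tuple_cons (x, xs)).
Proof.
move=> mF F0; rewrite /= /lebesgue_cons.
rewrite (ge0_integral_pushforward (@measurable_tuple_cons R n))//.
rewrite preimage_setT fubini_tonelli1//; first exact: measurable_tuple_consl.
by move=> x; exact: F0.
Qed.

Lemma ge0_integral_tupleS_sym n (F : n.+1.-tuple mR -> \bar R) :
  measurable_fun setT F -> (forall x, 0 <= F x) ->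
  \int[mu n.+1]_x F x = \int[mu n]_xs \int[leb]_x F (tuple_cons (x, xs)).
Proof.
move=> mF F0; rewrite ge0_integral_tupleS//.
apply: (fubini_tonelli (F \o @tuple_cons R n)); first exact: measurable_tuple_consl.
by move=> x; exact: F0.
Qed.

Lemma tnth_tuple_cons0 n (x : mR) (xs : n.-tuple mR) : tnth (tuple_cons (x, xs)) ord0 = x.
Proof. exact: tnth0. Qed.

Lemma tnth_tuple_consS n (x : mR) (xs : n.-tuple mR) i :
  tnth (tuple_cons (x, xs)) (lift ord0 i) = tnth xs i.
Proof. exact: tnthS. Qed.

Lemma measurable_prod_tnth n (phi : 'I_n -> mR -> R) :
  (forall i, measurable_fun setT (phi i)) ->
  measurable_fun setT (fun x : n.-tuple mR => \prod_(i < n) phi i (tnth x i))%R.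
Proof.
move=> mphi; apply: measurable_prod => i _.
by apply: measurableT_comp => //; exact: measurable_tnth.
Qed.

Lemma integral_prod_tnth n (phi : 'I_n -> mR -> R) :
  (forall i, measurable_fun setT (phi i)) -> (forall i x, (0 <= phi i x)%R) ->
  \int[mu n]_x (\prod_(i < n) phi i (tnth x i))%:E =
  \prod_(i < n) \int[leb]_x (phi i x)%:E.
Proof.
elim: n phi => [|n IH] phi mphi phi0.
  rewrite integral_tuple0 ?big_ord0//; apply/measurable_EFinP.
  exact: measurable_prod_tnth.
rewrite ge0_integral_tupleS; last 2 first.
- by apply/measurable_EFinP; exact: measurable_prod_tnth.
- by move=> x; rewrite lee_fin prodr_ge0.
rewrite big_ord_recl -(IH (fun i => phi (lift ord0 i)))//.
transitivity (\int[leb]_x ((phi ord0 x)%:E *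
    \int[mu n]_xs (\prod_(i < n) phi (lift ord0 i) (tnth xs i))%:E)).
  apply: eq_integral => x _.
  rewrite -ge0_integralZl//; last 3 first.
  - by apply/measurable_EFinP; exact: (@measurable_prod_tnth _ (fun i => phi (lift ord0 i))).
  - by move=> xs _; rewrite lee_fin prodr_ge0.
  - by rewrite lee_fin.
  apply: eq_integral => xs _; rewrite big_ord_recl tnth_tuple_cons0 EFinM.
  by congr (_ * (_)%:E); apply: eq_bigr => i _; rewrite tnth_tuple_consS.
rewrite ge0_integralZr//.
- exact/measurable_EFinP.
- by move=> x _; rewrite lee_fin.
- by apply: integral_ge0 => xs _; rewrite lee_fin prodr_ge0.
Qed.

Lemma integral_inv_oneDsqr : \int[leb]_x ((1 + x ^+ 2)^-1)%:E = pi%:E.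
Proof.
rewrite (ge0_symfun_integralT (f := fun x : R => (1 + x ^+ 2)^-1)%R)//=.
- rewrite (_ : [set x | _] = `[0%R, +oo[%classic); last first.
    by apply/seteqP; split => x/=; rewrite in_itv/= andbT.
  by rewrite integral0y_oneDsqr -EFinM mulrC divfK.
- by move=> x; rewrite invr_ge0 addr_ge0// sqr_ge0.
- by move=> x; exact: continuous_oneDsqrV.
- by move=> x/=; rewrite sqrrN.
Qed.

Lemma integral_decay_lty n : \int[mu n]_x (decay x)%:E < +oo.
Proof.
rewrite /decay (@integral_prod_tnth n (fun _ x => (1 + x ^+ 2)^-1)%R); last 2 first.
- by move=> i; apply: continuous_measurable_fun; exact: continuous_oneDsqrV.
- by move=> i x; rewrite invr_ge0 addr_ge0// sqr_ge0.
under eq_bigr do rewrite integral_inv_oneDsqr.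
by rewrite prodEFin ltry.
Qed.

End tuple_integral.

Lemma measurable_fun2 {d d1 d2 d3} {T : measurableType d} {T1 : measurableType d1}
    {T2 : measurableType d2} {T3 : measurableType d3} (k : T1 -> T2 -> T3) (f : T -> T1) (g : T -> T2) :
  measurable_fun setT (fun z : T1 * T2 => k z.1 z.2) ->
  measurable_fun setT f -> measurable_fun setT g ->
  measurable_fun setT (fun z => k (f z) (g z)).
Proof.
move=> mk mf mg; exact: (measurableT_comp mk (measurable_fun_pair mf mg)).
Qed.

(** Measurability by recursion on the shape of the function: hypotheses about named functions of one
    or two variables are used by composition, and a shape that matches nothing is left as a goal. *)
Ltac mfun := lazymatch goal with
  | |- measurable_fun _ (fun z => z) => exact: measurable_id
  | |- measurable_fun _ fst => exact: measurable_fst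
  | |- measurable_fun _ snd => exact: measurable_snd
  | |- measurable_fun _ (fun z => fst z) => exact: measurable_fst
  | |- measurable_fun _ (fun z => snd z) => exact: measurable_snd
  | |- measurable_fun _ (fun z => fst (@?f z)) =>
      apply: (measurableT_comp (@measurable_fst _ _ _ _)); mfun
  | |- measurable_fun _ (fun z => snd (@?f z)) =>
      apply: (measurableT_comp (@measurable_snd _ _ _ _)); mfun
  | |- measurable_fun _ (fun z => (@?f z, @?g z)) => apply: measurable_fun_pair; mfun
  | |- measurable_fun _ (fun z => EFin (@?f z)) => apply/measurable_EFinP; mfun
  | |- measurable_fun _ (fun z => GRing.mul (@?f z) (@?g z)) => apply: measurable_funM; mfun
  | |- measurable_fun _ (fun z => Algebra.add (@?f z) (Algebra.opp (@?g z))) =>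
      apply: measurable_funB; mfun
  | |- measurable_fun _ (fun z => Algebra.add (@?f z) (@?g z)) => apply: measurable_funD; mfun
  | |- measurable_fun _ (fun z => mule (@?f z) (@?g z)) => apply: emeasurable_funM; mfun
  | |- measurable_fun _ (fun z => Num.norm (@?f z)) =>
      apply: (measurableT_comp (@normr_measurable _ setT)); mfun
  | H : measurable_fun _ ?h |- measurable_fun _ ?h => exact: H
  | H : measurable_fun _ (fun w => ?k (fst w) (snd w)) |- measurable_fun _ (fun z => ?k (@?f z) (@?g z)) =>
      apply: (measurable_fun2 H); mfun
  | H : measurable_fun _ ?h |- measurable_fun _ (fun z => ?h (@?f z)) =>
      apply: (measurableT_comp H); mfun
  | |- measurable_fun _ (fun _ => ?c) => exact: measurable_cst
  | |- _ => idtac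
  end.

(** * Contraction kernels and their oscillation *)

Section contraction_kernels.
Context {R : realType}.
Local Open Scope ereal_scope.

(** Symmetric sub-Markov kernels. Symmetry turns the bound on rows into one on columns, so that the
    kernel contracts both the sup norm and the L^1 norm. *)
Definition contraction_kernel {d} {T : measurableType d} (m : set T -> \bar R)
    (k : T -> T -> R) :=
  [/\ measurable_fun setT (fun z : T * T => k z.1 z.2),
      forall x y, (0 <= k x y)%R,
      forall x y, k x y = k y x &
      forall x, \int[m]_y (k x y)%:E <= 1].

(** Controls the L^1 distance from g to its image up to the missing mass of the kernel. The absolute
    value is inside the integral, which is what makes the quantity compatible with products of
    kernels. *)
Definition oscillation {d} {T : measurableType d} (m : set T -> \bar R)
    (k : T -> T -> R) (g : T -> R) : \bar R :=
  \int[m]_x \int[m]_y (k x y * `|g y - g x|)%:E.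

Definition approx_id {d} {T : measurableType d} (m : {measure set T -> \bar R})
    (k : nat -> T -> T -> R) :=
  forall g : T -> R, m.-integrable setT (EFin \o g) ->
    oscillation m (k n) g @[n --> \oo] --> 0.

Section two_spaces.
Context {d1 d2} {T1 : measurableType d1} {T2 : measurableType d2}.
Context (m1 : {sigma_finite_measure set T1 -> \bar R}).
Context (m2 : {sigma_finite_measure set T2 -> \bar R}).

Lemma integral2_leD (F G H : T1 * T2 -> \bar R) :
  measurable_fun setT F -> measurable_fun setT G -> measurable_fun setT H ->
  (forall z, 0 <= F z) -> (forall z, 0 <= G z) -> (forall z, 0 <= H z) ->
  (forall z, F z <= G z + H z) ->
  \int[m1]_x \int[m2]_y F (x, y) <=
  \int[m1]_x \int[m2]_y G (x, y) + \int[m1]_x \int[m2]_y H (x, y).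
Proof.
move=> mF mG mH F0 G0 H0 FGH; rewrite -!fubini_tonelli1// -ge0_integralD//.
by apply: ge0_le_integral => //; exact: emeasurable_funD.
Qed.

End two_spaces.

Section one_space.
Context {d} {T : measurableType d} (m : {sigma_finite_measure set T -> \bar R}).
Implicit Types (k : T -> T -> R) (g h : T -> R).

Lemma contraction_kernel_L1 k (F : T -> \bar R) : contraction_kernel m k ->
  measurable_fun setT F -> (forall x, 0 <= F x) ->
  \int[m]_x \int[m]_y ((k x y)%:E * F y) <= \int[m]_y F y.
Proof.
move=> [mk k0 ks k1] mF F0.
have mG : measurable_fun setT (fun z : T * T => (k z.1 z.2)%:E * F z.2).
  by mfun.
have mk' y : measurable_fun setT (fun x => (k x y)%:E).
  by mfun.
rewrite (fubini_tonelli (fun z : T * T => (k z.1 z.2)%:E * F z.2))//=; last first.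
  by move=> z; rewrite mule_ge0// lee_fin.
apply: ge0_le_integral => //.
- by move=> y _; apply: integral_ge0 => x _; rewrite mule_ge0// lee_fin.
- apply: (measurable_fun_fubini_tonelli_G (fun z : T * T => (k z.1 z.2)%:E * F z.2)) => //.
  by move=> z; rewrite mule_ge0// lee_fin.
- move=> y _; rewrite ge0_integralZr//; last by move=> x _; rewrite lee_fin.
  rewrite -[leRHS]mul1e lee_wpmul2r//.
  by under eq_integral do rewrite ks.
Qed.

Lemma measurable_ker k x : measurable_fun setT (fun z : T * T => k z.1 z.2) ->
  measurable_fun setT (k x).
Proof. by move=> mk; apply: (measurable_fun2 mk); mfun. Qed.

Lemma contraction_kernel_out k (F : T -> \bar R) : contraction_kernel m k ->
  measurable_fun setT F -> (forall x, 0 <= F x) ->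
  \int[m]_x \int[m]_y ((k x y)%:E * F x) <= \int[m]_x F x.
Proof.
move=> [mk k0 ks k1] mF F0.
have mG : measurable_fun setT (fun z : T * T => (k z.1 z.2)%:E * F z.1) by mfun.
have mk' x : measurable_fun setT (k x) by exact: measurable_ker.
apply: ge0_le_integral => //.
- by move=> y _; apply: integral_ge0 => x _; rewrite mule_ge0// lee_fin.
- apply: (measurable_fun_fubini_tonelli_F (fun z : T * T => (k z.1 z.2)%:E * F z.1)) => //.
  by move=> z; rewrite mule_ge0// lee_fin.
- move=> y _; rewrite ge0_integralZr//; last 2 first.
  + exact/measurable_EFinP.
  + by move=> x _; rewrite lee_fin.
  by rewrite -[leRHS]mul1e lee_wpmul2r.
Qed.

Lemma oscillation_ge0 k g : contraction_kernel m k -> 0 <= oscillation m k g.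
Proof.
move=> [_ k0 _ _]; apply: integral_ge0 => x _; apply: integral_ge0 => y _.
by rewrite lee_fin mulr_ge0.
Qed.

(** Reduces approximate identities to a dense class in L^1. One copy of the error sits at x and one
    at y, hence the factor 2. *)
Lemma oscillation_le k g h : contraction_kernel m k ->
  measurable_fun setT g -> measurable_fun setT h ->
  oscillation m k g <= oscillation m k h + 2%:E * \int[m]_x (`|g x - h x|)%:E.
Proof.
move=> ck mg mh; have [mk k0 ks k1] := ck.
pose F (x : T) := (`|g x - h x|)%:E.
have mF : measurable_fun setT F.
  by rewrite /F; mfun.
have F0 x : 0 <= F x by rewrite lee_fin.
have h1 := contraction_kernel_L1 ck mF F0.
have h2 := contraction_kernel_out ck mF F0.
have mA : measurable_fun setT (fun z : T * T => (k z.1 z.2)%:E * F z.1) by mfun.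
have mB : measurable_fun setT (fun z : T * T => (k z.1 z.2)%:E * F z.2) by mfun.
have mO (g' : T -> R) : measurable_fun setT g' ->
    measurable_fun setT (fun z : T * T => (k z.1 z.2 * `|g' z.2 - g' z.1|)%:E).
  by move=> mg'; mfun.
have O0 (g' : T -> R) (z : T * T) : 0 <= (k z.1 z.2 * `|g' z.2 - g' z.1|)%:E by rewrite lee_fin mulr_ge0.
have A0 (z : T * T) : 0 <= (k z.1 z.2)%:E * F z.1 by rewrite mule_ge0// lee_fin.
have B0 (z : T * T) : 0 <= (k z.1 z.2)%:E * F z.2 by rewrite mule_ge0// lee_fin.
have S1 := @integral2_leD _ _ _ _ m m (fun z : T * T => (k z.1 z.2 * `|g z.2 - g z.1|)%:E)
  (fun z : T * T => (k z.1 z.2 * `|h z.2 - h z.1|)%:E)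
  (fun z => (k z.1 z.2)%:E * F z.1 + (k z.1 z.2)%:E * F z.2).
apply: le_trans; first apply: S1 => //.
- exact: mO.
- exact: mO.
- exact: emeasurable_funD.
- by move=> z; rewrite adde_ge0.
- move=> [x y] /=; rewrite -!EFinM -!EFinD lee_fin -mulrDr -mulrDr ler_wpM2l//.
  have -> : (g y - g x = (h y - h x) + ((g y - h y) - (g x - h x)))%R by ring.
  apply: le_trans (ler_normD _ _) _; rewrite lerD2l [leRHS]addrC.
  exact: ler_normB.
rewrite leeD2l//.
have S2 := @integral2_leD _ _ _ _ m m (fun z => (k z.1 z.2)%:E * F z.1 + (k z.1 z.2)%:E * F z.2)
  (fun z => (k z.1 z.2)%:E * F z.1) (fun z => (k z.1 z.2)%:E * F z.2).
apply: le_trans; first apply: S2 => //.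
- exact: emeasurable_funD.
- by move=> z; rewrite adde_ge0.
- by rewrite mule_natl mule2n leeD.
Qed.

Lemma oscillation_le0 k g : contraction_kernel m k -> measurable_fun setT g ->
  oscillation m k g <= 2%:E * \int[m]_x (`|g x|)%:E.
Proof.
move=> ck mg; apply: le_trans (oscillation_le ck mg (@measurable_cst _ _ _ _ _ (0%R : R))) _.
under [in leLHS]eq_integral do rewrite subr0.
rewrite [X in X + _](_ : _ = 0) ?add0e//.
rewrite /oscillation; under eq_integral.
  by move=> x _; under eq_integral do rewrite subrr normr0 mulr0; rewrite integral0; over.
by rewrite integral0.
Qed.

End one_space.
Section tensor.
Context {d1 d2} {T1 : measurableType d1} {T2 : measurableType d2}.
Context (m1 : {sigma_finite_measure set T1 -> \bar R}).
Context (m2 : {sigma_finite_measure set T2 -> \bar R}).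
Variables (k1 : T1 -> T1 -> R) (k2 : T2 -> T2 -> R).
Hypotheses (ck1 : contraction_kernel m1 k1) (ck2 : contraction_kernel m2 k2).

(** Move from (x1, x2) to (y1, y2) through (y1, x2), changing one coordinate at a time; the kernel
    of a variable absent from the difference integrates to at most 1. *)
Lemma oscillation_tensor (g : T1 * T2 -> R) : measurable_fun setT g ->
  \int[m1]_x1 \int[m2]_x2 \int[m1]_y1 \int[m2]_y2
    (k1 x1 y1 * k2 x2 y2 * `|g (y1, y2) - g (x1, x2)|)%:E <=
  \int[m1]_y1 oscillation m2 k2 (fun y2 => g (y1, y2)) +
  \int[m2]_x2 oscillation m1 k1 (fun x1 => g (x1, x2)).
Proof.
move=> mg; have [mk1 k10 k1s k11] := ck1; have [mk2 k20 k2s k21] := ck2.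
pose a (z : T2 * T1) : \bar R :=
  \int[m2]_y2 (k2 z.1 y2 * `|g (z.2, y2) - g (z.2, z.1)|)%:E.
have ma : measurable_fun setT a.
  apply: (measurable_fun_fubini_tonelli_F (fun w : (T2 * T1) * T2 =>
    (k2 w.1.1 w.2 * `|g (w.1.2, w.2) - g (w.1.2, w.1.1)|)%:E)); first mfun.
  by move=> w; rewrite lee_fin mulr_ge0.
have a0 z : 0 <= a z by apply: integral_ge0 => y _; rewrite lee_fin mulr_ge0.
pose A (z : T1 * T2) : \bar R := \int[m1]_y1 ((k1 z.1 y1)%:E * a (z.2, y1)).
pose B (z : T1 * T2) : \bar R := \int[m1]_y1 (k1 z.1 y1 * `|g (y1, z.2) - g (z.1, z.2)|)%:E.
pose I (z : T1 * T2) : \bar R := \int[m1]_y1 \int[m2]_y2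
    (k1 z.1 y1 * k2 z.2 y2 * `|g (y1, y2) - g (z.1, z.2)|)%:E.
have mI : measurable_fun setT I.
  have m' : measurable_fun setT (fun w : (T1 * T2) * T1 => \int[m2]_y2
     (k1 w.1.1 w.2 * k2 w.1.2 y2 * `|g (w.2, y2) - g (w.1.1, w.1.2)|)%:E).
    apply: (measurable_fun_fubini_tonelli_F (fun v : ((T1 * T2) * T1) * T2 =>
      (k1 v.1.1.1 v.1.2 * k2 v.1.1.2 v.2 * `|g (v.1.2, v.2) - g (v.1.1.1, v.1.1.2)|)%:E)).
      mfun.
    by move=> w; rewrite lee_fin !mulr_ge0.
  apply: (measurable_fun_fubini_tonelli_F _ m') => w.
  by apply: integral_ge0 => y _; rewrite lee_fin !mulr_ge0.
have mA : measurable_fun setT A.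
  apply: (measurable_fun_fubini_tonelli_F (fun w : (T1 * T2) * T1 =>
     (k1 w.1.1 w.2)%:E * a (w.1.2, w.2))); first mfun.
  by move=> w; rewrite mule_ge0// lee_fin.
have mB : measurable_fun setT B.
  apply: (measurable_fun_fubini_tonelli_F (fun w : (T1 * T2) * T1 =>
     (k1 w.1.1 w.2 * `|g (w.2, w.1.2) - g (w.1.1, w.1.2)|)%:E)); first mfun.
  by move=> w; rewrite lee_fin mulr_ge0.
have I0 z : 0 <= I z.
  by apply: integral_ge0 => y1 _; apply: integral_ge0 => y2 _; rewrite lee_fin !mulr_ge0.
have A0 z : 0 <= A z by apply: integral_ge0 => y1 _; rewrite mule_ge0// lee_fin.
have B0 z : 0 <= B z by apply: integral_ge0 => y1 _; rewrite lee_fin mulr_ge0.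
have IAB z : I z <= A z + B z.
  case: z => x1 x2.
  have S := @integral2_leD _ _ _ _ m1 m2
    (fun y => (k1 x1 y.1 * k2 x2 y.2 * `|g (y.1, y.2) - g (x1, x2)|)%:E)
    (fun y => (k1 x1 y.1 * (k2 x2 y.2 * `|g (y.1, y.2) - g (y.1, x2)|))%:E)
    (fun y => ((k1 x1 y.1 * `|g (y.1, x2) - g (x1, x2)|) * k2 x2 y.2)%:E).
  have mk1x : measurable_fun setT (k1 x1) by exact: measurable_ker.
  have mk2x : measurable_fun setT (k2 x2) by exact: measurable_ker.
  apply: le_trans; first apply: S => //.
  - mfun.
  - mfun.
  - mfun.
  - by move=> z; rewrite lee_fin !mulr_ge0.
  - by move=> z; rewrite lee_fin !mulr_ge0.
  - by move=> z; rewrite lee_fin !mulr_ge0.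
  - move=> [y1 y2] /=; rewrite -EFinD lee_fin.
    have kk : (0 <= k1 x1 y1 * k2 x2 y2)%R by rewrite mulr_ge0.
    have := ler_wpM2l kk (ler_distD (g (y1, x2)) (g (y1, y2)) (g (x1, x2))).
    move: (`|_ - _|)%R (`|_ - _|)%R (`|_ - _|)%R => u v w; nra.
  rewrite /A /B/=; apply: leeD.
    rewrite le_eqVlt; apply/orP; left; apply/eqP; apply: eq_integral => y1 _.
    under eq_integral do rewrite EFinM.
    rewrite ge0_integralZl//; [by mfun|by move=> y2 _; rewrite lee_fin mulr_ge0|].
    by rewrite lee_fin.
  apply: ge0_le_integral => //.
  - by move=> y1 _; apply: integral_ge0 => y2 _; rewrite lee_fin !mulr_ge0.
  - apply: (measurable_fun_fubini_tonelli_F (fun y : T1 * T2 =>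
      ((k1 x1 y.1 * `|g (y.1, x2) - g (x1, x2)|) * k2 x2 y.2)%:E)); first mfun.
    by move=> w; rewrite lee_fin !mulr_ge0.
  - mfun.
  - move=> y1 _; under eq_integral do rewrite EFinM.
    rewrite ge0_integralZl//; last 3 first.
    + exact/measurable_EFinP.
    + by move=> y2 _; rewrite lee_fin.
    + by rewrite lee_fin mulr_ge0.
    by rewrite -[leRHS]mule1 lee_wpmul2l// lee_fin mulr_ge0.
apply: le_trans.
  exact: (@integral2_leD _ _ _ _ m1 m2 I A B mI mA mB I0 A0 B0 IAB).
apply: leeD; last first.
  by rewrite (fubini_tonelli B).
pose al (y1 : T1) : \bar R := \int[m2]_x2 a (x2, y1).
have mal : measurable_fun setT al by exact: (measurable_fun_fubini_tonelli_G _ ma).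
apply: le_trans (contraction_kernel_L1 ck1 mal _); last first.
  by move=> y; apply: integral_ge0 => x _; exact: a0.
rewrite le_eqVlt; apply/orP; left; apply/eqP; apply: eq_integral => x1 _.
have mk1x : measurable_fun setT (k1 x1) by exact: measurable_ker.
rewrite /A/= (fubini_tonelli (fun w : T2 * T1 => (k1 x1 w.2)%:E * a w)); last 2 first.
- by mfun.
- by move=> w; rewrite mule_ge0// lee_fin.
apply: eq_integral => y1 _; rewrite /= ge0_integralZl//; last by rewrite lee_fin.
by apply: (measurableT_comp ma); mfun.
Qed.

End tensor.
End contraction_kernels.

(** * The one-dimensional heat kernel *)

Section heat_1d.
Context {R : realType}.
Local Notation mR := (measurableTypeR R).
Local Notation leb := (@lebesgue_measure R).
Implicit Types (r s x y : R).

Definition mehler_mass r x : R :=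
  Num.sqrt (2 / (1 + r ^+ 2)) * expR (- ((1 - r ^+ 2) / (2 * (1 + r ^+ 2)) * x ^+ 2)).

Lemma expR_half_ln (z : R) : 0 < z -> expR (- (ln z / 2)) = (Num.sqrt z)^-1.
Proof.
move=> z0; rewrite expRN; congr (_^-1).
by rewrite -powR12_sqrt ?ltW// /powR gt_eqF// mulrC.
Qed.

Lemma sqrt_pi_ratio (c v z : R) : 0 < c -> 0 < v -> 0 < z -> c * z = 2 * v ->
  (Num.sqrt pi)^-1 * (Num.sqrt z)^-1 = Num.sqrt c * (Num.sqrt (v * pi *+ 2))^-1.
Proof.
move=> c0 v0 z0 E; move: (@pi R) (@pi_gt0 R) => q p0.
rewrite -invfM -sqrtrM ?(ltW p0)// -(sqrtrV (x := v * q *+ 2)) -?sqrtrM ?(ltW c0)//; last first.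
  by rewrite mulrn_wge0// mulr_ge0// ltW.
rewrite -sqrtrV ?mulr_ge0 ?(ltW p0) ?(ltW z0)//; congr Num.sqrt.
rewrite -mulr_natr.
have -> : v * q * 2 = c * z * q by rewrite E; ring.
by field; rewrite !gt_eqF.
Qed.

(** Completing the square in y: the kernel is a normal density in y times its mass, so the Gaussian
    integral is inherited from [normal_pdf]. *)
Lemma mehler_normal r x y : 0 < r < 1 ->
  mehler r x y = mehler_mass r x *
    normal_pdf (2 * r / (1 + r ^+ 2) * x) (Num.sqrt ((1 - r ^+ 2) / (1 + r ^+ 2))) y.
Proof.
move=> /andP[r0 r1].
have z0 : 0 < 1 - r ^+ 2 by rewrite subr_gt0 expr_lt1// ltW.
have w0 : 0 < 1 + r ^+ 2 by rewrite addr_gt0// exprn_gt0.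
have v0 : 0 < (1 - r ^+ 2) / (1 + r ^+ 2) by rewrite divr_gt0.
rewrite normal_pdfE ?gt_eqF ?sqrtr_gt0// /normal_peak /normal_fun sqr_sqrtr ?ltW//.
rewrite /mehler /mehler_mass -addrA expRD (expR_half_ln z0).
set v := (1 - r ^+ 2) / (1 + r ^+ 2); set c := 2 / (1 + r ^+ 2).
have c0 : 0 < c by rewrite divr_gt0.
have E : c * (1 - r ^+ 2) = 2 * v by rewrite /c /v; field; rewrite gt_eqF.
rewrite mulrA (sqrt_pi_ratio c0 v0 z0 E).
rewrite [RHS]mulrACA -expRD; congr (_ * expR _); rewrite /v -mulr_natr.
have z1 : 1 - r ^+ 2 = (1 - r) * (1 + r) by ring.
rewrite z1; field; rewrite !gt_eqF//; lra.
Qed.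

(** Half of the quadratic form in x - y is kept as a normal density of variance 4(1-r)/(1+r), and
    the other half supplies decay away from the diagonal. The constant 3 bounds sqrt(8)/(1+r). *)
Lemma mehler_tail r x y : 0 < r < 1 ->
  mehler r x y <= 3 * normal_pdf x (Num.sqrt (4 * (1 - r) / (1 + r))) y *
    expR (- ((x - y) ^+ 2 / (8 * (1 - r)))).
Proof.
move=> /andP[r0 r1].
have z0 : 0 < 1 - r ^+ 2 by rewrite subr_gt0 expr_lt1// ltW.
have r1' : 0 < 1 - r by rewrite subr_gt0.
have r2' : 0 < 1 + r by rewrite addr_gt0.
have v0 : 0 < 4 * (1 - r) / (1 + r) by rewrite divr_gt0// mulr_gt0.
rewrite normal_pdfE ?gt_eqF ?sqrtr_gt0// /normal_peak /normal_fun sqr_sqrtr ?(ltW v0)//.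
rewrite /mehler -addrA expRD (expR_half_ln z0).
set v := 4 * (1 - r) / _ in v0 *.
pose c := 8 / (1 + r) ^+ 2.
have c0 : 0 < c by rewrite divr_gt0// exprn_gt0.
have E : c * (1 - r ^+ 2) = 2 * v.
  by rewrite /c /v; field; rewrite gt_eqF.
rewrite mulrA (sqrt_pi_ratio c0 v0 z0 E).
have c3 : Num.sqrt c <= 3.
  rewrite -[leRHS](@sqr_sqrtr _ 3)// -[leRHS]/(_ ^+ 2).
  have -> : Num.sqrt 3 ^+ 2 = Num.sqrt (9 : R).
    by rewrite sqr_sqrtr// (_ : 9 = 3 ^+ 2 :> R) ?sqrtr_sqr ?ger0_norm//; ring.
  rewrite ler_sqrt// ler_pdivrMr ?exprn_gt0//.
  by have := sqr_ge0 r; nra.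
rewrite -[leLHS]mulrA -[leRHS]mulrA -[X in _ <= _ * X]mulrA.
apply: ler_pM => //.
rewrite ler_wpM2l ?invr_ge0 ?sqrtr_ge0// -expRD ler_expR.
have h : 0 <= (1 - r) / (1 + r) * (x + y) ^+ 2 / 4.
  by rewrite divr_ge0// mulr_ge0 ?sqr_ge0// divr_ge0// ltW.
have -> : - (y - x) ^+ 2 / (v *+ 2) = - ((1 + r) / (1 - r) * (x - y) ^+ 2 / 8).
  by rewrite /v -mulr_natr; field; rewrite !gt_eqF.
have -> : (1 + r) / (1 - r) * (x - y) ^+ 2 / 4 =
  (1 + r) / (1 - r) * (x - y) ^+ 2 / 8 + ((x - y) ^+ 2 / (8 * (1 - r)) + r * ((x - y) ^+ 2 / (8 * (1 - r)))).
  by field; rewrite gt_eqF.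
have h2 : 0 <= r * ((x - y) ^+ 2 / (8 * (1 - r))).
  by rewrite mulr_ge0 ?divr_ge0 ?sqr_ge0 ?mulr_ge0// ltW.
lra.
Qed.

(** The kernel of e^(-sH) in dimension one: the eigenvalue 2k + 1 contributes e^(-s) (e^(-2s))^k. *)
Definition heat1 s x y : R := expR (- s) * mehler (expR (- (2 * s))) x y.

Definition heat1_mass s x : R := expR (- s) * mehler_mass (expR (- (2 * s))) x.

Lemma measurable_mehler r : measurable_fun setT (fun z : mR * mR => mehler r z.1 z.2).
Proof.
apply: measurable_funM => //; apply: measurableT_comp => //.
apply: measurable_funB; last first.
  apply: measurable_funM => //; apply: measurable_funM => //.
  by apply: measurable_funX; apply: measurable_funD.
apply: measurable_funB => //; apply: measurable_funM => //; apply: measurable_funM => //.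
by apply: measurable_funX; apply: measurable_funB.
Qed.

Lemma measurable_heat1 s : measurable_fun setT (fun z : mR * mR => heat1 s z.1 z.2).
Proof. by apply: measurable_funM => //; exact: measurable_mehler. Qed.

Lemma heat1_gt0 s x y : 0 < heat1 s x y.
Proof. by rewrite mulr_gt0 ?expR_gt0 ?mehler_gt0. Qed.

Lemma mehlerC r x y : mehler r x y = mehler r y x.
Proof.
by rewrite /mehler (addrC y x) -[in (y - x) ^+ 2]opprB sqrrN.
Qed.

Lemma heat1_ratio s : 0 < s -> 0 < expR (- (2 * s)) < 1.
Proof. by move=> s0; rewrite expR_gt0 expR_lt1 oppr_lt0 mulr_gt0. Qed.

Lemma integral_heat1 s x : 0 < s -> (\int[leb]_y (heat1 s x y)%:E = (heat1_mass s x)%:E)%E.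
Proof.
move=> s0; have r01 := heat1_ratio s0.
rewrite /heat1; under eq_integral do rewrite (mehler_normal x _ r01) mulrA EFinM.
rewrite ge0_integralZl//; last 3 first.
- by apply/measurable_EFinP; exact: measurable_normal_pdf.
- by move=> y _; rewrite lee_fin normal_pdf_ge0.
- by rewrite lee_fin !mulr_ge0 ?expR_ge0// sqrtr_ge0.
by rewrite integral_normal_pdf mule1.
Qed.

Lemma heat1_mass_ge0 s x : 0 <= heat1_mass s x.
Proof. by rewrite !mulr_ge0 ?expR_ge0 ?sqrtr_ge0. Qed.

(** With r = e^(-2s), the inequality 2r <= 1 + r^2 says that the square-root factor is at most
    e^s. *)
Lemma heat1_mass_le1 s x : 0 < s -> heat1_mass s x <= 1.
Proof.
move=> s0; have /andP[r0 r1] := heat1_ratio s0.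
rewrite /heat1_mass /mehler_mass; set r := expR (- (2 * s)) in r0 r1 *.
have z0 : 0 < 1 - r ^+ 2 by rewrite subr_gt0 expr_lt1// ltW.
have w0 : 0 < 1 + r ^+ 2 by rewrite addr_gt0// exprn_gt0.
have A : expR (- ((1 - r ^+ 2) / (2 * (1 + r ^+ 2)) * x ^+ 2)) <= 1.
  rewrite -[leRHS]expR0 ler_expR oppr_le0 mulr_ge0 ?sqr_ge0//.
  by rewrite divr_ge0 ?mulr_ge0// ltW.
have B : Num.sqrt (2 / (1 + r ^+ 2)) <= expR s.
  have -> : expR s = Num.sqrt (expR s ^+ 2) by rewrite sqrtr_sqr ger0_norm ?expR_ge0.
  rewrite ler_sqrt ?exprn_gt0 ?expR_gt0// -expRM_natl.
  have -> : expR (2 * s) = r^-1 by rewrite /r expRN invrK.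
  rewrite ler_pdivrMr// mulrC ler_pdivlMr//.
  by have := sqr_ge0 (1 - r); nra.
apply: (@le_trans _ _ (expR (- s) * (expR s * 1))).
  rewrite ler_wpM2l ?expR_ge0// ler_pM ?sqrtr_ge0 ?expR_ge0//.
by rewrite mulr1 -expRD addNr expR0.
Qed.

Lemma contraction_heat1 s : 0 < s -> contraction_kernel leb (heat1 s : mR -> mR -> R).
Proof.
move=> s0; split.
- exact: measurable_heat1.
- by move=> x y; rewrite ltW// heat1_gt0.
- by move=> x y; rewrite /heat1 mehlerC.
- by move=> x; rewrite integral_heat1// lee_fin heat1_mass_le1.
Qed.

End heat_1d.

Section cvge0.
Context {R : realType}.
Local Open Scope ereal_scope.

Lemma cvge0P {T : Type} (F : set_system T) {FF : ProperFilter F} (u : T -> \bar R) :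
  (forall n, 0 <= u n) ->
  (forall e : R, (0 < e)%R -> \forall n \near F, u n <= e%:E) <-> u n @[n --> F] --> 0.
Proof.
move=> u0; split=> [h|/fine_cvgP[ufin uc] e e0].
  apply/fine_cvgP; split.
    near=> n; rewrite ge0_fin_numE//.
    by apply: (@le_lt_trans _ _ 1%:E); [near: n; exact: h|rewrite ltry].
  apply/cvgrPdist_le => e e0; near=> n; rewrite sub0r normrN /=.
  have un : u n <= e%:E by near: n; exact: h.
  have uf : u n \is a fin_num by rewrite ge0_fin_numE// (le_lt_trans un)// ltry.
  by rewrite ger0_norm ?fine_ge0// -lee_fin fineK.
move/cvgrPdist_le : uc => /(_ _ e0) uc.
near=> n; have uf : u n \is a fin_num by near: n.
rewrite -(fineK uf) lee_fin.
have : (`|0 - (fine \o u) n| <= e)%R by near: n.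
by rewrite sub0r normrN /= ger0_norm// fine_ge0.
Unshelve. all: by end_near. Qed.

Lemma dct0 d (T : measurableType d) (m : {measure set T -> \bar R})
    (f_ : nat -> T -> \bar R) (g : T -> \bar R) :
  (forall n, measurable_fun setT (f_ n)) -> (forall n x, 0 <= f_ n x) ->
  (forall n x, f_ n x <= g x) -> measurable_fun setT g -> \int[m]_x g x < +oo ->
  {ae m, forall x, f_ ^~ x @ \oo --> 0} ->
  \int[m]_x f_ n x @[n --> \oo] --> 0.
Proof.
move=> mf f0 fg mg ig fc.
have g0 x : 0 <= g x by exact: le_trans (fg 0%N x).
have h1 : {ae m, forall x, setT x -> f_ ^~ x @ \oo --> cst 0 x}.
  by apply: filterS fc => x h _; exact: h.
have h2 : m.-integrable setT g.
  apply/integrableP; split => //; under eq_integral do rewrite gee0_abs//.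
  exact: ig.
have h3 : {ae m, forall x n, setT x -> `|f_ n x| <= g x}.
  by apply: nearW => x n _; rewrite gee0_abs.
have [_ _] := dominated_convergence measurableT mf (@measurable_cst _ _ _ _ setT 0) h1 h2 h3.
by rewrite integral0.
Qed.

End cvge0.

Section heat1_approx.
Context {R : realType}.
Local Notation mR := (measurableTypeR R).
Local Notation leb := (@lebesgue_measure R).
Implicit Types (r s x y : R).

(** The bound e^(-z) <= 1/z applied to the extra Gaussian factor of [mehler_tail] yields a factor
    linear in s, in front of a probability density in y. *)
Lemma heat1_tail s x y (rho : R) : 0 < s -> 0 < rho -> rho <= `|x - y| ->
  heat1 s x y <= 48 * s / rho ^+ 2 *
    normal_pdf x (Num.sqrt (4 * (1 - expR (- (2 * s))) / (1 + expR (- (2 * s))))) y.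
Proof.
move=> s0 rho0 xy; have r01 := heat1_ratio s0; have /andP[r0 r1] := r01.
set N := normal_pdf _ _ _; have N0 : 0 <= N by exact: normal_pdf_ge0.
have r1' : 0 < 1 - expR (- (2 * s)) by rewrite subr_gt0.
have hs : 1 - expR (- (2 * s)) <= 2 * s by have := expR_ge1Dx (- (2 * s)); lra.
have h1 : heat1 s x y <= mehler (expR (- (2 * s))) x y.
  rewrite /heat1 ger_pMl ?mehler_gt0// -[leRHS]expR0 ler_expR oppr_le0 ltW//.
apply: le_trans h1 _; apply: le_trans (mehler_tail _ _ r01) _; rewrite -/N.
have rho2 : 0 < rho ^+ 2 by rewrite exprn_gt0.
have e1 : expR (- ((x - y) ^+ 2 / (8 * (1 - expR (- (2 * s)))))) <= 16 * s / rho ^+ 2.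
  have xy2 : rho ^+ 2 <= (x - y) ^+ 2.
    by rewrite -(real_normK (num_real (x - y))) lerXn2r// nnegrE ltW.
  have h2 : rho ^+ 2 / (16 * s) <= (x - y) ^+ 2 / (8 * (1 - expR (- (2 * s)))).
    have a1 : 0 <= (16 * s)^-1 by rewrite invr_ge0 mulr_ge0// ltW.
    have a2 : (16 * s)^-1 <= (8 * (1 - expR (- (2 * s))))^-1.
      by rewrite lef_pV2 ?posrE ?mulr_gt0//; lra.
    by apply: ler_pM => //; exact: ltW.
  apply: (@le_trans _ _ (expR (- (rho ^+ 2 / (16 * s))))); first by rewrite ler_expR lerN2.
  rewrite expRN -[leRHS]invrK lef_pV2 ?posrE ?expR_gt0// ?invr_gt0 ?divr_gt0 ?mulr_gt0//.
  rewrite invf_div; have := expR_ge1Dx (rho ^+ 2 / (16 * s)); lra.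
have := ler_wpM2l (mulr_ge0 (ler0n R 3) N0) e1.
have -> : 3 * N * (16 * s / rho ^+ 2) = 48 * s / rho ^+ 2 * N by ring.
by [].
Qed.

(* off the diagonal the Gaussian factor beats the bound 2H on the oscillation *)
Lemma heat1_osc_le s x (h : mR -> R) (H e rho : R) : 0 < s -> 0 < rho -> 0 <= e ->
  measurable_fun setT h -> (forall y, `|h y| <= H) ->
  (forall y, `|x - y| < rho -> `|h y - h x| <= e) ->
  (\int[leb]_y (heat1 s x y * `|h y - h x|)%:E <= (e + 96 * H * s / rho ^+ 2)%:E)%E.
Proof.
move=> s0 rho0 e0 mh hH he.
set tau := Num.sqrt (4 * (1 - expR (- (2 * s))) / (1 + expR (- (2 * s)))).
have H0 : 0 <= H by exact: le_trans (hH 0).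
have c0 : 0 <= 96 * H * s / rho ^+ 2.
  by rewrite divr_ge0 ?sqr_ge0// !mulr_ge0// ltW.
have mk : measurable_fun setT (fun y : mR => heat1 s x y).
  exact: (measurable_ker x (measurable_heat1 s)).
have [_ k0 _ k1] := contraction_heat1 s0.
apply: (@le_trans _ _ (\int[leb]_y (e%:E * (heat1 s x y)%:E +
    (96 * H * s / rho ^+ 2)%:E * (normal_pdf x tau y)%:E))%E).
  apply: ge0_le_integral => //.
  - by move=> y _; rewrite lee_fin mulr_ge0.
  - by mfun.
  - apply: emeasurable_funD; apply: emeasurable_funM => //.
      exact/measurable_EFinP.
    by apply/measurable_EFinP; exact: measurable_normal_pdf.
  move=> y _; rewrite -!EFinM -EFinD lee_fin.
  have N0 := normal_pdf_ge0 x tau y.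
  have [xy|xy] := ltP `|x - y| rho.
    have := ler_wpM2l (k0 x y) (he _ xy); have := mulr_ge0 c0 N0; lra.
  have t := heat1_tail s0 rho0 xy; rewrite -/tau in t.
  have hd : `|h y - h x| <= 2 * H.
    apply: le_trans (ler_normB _ _) _; have := hH x; have := hH y; lra.
  have := ler_pM (k0 x y) (normr_ge0 _) t hd.
  have := mulr_ge0 e0 (k0 x y).
  have -> : 48 * s / rho ^+ 2 * normal_pdf x tau y * (2 * H) =
    96 * H * s / rho ^+ 2 * normal_pdf x tau y by ring.
  lra.
rewrite ge0_integralD//; last 4 first.
- by move=> y _; rewrite -EFinM lee_fin mulr_ge0.
- by apply: emeasurable_funM => //; exact/measurable_EFinP.
- by move=> y _; rewrite -EFinM lee_fin mulr_ge0// normal_pdf_ge0.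
- by apply: emeasurable_funM => //; apply/measurable_EFinP; exact: measurable_normal_pdf.
rewrite ge0_integralZl//; last 2 first.
- exact/measurable_EFinP.
- by move=> y _; rewrite lee_fin.
rewrite ge0_integralZl//; last 2 first.
- by apply/measurable_EFinP; exact: measurable_normal_pdf.
- by move=> y _; rewrite lee_fin normal_pdf_ge0.
rewrite integral_normal_pdf mule1 EFinD; apply: leeD => //.
by rewrite -[leRHS]mule1 lee_wpmul2l// lee_fin.
Qed.

End heat1_approx.

Section heat1_approx_id.
Context {R : realType}.
Local Notation mR := (measurableTypeR R).
Local Notation leb := (@lebesgue_measure R).
Local Open Scope ereal_scope.

Variable s : R^nat.
Hypotheses (s0 : forall n, (0 < s n)%R) (s_cvg : s @ \oo --> (0 : R)%R).

Lemma heat1_osc_cvg0 (x : R) (h : mR -> R) (H : R) :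
  measurable_fun setT h -> (forall y, (`|h y| <= H)%R) ->
  (forall e : R, (0 < e)%R -> exists2 rho : R, (0 < rho)%R &
     forall y, (`|x - y| < rho -> `|h y - h x| <= e)%R) ->
  \int[leb]_y (heat1 (s n) x y * `|h y - h x|)%:E @[n --> \oo] --> 0.
Proof.
move=> mh hH hc; apply/cvge0P.
  move=> n; apply: integral_ge0 => y _; rewrite lee_fin mulr_ge0//.
  by rewrite ltW// heat1_gt0.
move=> e e0; have e2 : (0 < e / 2)%R by rewrite divr_gt0.
have [rho rho0 hrho] := hc _ e2.
have H0 : (0 <= H)%R by exact: le_trans (hH x).
pose c : R := (96 * H / rho ^+ 2)%R.
have c0 : (0 <= c)%R by apply: divr_ge0; [exact: mulr_ge0|exact: sqr_ge0].
have sc : (fun n => c * s n)%R @ \oo --> (c * 0)%R by exact: cvgMl_tmp.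
rewrite mulr0 in sc; move/cvgrPdist_le : sc => /(_ _ e2) sc.
near=> n.
apply: le_trans (heat1_osc_le (s0 n) rho0 (ltW e2) mh hH hrho) _.
have : (`|0 - c * s n| <= e / 2)%R by near: n.
rewrite sub0r normrN lee_fin; have := ler_norm (c * s n)%R.
have -> : (96 * H * s n / rho ^+ 2 = c * s n)%R by rewrite /c; ring.
lra.
Unshelve. all: by end_near. Qed.

(** The truncated function jumps at the ends of the interval E. Pairs with both points outside E
    contribute nothing, and by symmetry the rest is at most twice the integral over x in E; there E
    being open gives continuity at x, and its finite measure gives domination. *)
Lemma heat1_osc_continuous (M : R) (h : mR -> R) : continuous (h : R -> R) ->
  oscillation leb (heat1 (s n) : mR -> mR -> R) (fun y => h y * \1_`](- M)%R, M[%classic y)%R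
    @[n --> \oo] --> 0.
Proof.
move=> hc; set E := `](- M)%R, M[%classic; set g : mR -> R := fun y => (h y * \1_E y)%R.
have mh : measurable_fun setT h by exact: continuous_measurable_fun.
have mE : measurable_fun setT (\1_E : mR -> R) by apply: measurable_indic; exact: measurable_itv.
have mg : measurable_fun setT g by apply: measurable_funM.
have [H hH] : exists H : R, forall y, (`|g y| <= H)%R.
  have [/compact_bounded [H [_ HH]]] : compact (h @` `[(- M)%R, M]) /\ True.
    split=> //; apply: continuous_compact; last exact: segment_compact.
    exact: continuous_subspaceT.
  exists (`|H| + 1)%R => y; rewrite /g indicE.
  case: (boolP (y \in E)) => yE; last by rewrite mulr0 normr0 addr_ge0.
  rewrite mulr1; apply: HH; first by rewrite (le_lt_trans (ler_norm H))// ltrDl.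
  exists y => //; move: yE; rewrite inE /E/= !in_itv/= => /andP[yM1 yM2].
  by rewrite !ltW.
have H0 : (0 <= H)%R by exact: le_trans (hH 0%R).
have J0 x : E x -> \int[leb]_y (heat1 (s n) x y * `|g y - g x|)%:E @[n --> \oo] --> 0.
  move=> Ex; apply: (heat1_osc_cvg0 mg hH) => e e0.
  have oE : open E by exact: interval_open.
  have /nbhs_ballP[r1 /= r10 h1] : nbhs x E by apply: open_nbhs_nbhs.
  have /cvgrPdist_le/(_ _ e0)/nbhs_ballP[r2 /= r20 h2] := hc x.
  exists (Num.min r1 r2); first by rewrite lt_min r10.
  move=> y; rewrite lt_min => /andP[y1 y2].
  have Ey : E y by exact: h1.
  rewrite /g !indicE !mem_set// !mulr1 distrC; exact: h2.
have ck n := contraction_heat1 (s0 n).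
pose F n (z : mR * mR) : \bar R := (heat1 (s n) z.1 z.2 * `|g z.2 - g z.1|)%:E.
have mF n : measurable_fun setT (F n).
  by have [mk _ _ _] := ck n; rewrite /F; mfun.
have F0 n z : 0 <= F n z.
  by have [_ k0 _ _] := ck n; rewrite lee_fin mulr_ge0.
pose J n (x : mR) : \bar R := (\1_E x)%:E * \int[leb]_y F n (x, y).
have Jint0 n x : 0 <= \int[leb]_y F n (x, y) by apply: integral_ge0.
have JH n x : \int[leb]_y F n (x, y) <= (2 * H)%:E.
  have [mk k0 _ k1] := ck n.
  have mkx : measurable_fun setT (fun y : mR => heat1 (s n) x y) by exact: (measurable_ker x mk).
  apply: (@le_trans _ _ (\int[leb]_y ((2 * H)%:E * (heat1 (s n) x y)%:E))).
    apply: ge0_le_integral => //.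
    - by rewrite /F/=; mfun.
    - by mfun.
    - move=> y _; rewrite /F/= -EFinM lee_fin mulrC ler_wpM2r//.
      apply: le_trans (ler_normB _ _) _; have := hH x; have := hH y; lra.
  rewrite ge0_integralZl//; last 3 first.
  - exact/measurable_EFinP.
  - by move=> y _; rewrite lee_fin.
  - by rewrite lee_fin mulr_ge0.
  by rewrite -[leRHS]mule1 lee_wpmul2l// lee_fin mulr_ge0.
have mJint n : measurable_fun setT (fun x : mR => \int[leb]_y F n (x, y)).
  exact: (measurable_fun_fubini_tonelli_F (F n)).
have mEE : measurable_fun setT (fun x : mR => (\1_E x)%:E : \bar R) by exact/measurable_EFinP.
have E0 x : 0 <= (\1_E x)%:E :> \bar R by rewrite lee_fin.
have finE : leb E < +oo.
  by rewrite /E lebesgue_measure_itv/=; case: ifPn => _; rewrite -?EFinB ltry.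
have Jcvg : \int[leb]_x J n x @[n --> \oo] --> 0.
  apply: (@dct0 _ _ _ leb _ (fun x => (\1_E x * (2 * H))%:E)).
  - by move=> n; exact: emeasurable_funM.
  - by move=> n x; rewrite mule_ge0.
  - by move=> n x; rewrite EFinM lee_wpmul2l.
  - by apply/measurable_EFinP; apply: measurable_funM.
  - under eq_integral do rewrite EFinM.
    rewrite ge0_integralZr//; last by rewrite lee_fin mulr_ge0.
    rewrite integral_indic//; last exact: measurable_itv.
    rewrite setIT; apply: lte_mul_pinfty => //; last by rewrite ltry.
    by rewrite ge0_fin_numE.
  - apply: nearW => x; rewrite /J indicE.
    case: (boolP (x \in E)) => [xE|_].
      by under eq_fun do rewrite mul1e; apply: J0; exact: set_mem.
    by under eq_fun do rewrite mul0e; exact: cvg_cst.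
have le2 n : oscillation leb (heat1 (s n) : mR -> mR -> R) g <= 2%:E * \int[leb]_x J n x.
  have [mk k0 ks k1] := ck n.
  have S := @integral2_leD _ _ _ _ _ leb leb (F n) (fun z => (\1_E z.1)%:E * F n z)
    (fun z => (\1_E z.2)%:E * F n z).
  have mG1 : measurable_fun setT (fun z : mR * mR => (\1_E z.1)%:E * F n z).
    apply: emeasurable_funM => //; apply: (measurableT_comp mEE); exact: measurable_fst.
  have mG2 : measurable_fun setT (fun z : mR * mR => (\1_E z.2)%:E * F n z).
    apply: emeasurable_funM => //; apply: (measurableT_comp mEE); exact: measurable_snd.
  apply: le_trans; first apply: S => //.
  - by move=> z; rewrite mule_ge0.
  - by move=> z; rewrite mule_ge0.
  - move=> [x y]; rewrite /= !indicE.
    case: (boolP (x \in E)) => xE; case: (boolP (y \in E)) => yE;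
      rewrite ?mul1e ?mul0e ?adde0 ?add0e//.
      by rewrite leeDl.
    by rewrite /F/= /g !indicE (negbTE xE) (negbTE yE) !mulr0 subrr normr0 mulr0.
  rewrite mule_natl mule2n; apply: leeD.
    apply: ge0_le_integral => //.
    - by move=> x _; apply: integral_ge0 => y _; rewrite mule_ge0.
    - apply: (measurable_fun_fubini_tonelli_F _ mG1) => z; by rewrite mule_ge0.
    - by apply: emeasurable_funM.
    move=> x _; rewrite /J /= ge0_integralZl//.
    by apply: (measurableT_comp (mF n)); mfun.
  rewrite (fubini_tonelli (fun z : mR * mR => (\1_E z.2)%:E * F n z))//; last first.
    by move=> z; rewrite mule_ge0.
  apply: ge0_le_integral => //.
  - by move=> x _; apply: integral_ge0 => y _; rewrite mule_ge0.
  - apply: (measurable_fun_fubini_tonelli_G _ mG2) => z; by rewrite mule_ge0.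
  - by apply: emeasurable_funM.
  move=> y _; rewrite /J /= ge0_integralZl//; last first.
    by apply: (measurableT_comp (mF n)); mfun.
  rewrite le_eqVlt; apply/orP; left; apply/eqP; congr (_ * _).
  by apply: eq_integral => x _; rewrite /F/= ks distrC.
apply/cvge0P; first by move=> n; exact: oscillation_ge0.
move=> e e0; have e2 : (0 < e / 2)%R by rewrite divr_gt0.
have J0' n : 0 <= \int[leb]_x J n x by apply: integral_ge0 => x _; rewrite mule_ge0.
move/(cvge0P J0') : Jcvg => /(_ _ e2); apply: filterS => n hn.
apply: le_trans (le2 n) _.
have := lee_wpmul2l (_ : 0 <= 2%:E) hn; rewrite -EFinM mulrCA divff// mulr1; apply.
by rewrite lee_fin.
Qed.

End heat1_approx_id.

Section heat1_L1.
Context {R : realType}.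
Local Notation mR := (measurableTypeR R).
Local Notation leb := (@lebesgue_measure R).
Local Open Scope ereal_scope.

(** The approximants have the truncated form treated by [heat1_osc_continuous]: cut [g] to a bounded
    interval, then approximate it there by a continuous function. *)
Lemma L1_dense_continuous (g : mR -> R) (e : R) : leb.-integrable setT (EFin \o g) ->
  (0 < e)%R -> exists (M : R) (h : mR -> R), continuous (h : R -> R) /\
  \int[leb]_y (`|g y - h y * \1_(`](- M)%R, M[%classic) y|)%:E <= e%:E.
Proof.
move=> /[dup] ig /integrableP[/measurable_EFinP mg lg] e0.
have e2 : (0 < e / 2)%R by rewrite divr_gt0.
pose E (n : nat) : set mR := `](- n%:R)%R, n%:R[%classic.
have mE n : measurable (E n) by exact: measurable_itv.
have mI n : measurable_fun setT (\1_(E n) : mR -> R) by exact: measurable_indic.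
have tail : \int[leb]_y (`|g y| * (1 - \1_(E n) y))%:E @[n --> \oo] --> 0.
  apply: (@dct0 _ _ _ leb _ (fun y => (`|g y|)%:E)) => //.
  - by move=> n; mfun.
  - move=> n x; rewrite lee_fin ler_piMr// gerBl indicE; by case: (_ \in _).
  - by mfun.
  - apply: nearW => y; apply: cvg_near_cst; near=> n.
    rewrite indicE mem_set ?subrr ?mulr0// /E /= in_itv/=.
    have : (`|y| < n%:R)%R by near: n; exact: nbhs_infty_gtr.
    by rewrite ltr_norml.
have t0 n : 0 <= \int[leb]_y (`|g y| * (1 - \1_(E n) y))%:E.
  by apply: integral_ge0 => y _; rewrite lee_fin mulr_ge0.
have [N hN] := filter_ex ((cvge0P t0).2 tail _ e2).
have finE : leb (E N) < +oo.
  by rewrite /E lebesgue_measure_itv/=; case: ifPn => _; rewrite -?EFinB ltry.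
have igE : leb.-integrable (E N) (EFin \o g) by apply: (integrableS _ _ _ ig).
have [h_ [hc _ hl]] := approximation_continuous_integrable (mE N) finE igE.
have l0 n : 0 <= \int[leb]_(z in E N) `|(g z - h_ n z)%:E| by apply: integral_ge0.
have [n hn] := filter_ex ((cvge0P l0).2 hl _ e2).
exists N%:R, (h_ n); split; first exact: hc.
have mh : measurable_fun setT (h_ n : mR -> R) by exact: continuous_measurable_fun.
rewrite -[leRHS]/((e)%:E) (splitr e) EFinD.
apply: le_trans (leeD hN hn).
pose F2 := (fun z => `|(g z - h_ n z)%:E|) \_ (E N).
have mF2 : measurable_fun setT F2.
  apply/(measurable_restrictT _ (mE N)); apply: measurable_funTS.
  by apply: measurableT_comp => //; mfun.
have F20 z : 0 <= F2 z by rewrite /F2 /patch; case: ifP.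
have mF1 : measurable_fun setT (fun y : mR => (`|g y| * (1 - \1_(E N) y))%:E) by mfun.
have F10 y : 0 <= (`|g y| * (1 - \1_(E N) y))%:E by rewrite lee_fin mulr_ge0.
rewrite (integral_mkcond (E N)) -/F2 -ge0_integralD//.
apply: ge0_le_integral => //.
- by mfun.
- exact: emeasurable_funD.
- move=> y _; rewrite /F2 /patch indicE -/(E N).
  case: ifPn => yE; first by rewrite !mulr1 subrr mulr0 add0e /=.
  by rewrite mulr0 !subr0 mulr1 adde0.
Unshelve. all: by end_near. Qed.

Variable s : R^nat.
Hypotheses (s0 : forall n, (0 < s n)%R) (s_cvg : s @ \oo --> (0 : R)%R).

Lemma approx_id_heat1 : approx_id leb (fun n => heat1 (s n) : mR -> mR -> R).
Proof.
move=> g ig; have /integrableP[/measurable_EFinP mg lg] := ig.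
have ck n := contraction_heat1 (s0 n).
apply/cvge0P; first by move=> n; exact: oscillation_ge0.
move=> e e0; have e4 : (0 < e / 4)%R by rewrite divr_gt0.
have e2 : (0 < e / 2)%R by rewrite divr_gt0.
have [M [h [hc hg]]] := L1_dense_continuous ig e4.
have c := heat1_osc_continuous s0 s_cvg M hc.
have o0 n := @oscillation_ge0 R _ _ leb _ (fun y => h y * \1_(`](- M)%R, M[%classic) y)%R (ck n).
move/(cvge0P o0) : c => /(_ _ e2); apply: filterS => n hn.
have mh : measurable_fun setT (fun y : mR => h y * \1_(`](- M)%R, M[%classic) y)%R.
  apply: measurable_funM; first exact: continuous_measurable_fun.
  by apply: measurable_indic; exact: measurable_itv.
apply: le_trans (oscillation_le (ck n) mg mh) _.
have -> : e%:E = (e / 2)%:E + 2%:E * (e / 4)%:E.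
  by rewrite -EFinM -EFinD; congr EFin; field.
by apply: leeD => //; rewrite lee_wpmul2l// lee_fin.
Qed.

End heat1_L1.

(** * Heat kernels in several variables *)

Section heatd.
Context {R : realType}.
Local Notation mR := (measurableTypeR R).
Local Notation leb := (@lebesgue_measure R).
Local Notation mu := (@lebesgue_tuple R).

Definition heatd {n} s (x y : n.-tuple mR) : R := \prod_(i < n) heat1 s (tnth x i) (tnth y i).

Definition heatd_mass {n} s (x : n.-tuple mR) : R := \prod_(i < n) heat1_mass s (tnth x i).

Lemma integral_heatd n s (x : n.-tuple mR) : 0 < s ->
  (\int[mu n]_y (heatd s x y)%:E = (heatd_mass s x)%:E)%E.
Proof.
move=> s0; rewrite /heatd (@integral_prod_tnth _ n (fun i y => heat1 s (tnth x i) y)).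
- by under eq_bigr do rewrite integral_heat1//; rewrite prodEFin.
- by move=> i; exact: (measurable_ker _ (measurable_heat1 s)).
- by move=> i y; rewrite ltW// heat1_gt0.
Qed.

Lemma heatd_mass_ge0 n s (x : n.-tuple mR) : 0 <= heatd_mass s x.
Proof. by apply: prodr_ge0 => i _; exact: heat1_mass_ge0. Qed.

Lemma heatd_mass_le1 n s (x : n.-tuple mR) : 0 < s -> heatd_mass s x <= 1.
Proof.
move=> s0; have -> : 1 = \prod_(i < n) (1 : R) by rewrite big1_eq.
by apply: ler_prod => i _; rewrite heat1_mass_ge0 heat1_mass_le1.
Qed.

Lemma contraction_heatd n s : 0 < s -> contraction_kernel (mu n) (@heatd n s).
Proof.
move=> s0; split.
- apply: measurable_prod => i _.
  have mh := measurable_heat1 s.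
  apply: (measurable_fun2 mh).
    by apply: (measurableT_comp (measurable_tnth i)); exact: measurable_fst.
  by apply: (measurableT_comp (measurable_tnth i)); exact: measurable_snd.
- by move=> x y; apply: prodr_ge0 => i _; rewrite ltW// heat1_gt0.
- by move=> x y; apply: eq_bigr => i _; rewrite /heat1 mehlerC.
- by move=> x; rewrite integral_heatd// lee_fin heatd_mass_le1.
Qed.

End heatd.

Section heatd_approx_id.
Context {R : realType}.
Local Notation mR := (measurableTypeR R).
Local Notation leb := (@lebesgue_measure R).
Local Notation mu := (@lebesgue_tuple R).
Local Open Scope ereal_scope.

Lemma heatd_cons n s (x y : mR) (xs ys : n.-tuple mR) :
  heatd s (tuple_cons (x, xs)) (tuple_cons (y, ys)) = (heat1 s x y * heatd s xs ys)%R.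
Proof.
rewrite /heatd big_ord_recl !tnth_tuple_cons0; congr (_ * _)%R.
by apply: eq_bigr => i _; rewrite !tnth_tuple_consS.
Qed.

Lemma oscillation_heatdS n s (g : n.+1.-tuple mR -> R) : (0 < s)%R ->
  measurable_fun setT g ->
  oscillation (mu n.+1) (heatd s) g <=
  \int[leb]_y1 oscillation (mu n) (heatd s) (fun ys => g (tuple_cons (y1, ys))) +
  \int[mu n]_xs oscillation leb (heat1 s : mR -> mR -> R) (fun x1 => g (tuple_cons (x1, xs))).
Proof.
move=> s0 mg; have [mk k0 ks k1] := contraction_heatd n.+1 s0.
rewrite /oscillation ge0_integral_tupleS; last 2 first.
- apply: (measurable_fun_fubini_tonelli_F (fun z : n.+1.-tuple mR * n.+1.-tuple mR =>
    (heatd s z.1 z.2 * `|g z.2 - g z.1|)%:E)); first by mfun.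
  by move=> z; rewrite lee_fin mulr_ge0.
- by move=> x; apply: integral_ge0 => y _; rewrite lee_fin mulr_ge0.
pose g' (z : mR * n.-tuple mR) : R := g (tuple_cons z).
have mg' : measurable_fun setT g'.
  by apply: (measurableT_comp mg); exact: measurable_tuple_cons.
have := oscillation_tensor (contraction_heat1 s0) (contraction_heatd n s0) mg'.
apply: le_trans; rewrite le_eqVlt; apply/orP; left; apply/eqP.
apply: eq_integral => x1 _; apply: eq_integral => xs _.
rewrite ge0_integral_tupleS; last 2 first.
- have mkx := measurable_ker (tuple_cons (x1, xs)) mk.
  by mfun.
- by move=> x; rewrite lee_fin mulr_ge0.
by apply: eq_integral => y1 _; apply: eq_integral => ys _; rewrite heatd_cons.
Qed.

Lemma measurable_oscillation_param d d' (T : measurableType d) (U : measurableType d')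
   (m : {sigma_finite_measure set T -> \bar R}) (k : T -> T -> R) (g : U * T -> R) :
  contraction_kernel m k -> measurable_fun setT g ->
  measurable_fun setT (fun u => oscillation m k (fun x => g (u, x))).
Proof.
move=> [mk k0 _ _] mg.
have m' : measurable_fun setT (fun w : U * T => \int[m]_y
     (k w.2 y * `|g (w.1, y) - g (w.1, w.2)|)%:E).
  apply: (measurable_fun_fubini_tonelli_F (fun v : (U * T) * T =>
    (k v.1.2 v.2 * `|g (v.1.1, v.2) - g (v.1.1, v.1.2)|)%:E)); first mfun.
  by move=> w; rewrite lee_fin mulr_ge0.
apply: (measurable_fun_fubini_tonelli_F _ m') => w.
by apply: integral_ge0 => y _; rewrite lee_fin mulr_ge0.
Qed.

(** Almost every slice g(u, .) is integrable, so its oscillation tends to 0; twice the L^1 norm of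
    the slice dominates. *)
Lemma cvg_integral_oscillation d d' (T : measurableType d) (U : measurableType d')
   (m : {sigma_finite_measure set T -> \bar R}) (m' : {sigma_finite_measure set U -> \bar R})
   (k : nat -> T -> T -> R) (g : U * T -> R) :
  (forall n, contraction_kernel m (k n)) -> approx_id m k -> measurable_fun setT g ->
  \int[m']_u \int[m]_x (`|g (u, x)|)%:E < +oo ->
  \int[m']_u oscillation m (k n) (fun x => g (u, x)) @[n --> \oo] --> 0.
Proof.
move=> ck ak mg lg.
have ig : (m' \x m).-integrable setT (EFin \o g).
  by apply/integrable12ltyP => //; exact/measurable_EFinP.
have mn : measurable_fun setT (fun u => \int[m]_x (`|g (u, x)|)%:E).
  apply: (measurable_fun_fubini_tonelli_F (fun z : U * T => (`|g z|)%:E)) => //; first mfun.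
have n0 u : 0 <= \int[m]_x (`|g (u, x)|)%:E by apply: integral_ge0.
apply: (@dct0 _ _ _ m' _ (fun u => 2%:E * \int[m]_x (`|g (u, x)|)%:E)).
- by move=> n; exact: measurable_oscillation_param.
- by move=> n u; exact: oscillation_ge0.
- move=> n u; apply: oscillation_le0 => //.
  by mfun.
- exact: measurable_funeM.
- by rewrite ge0_integralZl// lte_mul_pinfty.
- by have := ae_integrable1 ig; apply: filterS => u iu; exact: ak.
Qed.

Variable s : R^nat.
Hypotheses (s0 : forall n, (0 < s n)%R) (s_cvg : s @ \oo --> (0 : R)%R).

(** Induction on the dimension, splitting off the first coordinate. In dimension 0 the space is a
    single point and the oscillation vanishes. *)
Lemma approx_id_heatd n : approx_id (mu n) (fun k => @heatd R n (s k)).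
Proof.
elim: n => [|n IH] g ig; have /integrableP[/measurable_EFinP mg lg] := ig.
  rewrite (_ : (fun k => _) = cst 0); first exact: cvg_cst.
  apply/funext => k; rewrite /oscillation.
  have g0 (x y : 0.-tuple mR) : g x = g y by rewrite (tuple0 x) (tuple0 y).
  under eq_integral => x _.
    by under eq_integral => y _ do rewrite (g0 y x) subrr normr0 mulr0; rewrite integral0; over.
  by rewrite integral0.
pose g' (z : mR * n.-tuple mR) : R := g (tuple_cons z).
have mg' : measurable_fun setT g'.
  by apply: (measurableT_comp mg); exact: measurable_tuple_cons.
have lg1 : \int[leb]_x \int[mu n]_xs (`|g' (x, xs)|)%:E < +oo.
  by rewrite -(ge0_integral_tupleS (F := fun x => (`|g x|)%:E))//; mfun.
have lg2 : \int[mu n]_xs \int[leb]_x (`|g' (x, xs)|)%:E < +oo.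
  by rewrite -(ge0_integral_tupleS_sym (F := fun x => (`|g x|)%:E))//; mfun.
have ck1 k := contraction_heat1 (s0 k).
have ckn k := contraction_heatd n (s0 k).
have c1 := cvg_integral_oscillation ckn IH mg' lg1.
pose g'' (z : n.-tuple mR * mR) := g' (z.2, z.1).
have mg'' : measurable_fun setT g'' by rewrite /g''; mfun.
have c2 := cvg_integral_oscillation ck1 (approx_id_heat1 s0 s_cvg) mg'' lg2.
apply/cvge0P; first by move=> k; apply: oscillation_ge0; exact: contraction_heatd.
move=> e e0; have e2 : (0 < e / 2)%R by rewrite divr_gt0.
have p1 k : 0 <= \int[leb]_u oscillation (mu n) (heatd (s k)) (fun x => g' (u, x)).
  by apply: integral_ge0 => u _; exact: oscillation_ge0.
have p2 k : 0 <= \int[mu n]_u oscillation leb (heat1 (s k) : mR -> mR -> R) (fun x => g'' (u, x)).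
  by apply: integral_ge0 => u _; exact: oscillation_ge0.
near=> k; apply: le_trans (oscillation_heatdS (s0 k) mg) _.
rewrite -[leRHS]/((e)%:E) (splitr e) EFinD; apply: leeD.
  by near: k; exact: ((cvge0P p1).2 c1).
by near: k; exact: ((cvge0P p2).2 c2).
Unshelve. all: by end_near. Qed.

End heatd_approx_id.

Section kernel_action.
Context {R : realType} {d} {T : measurableType d} (m : {sigma_finite_measure set T -> \bar R}).
Implicit Types (k : T -> T -> R) (f g : T -> R).

Lemma integrable_le f g : measurable_fun setT f -> (forall x, `|f x| <= g x) ->
  m.-integrable setT (EFin \o g) -> m.-integrable setT (EFin \o f).
Proof.
move=> mf fg; apply: le_integrable => //; first exact/measurable_EFinP.
by move=> x _ /=; rewrite lee_fin (le_trans (fg x))// ler_norm.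
Qed.

Lemma integrableR f : m.-integrable setT (EFin \o f) <->
  measurable_fun setT f /\ (\int[m]_x (`|f x|)%:E < +oo)%E.
Proof.
by split=> [/integrableP[/measurable_EFinP]|[mf lf]]//; apply/integrableP; split => //;
  exact/measurable_EFinP.
Qed.

Lemma normr_Rintegral_le f : m.-integrable setT (EFin \o f) ->
  ((`|\int[m]_x f x|%R)%:E <= \int[m]_x (`|f x|)%:E)%E.
Proof.
move=> fi; rewrite EFin_normr_Rintegral//; apply: le_abse_integral => //.
by case/integrableP: fi.
Qed.

Lemma EFin_Rintegral f : m.-integrable setT (EFin \o f) ->
  ((\int[m]_x f x)%R%:E = \int[m]_x (f x)%:E)%E.
Proof. by move=> fi; rewrite /Rintegral fineK//; exact: integrable_fin_num. Qed.

Definition kapply k g x : R := (\int[m]_y (k x y * g y))%R.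

Lemma integrable_kmul k g x (B : R) : measurable_fun setT (fun z : T * T => k z.1 z.2) ->
  (forall y, `|k x y| <= B) -> m.-integrable setT (EFin \o g) ->
  m.-integrable setT (EFin \o (fun y => k x y * g y)).
Proof.
move=> mk kB ig; have [mg lg] := (integrableR g).1 ig.
have B0 : 0 <= B by exact: le_trans (kB x).
apply: (@integrable_le _ (fun y => B * `|g y|)).
- by have mkx := measurable_ker x mk; mfun.
- by move=> y; rewrite normrM ler_wpM2r.
- apply/integrableR; split; first by mfun.
  under eq_integral do rewrite normrM normr_id EFinM.
  have mn : measurable_fun setT (fun y => (`|g y|)%:E) by mfun.
  rewrite ge0_integralZl ?lee_fin//.
  by rewrite lte_mul_pinfty// ?lee_fin.
Qed.

Lemma measurable_Rintegral_param {d'} {Z : measurableType d'} (F : Z * T -> R) :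
  measurable_fun setT F -> measurable_fun setT (fun z => (\int[m]_y F (z, y))%R).
Proof.
move=> mF'; have mF : measurable_fun setT (EFin \o F) by exact/measurable_EFinP.
have mP := measurable_funepos mF; have mN := measurable_funeneg mF.
have h1 := measurable_fun_fubini_tonelli_F (m2 := m) _ mP (fun x => funepos_ge0 _ x).
have h2 := measurable_fun_fubini_tonelli_F (m2 := m) _ mN (fun x => funeneg_ge0 _ x).
rewrite (_ : (fun z => _) = fine \o (fun x => fubini_F m (EFin \o F)^\+%E x -
   fubini_F m (EFin \o F)^\-%E x)%E); last first.
  apply/funext => x; rewrite /Rintegral integralE /= /fubini_F.
  by congr (fine (_ - _)%E); apply: eq_integral => y _; rewrite ?funeposE ?funenegE.
apply: measurableT_comp; first exact: fine_measurable.
exact: (emeasurable_funB h1 h2).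
Qed.

Lemma measurable_kapply k g : measurable_fun setT (fun z : T * T => k z.1 z.2) ->
  measurable_fun setT g -> measurable_fun setT (kapply k g).
Proof.
move=> mk mg; apply: (measurable_Rintegral_param (F := fun z : T * T => k z.1 z.2 * g z.2)).
by mfun.
Qed.

Lemma Rintegral_sum I (s : seq I) (h : I -> T -> R) :
  (forall i, m.-integrable setT (EFin \o h i)) ->
  (\int[m]_x (\sum_(i <- s) h i x))%R = \sum_(i <- s) (\int[m]_x h i x)%R.
Proof.
move=> ih; rewrite /Rintegral; under eq_integral do rewrite -sumEFin.
rewrite (integral_sum measurableT ih) (eq_bigr (fun i => (\int[m]_x h i x)%R%:E)); last first.
  by move=> i _; rewrite EFin_Rintegral.
by rewrite sumEFin.
Qed.

(** Write Kg(x) - g(x) as the integral of k(x, y)(g(y) - g(x)) minus the missing mass times g(x). *)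
Lemma kapply_defect_le k g x (B mass : R) : contraction_kernel m k ->
  (forall y, `|k x y| <= B) -> m.-integrable setT (EFin \o g) ->
  (\int[m]_y (k x y)%:E = mass%:E)%E ->
  ((`|kapply k g x - g x|)%:E <= \int[m]_y (k x y * `|g y - g x|)%:E + (`|g x| * (1 - mass))%:E)%E.
Proof.
move=> ck kB ig Em; have [mk k0 ks k1] := ck; have [mg _] := (integrableR g).1 ig.
have mkx := measurable_ker x mk.
have mass1 : mass <= 1 by rewrite -lee_fin -Em.
have ik : m.-integrable setT (EFin \o k x).
  apply/integrableR; split => //; under eq_integral do rewrite ger0_norm//.
  by rewrite Em ltry.
have ikg := integrable_kmul mk kB ig.
have ikc : m.-integrable setT (EFin \o (fun y => k x y * g x)).
  rewrite (_ : _ \o _ = (fun y => (k x y)%:E * (g x)%:E)%E); last first.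
    by apply/funext => y /=; rewrite EFinM.
  exact: integrableZr.
have id' : m.-integrable setT (EFin \o (fun y => k x y * (g y - g x))).
  rewrite (_ : _ \o _ = (fun y => (k x y * g y)%:E - (k x y * g x)%:E)%E); last first.
    by apply/funext => y /=; rewrite mulrBr EFinB.
  exact: integrableB.
have E : kapply k g x - g x = (\int[m]_y (k x y * (g y - g x)))%R + g x * (mass - 1).
  have -> : (\int[m]_y (k x y * (g y - g x)))%R =
      (\int[m]_y (k x y * g y))%R - (\int[m]_y (k x y * g x))%R.
    by rewrite -RintegralB//; apply: eq_Rintegral => y _; rewrite mulrBr.
  rewrite RintegralZr//.
  have -> : (\int[m]_y k x y)%R = mass by rewrite /Rintegral Em.
  rewrite /kapply; ring.
rewrite E; apply: (@le_trans _ _ ((`|\int[m]_y (k x y * (g y - g x))|%R)%:E + (`|g x| * (1 - mass))%:E)%E).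
  rewrite -EFinD lee_fin; apply: le_trans (ler_normD _ _) _.
  by rewrite normrM (distrC mass) [`|1 - mass|]ger0_norm// subr_ge0.
rewrite leeD2r//; apply: le_trans (normr_Rintegral_le id') _.
by under eq_integral do rewrite normrM (ger0_norm (k0 _ _)).
Qed.

End kernel_action.

Section heatd_L1.
Context {R : realType}.
Local Notation mR := (measurableTypeR R).
Local Notation mu := (@lebesgue_tuple R).

Lemma mehler_le r x y : 0 < r < 1 ->
  mehler r x y <= (Num.sqrt pi)^-1 * expR (- (ln (1 - r ^+ 2) / 2)) :> R.
Proof.
move=> /andP[r0 r1]; rewrite /mehler ler_wpM2l ?invr_ge0// ler_expR.
have a : 0 <= (1 + r) / (1 - r) * (x - y) ^+ 2 / 4.
  by rewrite divr_ge0// mulr_ge0 ?sqr_ge0// divr_ge0; lra.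
have b : 0 <= (1 - r) / (1 + r) * (x + y) ^+ 2 / 4.
  by rewrite divr_ge0// mulr_ge0 ?sqr_ge0// divr_ge0; lra.
lra.
Qed.

Lemma heatd_bounded n s : 0 < s -> exists B : R, forall x y : n.-tuple mR, `|heatd s x y| <= B.
Proof.
move=> s0; pose r : R := expR (- (2 * s)).
exists (\prod_(i < n) (expR (- s) * ((Num.sqrt pi)^-1 * expR (- (ln (1 - r ^+ 2) / 2))))) => x y.
rewrite ger0_norm; last by apply: prodr_ge0 => i _; rewrite ltW// heat1_gt0.
apply: ler_prod => i _; rewrite ltW ?heat1_gt0//= ler_wpM2l ?expR_ge0//.
exact/mehler_le/heat1_ratio.
Qed.

Lemma heat1_mass_ge s (x : R) : 0 < s < 1 -> 1 - (1 + 2 * x ^+ 2) * s <= heat1_mass s x.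
Proof.
move=> /andP[s0 s1]; have /andP[r0 r1] := heat1_ratio s0.
rewrite /heat1_mass /mehler_mass.
have hr : 1 - 2 * s <= expR (- (2 * s)) by have := expR_ge1Dx (- (2 * s)); lra.
set r := expR (- (2 * s)) in r0 r1 hr *.
have z0 : 0 < 1 - r ^+ 2 by rewrite subr_gt0 expr_lt1// ltW.
have w0 : 0 < 1 + r ^+ 2 by rewrite addr_gt0// exprn_gt0.
have r2 : r ^+ 2 <= 1 by rewrite -subr_ge0 ltW.
have x2 : 0 <= x ^+ 2 by exact: sqr_ge0.
have A : 1 - 2 * s * x ^+ 2 <= expR (- ((1 - r ^+ 2) / (2 * (1 + r ^+ 2)) * x ^+ 2)).
  apply: le_trans (expR_ge1Dx _); rewrite lerD2l lerN2 ler_wpM2r//.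
  rewrite ler_pdivrMr ?mulr_gt0//.
  have -> : 1 - r ^+ 2 = (1 - r) * (1 + r) by ring.
  have := sqr_ge0 r; nra.
have B : 1 <= Num.sqrt (2 / (1 + r ^+ 2)).
  rewrite -[leLHS]sqrtr1 ler_sqrt; last by apply: divr_ge0 => //; exact: ltW.
  by rewrite ler_pdivlMr//; lra.
have C : 1 - s <= expR (- s) by have := expR_ge1Dx (- s); lra.
set b := Num.sqrt _ in B *; set a := expR (- (_ * _)) in A *; set c := expR (- s) in C *.
have a0 : 0 <= a by exact: expR_ge0.
have h1 : (1 - s) * (1 * a) <= c * (b * a).
  rewrite ler_pM//; [lra|lra|by rewrite ler_wpM2r].
apply: le_trans h1.
rewrite mul1r; have := ler_wpM2l (_ : 0 <= 1 - s) A; nra.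
Qed.

Variable s : R^nat.
Hypotheses (s0 : forall n, 0 < s n) (s_cvg : s @ \oo --> 0).

Lemma cvg_heat1_mass (x : R) : heat1_mass (s n) x @[n --> \oo] --> (1 : R).
Proof.
have c : (fun n => 1 - (1 + 2 * x ^+ 2) * s n) @ \oo --> 1 - (1 + 2 * x ^+ 2) * 0.
  by apply: cvgB; [exact: cvg_cst|exact: cvgMl_tmp].
rewrite mulr0 subr0 in c.
apply: (squeeze_cvgr _ c (cvg_cst (1 : R))).
move/cvgrPdist_lt : s_cvg => /(_ _ ltr01); apply: filterS => n.
rewrite sub0r normrN ger0_norm ?(ltW (s0 n))// => sn1.
by rewrite heat1_mass_ge ?s0 ?heat1_mass_le1.
Qed.

Lemma cvg_heatd_mass n (x : n.-tuple mR) : heatd_mass (s k) x @[k --> \oo] --> (1 : R).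
Proof.
have := @cvg_prod_ord R n (fun i k => heat1_mass (s k) (tnth x i)) (fun _ => 1)
  (fun i => cvg_heat1_mass _).
by rewrite big1_eq.
Qed.

Lemma heatd_L1_cvg n (g : n.-tuple mR -> R) : (mu n).-integrable setT (EFin \o g) ->
  (\int[mu n]_x (`|kapply (mu n) (heatd (s k)) g x - g x|)%:E)%E @[k --> \oo] --> 0%E.
Proof.
move=> ig; have [mg lg] := (integrableR (mu n) g).1 ig.
have ck k := contraction_heatd n (s0 k).
have mmass k : measurable_fun setT (fun x : n.-tuple mR => (`|g x| * (1 - heatd_mass (s k) x))%:E).
  apply/measurable_EFinP; apply: measurable_funM; first by mfun.
  apply: measurable_funB => //; apply: measurable_prod => i _.
  apply: (measurableT_comp (f := fun t : mR => heat1_mass (s k) t)); last exact: measurable_tnth.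
  apply: measurable_funM => //; apply: measurable_funM => //.
  apply: measurableT_comp => //; apply: measurableT_comp => //.
  by apply: measurable_funM.
have mass0 k x : 0 <= `|g x| * (1 - heatd_mass (s k) x).
  by rewrite mulr_ge0// subr_ge0 heatd_mass_le1.
have c1 := approx_id_heatd s0 s_cvg ig.
have c2 : (\int[mu n]_x (`|g x| * (1 - heatd_mass (s k) x))%:E)%E @[k --> \oo] --> 0%E.
  apply: (@dct0 _ _ _ (mu n) _ (fun x => (`|g x|)%:E)) => //.
  - by move=> k x; rewrite lee_fin ler_piMr// gerBl heatd_mass_ge0.
  - by mfun.
  - apply: nearW => x; apply: cvg_EFin; first exact: nearW.
    have -> : (0 : R) = `|g x| * (1 - 1) by rewrite subrr mulr0.
    apply: cvgMl_tmp; apply: cvgB; first exact: cvg_cst.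
    exact: cvg_heatd_mass.
have le k : (\int[mu n]_x (`|kapply (mu n) (heatd (s k)) g x - g x|)%:E <=
    oscillation (mu n) (heatd (s k)) g + \int[mu n]_x (`|g x| * (1 - heatd_mass (s k) x))%:E)%E.
  have [mk k0 _ _] := ck k; have [B hB] := @heatd_bounded n _ (s0 k).
  have mo : measurable_fun setT (fun x => (\int[mu n]_y (heatd (s k) x y * `|g y - g x|)%:E)%E).
    apply: (measurable_fun_fubini_tonelli_F (fun z : n.-tuple mR * n.-tuple mR =>
      (heatd (s k) z.1 z.2 * `|g z.2 - g z.1|)%:E)); first by mfun.
    by move=> z; rewrite lee_fin mulr_ge0.
  have o0 x : (0 <= \int[mu n]_y (heatd (s k) x y * `|g y - g x|)%:E)%E.
    by apply: integral_ge0 => y _; rewrite lee_fin mulr_ge0.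
  rewrite /oscillation -ge0_integralD//; last by move=> x _; rewrite lee_fin.
  apply: ge0_le_integral => //.
  - apply/measurable_EFinP; apply: measurableT_comp => //; apply: measurable_funB => //.
    exact: measurable_kapply.
  - exact: emeasurable_funD.
  - move=> x _; apply: (kapply_defect_le (ck k) (hB x) ig).
    exact: integral_heatd.
apply/cvge0P; first by move=> k; apply: integral_ge0.
move=> e e0; have e2 : 0 < e / 2 by rewrite divr_gt0.
have p1 k := @oscillation_ge0 R _ _ (mu n) _ g (ck k).
have p2 k : (0 <= \int[mu n]_x (`|g x| * (1 - heatd_mass (s k) x))%:E)%E.
  by apply: integral_ge0 => x _; rewrite lee_fin.
near=> k; apply: le_trans (le k) _.
rewrite -[leRHS]/((e)%:E) (splitr e) EFinD; apply: leeD.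
  by near: k; exact: ((cvge0P p1).2 c1).
by near: k; exact: ((cvge0P p2).2 c2).
Unshelve. all: by end_near. Qed.

End heatd_L1.

(** * The kernel of the fractional Hermite semigroup *)

Section multipliers.
Context {R : realType} {d : nat}.
Local Notation mR := (measurableTypeR R).
Local Notation Rd := (d.-tuple mR).
Local Notation kb := (@kbound R d).
Implicit Types (m u v : R^nat) (x y : Rd).

(** Spectral multipliers whose kernel series converges absolutely at every pair of points: the
    weights are the bounds on the projection kernels, and [msize] is the resulting constant in front
    of [decay x * decay y]. *)
Definition adm m := cvgn (series (fun k => `|m k| * kb k)).

Definition msize m : R := limn (series (fun k => `|m k| * kb k)).

Definition mker m x y : R := limn (series (fun k => m k * hker k x y)).

Lemma mterm_ge0 m k : 0 <= `|m k| * kb k.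
Proof. by rewrite mulr_ge0// ltW// kbound_gt0. Qed.

Lemma adm_le u v : (forall k, `|u k| <= `|v k|) -> adm v -> adm u.
Proof.
move=> uv; apply: series_le_cvg => k; try exact: mterm_ge0.
by rewrite ler_wpM2r// ltW// kbound_gt0.
Qed.

Lemma msize_le u v : (forall k, `|u k| <= `|v k|) -> adm v -> msize u <= msize v.
Proof.
move=> uv av; apply: lim_series_le => // [|k]; first exact: (adm_le uv av).
by rewrite ler_wpM2r// ltW// kbound_gt0.
Qed.

Lemma admD u v : adm u -> adm v -> adm (fun k => u k + v k).
Proof.
move=> au av; apply: (@series_le_cvg _ _ (fun k => `|u k| * kb k + `|v k| * kb k)).
- by move=> k; exact: (mterm_ge0 (fun k => u k + v k)).
- by move=> k; rewrite addr_ge0 ?mterm_ge0.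
- by move=> k; rewrite -mulrDl ler_wpM2r ?ler_normD// ltW// kbound_gt0.
- exact: (is_cvg_seriesD au av).
Qed.

Lemma msizeD u v : adm u -> adm v -> msize (fun k => u k + v k) <= msize u + msize v.
Proof.
move=> au av; rewrite /msize -lim_seriesD//; apply: lim_series_le.
- exact: admD.
- exact: is_cvg_seriesD.
- by move=> k; rewrite -[leRHS]/(_ + _) -mulrDl ler_wpM2r ?ler_normD// ltW// kbound_gt0.
Qed.

Lemma admZ c u : adm u -> adm (fun k => c * u k).
Proof.
move=> au; rewrite /adm (_ : (fun k => _) = `|c| *: (fun k => `|u k| * kb k)).
  exact: is_cvg_seriesZ.
by apply/funext => k; rewrite normrM -mulrA.
Qed.

Lemma msizeZ c u : adm u -> msize (fun k => c * u k) = `|c| * msize u.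
Proof.
move=> au; rewrite /msize (_ : (fun k => _) = `|c| *: (fun k => `|u k| * kb k)).
  by rewrite lim_seriesZ.
by apply/funext => k; rewrite normrM -mulrA.
Qed.

Lemma msize_ge0 m : adm m -> 0 <= msize m.
Proof.
move=> am; apply: limr_ge => //; apply: nearW => n; apply: sumr_ge0 => k _.
exact: mterm_ge0.
Qed.

Lemma mker_normed_cvg m x y : adm m -> cvgn [normed series (fun k => m k * hker k x y)].
Proof.
move=> am; apply: (@series_le_cvg _ _ ((decay x * decay y) *: (fun k => `|m k| * kb k))).
- by move=> k; exact: normr_ge0.
- move=> k; apply: mulr_ge0; last exact: mterm_ge0.
  by rewrite ltW// mulr_gt0// decay_gt0.
- move=> k; rewrite [leLHS](normrM (m k)) -[leRHS]/(_ * (_ * _)) mulrCA ler_wpM2l//.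
  by rewrite mulrC; exact: hker_le.
- exact: is_cvg_seriesZ.
Qed.

Lemma mker_cvg m x y : adm m -> series (fun k => m k * hker k x y) @ \oo --> mker m x y.
Proof. by move=> am; apply: normed_cvg; exact: mker_normed_cvg. Qed.

Lemma mker_le m x y : adm m -> `|mker m x y| <= msize m * (decay x * decay y).
Proof.
move=> am; have c := @mker_normed_cvg m x y am.
apply: le_trans (lim_series_norm c) _.
rewrite mulrC -[leRHS]/(_ *: _) -lim_seriesZ//; apply: lim_series_le => //.
  exact: is_cvg_seriesZ.
move=> k; rewrite [leLHS](normrM (m k)) -[leRHS]/(_ * (_ * _)) mulrCA ler_wpM2l//.
by rewrite mulrC; exact: hker_le.
Qed.

Lemma mkerB u v x y : adm u -> adm v -> mker u x y - mker v x y = mker (fun k => u k - v k) x y.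
Proof.
move=> au av; apply/esym/cvg_lim => //.
have c : (fun n => series (fun k => u k * hker k x y) n - series (fun k => v k * hker k x y) n)
   @ \oo --> mker u x y - mker v x y.
  by apply: cvgB; exact: mker_cvg.
rewrite (_ : series _ = (fun n => series (fun k => u k * hker k x y) n - series (fun k => v k * hker k x y) n))//.
by apply/funext => n; rewrite /series/= -sumrB; apply: eq_bigr => k _; rewrite mulrBl.
Qed.

Lemma measurable_hker k : measurable_fun setT (fun z : Rd * Rd => hker k z.1 z.2).
Proof.
have mPhi a : measurable_fun setT (fun x : Rd => hermite_Phi a x : R).
  apply: (@measurable_prod_tnth _ d (fun i t => hermite_fun (a i) t)) => i; apply: measurable_funM.
    apply: measurable_funM => //; apply: continuous_measurable_fun => t.
    exact: continuous_horner.
  by apply: measurableT_comp => //; apply: measurableT_comp => //; exact: measurable_funM.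
rewrite /hker; under eq_fun do rewrite big_mkcond/=.
apply: (@measurable_sum _ (Rd * Rd)%type R setT) => a.
have [_|_] := eqVneq (\sum_(i < d) a i)%N k; last exact: measurable_cst.
apply: measurable_funM; apply: (measurableT_comp (mPhi _)); first exact: measurable_fst.
exact: measurable_snd.
Qed.

Lemma hkerC k x y : hker k x y = hker k y x.
Proof. by apply: eq_bigr => a _; rewrite mulrC. Qed.

Lemma measurable_mker m : adm m -> measurable_fun setT (fun z : Rd * Rd => mker m z.1 z.2).
Proof.
move=> am; apply: (@measurable_fun_cvg _ _ _ _ (fun n (z : Rd * Rd) =>
   series (fun k => m k * hker k z.1 z.2) n)).
- move=> n; apply: measurable_sum => k; apply: measurable_funM => //.
  exact: measurable_hker.
- by move=> z _; exact: mker_cvg.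
Qed.

(* dominated convergence for the counting measure *)
Lemma tannery (u : nat -> R^nat) m : (forall n k, `|u n k| <= `|m k|) -> adm m ->
  (forall k, u n k @[n --> \oo] --> (0 : R)) -> msize (u n) @[n --> \oo] --> (0 : R).
Proof.
move=> um am u0; apply/cvgrPdist_le => e e0.
have e2 : 0 < e / 2 by rewrite divr_gt0.
pose S := series (fun k => `|m k| * kb k).
have [N hN] : exists N, msize m - S N <= e / 2.
  have /cvgrPdist_le/(_ _ e2)/filter_ex[N hN] : S @ \oo --> msize m by [].
  by exists N; apply: le_trans (ler_norm _) hN.
have fin0 : series (fun k => `|u n k| * kb k) N @[n --> \oo] --> (0 : R).
  rewrite (_ : 0 = \sum_(0 <= k < N) (0 : R)); last by rewrite big1_eq.
  rewrite /series/=; apply: (@cvg_big R nat ( +%R ) 0 predT (@add_continuous R)) => k _.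
  rewrite -(mul0r (kb k)); apply: cvgMr_tmp.
  by apply/norm_cvg0P; exact: u0.
move/cvgrPdist_le : fin0 => /(_ _ e2); apply: filterS => n.
rewrite !sub0r !normrN [in X in X -> _]ger0_norm; last first.
  by apply: sumr_ge0 => k _; exact: mterm_ge0.
move=> hn; have au : adm (u n) by exact: (adm_le (um n) am).
rewrite ger0_norm ?msize_ge0//.
apply: limr_le => //; near=> K.
have NK : (N <= K)%N by near: K; exact: nbhs_infty_ge.
have SK : S K <= msize m.
  by apply: nondecreasing_cvgn_le => //; apply: nondecreasing_series => k _ _; exact: mterm_ge0.
rewrite -(subrK (series (fun k => `|u n k| * kb k) N) (series _ K)) (splitr e).
rewrite lerD// sub_series_geq//.
apply: le_trans hN; apply: le_trans (lerB SK (lexx _)).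
rewrite /S sub_series_geq//; apply: ler_sum => k _.
by rewrite ler_wpM2r ?um// ltW// kbound_gt0.
Unshelve. all: by end_near. Qed.

Definition heat_mult (beta t : R) : R^nat := fun k => expR (- (t * (2 * k + d)%:R `^ beta)).

Lemma heat_mult_ge0 beta t k : 0 <= heat_mult beta t k. Proof. exact: expR_ge0. Qed.

Lemma telescope_inv n : series (fun k => (k.+1%:R * k.+2%:R)^-1 : R) n = 1 - n.+1%:R^-1.
Proof.
elim: n => [|n IH]; first by rewrite /series/= big_nil invr1 subrr.
rewrite seriesSr IH; have n0 : 0 <= n%:R :> R by [].
by rewrite -![_.+2%:R]natr1 -![_.+1%:R]natr1; field; rewrite !gt_eqF//; lra.
Qed.

Lemma is_cvg_telescope_inv : cvgn (series (fun k => (k.+1%:R * k.+2%:R)^-1 : R)).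
Proof.
apply: nondecreasing_is_cvgn; first by apply: nondecreasing_series => k _ _; rewrite invr_ge0.
by exists 1 => _ [n _ <-]; rewrite telescope_inv gerBl.
Qed.

Lemma lim_telescope_inv_le1 : limn (series (fun k => (k.+1%:R * k.+2%:R)^-1 : R)) <= 1.
Proof.
apply: limr_le; first exact: is_cvg_telescope_inv.
by apply: nearW => n; rewrite telescope_inv gerBl.
Qed.

(* e^{-z} <= N!/z^N with N beta >= 3d+2 beats the polynomial growth of kbound *)
Lemma heat_mult_kbound beta : 0 < beta -> (1 <= d)%N ->
  exists (A : nat) (C : R), [/\ (0 < A)%N, 0 < C & forall t k, 0 < t ->
    heat_mult beta t k * kb k <= C / t ^+ A * (k.+1%:R * k.+2%:R)^-1].
Proof.
move=> b0 d1.
pose N := Num.bound ((3 * d + 2)%:R / beta).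
have hN : (3 * d + 2)%:R <= beta * N%:R.
  have x0 : 0 <= (3 * d + 2)%:R / beta by apply: divr_ge0 => //; exact: ltW.
  have h := archi_boundP x0; by rewrite mulrC -(ler_pdivrMr _ _ b0) ltW.
have N0 : (0 < N)%N.
  rewrite lt0n; apply/negP => /eqP N0; move: hN; rewrite N0 mulr0 lern0.
  by rewrite addn2.
pose C : R := N`!%:R * 2 ^+ (3 * d + 2) * (expR 1 * 16 ^+ d).
have C0 : 0 < C.
  by rewrite !mulr_gt0 ?expR_gt0 ?exprn_gt0// ltr0n fact_gt0.
exists N, C; split => // t k t0.
pose lam : R := (2 * k + d)%:R.
(* At least 1 and, since d >= 1, at most the eigenvalue 2k + d. Its power 3d + 2 pays for the degree
   3d of [kbound] and leaves two inverse powers of k + 2 for summability. *)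
pose w : R := k.+2%:R / 2.
have w1 : 1 <= w by rewrite /w ler_pdivlMr// mul1r ler_nat.
have w0 : 0 < w by apply: lt_le_trans w1.
have wl : w <= lam.
  rewrite /w ler_pdivrMr// -natrM ler_nat; lia.
have lb : w ^+ (3 * d + 2) <= (lam `^ beta) ^+ N.
  rewrite -[leRHS]powR_mulrn ?powR_ge0// -powRrM.
  apply: (@le_trans _ _ (w `^ (beta * N%:R))).
    by rewrite -powR_mulrn ?(ltW w0)// ler_powR.
  apply: ge0_ler_powR => //; rewrite ?nnegrE; first by apply: mulr_ge0 => //; exact: ltW.
    exact: ltW.
  exact: le_trans (ltW w0) wl.
pose z := t * lam `^ beta.
have z0 : 0 < z by rewrite mulr_gt0// powR_gt0// (lt_le_trans w0).
have ez : expR (- z) <= N`!%:R / z ^+ N.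
  rewrite expRN -[leRHS]invrK lef_pV2 ?posrE ?expR_gt0//; last first.
    by rewrite invr_gt0 divr_gt0 ?exprn_gt0// ltr0n fact_gt0.
  rewrite invf_div; have := expR_ge1Dxn N.-1 (ltW z0); rewrite prednK//.
  by apply: le_trans; rewrite lerDr.
have wn0 : 0 < w ^+ (3 * d + 2) by rewrite exprn_gt0.
have tn0 : 0 < t ^+ N by rewrite exprn_gt0.
apply: (@le_trans _ _ (N`!%:R / (t ^+ N * w ^+ (3 * d + 2)) * kb k)).
  apply: ler_wpM2r; first exact/ltW/kbound_gt0.
  apply: le_trans ez _.
  apply: ler_wpM2l => //; rewrite lef_pV2 ?posrE; last 2 first.
  - exact: exprn_gt0.
  - exact: mulr_gt0.
  by rewrite /z (exprMn N t); apply: ler_wpM2l => //; exact: ltW.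
have k2 : 0 < k.+2%:R :> R by [].
have k3 : k.+2%:R ^+ (3 * d) != 0 :> R by rewrite expf_neq0// gt_eqF.
have -> : N`!%:R / (t ^+ N * w ^+ (3 * d + 2)) * kb k = C / t ^+ N * (k.+2%:R * k.+2%:R)^-1.
  rewrite /kbound /C /w (exprMn d) (exprMn (3 * d + 2) k.+2%:R) exprVn.
  rewrite -[(k.+2%:R ^+ 3) ^+ d]exprM [in X in t ^+ N * (X / _)]exprD expr2.
  by field; rewrite !gt_eqF ?exprn_gt0.
apply: ler_wpM2l; first by rewrite divr_ge0// ltW.
rewrite lef_pV2 ?posrE ?mulr_gt0//.
by rewrite ler_wpM2r// ler_nat.
Qed.

Lemma adm_heat_mult beta t : 0 < beta -> (1 <= d)%N -> 0 < t -> adm (heat_mult beta t).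
Proof.
move=> b0 d1 t0; have [A [C [_ C0 h]]] := heat_mult_kbound b0 d1.
apply: (@series_le_cvg _ _ ((C / t ^+ A) *: (fun k => (k.+1%:R * k.+2%:R)^-1))).
- by move=> k; exact: mterm_ge0.
- move=> k; rewrite -[leRHS]/(_ * _) mulr_ge0//.
  by rewrite divr_ge0 ?exprn_ge0// ltW.
- by move=> k; rewrite ger0_norm ?heat_mult_ge0//; exact: h.
- exact/is_cvg_seriesZ/is_cvg_telescope_inv.
Qed.

Lemma msize_heat_mult beta : 0 < beta -> (1 <= d)%N ->
  exists (A : nat) (C : R), [/\ (0 < A)%N, 0 < C &
    forall t, 0 < t -> msize (heat_mult beta t) <= C / t ^+ A].
Proof.
move=> b0 d1; have [A [C [A0 C0 h]]] := heat_mult_kbound b0 d1.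
exists A, C; split => // t t0.
have c0 : 0 <= C / t ^+ A by rewrite divr_ge0 ?exprn_ge0// ltW.
apply: (@le_trans _ _ (C / t ^+ A * limn (series (fun k => (k.+1%:R * k.+2%:R)^-1 : R)))).
  rewrite -[leRHS]/(_ *: _) -lim_seriesZ; last exact: is_cvg_telescope_inv.
  apply: lim_series_le; first exact: adm_heat_mult.
    exact/is_cvg_seriesZ/is_cvg_telescope_inv.
  by move=> k; rewrite ger0_norm ?heat_mult_ge0//; exact: h.
by rewrite -[leRHS]mulr1 ler_wpM2l// lim_telescope_inv_le1.
Qed.

(** The multi-dimensional Mehler formula: e^(-s(2k+d)) is e^(-ds) times the k-th power of
    e^(-2s). *)
Lemma mker_heatd s x y : 0 < s -> mker (heat_mult 1 s) x y = heatd s x y.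
Proof.
move=> s0; apply: cvg_lim => //.
have /andP[r0 r1] := heat1_ratio s0.
have r01 : 0 <= expR (- (2 * s)) < 1 by rewrite ltW.
have c := @cvg_mehlerd R d x y _ r01.
have : (fun n => expR (- (d%:R * s)) * series (fun k => hker k x y * expR (- (2 * s)) ^+ k) n)
   @ \oo --> expR (- (d%:R * s)) * mehlerd (expR (- (2 * s))) x y by exact: cvgMl_tmp.
have -> : expR (- (d%:R * s)) * mehlerd (expR (- (2 * s))) x y = heatd s x y.
  by rewrite /mehlerd /heatd /heat1 [in RHS]big_split/= prodr_const card_ord -expRM_natl mulrN.
rewrite (_ : (fun n => _) = series (fun k => heat_mult 1 s k * hker k x y))//.
apply/funext => n; rewrite /series/= mulr_sumr; apply: eq_bigr => k _.
rewrite /heat_mult powRr1// -expRM_natl mulrCA -expRD mulrC; congr (expR _ * _).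
by rewrite natrD natrM; ring.
Qed.

End multipliers.

(** * The fractional kernel as a limit of combinations of Mehler kernels *)

Section frac_heat_approximation.
Context {R : realType} {d : nat}.
Local Notation mR := (measurableTypeR R).
Local Notation Rd := (d.-tuple mR).
Implicit Types (u v : R^nat) (x y : Rd).

Lemma mkerD u v x y : adm (d := d) u -> adm (d := d) v ->
  mker (fun k => u k + v k) x y = mker u x y + mker v x y.
Proof.
move=> au av; apply/cvg_lim => //.
have c : (fun n => series (fun k => u k * hker k x y) n + series (fun k => v k * hker k x y) n)
   @ \oo --> mker u x y + mker v x y.
  by apply: cvgD; exact: mker_cvg.
rewrite (_ : series _ = (fun n => series (fun k => u k * hker k x y) n + series (fun k => v k * hker k x y) n))//.
by apply/funext => n; rewrite /series/= -big_split; apply: eq_bigr => k _; rewrite mulrDl.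
Qed.

Lemma mkerZ c u x y : adm (d := d) u -> mker (fun k => c * u k) x y = c * mker u x y.
Proof.
move=> au; apply/cvg_lim => //.
have h : (fun n => c * series (fun k => u k * hker k x y) n) @ \oo --> c * mker u x y.
  by apply: cvgMl_tmp; exact: mker_cvg.
rewrite (_ : series _ = (fun n => c * series (fun k => u k * hker k x y) n))//.
by apply/funext => n; rewrite /series/= mulr_sumr; apply: eq_bigr => k _; rewrite mulrA.
Qed.

Hypothesis d1 : (1 <= d)%N.

Lemma mker_heatd_sum n (c s : nat -> R) : (forall j, 0 < s j) ->
  let u k := \sum_(j < n) c j * @heat_mult R d 1 (s j) k in
  adm (d := d) u /\
  forall x y, mker u x y = \sum_(j < n) c j * heatd (s j) x y.
Proof.
move=> s0 u; rewrite {}/u.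
have a1 j : adm (d := d) (@heat_mult R d 1 (s j)) by exact: adm_heat_mult.
elim: n => [|n [au IH]].
  have -> : (fun k => \sum_(j < 0) c j * @heat_mult R d 1 (s j) k) =
     (fun k => 0 * @heat_mult R d 1 (s 0%N) k).
    by apply/funext => k; rewrite big_ord0 mul0r.
  split; first exact: admZ.
  by move=> x y; rewrite mkerZ// big_ord0 mul0r.
have -> : (fun k => \sum_(j < n.+1) c j * @heat_mult R d 1 (s j) k) =
  (fun k => \sum_(j < n) c j * @heat_mult R d 1 (s j) k + c n * @heat_mult R d 1 (s n) k).
  by apply/funext => k; rewrite big_ord_recr.
split; first by apply: admD => //; exact: admZ.
move=> x y; rewrite mkerD//; last exact: admZ.
by rewrite IH mkerZ// big_ord_recr/= mker_heatd.
Qed.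

Lemma heat_mult_le1 beta t k : 0 <= t -> @heat_mult R d beta t k <= 1.
Proof. by move=> t0; rewrite -expR0 ler_expR oppr_le0 mulr_ge0// powR_ge0. Qed.

Lemma heat_mult_mulX h e j k : @heat_mult R d 1 e k * expR (- (h * (2 * k + d)%:R)) ^+ j =
  @heat_mult R d 1 (h * j%:R + e) k.
Proof.
by rewrite /heat_mult -expRM_natl -expRD powRr1//; congr expR; ring.
Qed.

Lemma horner_itv01 (P : {poly R}) z : (forall n, 0 <= P`_n) -> P.[1] <= 1 ->
  0 <= z <= 1 -> 0 <= P.[z] <= 1.
Proof.
move=> P0 P1 /andP[z0 z1]; rewrite !horner_coef in P1 *; apply/andP; split.
  by apply: sumr_ge0 => i _; rewrite mulr_ge0// exprn_ge0.
apply: le_trans P1; apply: ler_sum => i _; rewrite ler_wpM2l//.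
by rewrite expr1n exprn_ile1.
Qed.

(** A constant term in P would stand for the identity, which has no kernel. So the multiplier is
    first damped by e^(-e lam), which puts every summand at a positive time h j + e and provides a
    summable majorant for the polynomial error. The estimate on the mode k = 0 is recorded for the
    continuity at t = 0. *)
Lemma frac_heat_approx beta t eta : 0 < beta <= 1 -> 0 < t -> 0 < eta ->
  exists h e (P : {poly R}), [/\ 0 < h /\ 0 < e <= eta, forall n, 0 <= P`_n, P.[1] <= 1,
    @heat_mult R d beta t 0 - P.[expR (- (h * d%:R))] <= eta &
    forall x y, `|mker (@heat_mult R d beta t) x y -
      \sum_(j < size P) P`_j * heatd (h * j%:R + e) x y| <= eta * (decay x * decay y)].
Proof.
move=> b01 t0 eta0; have /andP[b0 b1] := b01.
have eta2 : 0 < eta / 2 by rewrite divr_gt0.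
set m := @heat_mult R d beta t.
have am : adm (d := d) m by exact: adm_heat_mult.
have m0 k : 0 <= m k by exact: heat_mult_ge0.
(* The error of the damping at time 1/(n+1). *)
pose u1 n k := m k * (1 - @heat_mult R d 1 n.+1%:R^-1 k).
have u1m n k : `|u1 n k| <= `|m k|.
  rewrite normrM ler_piMr// ger0_norm ?subr_ge0 ?heat_mult_le1//.
  by rewrite gerBl heat_mult_ge0.
have u1c k : u1 n k @[n --> \oo] --> (0 : R).
  rewrite /u1 -(mulr0 (m k)) -(subrr (1 : R)); apply: cvgMl_tmp; apply: cvgB; first exact: cvg_cst.
  rewrite -[X in _ --> X]expR0; apply: (cvg_comp _ (@expR R)); last exact: continuous_expR.
  rewrite -oppr0 -(mul0r ((2 * k + d)%:R `^ 1 : R)); apply: cvgN; apply: cvgMr_tmp.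
  exact: cvg_harmonic.
have [n1 [hn1 n1eta]] : exists n, @msize R d (u1 n) <= eta / 2 /\ n.+1%:R^-1 <= eta.
  have /cvgrPdist_le/(_ _ eta2) c := tannery u1m am u1c.
  have c' := near_infty_natSinv_lt (PosNum eta0).
  have [n [cn /ltW c'n]] := filter_ex (filterI c c').
  by exists n; split => //; apply: le_trans cn; rewrite sub0r normrN ler_norm.
set e := n1.+1%:R^-1 in n1eta; have e0 : 0 < e by rewrite invr_gt0.
set w := @heat_mult R d 1 e.
have aw : adm (d := d) w by exact: adm_heat_mult.
have w0 k : 0 <= w k by exact: heat_mult_ge0.
have lam0 n (i : 'I_n.+1) : 0 < (2 * i + d)%:R :> R by rewrite ltr0n; lia.
have en n : 0 < n.+1%:R^-1 :> R by [].
have /choice[hP hPP] : forall n, exists z : R * {poly R}, [/\ 0 < z.1,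
    forall k, 0 <= z.2`_k, z.2.[1] <= 1 &
    forall i : 'I_n.+1, `|expR (- (t * (2 * i + d)%:R `^ beta)) -
      z.2.[expR (- (z.1 * (2 * i + d)%:R))]| < n.+1%:R^-1].
  move=> n; have [h [P q]] := frac_exp_approx b01 (ltW t0) (@lam0 n) (en n).
  by exists (h, P).
pose h n := (hP n).1; pose P n := (hP n).2.
have h0 n : 0 < h n by have [] := hPP n.
have P0 n k : 0 <= (P n)`_k by have [] := hPP n.
have P1 n : (P n).[1] <= 1 by have [] := hPP n.
have PE n k : (k <= n)%N -> `|m k - (P n).[expR (- (h n * (2 * k + d)%:R))]| < n.+1%:R^-1.
  by move=> kn; have [_ _ _ /(_ (Ordinal (kn : (k < n.+1)%N)))] := hPP n.
have z01 n k : 0 <= expR (- (h n * (2 * k + d)%:R)) <= 1.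
  by rewrite expR_ge0 -expR0 ler_expR oppr_le0 mulr_ge0// ltW.
(* The polynomial error on the damped multiplier: small on the modes k <= n and dominated by [w] on
   all of them. *)
pose u2 n k := w k * (m k - (P n).[expR (- (h n * (2 * k + d)%:R))]).
have u2w n k : `|u2 n k| <= `|w k|.
  rewrite normrM ler_piMr//; have /andP[p0 p1] := horner_itv01 (P0 n) (P1 n) (z01 n k).
  have mk1 : m k <= 1 by rewrite heat_mult_le1// ltW.
  by rewrite ler_norml; have := m0 k; lra.
have u2c k : u2 n k @[n --> \oo] --> (0 : R).
  rewrite /u2 -(mulr0 (w k)); apply: cvgMl_tmp; apply/norm_cvg0P.
  apply: (squeeze_cvgr _ (cvg_cst (0 : R)) (@cvg_harmonic R)).
  by near=> n; rewrite normr_ge0/= ltW// PE//; near: n; exact: nbhs_infty_ge.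
have [n [hn neta]] : exists n, @msize R d (u2 n) <= eta / 2 /\ n.+1%:R^-1 <= eta.
  have /cvgrPdist_le/(_ _ eta2) c := tannery u2w aw u2c.
  have c' := near_infty_natSinv_lt (PosNum eta0).
  have [n [cn /ltW c'n]] := filter_ex (filterI c c').
  by exists n; split => //; apply: le_trans cn; rewrite sub0r normrN ler_norm.
exists (h n), e, (P n); split => //; first by rewrite e0 n1eta.
  have := ltW (PE n 0%N (leq0n n)); rewrite muln0 add0n => pe.
  exact: le_trans (ler_norm _) (le_trans pe neta).
move=> x y.
have s0 j : 0 < h n * j%:R + e by rewrite ltr_wpDl// mulr_ge0// ltW.
have [asum <-] := @mker_heatd_sum (size (P n)) (fun j => (P n)`_j) (fun j => h n * j%:R + e) s0.
set v := fun k => _ in asum *.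
have vE k : v k = w k * (P n).[expR (- (h n * (2 * k + d)%:R))].
  rewrite /v horner_coef mulr_sumr; apply: eq_bigr => j _.
  by rewrite -heat_mult_mulX mulrCA.
rewrite mkerB//.
have au1 : adm (d := d) (u1 n1) by exact: adm_le (u1m n1) am.
have au2 : adm (d := d) (u2 n) by exact: adm_le (u2w n) aw.
have -> : (fun k => m k - v k) = (fun k => u1 n1 k + u2 n k).
  by apply/funext => k; rewrite vE /u1 /u2 -/e -/w; ring.
apply: le_trans (mker_le _ _ (admD au1 au2)) _.
rewrite ler_wpM2r//; first by rewrite mulr_ge0// ltW// decay_gt0.
apply: le_trans (msizeD au1 au2) _.
by rewrite (splitr eta) lerD.
Unshelve. all: by end_near. Qed.

End frac_heat_approximation.

Section frac_heat_kernel.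
Context {R : realType} {d : nat}.
Local Notation mR := (measurableTypeR R).
Local Notation Rd := (d.-tuple mR).
Local Notation mu := (@lebesgue_tuple R d).
Local Notation hm := (@heat_mult R d).
Variable beta : R.
Hypotheses (d1 : (1 <= d)%N) (b01 : 0 < beta <= 1).
Implicit Types (x y : Rd) (t : R) (g : Rd -> R).

Let b0 : 0 < beta. Proof. by case/andP: b01. Qed.

(** The value 0 at nonpositive times makes the kernel jointly measurable on the whole line and
    restricts Duhamel integrals to s < t by itself. *)
Definition fker t x y : R := if 0 < t then mker (hm beta t) x y else 0.

Let adm_hm t : 0 < t -> adm (d := d) (hm beta t).
Proof. by move=> t0; exact: adm_heat_mult. Qed.

Lemma measurable_decay : measurable_fun setT (@decay R d).
Proof.
apply: (measurable_prod_tnth (phi := fun _ t => (1 + t ^+ 2)^-1)) => i.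
apply: continuous_measurable_fun => t; apply: cvgV; first by rewrite gt_eqF// ltr_pwDl// sqr_ge0.
by apply: cvgD; [exact: cvg_cst|exact: exprn_continuous].
Qed.

Lemma integrable_decay : mu.-integrable setT (EFin \o (@decay R d)).
Proof.
apply/integrableR; split; first exact: measurable_decay.
under eq_integral do rewrite gtr0_norm ?decay_gt0//.
exact: integral_decay_lty.
Qed.

Lemma fkerC t x y : fker t x y = fker t y x.
Proof.
rewrite /fker; case: ifP => // _; congr (limn (series _)).
by apply/funext => k; rewrite hkerC.
Qed.

Lemma fker_ge0 t x y : 0 <= fker t x y.
Proof.
rewrite /fker; case: ifPn => // t0; apply/ler_addgt0Pl => e e0.
have [h [s [P [[h0 /andP[s0 se]] P0 _ _ /(_ x y)]]]] := frac_heat_approx d1 b01 t0 e0.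
have : 0 <= \sum_(j < size P) P`_j * heatd (h * j%:R + s) x y.
  apply: sumr_ge0 => j _; rewrite mulr_ge0//.
  have : 0 < h * j%:R + s by rewrite ltr_wpDl// mulr_ge0// ltW.
  by case/(contraction_heatd d) => _ k0 _ _; exact: k0.
have : e * (decay x * decay y) <= e.
  by rewrite ler_piMr ?(ltW e0)// mulr_ile1 ?decay_le1// ltW// decay_gt0.
by rewrite ler_norml; set u := \sum_(_ < _) _; move=> ? ? /andP[? _]; lra.
Qed.

Lemma fker_le : exists (A : nat) (C : R), [/\ (0 < A)%N, 0 < C &
  forall t x y, 0 < t -> fker t x y <= C / t ^+ A * (decay x * decay y)].
Proof.
have [A [C [A0 C0 h]]] := @msize_heat_mult R d _ b0 d1; exists A, C; split => // t x y t0.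
have := fker_ge0 t x y; rewrite /fker t0 => k0.
rewrite -(ger0_norm k0); apply: le_trans (mker_le _ _ (adm_hm t0)) _.
by rewrite ler_wpM2r ?h// mulr_ge0// ltW// decay_gt0.
Qed.

Lemma fker_bounded t : exists B : R, forall x y, `|fker t x y| <= B.
Proof.
have [A [C [_ C0 h]]] := fker_le; have [t0|t0] := ltP 0 t; last first.
  by exists 0 => x y; rewrite /fker ltNge t0/= normr0.
have c0 : 0 <= C / t ^+ A by rewrite divr_ge0 ?exprn_ge0// ltW.
exists (C / t ^+ A) => x y; rewrite ger0_norm ?fker_ge0//.
apply: le_trans (h _ _ _ t0) _; by rewrite ler_piMr//; apply: mulr_ile1; rewrite ?decay_le1// ltW// decay_gt0.
Qed.

(** The factor L lost by differentiating in time is absorbed by half of the decay; the other half is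
    again a heat multiplier, hence admissible. *)
Lemma expR_lip (L delta a b : R) : 0 <= L -> 0 < delta -> delta <= a -> delta <= b ->
  `|expR (- (a * L)) - expR (- (b * L))| <= `|a - b| * (2 / delta * expR (- (delta / 2 * L))).
Proof.
move=> L0 D0; wlog ab : a b / a <= b.
  move=> H da db; have [ab|/ltW ba] := leP a b; first exact: H.
  by rewrite distrC (distrC a); apply: H.
move=> da db; rewrite (distrC a) (ger0_norm (_ : 0 <= b - a)) ?subr_ge0//.
have e1 : expR (- (b * L)) <= expR (- (a * L)) by rewrite ler_expR lerN2 ler_wpM2r.
rewrite ger0_norm ?subr_ge0//.
have -> : expR (- (b * L)) = expR (- (a * L)) * expR (- ((b - a) * L)).
  by rewrite -expRD; congr expR; ring.
have h1 : 1 - (b - a) * L <= expR (- ((b - a) * L)) by exact: expR_ge1Dx.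
have h2 : expR (- (a * L)) <= expR (- (delta / 2 * L)) * expR (- (delta / 2 * L)).
  by rewrite -expRD ler_expR -opprD lerN2 -mulrDl -splitr ler_wpM2r.
have h3 : L * expR (- (delta / 2 * L)) <= 2 / delta.
  rewrite expRN ler_pdivrMr ?expR_gt0// mulrC -ler_pdivrMr ?divr_gt0//.
  rewrite invf_div mulrC; apply: le_trans (expR_ge1Dx _).
  by rewrite lerDr.
apply: (@le_trans _ _ (expR (- (a * L)) * ((b - a) * L))).
  have := expR_ge0 (- (a * L)); nra.
rewrite mulrCA ler_wpM2l ?subr_ge0//.
apply: le_trans (ler_wpM2r L0 h2) _.
have E0 := expR_ge0 (- (delta / 2 * L)); move: h3 E0; set E := expR _ => h3 E0.
have h5 := ler_wpM2l E0 h3; lra.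
Qed.

Lemma fker_lip delta : 0 < delta -> exists C : R, 0 <= C /\ forall s t x y,
  delta <= s -> delta <= t -> `|fker s x y - fker t x y| <= C * `|s - t| * (decay x * decay y).
Proof.
move=> D0; have D2 : 0 < delta / 2 by rewrite divr_gt0.
have aD := adm_hm D2.
exists (2 / delta * msize (d := d) (hm beta (delta / 2))); split.
  by rewrite mulr_ge0 ?msize_ge0// divr_ge0// ltW.
move=> s t x y sD tD; have s0 := lt_le_trans D0 sD; have t0 := lt_le_trans D0 tD.
rewrite /fker s0 t0 (mkerB _ _ (adm_hm s0) (adm_hm t0)).
pose c := `|s - t| * (2 / delta).
have cu k : `|hm beta s k - hm beta t k| <= `|c * hm beta (delta / 2) k|.
  rewrite (ger0_norm (_ : 0 <= c * _)); last first.
    by rewrite !mulr_ge0 ?heat_mult_ge0// ?invr_ge0 ltW.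
  by rewrite /c -mulrA; apply: expR_lip => //; exact: powR_ge0.
have ac : adm (d := d) (fun k => c * hm beta (delta / 2) k) by exact: admZ.
apply: le_trans (mker_le _ _ (adm_le cu ac)) _.
apply: ler_wpM2r; first by rewrite mulr_ge0// ltW// decay_gt0.
apply: le_trans (msize_le cu ac) _; rewrite msizeZ// /c normrM normr_id.
have -> : `|2 / delta| = 2 / delta by rewrite ger0_norm// divr_ge0// ltW.
by rewrite le_eqVlt; apply/orP; left; apply/eqP; ring.
Qed.

Lemma measurable_fker :
  measurable_fun setT (fun z : mR * (Rd * Rd) => fker z.1 z.2.1 z.2.2).
Proof.
apply: (@measurable_fun_cvg _ _ _ _ (fun n (z : mR * (Rd * Rd)) =>
   if 0 < z.1 then series (fun k => hm beta z.1 k * hker k z.2.1 z.2.2) n else 0)).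
- move=> n; apply: measurable_fun_ifT.
  + by apply: measurable_fun_ltr; [exact: measurable_cst|exact: measurable_fst].
  + apply: measurable_sum => k; apply: measurable_funM.
      apply: measurableT_comp => //; apply: measurableT_comp => //.
      by apply: measurable_funM; [exact: measurable_fst|exact: measurable_cst].
    apply: (measurableT_comp (@measurable_hker R d k)); exact: measurable_snd.
  + exact: measurable_cst.
- move=> z _; rewrite /fker; case: ifPn => z0; last exact: cvg_cst.
  by apply: mker_cvg; exact: adm_hm.
Qed.

Lemma measurable_fker1 t : measurable_fun setT (fun z : Rd * Rd => fker t z.1 z.2).
Proof.
have m' : measurable_fun setT (fun z : Rd * Rd => ((t, (z.1, z.2)) : mR * (Rd * Rd))) by mfun.
exact: (measurableT_comp measurable_fker m').
Qed.

Local Open Scope ereal_scope.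

(** The approximating combination has mass at most P(1) <= 1, and its error integrates to a multiple
    of the integral of [decay]. *)
Lemma fker_mass t x : \int[mu]_y (fker t x y)%:E <= 1.
Proof.
have [t0|t0] := ltP 0%R t; last first.
  by rewrite (eq_integral (cst 0)) ?integral0// => y _; rewrite /fker ltNge t0.
have lD := @integral_decay_lty R d; set c := \int[_]__ _ in lD.
have c0 : 0 <= c by apply: integral_ge0 => y _; rewrite lee_fin ltW// decay_gt0.
have cE : c = (fine c)%:E by rewrite fineK// ge0_fin_numE.
apply/lee_addgt0Pr => e e0.
(* Chosen so that eta times the integral of [decay] is at most e; adding 1 keeps the divisor
   positive. *)
pose eta := (e / (1 + fine c))%R.
have c1 : (0 < 1 + fine c)%R by rewrite ltr_pwDl// fine_ge0.
have eta0 : (0 < eta)%R by rewrite divr_gt0.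
have [h [s [P [[h0 /andP[s0 _]] P0 P1 _ K]]]] := frac_heat_approx d1 b01 t0 eta0.
have sj j : (0 < h * j%:R + s)%R by rewrite ltr_wpDl// mulr_ge0// ltW.
have mkx : measurable_fun setT (fker t x) by exact: (measurable_ker x (measurable_fker1 t)).
have mh j : measurable_fun setT (fun y => (P`_j * heatd (h * j%:R + s) x y)%:E).
  have [mk _ _ _] := contraction_heatd d (sj j).
  by have mhx := measurable_ker x mk; mfun.
have h0' j y : 0 <= (P`_j * heatd (h * j%:R + s) x y)%:E.
  have [_ k0 _ _] := contraction_heatd d (sj j).
  by rewrite lee_fin mulr_ge0.
have mD : measurable_fun setT (fun y : Rd => (eta * decay y)%:E).
  by have mdec := @measurable_decay; mfun.
have D0 (y : Rd) : 0 <= (eta * decay y)%:E by rewrite lee_fin mulr_ge0// ltW// decay_gt0.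
apply: (@le_trans _ _ (\int[mu]_y (\sum_(j <- index_iota 0 (size P)) (P`_j * heatd (h * j%:R + s) x y)%:E +
    (eta * decay y)%:E))).
  apply: ge0_le_integral => //.
  - by move=> y _; rewrite lee_fin fker_ge0.
  - exact/measurable_EFinP.
  - by apply: emeasurable_funD => //; exact: emeasurable_sum.
  - move=> y _; rewrite sumEFin -EFinD lee_fin big_mkord.
    have := K x y; rewrite ler_norml /fker t0 => /andP[_].
    have : (eta * (decay x * decay y) <= eta * decay y)%R.
      by rewrite ler_wpM2l ?(ltW eta0)// ler_piMl ?decay_le1// ltW// decay_gt0.
    by set u := (\sum_(_ < _) _)%R; move=> ? ?; lra.
rewrite ge0_integralD//; last 2 first.
- by move=> y _; rewrite sume_ge0.
- exact: emeasurable_sum.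
rewrite ge0_integral_sum//; apply: leeD; last first.
  under eq_integral do rewrite EFinM.
  rewrite ge0_integralZl ?lee_fin ?(ltW eta0)//; last 2 first.
  - by apply/measurable_EFinP; exact: measurable_decay.
  - by move=> y _; rewrite lee_fin ltW// decay_gt0.
  rewrite -/c cE -EFinM lee_fin /eta -mulrA ler_piMr ?(ltW e0)//.
  by rewrite mulrC ler_pdivrMr// mul1r lerDr.
apply: (@le_trans _ _ (\sum_(j <- index_iota 0 (size P)) (P`_j)%:E)).
  apply: lee_sum => j _; have [mk k0 _ k1] := contraction_heatd d (sj j).
  under eq_integral do rewrite EFinM.
  rewrite ge0_integralZl ?lee_fin//.
  - by rewrite -[leRHS]mule1 lee_wpmul2l ?lee_fin// k1.
  - by apply/measurable_EFinP; exact: measurable_ker.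
  - by move=> y _; rewrite lee_fin.
rewrite sumEFin lee_fin big_mkord; apply: le_trans P1.
by rewrite horner_coef le_eqVlt; apply/orP; left; apply/eqP/eq_bigr => j _; rewrite expr1n mulr1.
Qed.

End frac_heat_kernel.

(** * Strong L^1 continuity of the fractional semigroup at time 0 *)

Section frac_heat_semigroup.
Context {R : realType} {d : nat}.
Local Notation mR := (measurableTypeR R).
Local Notation Rd := (d.-tuple mR).
Local Notation mu := (@lebesgue_tuple R d).
Local Notation hm := (@heat_mult R d).
Local Notation K := (@fker R d).
Variable beta : R.
Hypotheses (d1 : (1 <= d)%N) (b01 : 0 < beta <= 1).
Implicit Types (x y : Rd) (t : R) (g : Rd -> R).

Let b0 : 0 < beta. Proof. by case/andP: b01. Qed.
Let adm_hm t : 0 < t -> adm (d := d) (hm beta t).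
Proof. by move=> t0; exact: adm_heat_mult. Qed.

Lemma integrable_fker_mul t g x : mu.-integrable setT (EFin \o g) ->
  mu.-integrable setT (EFin \o (fun y => K beta t x y * g y)).
Proof.
move=> ig; have [B hB] := fker_bounded d1 b01 t.
exact: (integrable_kmul (measurable_fker1 d1 b01 t) (hB x) ig).
Qed.

(* The tail of the weights P_j is controlled by testing the approximation on
   the lowest eigenvalue, where e^{-t d^beta} is close to 1. *)
Lemma kapply_fker_sub_le t eta h e (P : {poly R}) g (N : R) : 0 < t -> 0 < eta ->
  0 < h -> 0 < e -> (forall n, 0 <= P`_n) ->
  (forall x y, `|K beta t x y -
      \sum_(j < size P) P`_j * heatd (h * j%:R + e) x y| <= eta * (decay x * decay y)) ->
  P.[1] <= 1 ->
  mu.-integrable setT (EFin \o g) -> (\int[mu]_x `|g x|%:E <= N%:E)%E ->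
  forall x, `|kapply mu (K beta t) g x - g x| <=
    \sum_(j < size P) P`_j * `|kapply mu (heatd (h * j%:R + e)) g x - g x| +
    (1 - P.[1]) * `|g x| + eta * N * decay x.
Proof.
move=> t0 eta0 h0 e0 P0 HK P1 ig lN x; have [mg lg] := (integrableR mu g).1 ig.
pose s j := h * j%:R + e.
have s0 (j : nat) : 0 < s j by rewrite ltr_wpDl// mulr_ge0// ltW.
have ij (j : nat) : mu.-integrable setT (EFin \o (fun y => P`_j * (heatd (s j) x y * g y))).
  have [B hB] := @heatd_bounded R d _ (s0 j); have [mk _ _ _] := contraction_heatd d (s0 j).
  apply: (@integrable_le _ _ _ mu _ (fun y => P`_j * B * `|g y|)).
  - have mkx := measurable_ker x mk; by mfun.
  - by move=> y; rewrite !normrM -mulrA ger0_norm// ler_wpM2l// ler_wpM2r.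
  - have ia := integrable_norm ig.
    rewrite (_ : _ \o _ = (fun y => (P`_j * B)%:E * (`|g y|)%:E)%E); last first.
      by apply/funext => y /=; rewrite EFinM.
    by apply: integrableZl.
have iS : mu.-integrable setT (EFin \o (fun y => \sum_(j < size P) P`_j * (heatd (s j) x y * g y))).
  rewrite (_ : _ \o _ = (fun y => \sum_(j <- index_enum 'I_(size P)) (P`_j * (heatd (s j) x y * g y))%:E)%E).
    by apply: integrable_sum => // j _; exact: ij.
  by apply/funext => y; rewrite sumEFin.
have iK := integrable_fker_mul t x ig.
have sumE : (\int[mu]_y (\sum_(j < size P) P`_j * (heatd (s j) x y * g y)))%R =
   \sum_(j < size P) P`_j * kapply mu (heatd (s j)) g x.
  rewrite Rintegral_sum//; apply: eq_bigr => j _; rewrite RintegralZl//.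
  have [B hB] := @heatd_bounded R d _ (s0 j); have [mk _ _ _] := contraction_heatd d (s0 j).
  exact: (integrable_kmul mk (hB x) ig).
have dle : `|kapply mu (K beta t) g x - \sum_(j < size P) P`_j * kapply mu (heatd (s j)) g x| <=
    eta * N * decay x.
  rewrite -sumE -RintegralB//.
  have id' : mu.-integrable setT (EFin \o (fun y => K beta t x y * g y -
      \sum_(j < size P) P`_j * (heatd (s j) x y * g y))).
    rewrite (_ : _ \o _ = (fun y => (K beta t x y * g y)%:E -
      (\sum_(j < size P) P`_j * (heatd (s j) x y * g y))%:E)%E); last first.
      by apply/funext => y /=; rewrite EFinB.
    exact: integrableB.
  rewrite -lee_fin; apply: le_trans (normr_Rintegral_le id') _.
  apply: (@le_trans _ _ (\int[mu]_y ((eta * decay x)%:E * (`|g y|)%:E))%E).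
    have [mid _] := (integrableR _ _).1 id'.
    apply: ge0_le_integral => //.
    - by apply/measurable_EFinP; apply: (measurableT_comp (@normr_measurable _ setT)); exact: mid.
    - by mfun.
    - move=> y _; rewrite -EFinM lee_fin.
      have -> : K beta t x y * g y - \sum_(j < size P) P`_j * (heatd (s j) x y * g y) =
         (K beta t x y - \sum_(j < size P) P`_j * heatd (s j) x y) * g y.
        rewrite mulrBl mulr_suml; congr (_ - _); apply: eq_bigr => j _; exact: mulrA.
      rewrite normrM ler_wpM2r//; apply: le_trans (HK x y) _.
      by rewrite mulrA ler_piMr ?decay_le1// mulr_ge0// ltW// decay_gt0.
  rewrite ge0_integralZl//; last 2 first.
  - by mfun.
  - by rewrite lee_fin mulr_ge0// ltW// decay_gt0.
  apply: le_trans (lee_wpmul2l _ lN) _.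
    by rewrite lee_fin mulr_ge0// ltW// decay_gt0.
  by rewrite -EFinM mulrAC.
have -> : kapply mu (K beta t) g x - g x =
  (\sum_(j < size P) P`_j * (kapply mu (heatd (s j)) g x - g x) - (1 - P.[1]) * g x) +
  (kapply mu (K beta t) g x - \sum_(j < size P) P`_j * kapply mu (heatd (s j)) g x).
  under eq_bigr do rewrite mulrBr.
  rewrite big_split/= sumrN -mulr_suml.
  have -> : \sum_(j < size P) P`_j = P.[1].
    by rewrite horner_coef; apply: eq_bigr => j _; rewrite expr1n mulr1.
  ring.
apply: le_trans (ler_normD _ _) _; apply: lerD => //.
apply: le_trans (ler_normB _ _) _; apply: lerD; last by rewrite normrM ger0_norm// subr_ge0.
apply: le_trans (ler_norm_sum _ _ _) _; apply: ler_sum => j _.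
by rewrite normrM ger0_norm.
Qed.

Let defect (k : Rd -> Rd -> R) g := (\int[mu]_x (`|kapply mu k g x - g x|)%:E)%E.

Lemma kapply_contraction (k : Rd -> Rd -> R) g : contraction_kernel mu k ->
  (forall x, mu.-integrable setT (EFin \o (fun y => k x y * g y))) -> measurable_fun setT g ->
  (\int[mu]_x (`|kapply mu k g x|)%:E <= \int[mu]_x (`|g x|)%:E)%E.
Proof.
move=> ck ikg mg; have [mk k0 _ _] := ck.
have mF : measurable_fun setT (fun y => (`|g y|)%:E) by mfun.
apply: le_trans (contraction_kernel_L1 ck mF _); last by move=> y; rewrite lee_fin.
have mkg := measurable_kapply mu mk mg.
apply: ge0_le_integral => //.
- by mfun.
- apply: (measurable_fun_fubini_tonelli_F (fun z : Rd * Rd => (k z.1 z.2)%:E * (`|g z.2|)%:E)%E).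
    by mfun.
  by move=> z; rewrite mule_ge0// lee_fin.
- move=> x _; apply: le_trans (normr_Rintegral_le (ikg x)) _.
  by apply: ge0_le_integral => //; [have mkx := measurable_ker x mk; mfun|
    have mkx := measurable_ker x mk; mfun|move=> y _; rewrite -EFinM normrM ger0_norm].
Qed.

(** The semigroup is close to an average of Mehler semigroups at the times hj + s. Times below rho
    have small defect. At later times the defect is at most 2N, but 1 - z^j >= kap with z = e^(-hd),
    and the sum of P_j (1 - z^j) is P(1) - P(z) <= 1 - P(z) = O(t). *)
Lemma fker_L1_continuous g : mu.-integrable setT (EFin \o g) ->
  forall e, 0 < e -> exists2 delta, 0 < delta & forall t, 0 < t < delta ->
    (defect (K beta t) g <= e%:E)%E.
Proof.
move=> ig e e0; have [mg lg] := (integrableR mu g).1 ig.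
have e4 : 0 < e / 4 by rewrite divr_gt0.
have [rho rho0 hrho] : exists2 rho, 0 < rho & forall s, 0 < s < rho -> (defect (heatd s) g <= (e / 4)%:E)%E.
  (* The Mehler case is known along sequences tending to 0; bad times s_n < 1/(n+1) would contradict
     it. *)
  apply: contrapT => /forall2NP H.
  have /choice[s hs] : forall n, exists s : R, 0 < s < n.+1%:R^-1 /\ ~ (defect (heatd s) g <= (e / 4)%:E)%E.
    move=> n; case: (H n.+1%:R^-1) => [|/existsNP[s /not_implyP[]]]; last by exists s.
    by rewrite invr_gt0 ltr0n.
  have s0 n : 0 < s n by case: (hs n) => /andP[].
  have sc : s @ \oo --> 0.
    apply: (squeeze_cvgr _ (cvg_cst (0 : R)) (@cvg_harmonic R)).
    by apply: nearW => n; have [/andP[/ltW -> /ltW]] := hs n.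
  have c := heatd_L1_cvg s0 sc ig.
  have p n : (0 <= defect (heatd (s n)) g)%E by apply: integral_ge0.
  have [n hn] := filter_ex ((cvge0P p).2 c _ e4).
  by have [_] := hs n.
set N := fine (\int[mu]_x `|g x|%:E)%E.
have NE : (\int[mu]_x `|g x|%:E = N%:E)%E.
  by rewrite /N fineK// ge0_fin_numE//; apply: integral_ge0.
have N0 : 0 <= N by rewrite fine_ge0//; apply: integral_ge0.
set c := fine (\int[mu]_x (@decay R d x)%:E)%E.
have D0 (x : Rd) : (0 <= (@decay R d x)%:E)%E by rewrite lee_fin ltW// decay_gt0.
have cE : (\int[mu]_x (@decay R d x)%:E = c%:E)%E.
  rewrite /c fineK// ge0_fin_numE; [exact: integral_decay_lty|].
  by apply: integral_ge0.
have c0 : 0 <= c by rewrite fine_ge0//; apply: integral_ge0.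
have dR0 : 0 < d%:R :> R by rewrite ltr0n.
pose kap := 1 - expR (- (rho / 2 * d%:R)).
have rd : 0 < rho / 2 * d%:R by apply: mulr_gt0 => //; rewrite divr_gt0.
have kap0 : 0 < kap.
  by rewrite /kap subr_gt0 -[ltRHS]expR0 ltr_expR oppr_lt0.
pose L : R := d%:R `^ beta.
have L0 : 0 <= L by exact: powR_ge0.
(* Collects the coefficients of t in the final estimate: the weight at late times, the missing mass
   of P, and the kernel error. *)
pose M := (2 * N / kap + N) * (L + 1) + c * N.
have M0 : 0 <= M.
  by rewrite addr_ge0 ?mulr_ge0 ?addr_ge0 ?divr_ge0 ?mulr_ge0// ltW.
exists (Num.min (rho / 2) (e / 4 / (M + 1))).
  by rewrite lt_min !divr_gt0// ltr_wpDl.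
move=> t /andP[t0]; rewrite lt_min => /andP[tr tM].
(* The accuracy is t itself, so that every approximation error is O(t). *)
have [h [s [P [[h0 /andP[s0 st]] P0 P1 Pd HP]]]] := frac_heat_approx d1 b01 t0 t0.
have HK x y : `|K beta t x y - \sum_(j < size P) P`_j * heatd (h * j%:R + s) x y| <= t * (decay x * decay y).
  by rewrite /fker t0; exact: HP.
have sj (j : nat) : 0 < h * j%:R + s by rewrite ltr_wpDl// mulr_ge0// ltW.
pose D j := defect (heatd (h * j%:R + s)) g.
have mD (j : nat) : measurable_fun setT (fun x => (P`_j * `|kapply mu (heatd (h * j%:R + s)) g x - g x|)%:E).
  have [mk _ _ _] := contraction_heatd d (sj j).
  have mkg := measurable_kapply mu mk mg.
  by mfun.
have mdec := @measurable_decay R d.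
have mK : measurable_fun setT (fun x => kapply mu (K beta t) g x).
  exact: (measurable_kapply mu (measurable_fker1 d1 b01 t) mg).
have lN : (\int[mu]_x `|g x|%:E <= N%:E)%E by rewrite NE.
have pw := kapply_fker_sub_le t0 t0 h0 s0 P0 HK P1 ig lN.
apply: (@le_trans _ _ (\int[mu]_x (\sum_(j <- index_iota 0 (size P))
    (P`_j * `|kapply mu (heatd (h * j%:R + s)) g x - g x|)%:E +
    (((1 - P.[1])%:E * `|g x|%:E) + ((t * N)%:E * (decay x)%:E))))%E).
  apply: ge0_le_integral => //.
  - by mfun.
  - apply: emeasurable_funD; first exact: emeasurable_sum.
    by apply: emeasurable_funD; mfun.
  - by move=> x _; rewrite sumEFin -!EFinM -!EFinD lee_fin big_mkord addrA; exact: pw.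
have P1' : 0 <= 1 - P.[1] by rewrite subr_ge0.
have tN : 0 <= t * N by rewrite mulr_ge0// ltW.
have q1 x : (0 <= (1 - P.[1])%:E * `|g x|%:E)%E by rewrite mule_ge0.
have q2 x : (0 <= (t * N)%:E * (@decay R d x)%:E)%E by rewrite mule_ge0.
have q3 (j : nat) x : (0 <= (P`_j * `|kapply mu (heatd (h * j%:R + s)) g x - g x|)%:E)%E.
  by rewrite lee_fin mulr_ge0.
have mq1 : measurable_fun setT (fun x => (1 - P.[1])%:E * `|g x|%:E)%E by mfun.
have mq2 : measurable_fun setT (fun x => (t * N)%:E * (@decay R d x)%:E)%E by mfun.
rewrite ge0_integralD//; last 4 first.
- by move=> x _; rewrite sume_ge0.
- exact: emeasurable_sum.
- by move=> x _; rewrite adde_ge0.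
- exact: emeasurable_funD.
rewrite ge0_integralD// ge0_integral_sum//.
have mna : measurable_fun setT (fun x => `|g x|%:E) by mfun.
have mnd : measurable_fun setT (fun x => (@decay R d x)%:E) by mfun.
rewrite (ge0_integralZl _ measurableT mna)// (ge0_integralZl _ measurableT mnd)// NE cE.
pose z := expR (- (h * d%:R)).
have z01 : 0 <= z <= 1.
  by rewrite /z expR_ge0/= -expR0 ler_expR oppr_le0 mulr_ge0// ltW.
(* One bound for both regimes. At late times hj >= rho/2, because s <= t < rho/2, and this gives 1 -
   z^j >= kap. *)
have Dj (j : nat) : (\int[mu]_x (P`_j * `|kapply mu (heatd (h * j%:R + s)) g x - g x|)%:E <=
    (P`_j * (e / 4) + 2 * N / kap * (P`_j * (1 - z ^+ j)))%:E)%E.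
  have [mk _ _ _] := contraction_heatd d (sj j); have [B hB] := @heatd_bounded R d _ (sj j).
  have mkg := measurable_kapply mu mk mg.
  under eq_integral do rewrite EFinM.
  rewrite ge0_integralZl ?lee_fin//; last by mfun.
  rewrite [2 * N / kap * _]mulrCA -mulrDr EFinM lee_wpmul2l ?lee_fin//.
  have zj : 0 <= 1 - z ^+ j by case/andP: z01 => z0 z1; rewrite subr_ge0 exprn_ile1.
  have nk : 0 <= 2 * N / kap by rewrite divr_ge0 ?mulr_ge0// ltW.
  have [small|big] := ltP (h * j%:R + s) rho.
    apply: (@le_trans _ _ (e / 4)%:E); first by apply: hrho; rewrite sj.
    by rewrite lee_fin lerDl mulr_ge0.
  apply: (@le_trans _ _ (2 * N)%:E).
    apply: (@le_trans _ _ (\int[mu]_x (`|kapply mu (heatd (h * j%:R + s)) g x|%:E + `|g x|%:E))%E).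
      apply: ge0_le_integral => //; [by mfun|by apply: emeasurable_funD; mfun|].
      by move=> x _; rewrite -EFinD lee_fin ler_normB.
    rewrite ge0_integralD//; last by mfun.
    have ikg x := integrable_kmul mk (hB x) ig.
    have := kapply_contraction (contraction_heatd d (sj j)) ikg mg.
    by rewrite NE mulr_natl mulr2n EFinD => ?; rewrite leeD.
  rewrite lee_fin -[leLHS]addr0 addrC; apply: lerD; first exact: ltW.
  have kz : kap <= 1 - z ^+ j.
    rewrite /kap lerD2l lerN2 /z -expRM_natl ler_expR mulrN lerN2 mulrA ler_wpM2r//.
    rewrite mulrC; have : rho <= h * j%:R + rho / 2; last by lra.
    by apply: le_trans big _; rewrite lerD2l; apply: le_trans st (ltW tr).
  by rewrite mulrAC ler_pdivlMr//; apply: ler_wpM2l => //; rewrite mulr_ge0.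
apply: (@le_trans _ _ ((\sum_(j < size P) (P`_j * (e / 4) + 2 * N / kap * (P`_j * (1 - z ^+ j)))) +
   ((1 - P.[1]) * N + t * N * c))%:E).
  rewrite [leRHS]EFinD -sumEFin -(big_mkord predT (fun j => (P`_j * (e / 4) + 2 * N / kap * (P`_j * (1 - z ^+ j)))%:E)).
  by apply: leeD; [exact: lee_sum|rewrite -!EFinM -EFinD].
have -> : \sum_(j < size P) (P`_j * (e / 4) + 2 * N / kap * (P`_j * (1 - z ^+ j))) =
    P.[1] * (e / 4) + 2 * N / kap * (P.[1] - P.[z]).
  rewrite big_split/= -mulr_suml -mulr_sumr !horner_coef; congr (_ * _ + _ * _).
    by apply: eq_bigr => j _; rewrite expr1n mulr1.
  by rewrite -sumrB; apply: eq_bigr => j _; rewrite mulrBr expr1n.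
have hz : 1 - P.[z] <= (L + 1) * t.
  have : 1 - t * L <= hm beta t 0 by rewrite /heat_mult muln0 add0n; exact: expR_ge1Dx.
  by move: Pd; rewrite -/z; lra.
have /andP[Pz0 Pz1] := horner_itv01 P0 P1 z01.
have PzP1 : P.[z] <= P.[1].
  rewrite !horner_coef; apply: ler_sum => j _; rewrite ler_wpM2l// expr1n.
  by case/andP: z01 => z0 z1; rewrite exprn_ile1.
have tM' : t * (M + 1) < e / 4 by rewrite -ltr_pdivlMr// ltr_wpDl.
have nk : 0 <= 2 * N / kap by rewrite divr_ge0 ?mulr_ge0// ltW.
move: tM'; rewrite lee_fin /M; move: (2 * N / kap) nk => W W0 tM'.
have i1 : P.[1] * (e / 4) <= e / 4 by rewrite ler_piMl// ltW.
have i2 : W * (P.[1] - P.[z]) <= W * ((L + 1) * t) by rewrite ler_wpM2l//; lra.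
have i3 : (1 - P.[1]) * N <= (L + 1) * t * N by rewrite ler_wpM2r//; lra.
lra.
Qed.

End frac_heat_semigroup.

Lemma dominated_Rintegral {R : realType} {d} {T : measurableType d} (m : {sigma_finite_measure set T -> \bar R})
    (F : nat -> T -> R) (G B : T -> R) :
  (forall n, measurable_fun setT (F n)) -> measurable_fun setT G ->
  (forall y, F n y @[n --> \oo] --> G y) -> m.-integrable setT (EFin \o B) ->
  (forall n y, `|F n y| <= B y) ->
  (\int[m]_y F n y)%R @[n --> \oo] --> (\int[m]_y G y)%R.
Proof.
move=> mF mG cF iB FB.
have [iG _ c] : [/\ m.-integrable setT (EFin \o G),
    [sequence \int[m]_y `|(EFin \o F n) y - (EFin \o G) y|]_n%E @ \oo --> 0%E &
    [sequence \int[m]_y (EFin \o F n) y]_n%E @ \oo --> (\int[m]_y (EFin \o G) y)%E].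
  apply: (@dominated_convergence _ _ _ m setT measurableT (fun n => EFin \o F n) (EFin \o G) (EFin \o B)) => //.
  - by move=> n; apply/measurable_EFinP.
  - exact/measurable_EFinP.
  - by apply: aeW => y _; apply: cvg_EFin; [exact: nearW|exact: cF].
  - by apply: aeW => y n _ /=; rewrite lee_fin.
have iF n : m.-integrable setT (EFin \o F n) by exact: (integrable_le (mF n) (FB n) iB).
move: c; rewrite -EFin_Rintegral// => /fine_cvgP[_].
by apply: cvg_trans; apply: near_eq_cvg; apply: nearW => n /=; rewrite -EFin_Rintegral.
Qed.

(** * From the spectral definition to the kernel *)

Section hermite_heat_kernel.
Context {R : realType} {d : nat}.
Local Notation mR := (measurableTypeR R).
Local Notation Rd := (d.-tuple mR).
Local Notation mu := (@lebesgue_tuple R d).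
Local Notation hm := (@heat_mult R d).
Local Notation kb := (@kbound R d).
Variable beta : R.
Hypotheses (d1 : (1 <= d)%N) (b0 : 0 < beta).
Implicit Types (x y : Rd) (t : R) (g : Rd -> R).

(** The constant kb + 1 dominates the square root of kb without introducing one. *)
Lemma hermite_Phi_le k (a : {ffun 'I_d -> 'I_k.+1}) x : (\sum_(i < d) a i == k)%N ->
  `|hermite_Phi (fun i => a i) x| <= (kb k + 1) * decay x.
Proof.
move=> ak; have k0 : 0 < kb k by exact: kbound_gt0.
have D0 : 0 <= decay x by rewrite ltW// decay_gt0.
rewrite -ler_sqr ?nnegrE ?normr_ge0 ?mulr_ge0 ?addr_ge0 ?(ltW k0)//.
rewrite real_normK ?num_real//; apply: le_trans (hermite_Phi_sqr_le x ak) _.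
apply: le_trans (hker_diag_le k x) _; rewrite exprMn ler_wpM2r ?sqr_ge0//.
by nra.
Qed.

Lemma measurable_hermite_Phi (a : 'I_d -> nat) : measurable_fun setT (fun x : Rd => hermite_Phi a x : R).
Proof.
apply: (@measurable_prod_tnth _ d (fun i t => hermite_fun (a i) t)) => i; apply: measurable_funM.
  apply: measurable_funM => //; apply: continuous_measurable_fun => t.
  exact: continuous_horner.
by apply: measurableT_comp => //; apply: measurableT_comp => //; exact: measurable_funM.
Qed.

Lemma series_mker_le m n x y : adm (d := d) m ->
  `|series (fun k => m k * hker k x y) n| <= msize (d := d) m * (decay x * decay y).
Proof.
move=> am; have DD : 0 <= decay x * decay y by rewrite mulr_ge0// ltW// decay_gt0.
apply: le_trans (ler_norm_sum _ _ _) _.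
apply: (@le_trans _ _ (series (fun k => `|m k| * kb k) n * (decay x * decay y))).
  rewrite /series/= mulr_suml; apply: ler_sum => k _.
  by rewrite normrM -mulrA ler_wpM2l// hker_le.
rewrite ler_wpM2r//; apply: nondecreasing_cvgn_le => //.
by apply: nondecreasing_series => k _ _; exact: mterm_ge0.
Qed.

(** Weighted integrability gives meaning to all Hermite coefficients. Partial sums of the spectral
    series are integrals of partial sums of the kernel, which are dominated by a constant times
    decay(y)|g(y)|. *)
Lemma hermite_heatE t g x : 0 < t ->
  mu.-integrable setT (EFin \o (fun y => decay y * g y)) ->
  measurable_fun setT g ->
  hermite_heat beta t g x = kapply mu (fker beta t) g x.
Proof.
move=> t0 iW mg.
have iP k (a : {ffun 'I_d -> 'I_k.+1}) : (\sum_(i < d) a i == k)%N ->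
    mu.-integrable setT (EFin \o (fun y => g y * hermite_Phi (fun i => a i) y)).
  move=> ak.
  apply: (@integrable_le _ _ _ mu _ (fun y => (kb k + 1) * `|decay y * g y|)).
  - have mP := @measurable_hermite_Phi (fun i => a i); by mfun.
  - move=> y; rewrite !normrM (ger0_norm (ltW (decay_gt0 y))) mulrA mulrC ler_wpM2r//.
    exact: hermite_Phi_le.
  - have ia := integrable_norm iW.
    rewrite (_ : _ \o _ = (fun y => (kb k + 1)%:E * (`|decay y * g y|)%:E)%E); last first.
      by apply/funext => y /=; rewrite EFinM.
    by apply: integrableZl.
have ih k : mu.-integrable setT (EFin \o (fun y => hker k x y * g y)).
  apply: (@integrable_le _ _ _ mu _ (fun y => kb k * decay x * `|decay y * g y|)).
  - have mh := @measurable_hker R d k; have mhx := measurable_ker x mh; by mfun.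
  - move=> y; rewrite !normrM (ger0_norm (ltW (decay_gt0 y))) mulrA ler_wpM2r//.
    by rewrite -mulrA hker_le.
  - have ia := integrable_norm iW.
    rewrite (_ : _ \o _ = (fun y => (kb k * decay x)%:E * (`|decay y * g y|)%:E)%E); last first.
      by apply/funext => y /=; rewrite EFinM.
    by apply: integrableZl.
have projE k : hermite_proj k g x = (\int[mu]_y (hker k x y * g y))%R.
  rewrite /hermite_proj -big_filter.
  (* Zero off degree k, so that integrability holds for every index, as [Rintegral_sum] requires. *)
  pose G (a : {ffun 'I_d -> 'I_k.+1}) y : R := if (\sum_(i < d) a i == k)%N
    then g y * hermite_Phi (fun i => a i) y * hermite_Phi (fun i => a i) x else 0.
  set r := [seq _ <- _ | _].
  transitivity (\sum_(a <- r)
      (\int[mu]_y G a y)%R).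
    rewrite [LHS]big_seq [RHS]big_seq; apply: eq_bigr => a; rewrite /r mem_filter => /andP[ak _].
    by rewrite /G ak RintegralZr// iP.
  rewrite -Rintegral_sum; last first.
    move=> a; rewrite /G; have [ak|_] := boolP (\sum_(i < d) a i == k)%N; last first.
      by apply/integrableR; split => //; under eq_integral do rewrite normr0; rewrite integral0.
    rewrite (_ : _ \o _ = (fun y => (g y * hermite_Phi (fun i => a i) y)%:E * (hermite_Phi (fun i => a i) x)%:E)%E); last first.
      by apply/funext => y /=; rewrite EFinM.
    by apply: integrableZr => //; exact: iP.
  apply: eq_Rintegral => y _; rewrite /G /r -big_mkcond big_filter_cond/= /hker mulr_suml.
  by under eq_bigl do rewrite andbb; apply: eq_bigr => a _; ring.
rewrite /hermite_heat gt_eqF//; apply/cvg_lim => //.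
have am : adm (d := d) (hm beta t) by exact: adm_heat_mult.
have sE n : series (fun k => expR (- (t * (2 * k + d)%:R `^ beta)) * hermite_proj k g x) n =
    (\int[mu]_y (series (fun k => hm beta t k * hker k x y) n * g y))%R.
  transitivity (\int[mu]_y (\sum_(k <- index_iota 0 n) hm beta t k * (hker k x y * g y)))%R.
    rewrite Rintegral_sum; last first.
      move=> k; rewrite (_ : _ \o _ = (fun y => (hm beta t k)%:E * (hker k x y * g y)%:E)%E); last first.
        by apply/funext => y /=; rewrite EFinM.
      by apply: integrableZl => //; exact: ih.
    by rewrite /series/=; apply: eq_bigr => k _; rewrite projE RintegralZl.
  by apply: eq_Rintegral => y _; rewrite /series/= mulr_suml; apply: eq_bigr => k _; rewrite mulrA.
rewrite (_ : series _ = fun n => (\int[mu]_y (series (fun k => hm beta t k * hker k x y) n * g y))%R); last first.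
  exact/funext.
pose F n y := series (fun k => hm beta t k * hker k x y) n * g y.
have mF n : measurable_fun setT (F n).
  apply: measurable_funM => //; apply: measurable_sum => k.
  have mh := @measurable_hker R d k; have mhx := measurable_ker x mh; by mfun.
have msz : 0 <= msize (d := d) (hm beta t) * decay x by rewrite mulr_ge0 ?msize_ge0// ltW// decay_gt0.
have Fle n y : `|F n y| <= msize (d := d) (hm beta t) * decay x * `|decay y * g y|.
  rewrite !normrM (ger0_norm (ltW (decay_gt0 y))) mulrA ler_wpM2r// -mulrA.
  exact: series_mker_le.
have iB : mu.-integrable setT (EFin \o (fun y => msize (d := d) (hm beta t) * decay x * `|decay y * g y|)).
  have ia := integrable_norm iW.
  rewrite (_ : _ \o _ = (fun y => (msize (d := d) (hm beta t) * decay x)%:E * (`|decay y * g y|)%:E)%E); last first.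
    by apply/funext => y /=; rewrite EFinM.
  by apply: integrableZl.
have mK : measurable_fun setT (fun y => fker beta t x y * g y).
  apply: measurable_funM => //; rewrite /fker t0.
  exact: (measurable_ker x (measurable_mker am)).
apply: (dominated_Rintegral mF mK _ iB Fle) => y.
by apply: cvgMr_tmp; rewrite /fker t0; exact: mker_cvg.
Qed.

End hermite_heat_kernel.

(** The Young function of exp L^p with its scale as a parameter; locked to keep unification and
    automation from unfolding it. *)
HB.lock Definition gauge {R : realType} (p a z : R) : R := expR (a * (`|z| `^ p)) - 1.

Lemma gaugeE {R : realType} (p a z : R) : gauge p a z = expR (a * (`|z| `^ p)) - 1.
Proof. by rewrite gauge.unlock. Qed.

(** * The exponential gauge and the nonlinearity *)

Section exponential_gauge.
Context {R : realType}.
Variable p : R.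
Hypothesis p1 : 1 < p.
Implicit Types (a z w M : R).

Let p0 : 0 < p. Proof. exact: lt_trans ltr01 p1. Qed.

Lemma gauge_ge0 a z : 0 <= a -> 0 <= gauge p a z.
Proof. by move=> a0; rewrite gaugeE subr_ge0 -expR0 ler_expR mulr_ge0// powR_ge0. Qed.

Lemma gauge0 a : gauge p a 0 = 0.
Proof. by rewrite !gaugeE normr0 powR0 ?gt_eqF// mulr0 expR0 subrr. Qed.

Lemma gauge_norm a z : gauge p a `|z| = gauge p a z.
Proof. by rewrite !gaugeE normr_id. Qed.

Lemma ler_normp z w : `|z| <= `|w| -> `|z| `^ p <= `|w| `^ p.
Proof. by move=> zw; apply: ge0_ler_powR; rewrite ?nnegrE// ltW. Qed.

Lemma gauge_le a z w : 0 <= a -> `|z| <= `|w| -> gauge p a z <= gauge p a w.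
Proof. by move=> a0 zw; rewrite !gaugeE lerD2r ler_expR ler_wpM2l// ler_normp. Qed.

Lemma gauge_lel a b z : a <= b -> gauge p a z <= gauge p b z.
Proof. by move=> ab; rewrite !gaugeE lerD2r ler_expR ler_wpM2r// powR_ge0. Qed.

Lemma gaugeM a b z : 0 <= b -> gauge p a (b * z) = gauge p (a * b `^ p) z.
Proof. by move=> b0; rewrite !gaugeE normrM powRM// (ger0_norm b0) mulrA. Qed.

(** Since |z + w| <= 2 max(|z|, |w|), a sum costs a factor 2^p in the parameter, harmless because
    all parameters are available in exp L^p_0. *)
Lemma gaugeD a z w : 0 <= a -> gauge p a (z + w) <= gauge p (a * 2 `^ p) z + gauge p (a * 2 `^ p) w.
Proof.
move=> a0; rewrite -!gaugeM//.
have gz b : 0 <= gauge p a b by exact: gauge_ge0.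
have [zw|/ltW wz] := leP `|z| `|w|.
  rewrite -[leLHS]add0r lerD//; apply: gauge_le => //.
  by rewrite normrM ger0_norm//; apply: le_trans (ler_normD _ _) _; lra.
rewrite -[leLHS]addr0 lerD//; apply: gauge_le => //.
by rewrite normrM ger0_norm//; apply: le_trans (ler_normD _ _) _; lra.
Qed.

Lemma gaugeN a z : gauge p a (- z) = gauge p a z.
Proof. by rewrite !gaugeE normrN. Qed.

Lemma expR_sub1_le (y : R) : 0 <= y -> expR y - 1 <= y * expR y.
Proof.
move=> y0; have := expR_ge1Dx (- y); rewrite expRN.
have e0 := expR_gt0 y; rewrite -(ler_pM2r e0) mulVf ?gt_eqF//; lra.
Qed.

(** On bounded functions the exponential integral is thus controlled by the integral of |z|^p; it
    comes from e^y - 1 <= y e^y. *)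
Lemma gauge_le_pow a z M : 0 <= a -> `|z| <= M ->
  gauge p a z <= a * expR (a * M `^ p) * (`|z| `^ p).
Proof.
move=> a0 zM; have y0 : 0 <= a * `|z| `^ p by rewrite mulr_ge0// powR_ge0.
rewrite gaugeE; apply: le_trans (expR_sub1_le y0) _; rewrite [leLHS]mulrAC.
apply: ler_wpM2r; first exact: powR_ge0.
apply: ler_wpM2l => //; rewrite ler_expR ler_wpM2l//; apply: ge0_ler_powR; rewrite ?nnegrE ?(ltW p0)//.
exact: le_trans zM.
Qed.

Lemma pow_le_gauge z : `|z| `^ p <= gauge p 1 z.
Proof. by rewrite !gaugeE mul1r; have := expR_ge1Dx (`|z| `^ p); lra. Qed.

Lemma norm_le_pow z : `|z| <= 1 + `|z| `^ p.
Proof.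
have [z1|/ltW z1] := leP `|z| 1; first by rewrite -[leLHS]addr0 lerD// powR_ge0.
rewrite -[leLHS]add0r lerD// -[leLHS]powRr1//; apply: ler_powR => //; exact: ltW.
Qed.

Lemma pow_le_norm z M : `|z| <= M -> `|z| `^ p <= M `^ (p - 1) * `|z|.
Proof.
move=> zM; rewrite -mulr_powRB1// mulrC ler_wpM2r//.
apply: ge0_ler_powR; rewrite ?nnegrE// ?subr_ge0 ?(ltW p1)//; exact: le_trans zM.
Qed.

(** Makes functions cut off away from 0 integrable, although the measure of the space is
    infinite. *)
Lemma norm_le_pow_scale z M : 0 < M -> M^-1 <= `|z| -> `|z| <= M `^ (p - 1) * `|z| `^ p.
Proof.
move=> M0 zM; have z0 : 0 < `|z| by apply: lt_le_trans zM; rewrite invr_gt0.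
rewrite -(mulr_powRB1 (normr_ge0 z) p0) mulrCA ler_peMr//.
have q0 : 0 <= p - 1 by rewrite subr_ge0 ltW.
rewrite -powRM//; last exact: ltW.
have Mz : 1 <= M * `|z| by rewrite mulrC -ler_pdivrMr// mul1r.
have e1 : (1 : R) `^ (p - 1) = 1 by rewrite powR1.
rewrite -[leLHS]e1; apply: ge0_ler_powR; rewrite ?nnegrE//.
exact: le_trans Mz.
Qed.

(** This is (X - 1)^q <= X^q - 1 for X >= 1; it places the gauge of a function of exp L^p_0 in every
    L^q with q a positive integer. *)
Lemma gaugeX a z q : (0 < q)%N -> 0 <= a -> gauge p a z ^+ q <= gauge p (q%:R * a) z.
Proof.
move=> q0 a0; rewrite !gaugeE -mulrA expRM_natl.
have : 1 <= expR (a * `|z| `^ p) by rewrite -expR0 ler_expR mulr_ge0// powR_ge0.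
case: q q0 => // q _; move: (expR _) => X X1; elim: q => [|q IH]; first by rewrite !expr1.
have X0 : 0 <= X - 1 by rewrite subr_ge0.
rewrite exprS; apply: le_trans (ler_wpM2l X0 IH) _.
rewrite [X ^+ q.+2]exprS; have : 1 <= X ^+ q.+1 by exact: exprn_ege1.
by move: (X ^+ q.+1) => Y; nra.
Qed.

Lemma measurable_powp d (T : measurableType d) (g : T -> R) : measurable_fun setT g ->
  measurable_fun setT (fun x => `|g x| `^ p).
Proof.
move=> mg; exact: (measurableT_comp (@measurable_powR R p) (measurableT_comp (@normr_measurable _ setT) mg)).
Qed.

Lemma measurable_gauge d (T : measurableType d) (g : T -> R) a : measurable_fun setT g ->
  measurable_fun setT (fun x => gauge p a (g x)).
Proof.
move=> mg; under eq_fun do rewrite gaugeE.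
apply: measurable_funB => //; apply: measurableT_comp => //.
by apply: measurable_funM => //; exact: measurable_powp.
Qed.

(** The tangent line inequality, as Young's inequality for w and z^(p-1) with the exponents p and
    p/(p-1). *)
Lemma powR_subgradient z w : 0 <= z -> 0 <= w ->
  z `^ p + p * z `^ (p - 1) * (w - z) <= w `^ p.
Proof.
move=> z0 w0; have q0 : 0 < p - 1 by rewrite subr_gt0.
have zq : 0 <= z `^ (p - 1) by exact: powR_ge0.
have q1 : 0 < p / (p - 1) by rewrite divr_gt0.
have pq : p^-1 + (p / (p - 1))^-1 = 1 by field; rewrite !gt_eqF.
have := conjugate_powR w0 zq p0 q1 pq.
rewrite -powRrM mulrCA divff ?gt_eqF// mulr1 invf_div => h.
have e : z * z `^ (p - 1) = z `^ p by rewrite mulr_powRB1.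
have h' : p * (w * z `^ (p - 1)) <= w `^ p + z `^ p * (p - 1).
  rewrite mulrC -ler_pdivlMr// mulrDl -[in leRHS]mulrA; exact: h.
rewrite mulrBr [p * _ * z]mulrAC -[p * z * _]mulrA e; lra.
Qed.

Lemma gauge_subgradient a z w : 0 <= a -> 0 <= z -> 0 <= w ->
  gauge p a z + expR (a * z `^ p) * a * (p * z `^ (p - 1)) * (w - z) <= gauge p a w.
Proof.
move=> a0 z0 w0; rewrite !gaugeE !ger0_norm//.
have h := powR_subgradient z0 w0.
have := expR_ge1Dx (a * w `^ p - a * z `^ p).
have eE : expR (a * w `^ p) = expR (a * z `^ p) * expR (a * w `^ p - a * z `^ p).
  by rewrite -expRD; congr expR; ring.
rewrite {}eE; have e0 := expR_ge0 (a * z `^ p).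
move: (expR (a * z `^ p)) e0 (expR (_ - _)) => E E0 E' hE.
have h2 : E * (a * (p * z `^ (p - 1) * (w - z))) <= E * (a * w `^ p - a * z `^ p).
  by apply: ler_wpM2l => //; rewrite -mulrBr; apply: ler_wpM2l => //; lra.
have h3 := ler_wpM2l E0 hE; lra.
Qed.

Section jensen.
Context {d} {T : measurableType d} (m : {measure set T -> \bar R}).
Variables (k F : T -> R).
Hypotheses (k0 : forall y, 0 <= k y) (mk : measurable_fun setT k) (mF : measurable_fun setT F).
Hypothesis k1 : (\int[m]_y (k y)%:E <= 1)%E.

(** Jensen for a kernel of mass at most 1: the tangent line at z is integrated against k, and phi(0)
    = 0 makes c z - phi(z) nonnegative, which absorbs the missing mass. The point z may be anything
    below the mean. *)
Lemma jensen (phi : R -> R) z c : measurable_fun setT (fun y => phi `|F y|) ->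
  (forall w, 0 <= w -> 0 <= phi w) -> phi 0 = 0 -> 0 <= c -> 0 <= z ->
  (forall w, 0 <= w -> phi z + c * (w - z) <= phi w) ->
  (z%:E <= \int[m]_y (k y * `|F y|)%:E)%E ->
  ((phi z)%:E <= \int[m]_y (k y * phi `|F y|)%:E)%E.
Proof.
move=> mphi phi0 phi00 c0 z0 sub zF.
have e0 : 0 <= c * z - phi z by have := sub 0 (lexx _); rewrite phi00; lra.
have kphi0 y : (0 <= (k y * phi `|F y|)%:E)%E by rewrite lee_fin mulr_ge0// phi0.
have le1 : ((c * z)%:E <= \int[m]_y (k y * phi `|F y|)%:E + (c * z - phi z)%:E)%E.
  apply: (@le_trans _ _ (\int[m]_y (c%:E * (k y * `|F y|)%:E))%E).
    rewrite ge0_integralZl//.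
    - by rewrite EFinM lee_wpmul2l.
    - by mfun.
    - by move=> y _; rewrite lee_fin mulr_ge0.
  apply: (@le_trans _ _ (\int[m]_y ((k y * phi `|F y|)%:E + (c * z - phi z)%:E * (k y)%:E))%E).
    apply: ge0_le_integral => //.
    - by move=> y _; rewrite -EFinM lee_fin !mulr_ge0.
    - by mfun.
    - by apply: emeasurable_funD; mfun.
    - move=> y _; rewrite -!EFinM -EFinD lee_fin.
      have := sub _ (normr_ge0 (F y)); have := k0 y.
      move: (phi `|F y|) (`|F y|) (k y) => u v w w0 h; nra.
  rewrite ge0_integralD//; last 3 first.
  - by mfun.
  - by move=> y _; rewrite -EFinM lee_fin mulr_ge0.
  - by mfun.
  rewrite leeD2l// ge0_integralZl//.
  - by rewrite -[leRHS]mule1 lee_wpmul2l.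
  - by mfun.
  - by move=> y _; rewrite lee_fin.
move: le1; case: (\int[m]_y _)%E => [r| |]//.
  by rewrite -EFinD !lee_fin; lra.
by move=> _; rewrite leey.
Qed.

Lemma jensen_pow (v : R) : ((`|v|)%:E <= \int[m]_y (k y * `|F y|)%:E)%E ->
  ((`|v| `^ p)%R%:E <= \int[m]_y (k y * `|F y| `^ p)%R%:E)%E.
Proof.
move=> vF; refine (@jensen (fun w => w `^ p) `|v| (p * `|v| `^ (p - 1)) _ _ _ _ _ _ vF).
- exact: measurable_powp.
- by move=> w _; exact: powR_ge0.
- by rewrite powR0// gt_eqF.
- by rewrite mulr_ge0 ?powR_ge0// ltW.
- exact: normr_ge0.
- by move=> w w0; apply: powR_subgradient.
Qed.

Lemma jensen_gauge a (v : R) : 0 <= a -> ((`|v|)%:E <= \int[m]_y (k y * `|F y|)%:E)%E ->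
  ((gauge p a v)%:E <= \int[m]_y (k y * gauge p a (F y))%:E)%E.
Proof.
move=> a0 vF; rewrite -gauge_norm; under eq_integral do rewrite -gauge_norm.
apply: (@jensen (gauge p a) `|v| (expR (a * `|v| `^ p) * a * (p * `|v| `^ (p - 1)))) => //.
- by under eq_fun do rewrite gauge_norm; exact: measurable_gauge.
- by move=> w _; exact: gauge_ge0.
- exact: gauge0.
- by rewrite !mulr_ge0 ?expR_ge0 ?powR_ge0// ltW.
- by move=> w w0; exact: gauge_subgradient.
Qed.

End jensen.

Section nonlinearity.
Variables (f : R -> R) (C lam : R).
Hypotheses (f0 : f 0 = 0) (C0 : 0 < C) (lam0 : 0 < lam).
Hypothesis flip : forall u v : R, `|f u - f v| <=
    C * `|u - v| * (expR (lam * (`|u| `^ p)) + expR (lam * (`|v| `^ p))).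

Lemma nonlin_le0 v : `|f v| <= 2 * C * (`|v| * expR (lam * `|v| `^ p)).
Proof.
have := flip v 0; rewrite f0 !subr0 normr0 powR0 ?gt_eqF// mulr0 expR0.
have : 1 <= expR (lam * `|v| `^ p) by rewrite -expR0 ler_expR mulr_ge0 ?powR_ge0// ltW.
move: (expR _) => X X1 h; apply: le_trans h _.
have -> : 2 * C * (`|v| * X) = C * `|v| * (2 * X) by ring.
by apply: ler_wpM2l; [rewrite mulr_ge0// ltW|lra].
Qed.

Lemma nonlin_le v : `|f v| <= 2 * C * (1 + gauge p (lam + 1) v).
Proof.
apply: le_trans (nonlin_le0 v) _; rewrite ler_wpM2l ?mulr_ge0 ?(ltW C0)//.
rewrite !gaugeE addrC subrK mulrDl expRD mul1r mulrC ler_wpM2l ?expR_ge0//.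
exact: le_trans (norm_le_pow v) (expR_ge1Dx _).
Qed.

(** Unlike [nonlin_le], no constant term: f(0) = 0 leaves a factor |v|, and its p-th power is at
    most e^(|v|^p) - 1. Hence f(u) has an integrable p-th power on a space of infinite measure. *)
Lemma nonlin_pow_le v : `|f v| `^ p <= (2 * C) `^ p * gauge p (1 + p * lam) v.
Proof.
have c0 : 0 <= 2 * C by rewrite mulr_ge0// ltW.
have X0 : 0 <= `|v| * expR (lam * `|v| `^ p) by rewrite mulr_ge0.
apply: (@le_trans _ _ ((2 * C * (`|v| * expR (lam * `|v| `^ p))) `^ p)).
  apply: ge0_ler_powR; rewrite ?nnegrE; [exact: ltW|exact: normr_ge0|exact: mulr_ge0|exact: nonlin_le0].
rewrite powRM// ler_wpM2l ?powR_ge0// powRM//.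
have -> : expR (lam * `|v| `^ p) `^ p = expR (p * lam * `|v| `^ p).
  by rewrite /powR gt_eqF ?expR_gt0// expRK mulrA.
rewrite !gaugeE mulrDl expRD mul1r.
have h := expR_ge1Dx (`|v| `^ p).
have X1 : 1 <= expR (p * lam * `|v| `^ p).
  by rewrite -expR0 ler_expR !mulr_ge0 ?powR_ge0// ltW.
by move: (expR _) (expR _) X1 h => X Y Y1 h; nra.
Qed.

(* |u|, |v| <= max(2|U|, 2) whenever they are within distance 1 of U *)
Lemma nonlin_local_lip U z w : `|z| <= 1 -> `|w| <= 1 ->
  let a := (lam + 1) * 2 `^ p in
  `|f (U + z) - f (U + w)| <= 2 * C * expR a * (`|z - w| * (1 + gauge p a U)) /\
  `|f (U + z)| <= 2 * C * expR a * (1 + gauge p a U).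
Proof.
move=> z1 w1 a.
have tp : 0 <= 2 `^ p :> R by exact: powR_ge0.
have a0 : 0 <= a by rewrite mulr_ge0// addr_ge0// ltW.
have key y : `|y| <= 1 -> expR ((lam + 1) * `|U + y| `^ p) <= expR a * (1 + gauge p a U).
  move=> y1; rewrite !gaugeE [1 + _]addrC subrK -expRD ler_expR -[in X in _ <= X + _](mulr1 a) -mulrDr /a -mulrA.
  rewrite ler_wpM2l ?addr_ge0 ?(ltW lam0)//.
  have [U1|/ltW U1] := leP `|U| 1.
    apply: (@le_trans _ _ (2 `^ p)); last by rewrite ler_peMr// lerDl powR_ge0.
    apply: ge0_ler_powR; rewrite ?nnegrE ?(ltW p0)//.
    by apply: le_trans (ler_normD _ _) _; lra.
  apply: (@le_trans _ _ (2 `^ p * `|U| `^ p)); last by rewrite ler_wpM2l// lerDr.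
  rewrite -powRM//; apply: ge0_ler_powR; rewrite ?nnegrE ?(ltW p0) ?mulr_ge0//.
  by apply: le_trans (ler_normD _ _) _; lra.
have key' y : `|y| <= 1 -> expR (lam * `|U + y| `^ p) <= expR a * (1 + gauge p a U).
  move=> y1; apply: le_trans (key y y1).
  by rewrite ler_expR ler_wpM2r ?powR_ge0// lerDl.
split.
  apply: le_trans (flip _ _) _.
  have -> : U + z - (U + w) = z - w by ring.
  have -> : 2 * C * expR a * (`|z - w| * (1 + gauge p a U)) =
    C * `|z - w| * (expR a * (1 + gauge p a U) + expR a * (1 + gauge p a U)) by ring.
  by rewrite ler_wpM2l ?mulr_ge0 ?(ltW C0)// lerD ?key'.
apply: le_trans (nonlin_le _) _; rewrite -[leRHS]mulrA.
rewrite ler_wpM2l ?mulr_ge0 ?(ltW C0)//.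
have -> : 1 + gauge p (lam + 1) (U + z) = expR ((lam + 1) * `|U + z| `^ p) by rewrite !gaugeE; ring.
exact: key.
Qed.

Lemma nonlin_continuous : continuous f.
Proof.
move=> u; apply/cvgrPdist_le => e e0.
pose B := expR (lam * `|u| `^ p) + expR (lam * (`|u| + 1) `^ p).
have B0 : 0 < B by rewrite addr_gt0 ?expR_gt0.
have nb r : 0 < r -> \forall v \near u, `|v - u| <= r.
  by move=> r0; have := nbhsx_ballx u r r0; apply: filterS => w; rewrite /ball/= distrC => /ltW.
near=> v; rewrite distrC; apply: le_trans (flip v u) _.
have v1 : `|v - u| <= 1 by near: v; exact: nb.
have vB : expR (lam * `|v| `^ p) <= expR (lam * (`|u| + 1) `^ p).
  rewrite ler_expR ler_wpM2l ?(ltW lam0)//; apply: ge0_ler_powR; rewrite ?nnegrE ?(ltW p0)//.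
  by rewrite -(subrK u v) addrC; apply: le_trans (ler_normD _ _) _; rewrite lerD2l.
apply: (@le_trans _ _ (C * `|v - u| * B)).
  by rewrite ler_wpM2l ?mulr_ge0 ?(ltW C0)// /B addrC lerD2l.
rewrite mulrAC -ler_pdivlMl ?mulr_gt0//; near: v; apply: nb.
by rewrite mulr_gt0// invr_gt0 mulr_gt0.
Unshelve. all: by end_near. Qed.

Lemma measurable_nonlin : measurable_fun setT f.
Proof. exact: continuous_measurable_fun nonlin_continuous. Qed.

End nonlinearity.
End exponential_gauge.

(** The interface between the linear and the nonlinear halves: existence and uniqueness are proved
    for an arbitrary family of kernels of this kind on a sigma-finite space. *)
Record regularizing {R : realType} {d} {T : measurableType d} (m : {sigma_finite_measure set T -> \bar R})
  (D : T -> R) (K : R -> T -> T -> R) (A : nat) (CK : R) : Prop := Regularizing {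
  reg_D0 : forall x, 0 < D x;
  reg_D1 : forall x, D x <= 1;
  reg_iD : m.-integrable setT (EFin \o D);
  reg_mK : measurable_fun setT (fun z : measurableTypeR R * (T * T) => K z.1 z.2.1 z.2.2);
  reg_K0 : forall t x y, 0 <= K t x y;
  reg_KC : forall t x y, K t x y = K t y x;
  reg_K1 : forall t x, (\int[m]_y (K t x y)%:E <= 1)%E;
  reg_Kneg : forall t x y, t <= 0 -> K t x y = 0;
  reg_A0 : (0 < A)%N;
  reg_C0 : 0 < CK;
  reg_le : forall t x y, 0 < t -> K t x y <= CK / t ^+ A * (D x * D y);
  reg_lip : forall delta, 0 < delta -> exists C : R, 0 <= C /\ forall s t x y,
    delta <= s -> delta <= t -> `|K s x y - K t x y| <= C * `|s - t| * (D x * D y);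
  reg_L1 : forall g, m.-integrable setT (EFin \o g) ->
    forall e, 0 < e -> exists2 delta, 0 < delta & forall t, 0 < t < delta ->
    (\int[m]_x (`|kapply m (K t) g x - g x|)%:E <= e%:E)%E }.

Section setT_integrals.
Context {R : realType} {d} {T : measurableType d} (m : {measure set T -> \bar R}).
Local Open Scope ereal_scope.
Implicit Types f g : T -> \bar R.

Lemma le_integralT f g : measurable_fun setT f -> measurable_fun setT g ->
  (forall x, 0 <= f x) -> (forall x, f x <= g x) -> \int[m]_x f x <= \int[m]_x g x.
Proof. by move=> mf mg f0 fg; apply: ge0_le_integral. Qed.

Lemma integralDT f g : measurable_fun setT f -> measurable_fun setT g ->
  (forall x, 0 <= f x) -> (forall x, 0 <= g x) ->
  \int[m]_x (f x + g x) = \int[m]_x f x + \int[m]_x g x.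
Proof. by move=> mf mg f0 g0; apply: ge0_integralD. Qed.

Lemma integralZT (c : R) f : measurable_fun setT f -> (forall x, 0 <= f x) -> (0 <= c)%R ->
  \int[m]_x (c%:E * f x) = c%:E * \int[m]_x f x.
Proof. by move=> mf f0 c0; apply: ge0_integralZl. Qed.

End setT_integrals.

(** If f is not integrable the right side is infinite, so measurability suffices; this spares many
    integrability proofs. *)
Lemma normr_Rintegral_le_measurable {R : realType} {d} {T : measurableType d}
    (m : {sigma_finite_measure set T -> \bar R}) (f : T -> R) : measurable_fun setT f ->
  ((`|\int[m]_x f x|%R)%:E <= \int[m]_x (`|f x|)%:E)%E.
Proof.
move=> mf; have [oo|] := eqVneq (\int[m]_x (`|f x|)%:E)%E +oo%E; first by rewrite oo leey.
rewrite -ltey => lf; apply: normr_Rintegral_le; exact/integrableR.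
Qed.

HB.lock Definition gauge_int {R : realType} {d} {T : measurableType d} (m : {sigma_finite_measure set T -> \bar R})
  (p a : R) (g : T -> R) : \bar R := (\int[m]_x (gauge p a (g x))%:E)%E.

Lemma gauge_intE {R : realType} {d} {T : measurableType d} (m : {sigma_finite_measure set T -> \bar R})
  (p a : R) (g : T -> R) : gauge_int m p a g = (\int[m]_x (gauge p a (g x))%:E)%E.
Proof. by rewrite gauge_int.unlock. Qed.

(** * Regularizing semigroups *)

Section regularizing_semigroup.
Context {R : realType} {d} {T : measurableType d} (m : {sigma_finite_measure set T -> \bar R}).
Local Notation mR := (measurableTypeR R).
Variables (D : T -> R) (K : R -> T -> T -> R) (A : nat) (CK : R).
Hypothesis reg : regularizing m D K A CK.
Variable p : R.
Hypothesis p1 : 1 < p.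
Implicit Types (g h : T -> R) (t a : R) (x y : T).

Let p0 : 0 < p. Proof. exact: lt_trans ltr01 p1. Qed.

Lemma regular_mK t : measurable_fun setT (fun z : T * T => K t z.1 z.2).
Proof.
have m' : measurable_fun setT (fun z : T * T => ((t, (z.1, z.2)) : mR * (T * T))) by mfun.
exact: (measurableT_comp (reg_mK reg) m').
Qed.

Lemma regular_mKx t x : measurable_fun setT (K t x).
Proof. exact: measurable_ker (regular_mK t). Qed.

Lemma regular_contraction t : contraction_kernel m (K t).
Proof. by split; [exact: regular_mK|exact: (reg_K0 reg t)|exact: (reg_KC reg t)|exact: (reg_K1 reg t)]. Qed.

Lemma gauge_lef a g x : 0 <= a -> (0 <= (gauge p a (g x))%:E)%E.
Proof. by move=> a0; rewrite lee_fin gauge_ge0. Qed.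

Lemma gauge_int_ge0 a g : 0 <= a -> (0 <= gauge_int m p a g)%E.
Proof. by move=> a0; rewrite gauge_intE; apply: integral_ge0 => x _; exact: gauge_lef. Qed.

Lemma gauge_intD a g h : 0 <= a -> measurable_fun setT g -> measurable_fun setT h ->
  (gauge_int m p a (fun x => (g x + h x)%R) <= gauge_int m p (a * 2 `^ p)%R g + gauge_int m p (a * 2 `^ p)%R h)%E.
Proof.
move=> a0 mg mh; have a2 : 0 <= a * 2 `^ p by rewrite mulr_ge0// powR_ge0.
have mG b g' : measurable_fun setT g' -> measurable_fun setT (fun x => (gauge p b (g' x))%:E).
  by move=> mg'; apply/measurable_EFinP; exact: measurable_gauge.
have mgh : measurable_fun setT (fun x => g x + h x) by exact: measurable_funD.
rewrite !gauge_intE -integralDT; first apply: le_integralT.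
- exact: (mG _ (fun x => g x + h x)).
- by apply: emeasurable_funD; exact: mG.
- by move=> x; exact: (gauge_lef (fun x => g x + h x)).
- by move=> x; rewrite -EFinD lee_fin; exact: gaugeD.
- exact: mG.
- exact: mG.
- by move=> x; exact: gauge_lef.
- by move=> x; exact: gauge_lef.
Qed.

Lemma gauge_intB a g h : 0 <= a -> measurable_fun setT g -> measurable_fun setT h ->
  (gauge_int m p a (fun x => (g x - h x)%R) <= gauge_int m p (a * 2 `^ p)%R g + gauge_int m p (a * 2 `^ p)%R h)%E.
Proof.
move=> a0 mg mh; have mn : measurable_fun setT (fun x => - h x) by exact: measurableT_comp.
have E : gauge_int m p (a * 2 `^ p) (fun x => (- h x)%R) = gauge_int m p (a * 2 `^ p) h.
  by rewrite !gauge_intE; under eq_integral do rewrite gaugeN.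
by have := gauge_intD a0 mg mn; rewrite E.
Qed.

Lemma kapply_norm_le t g x : measurable_fun setT g ->
  ((`|kapply m (K t) g x|)%:E <= \int[m]_y (K t x y * `|g y|)%:E)%E.
Proof.
move=> mg; have mKx := regular_mKx t x.
have mf : measurable_fun setT (fun y => K t x y * g y) by mfun.
apply: le_trans (normr_Rintegral_le_measurable m mf) _.
by under eq_integral do rewrite normrM (ger0_norm (reg_K0 reg _ _ _)).
Qed.

Lemma measurable_semigroup t g : measurable_fun setT g -> measurable_fun setT (kapply m (K t) g).
Proof. by move=> mg; exact: (measurable_kapply m (regular_mK t) mg). Qed.

Lemma gauge_int_semigroup a t g : 0 <= a -> measurable_fun setT g ->
  (gauge_int m p a (kapply m (K t) g) <= gauge_int m p a g)%E.
Proof.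
move=> a0 mg.
have mG : measurable_fun setT (fun x => (gauge p a (g x))%:E).
  by apply/measurable_EFinP; exact: measurable_gauge.
have mS := measurable_semigroup t mg; have mKt := regular_mK t; rewrite !gauge_intE.
apply: le_trans (contraction_kernel_L1 (regular_contraction t) mG _); last first.
  by move=> x; exact: gauge_lef.
apply: le_integralT.
- by apply/measurable_EFinP; exact: measurable_gauge.
- apply: (measurable_fun_fubini_tonelli_F (fun z : T * T => (K t z.1 z.2)%:E * (gauge p a (g z.2))%:E)%E).
    apply: emeasurable_funM; first by mfun.
    by apply: (measurableT_comp mG); mfun.
  by move=> z; apply: mule_ge0; [rewrite lee_fin; exact: (reg_K0 reg)|exact: gauge_lef].
- by move=> x; exact: gauge_lef.
- move=> x; under eq_integral do rewrite -EFinM.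
  apply: jensen_gauge.
  + exact: p1.
  + exact: (reg_K0 reg t x).
  + exact: regular_mKx.
  + exact: mg.
  + exact: (reg_K1 reg t x).
  + exact: a0.
  + exact: kapply_norm_le.
Qed.

Lemma regular_mD : measurable_fun setT D.
Proof. by have /integrableP[/measurable_EFinP] := reg_iD reg. Qed.

Lemma regular_D_ge0 x : 0 <= D x. Proof. exact/ltW/(reg_D0 reg). Qed.

Lemma integrable_weight g : measurable_fun setT g -> (gauge_int m p 1 g < +oo)%E ->
  m.-integrable setT (EFin \o (fun y => D y * g y)).
Proof.
rewrite gauge_intE => mg lg; have mD := regular_mD.
have iG : m.-integrable setT (EFin \o (fun x => gauge p 1 (g x))).
  apply/integrableR; split; first exact: measurable_gauge.
  by under eq_integral do rewrite ger0_norm ?gauge_ge0//.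
apply: (@integrable_le _ _ _ m _ (fun y => D y + gauge p 1 (g y))).
- by mfun.
- move=> y; rewrite normrM (ger0_norm (regular_D_ge0 y)).
  have := norm_le_pow p1 (g y); have := pow_le_gauge p (g y); have := normr_ge0 (g y).
  have := regular_D_ge0 y; have := reg_D1 reg y; have := gauge_ge0 p (g y) ler01.
  by move: (gauge _ _ _) (D y) (`|g y|) => G e z; nra.
- rewrite (_ : _ \o _ = (fun x => (D x)%:E + (gauge p 1 (g x))%:E)%E).
    exact: (integrableD measurableT (reg_iD reg) iG).
  by apply/funext => x /=; rewrite EFinD.
Qed.

Lemma integrable_semigroup t g x : m.-integrable setT (EFin \o (fun y => D y * g y)) ->
  measurable_fun setT g -> m.-integrable setT (EFin \o (fun y => K t x y * g y)).
Proof.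
move=> iW mg; have mKx := regular_mKx t x; have [t0|t0] := ltP 0 t; last first.
  rewrite (_ : _ \o _ = cst 0%E); first exact: integrable0.
  by apply/funext => y /=; rewrite (reg_Kneg reg)// mul0r.
apply: (@integrable_le _ _ _ m _ (fun y => CK / t ^+ A * D x * `|D y * g y|)).
- by mfun.
- move=> y; rewrite !normrM (ger0_norm (reg_K0 reg _ _ _)) (ger0_norm (regular_D_ge0 y)) mulrA.
  by rewrite ler_wpM2r// -mulrA; exact: (reg_le reg x y t0).
- have ia := integrable_norm iW.
  rewrite (_ : _ \o _ = (fun y => (CK / t ^+ A * D x)%:E * (`|D y * g y|)%:E)%E); last first.
    by apply/funext => y /=; rewrite EFinM.
  by apply: integrableZl.
Qed.

Lemma semigroupB t g h x :
  m.-integrable setT (EFin \o (fun y => D y * g y)) -> measurable_fun setT g ->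
  m.-integrable setT (EFin \o (fun y => D y * h y)) -> measurable_fun setT h ->
  kapply m (K t) (fun y => g y - h y) x = kapply m (K t) g x - kapply m (K t) h x.
Proof.
move=> ig mg ih mh; rewrite /kapply -RintegralB//; try exact: integrable_semigroup.
by apply: eq_Rintegral => y _; rewrite mulrBr.
Qed.

(* G <= M + G^q / M^(q-1) with q = 2A and M = t^(-1/2) trades the singularity
   t^(-A) of the kernel for the integrable t^(-1/2). *)
Lemma smoothing t x (G : T -> R) (B : R) : 0 < t <= 1 -> measurable_fun setT G -> (forall y, 0 <= G y) ->
  (\int[m]_y (G y ^+ (2 * A))%:E <= B%:E)%E ->
  (\int[m]_y (K t x y * G y)%:E <= ((1 + CK * B) / Num.sqrt t)%:E)%E.
Proof.
move=> /andP[t0 t1] mG G0 GB; have mKx := regular_mKx t x.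
have s0 : 0 < Num.sqrt t by rewrite sqrtr_gt0.
set s := Num.sqrt t in s0 *; have ts : t = s ^+ 2 by rewrite sqr_sqrtr// ltW.
have C0 := reg_C0 reg; have K0 y := reg_K0 reg t x y.
have pw y : K t x y * G y <= s^-1 * K t x y + CK / s * G y ^+ (2 * A).
  have DD : D x * D y <= 1.
    by apply: mulr_ile1; rewrite ?(reg_D1 reg) ?regular_D_ge0.
  have kl : K t x y <= CK / s ^+ (2 * A).
    apply: le_trans (reg_le reg x y t0) _; rewrite ts -exprM ler_piMr//.
    by rewrite divr_ge0 ?exprn_ge0// ltW.
  have [Gs|/ltW Gs] := leP (G y) s^-1.
    rewrite -[leLHS]addr0 lerD//; first by rewrite mulrC ler_wpM2r.
    by rewrite mulr_ge0 ?exprn_ge0// divr_ge0// ltW.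
  rewrite -[leLHS]add0r lerD//; first by rewrite mulr_ge0// invr_ge0 ltW.
  apply: le_trans (ler_wpM2r (G0 y) kl) _.
  have := reg_A0 reg; case: (A) => // A' _.
  have -> : CK / s ^+ (2 * A'.+1) * G y = CK / s * (G y / s ^+ (2 * A').+1).
    by rewrite mulnS -addn1 addSn addn1 [s ^+ (2 * A').+2]exprS; field; rewrite expf_neq0 ?gt_eqF.
  apply: ler_wpM2l; first by rewrite divr_ge0// ltW.
  rewrite ler_pdivrMr ?exprn_gt0//.
  have Gs1 : 1 <= G y * s by rewrite -ler_pdivrMr// mul1r.
  have -> : G y ^+ (2 * A'.+1) * s ^+ (2 * A').+1 = G y * (G y * s) ^+ (2 * A').+1.
    by rewrite exprMn mulrA -exprS mulnS add2n.
  by rewrite ler_peMr// exprn_ege1.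
have mx : measurable_fun setT (fun y => G y ^+ (2 * A)) by exact: measurable_funX.
have mq : measurable_fun setT (fun y => (G y ^+ (2 * A))%:E).
  by apply/measurable_EFinP; exact: measurable_funX.
have G0' y : (0 <= (G y ^+ (2 * A))%:E)%E by rewrite lee_fin exprn_ge0.
have i0 : 0 <= s^-1 by rewrite invr_ge0 ltW.
have i1 : 0 <= CK / s by rewrite divr_ge0// ltW.
apply: (@le_trans _ _ (\int[m]_y ((s^-1)%:E * (K t x y)%:E + (CK / s)%:E * (G y ^+ (2 * A))%:E))%E).
  apply: ge0_le_integral => //.
  - by move=> y _; rewrite lee_fin mulr_ge0.
  - by mfun.
  - by apply: emeasurable_funD; mfun.
  - by move=> y _; rewrite -!EFinM -EFinD lee_fin.
rewrite ge0_integralD//; last 4 first.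
- by move=> y _; rewrite -EFinM lee_fin mulr_ge0.
- by mfun.
- by move=> y _; rewrite mule_ge0.
- by mfun.
have mk : measurable_fun setT (fun y => (K t x y)%:E) by mfun.
have -> : (\int[m]_y ((s^-1)%:E * (K t x y)%:E) = (s^-1)%:E * \int[m]_y (K t x y)%:E)%E.
  by apply: integralZT => // y; rewrite lee_fin.
have -> : (\int[m]_y ((CK / s)%:E * (G y ^+ (2 * A))%:E) =
    (CK / s)%:E * \int[m]_y (G y ^+ (2 * A))%:E)%E by exact: integralZT.
rewrite mulrDl mul1r EFinD; apply: leeD.
  by rewrite -[leRHS]mule1 lee_wpmul2l// (reg_K1 reg).
apply: (@le_trans _ _ ((CK / s)%:E * B%:E)%E); first by rewrite lee_wpmul2l.
by rewrite -EFinM mulrAC.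
Qed.

(** By [gaugeX] the power 2A required by [smoothing] only multiplies the parameter by 2A. The
    constant function contributes at most 1 <= t^(-1/2), which raises the 1 to 2. *)
Lemma smoothing_gauge t x a g (B : R) : 0 < t <= 1 -> measurable_fun setT g -> 0 <= a ->
  (gauge_int m p ((2 * A)%:R * a)%R g <= B%:E)%E ->
  (\int[m]_y (K t x y * (1 + gauge p a (g y)))%:E <= ((2 + CK * B) / Num.sqrt t)%:E)%E.
Proof.
move=> t01 mg a0 gB; have /andP[t0 t1] := t01.
have mKx := regular_mKx t x; have mG := measurable_gauge p a mg.
have A2 : (0 < 2 * A)%N by rewrite muln_gt0 (reg_A0 reg).
have qa0 : 0 <= (2 * A)%:R * a by rewrite mulr_ge0.
under eq_integral do rewrite mulrDr mulr1 EFinD.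
rewrite integralDT; last 4 first.
- by mfun.
- by apply/measurable_EFinP; exact: measurable_funM.
- by move=> y; rewrite lee_fin (reg_K0 reg).
- by move=> y; rewrite lee_fin; apply: mulr_ge0; [exact: (reg_K0 reg)|exact: gauge_ge0].
have -> : (2 + CK * B) / Num.sqrt t = (Num.sqrt t)^-1 + (1 + CK * B) / Num.sqrt t by ring.
rewrite EFinD; apply: leeD.
  apply: le_trans (reg_K1 reg t x) _; rewrite lee_fin -[leLHS]invr1 lef_pV2 ?posrE ?sqrtr_gt0//.
  by rewrite -sqrtr1 ler_sqrt.
apply: smoothing; [exact: t01|exact: mG|by move=> y; exact: gauge_ge0|].
apply: le_trans gB; rewrite gauge_intE; apply: le_integralT.
- by apply/measurable_EFinP; exact: measurable_funX.
- by apply/measurable_EFinP; exact: measurable_gauge.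
- by move=> y; rewrite lee_fin; apply: exprn_ge0; exact: gauge_ge0.
- by move=> y; rewrite lee_fin; exact: gaugeX.
Qed.

End regularizing_semigroup.

(** * Strong continuity in exponential integrals *)

Section strong_continuity.
Context {R : realType} {d} {T : measurableType d} (m : {sigma_finite_measure set T -> \bar R}).
Variables (D : T -> R) (K : R -> T -> T -> R) (A : nat) (CK : R).
Hypothesis reg : regularizing m D K A CK.
Variable p : R.
Hypothesis p1 : 1 < p.
Implicit Types (g h : T -> R) (t a : R) (x y : T).

(** The kernel is 0 at time 0 by convention, so the identity has to be put in by hand. *)
Definition heat t g x : R := if t == 0 then g x else kapply m (K t) g x.

Lemma measurable_heat t g : measurable_fun setT g -> measurable_fun setT (heat t g).
Proof.
by move=> mg; rewrite /heat; case: eqP => // _; exact: (measurable_semigroup reg).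
Qed.

Lemma gauge_int_heat a t g : 0 <= a -> measurable_fun setT g ->
  (gauge_int m p a (heat t g) <= gauge_int m p a g)%E.
Proof. by move=> a0 mg; rewrite /heat; case: eqP => // _; exact: (gauge_int_semigroup reg). Qed.

Lemma heatB t g h x :
  m.-integrable setT (EFin \o (fun y => D y * g y)) -> measurable_fun setT g ->
  m.-integrable setT (EFin \o (fun y => D y * h y)) -> measurable_fun setT h ->
  heat t (fun y => g y - h y) x = heat t g x - heat t h x.
Proof. by move=> *; rewrite /heat; case: eqP => // _; exact: (semigroupB reg). Qed.

Lemma heat_bounded t g M x : 0 <= M -> measurable_fun setT g -> (forall y, `|g y| <= M) ->
  `|heat t g x| <= M.
Proof.
move=> M0 mg gM; rewrite /heat; case: eqP => // _.
rewrite -lee_fin; apply: le_trans (kapply_norm_le reg t x mg) _.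
have mKx := regular_mKx reg t x; have K0 := reg_K0 reg t x.
apply: (@le_trans _ _ (\int[m]_y (M%:E * (K t x y)%:E))%E).
  apply: le_integralT; [by mfun|by mfun|by move=> y; rewrite lee_fin mulr_ge0|].
  by move=> y; rewrite -EFinM lee_fin mulrC ler_wpM2r.
rewrite integralZT; [|by mfun|by move=> y; rewrite lee_fin|exact: M0].
by rewrite -[leRHS]mule1 lee_wpmul2l// (reg_K1 reg).
Qed.

Lemma integrable_weight_L1 g : m.-integrable setT (EFin \o g) ->
  m.-integrable setT (EFin \o (fun y => D y * g y)).
Proof.
move=> ig; have [mg _] := (integrableR m g).1 ig; have mD := regular_mD reg.
apply: (integrable_le (g := fun y => `|g y|)); [by mfun| |exact: integrable_norm ig].
move=> y; rewrite normrM (ger0_norm (regular_D_ge0 reg y)) ler_piMl//.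
exact: reg_D1 reg y.
Qed.

Lemma semigroup_lip delta : 0 < delta -> exists C, 0 <= C /\ forall h N,
  m.-integrable setT (EFin \o (fun y => D y * h y)) -> measurable_fun setT h ->
  (\int[m]_y (`|D y * h y|)%:E <= N%:E)%E ->
  forall s t x, delta <= s -> delta <= t ->
  `|kapply m (K s) h x - kapply m (K t) h x| <= C * `|s - t| * N * D x.
Proof.
move=> D0; have [C [C0 hC]] := reg_lip reg D0; exists C; split => // h N ih mh hN s t x sd td.
have is' := integrable_semigroup reg s x ih mh; have it := integrable_semigroup reg t x ih mh.
rewrite /kapply -RintegralB// -lee_fin.
have mKs := regular_mKx reg s x; have mKt := regular_mKx reg t x; have mD := regular_mD reg.
have mf : measurable_fun setT (fun y => K s x y * h y - K t x y * h y) by mfun.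
apply: le_trans (normr_Rintegral_le_measurable m mf) _.
have c0 : 0 <= C * `|s - t| * D x by rewrite !mulr_ge0// (regular_D_ge0 reg).
apply: (@le_trans _ _ (\int[m]_y ((C * `|s - t| * D x)%:E * (`|D y * h y|)%:E))%E).
  apply: le_integralT; [|by mfun|by move=> y; rewrite lee_fin|].
    by apply/measurable_EFinP; apply: (measurableT_comp (@normr_measurable _ setT)); exact: mf.
  move=> y; rewrite -EFinM lee_fin -mulrBl !normrM (ger0_norm (regular_D_ge0 reg y)) mulrA.
  by rewrite ler_wpM2r// -[leRHS]mulrA; exact: hC.
rewrite integralZT//; last by mfun.
apply: le_trans (lee_wpmul2l _ hN) _; first by rewrite lee_fin.
by rewrite -EFinM lee_fin mulrAC.
Qed.

(** At t = 0 this is [reg_L1]. At t > 0 the kernel is Lipschitz in time from t/2 on, which treats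
    both sides of t at once, and the integrable weight bounds the L^1 norm. *)
Lemma heat_L1_continuous h t e : m.-integrable setT (EFin \o h) -> 0 <= t -> 0 < e ->
  exists2 delta, 0 < delta & forall s, 0 <= s -> `|s - t| < delta ->
    (\int[m]_x (`|heat s h x - heat t h x|)%:E <= e%:E)%E.
Proof.
move=> ih t0 e0; have [mh _] := (integrableR m h).1 ih.
have zero x : `|heat t h x - heat t h x| = 0 by rewrite subrr normr0.
have [tE|tn0] := eqVneq t 0.
  have [delta d0 hd] := reg_L1 reg ih e0; exists delta => // s s0 sd.
  have [->|sn0] := eqVneq s t; first by under eq_integral do rewrite zero; rewrite integral0 lee_fin ltW.
  rewrite /heat tE eqxx -[X in s == X]tE (negbTE sn0); apply: hd.
  by rewrite lt_neqAle eq_sym -[X in _ != X]tE sn0 s0/=; move: sd; rewrite tE subr0 ger0_norm.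
have tp : 0 < t by rewrite lt_neqAle eq_sym tn0.
have t2 : 0 < t / 2 by rewrite divr_gt0.
have iW := integrable_weight_L1 ih; have [mW lW] := (integrableR _ _).1 iW.
set N := fine (\int[m]_y (`|D y * h y|)%:E)%E.
have NE : (\int[m]_y (`|D y * h y|)%:E = N%:E)%E.
  by rewrite /N fineK// ge0_fin_numE//; apply: integral_ge0.
have N0 : 0 <= N by rewrite fine_ge0//; apply: integral_ge0.
have [_ lD] := (integrableR _ _).1 (reg_iD reg).
set c := fine (\int[m]_y (`|D y|)%:E)%E.
have cE : (\int[m]_y (`|D y|)%:E = c%:E)%E.
  by rewrite /c fineK// ge0_fin_numE//; apply: integral_ge0.
have c0 : 0 <= c by rewrite fine_ge0//; apply: integral_ge0.
have [C [C0 hC]] := semigroup_lip t2.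
have B0 : 0 < C * N * c + 1 by rewrite ltr_wpDl// !mulr_ge0.
exists (Num.min (t / 2) (e / (C * N * c + 1))); first by rewrite lt_min t2 divr_gt0.
move=> s s0; rewrite lt_min => /andP[st se].
have ts : t / 2 <= s by move: st; rewrite ltr_norml => /andP[]; lra.
have tt : t / 2 <= t by lra.
have sn0 : s != 0 by rewrite gt_eqF// (lt_le_trans t2).
have mD := regular_mD reg.
have msg := measurable_semigroup reg s mh; have mtg := measurable_semigroup reg t mh.
apply: (@le_trans _ _ (\int[m]_x ((C * `|s - t| * N)%:E * (`|D x|)%:E))%E).
  have lN : (\int[m]_y (`|D y * h y|)%:E <= N%:E)%E by rewrite NE.
  rewrite /heat (negbTE sn0) (negbTE tn0); apply: le_integralT.
  - by apply/measurable_EFinP; apply: (measurableT_comp (@normr_measurable _ setT)); exact: measurable_funB.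
  - by mfun.
  - by move=> x; rewrite lee_fin.
  - move=> x; rewrite -EFinM lee_fin (ger0_norm (regular_D_ge0 reg x)).
    exact: (hC h N iW mh lN s t x ts tt).
rewrite integralZT//; [|by mfun|by rewrite !mulr_ge0].
rewrite cE -EFinM lee_fin.
move: se; rewrite ltr_pdivlMr// => /ltW; have := normr_ge0 (s - t).
move: `|s - t| => r r0; have -> : C * r * N * c = r * (C * N * c) by ring.
lra.
Qed.

(** Split g into a truncation h and a rest r. The rest has a small exponential integral, by
    domination at the larger parameter [a2], and the semigroup does not increase it. The truncation
    is bounded and integrable, so L^1 continuity suffices for it. *)
Lemma heat_gauge_int_continuous g a t e : measurable_fun setT g ->
  (forall b, 0 < b -> (gauge_int m p b g < +oo)%E) -> 0 < a -> 0 <= t -> 0 < e ->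
  exists2 delta, 0 < delta & forall s, 0 <= s -> `|s - t| < delta ->
    (gauge_int m p a (fun x => (heat s g x - heat t g x)%R) <= e%:E)%E.
Proof.
move=> mg lg a0 t0 e0; have p0 : 0 < p by exact: lt_trans p1.
have two_p : 0 < 2 `^ p :> R by exact: powR_gt0.
(* One factor 2^p for separating h from r, another for separating the two times in the part r. *)
pose a1 := a * 2 `^ p; pose a2 := a1 * 2 `^ p.
have a10 : 0 < a1 by exact: mulr_gt0.
have a20 : 0 < a2 by exact: mulr_gt0.
(* The upper cut makes h bounded; the lower one makes it integrable. *)
pose cut n x := (`|g x| <= n.+1%:R) && (n.+1%:R^-1 <= `|g x|).
pose h n x := if cut n x then g x else 0.
pose r n x := if cut n x then 0 else g x.
have mcut n : measurable_fun setT (cut n).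
  apply: measurable_and; apply: measurable_fun_ler => //;
    by apply: (measurableT_comp (@normr_measurable _ setT)).
have mh n : measurable_fun setT (h n) by exact: measurable_fun_ifT.
have mr n : measurable_fun setT (r n) by exact: measurable_fun_ifT.
have mG b f : measurable_fun setT f -> measurable_fun setT (fun x : T => (gauge p b (f x))%:E).
  by move=> mf; apply/measurable_EFinP; exact: measurable_gauge.
have c : (gauge_int m p a2 (r n) @[n --> \oo] --> 0)%E.
  under eq_fun do rewrite gauge_intE.
  apply: (@dct0 _ _ _ m _ (fun x => (gauge p a2 (g x))%:E)).
  - by move=> n; exact: mG.
  - by move=> n x; rewrite lee_fin gauge_ge0// ltW.
  - move=> n x; rewrite lee_fin /r; case: ifP => // _.
    by rewrite gauge0// gauge_ge0// ltW.
  - exact: mG.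
  - by have := lg _ a20; rewrite gauge_intE.
  - apply: nearW => x; have [gx0|gx0] := eqVneq (g x) 0.
      rewrite (_ : (fun n => _) = cst 0%E); first exact: cvg_cst.
      by apply/funext => n; rewrite /r gx0 if_same gauge0.
    have ng0 : 0 < `|g x| by rewrite normr_gt0.
    apply: cvg_near_cst; near=> n; rewrite /r.
    have -> : cut n x.
      apply/andP; split.
        near: n; have [N _ hN] := nbhs_infty_ger `|g x|.
        by exists N => // k /hN/= h'; apply: le_trans h' _; rewrite ler_nat.
      near: n; have := near_infty_natSinv_lt (PosNum ng0).
      by apply: filterS => k /ltW.
    by rewrite gauge0.
have r0 n : (0 <= gauge_int m p a2 (r n))%E by rewrite gauge_int_ge0// ltW.
have e4 : 0 < e / 4 by rewrite divr_gt0.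
have [n hn] := filter_ex ((cvge0P r0).2 c _ e4).
pose M : R := n.+1%:R; have M0 : 0 < M by rewrite ltr0n.
have hM x : `|h n x| <= M.
  by rewrite /h; case: ifP => [/andP[]//|_]; rewrite normr0 ltW.
have lt1 : (gauge_int m p 1 g < +oo)%E by exact: lg.
have ih : m.-integrable setT (EFin \o h n).
  apply: (integrable_le (g := fun x => M `^ (p - 1) * gauge p 1 (g x))) => //.
    move=> x; rewrite /h; case: ifP => [/andP[_ gx]|_]; last first.
      by rewrite normr0 mulr_ge0 ?powR_ge0// gauge_ge0.
    apply: le_trans (norm_le_pow_scale p1 M0 gx) _.
    by rewrite ler_wpM2l ?powR_ge0//; exact: pow_le_gauge.
  have ig : m.-integrable setT (EFin \o (fun x => gauge p 1 (g x))).
    apply/integrableR; split; first exact: measurable_gauge.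
    under eq_integral do rewrite ger0_norm ?gauge_ge0//.
    by rewrite gauge_intE in lt1.
  rewrite (_ : _ \o _ = (fun x => (M `^ (p - 1))%:E * (gauge p 1 (g x))%:E)%E); last first.
    by apply/funext => x /=; rewrite EFinM.
  by apply: integrableZl.
(* Converts the gauge of a difference bounded by 2M into its absolute value, through |z|^p. *)
pose Q := a1 * expR (a1 * (2 * M) `^ p) * (2 * M) `^ (p - 1).
have Q0 : 0 <= Q by rewrite !mulr_ge0 ?expR_ge0 ?powR_ge0// ltW.
have eQ : 0 < e / 2 / (Q + 1) by rewrite !divr_gt0// ltr_wpDl.
have [delta d0 hd] := heat_L1_continuous ih t0 eQ; exists delta => // s s0 sd.
have iWg := integrable_weight reg p1 mg lt1; have iWh := integrable_weight_L1 ih.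
have rE x : r n x = g x - h n x by rewrite /r /h; case: ifP => _; rewrite ?subrr ?subr0.
have split_ x : heat s g x - heat t g x =
    (heat s (h n) x - heat t (h n) x) + (heat s (r n) x - heat t (r n) x).
  have -> : r n = (fun y => g y - h n y) by apply/funext => y; exact: rE.
  by rewrite !heatB//; ring.
have mH f t' : measurable_fun setT f -> measurable_fun setT (heat t' f) by exact: measurable_heat.
have -> : (fun x => heat s g x - heat t g x) =
    (fun x => (heat s (h n) x - heat t (h n) x) + (heat s (r n) x - heat t (r n) x)).
  exact/funext.
have m1 : measurable_fun setT (fun x => heat s (h n) x - heat t (h n) x).
  by apply: measurable_funB; exact: mH.
have m2 : measurable_fun setT (fun x => heat s (r n) x - heat t (r n) x).
  by apply: measurable_funB; exact: mH.
apply: le_trans (gauge_intD m p1 (ltW a0) m1 m2) _.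
rewrite -[leRHS]/(e%:E) (splitr e) EFinD; apply: leeD; last first.
  apply: le_trans (gauge_intB m p1 (ltW a10) (mH _ s (mr n)) (mH _ t (mr n))) _.
  have -> : e / 2 = e / 4 + e / 4 by field.
  by rewrite EFinD; apply: leeD; apply: le_trans (gauge_int_heat _ (ltW a20) (mr n)) hn.
rewrite gauge_intE; apply: (@le_trans _ _ (\int[m]_x (Q%:E * (`|heat s (h n) x - heat t (h n) x|)%:E))%E).
  apply: le_integralT.
  - exact: mG.
  - apply: emeasurable_funM => //; apply/measurable_EFinP.
    exact: (measurableT_comp (@normr_measurable _ setT)).
  - by move=> x; rewrite lee_fin gauge_ge0// ltW.
  - move=> x; rewrite -EFinM lee_fin.
    have z2 : `|heat s (h n) x - heat t (h n) x| <= 2 * M.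
      apply: le_trans (ler_normB _ _) _; rewrite mulr_natl mulr2n.
      by rewrite lerD//; apply: heat_bounded => //; exact: ltW.
    apply: le_trans (gauge_le_pow p1 (ltW a10) z2) _; rewrite /Q -[leRHS]mulrA.
    apply: ler_wpM2l; first by rewrite mulr_ge0 ?expR_ge0// ltW.
    exact: pow_le_norm.
rewrite integralZT//; last first.
  by apply/measurable_EFinP; exact: (measurableT_comp (@normr_measurable _ setT)).
apply: le_trans (lee_wpmul2l _ (hd s s0 sd)) _; first by rewrite lee_fin.
rewrite -EFinM lee_fin mulrCA -[leRHS]mulr1 ler_wpM2l ?(ltW (divr_gt0 e0 _))//.
by rewrite ler_pdivrMr ?ltr_wpDl// mul1r lerDl.
Unshelve. all: by end_near. Qed.

End strong_continuity.

Lemma fatou_le {R : realType} {d} {T : measurableType d} (m : {measure set T -> \bar R})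
    (f_ : nat -> T -> R) (f : T -> R) (B : \bar R) :
  (forall n, measurable_fun setT (f_ n)) -> (forall n x, 0 <= f_ n x) ->
  (forall x, f_ n x @[n --> \oo] --> f x) ->
  (forall n, (\int[m]_x (f_ n x)%:E <= B)%E) -> (\int[m]_x (f x)%:E <= B)%E.
Proof.
move=> mf f0 fc fB.
have mE n : measurable_fun setT (EFin \o f_ n) by exact/measurable_EFinP.
have := @fatou _ _ _ m setT measurableT (fun n => EFin \o f_ n) mE (fun n x _ => f0 n x).
have -> : (\int[m]_x limn_einf (fun n => (EFin \o f_ n) x) = \int[m]_x (f x)%:E)%E.
  apply: eq_integral => x _.
  have c : (fun n => (EFin \o f_ n) x) @ \oo --> (f x)%:E.
    by apply: cvg_EFin; [exact: nearW|exact: fc].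
  by have [] := cvg_limn_einf_sup c.
move=> h; apply: le_trans h _; rewrite limn_einf_lim; apply: lime_le; first exact: is_cvg_einfs.
apply: nearW => n; apply: le_trans (fB n); apply: ereal_inf_lbound.
by exists n => //=.
Qed.

(** * The Duhamel operator *)

Section singular_integral.
Context {R : realType}.
Local Notation leb := (@lebesgue_measure R).
Local Notation mR := (measurableTypeR R).
Implicit Types (s t eta : R).

(** Worse than the singularity (t-s)^(-1/2) of the smoothing estimate but integrable; the margin 1/4
    is what a weight e^(-gamma (t-s)) turns into a small constant. *)
Definition singular t s : R := if (0 < s) && (s < t) then (t - s) `^ (- (3 / 4)) else 0.

Lemma singular_ge0 t s : 0 <= singular t s.
Proof. by rewrite /singular; case: ifP => // _; exact: powR_ge0. Qed.

Let is_derive_quarter b s : s < b ->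
  is_derive s 1 (fun s => - 4 * (b - s) `^ 4^-1) ((b - s) `^ (- (3 / 4))).
Proof.
move=> sb; have bs : b - s \in `]0, +oo[ by rewrite in_itv/= subr_gt0 sb.
have d1 : is_derive (b - s) 1 (fun y : R => y `^ 4^-1) (4^-1 * (b - s) `^ (4^-1 - 1)).
  by apply: DeriveDef; [exact: derivable_powR|rewrite -derive1E powR_derive1].
have d2 : is_derive s 1 (fun s => b - s) (0 - 1).
  by apply: is_deriveB.
have d3 := @is_derive1_comp _ (fun y : R => y `^ 4^-1) (fun s => b - s) s _ _ d1 d2.
have d4 := is_deriveZ (- 4) d3.
apply: is_derive_eq.
rewrite -[_ *: _]/(_ * _) sub0r (_ : 4^-1 - 1 = - (3 / 4)); last by field.
by field.
Qed.

Let integral_shifted t eta : 0 < t -> 0 < eta -> eta <= t ->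
  (\int[leb]_(s in `[0%R, t]) ((t + eta - s) `^ (- (3 / 4)))%:E <= (8 * t `^ 4^-1)%:E)%E.
Proof.
move=> t0 eta0 etat; pose b := t + eta.
pose F s : R := - 4 * (b - s) `^ 4^-1; pose f s : R := (b - s) `^ (- (3 / 4)).
have sb s : s <= t -> s < b by move=> st; rewrite /b; lra.
have dF s : s <= t -> is_derive s 1 F (f s) by move=> st; exact: is_derive_quarter (sb s st).
have cF s : s <= t -> {for s, continuous F}.
  move=> st; apply/differentiable_continuous/derivable1_diffP.
  by have [] := dF s st.
have cf s : s <= t -> {for s, continuous f}.
  move=> st; have bs : b - s \in `]0, +oo[ by rewrite in_itv/= subr_gt0 sb.
  apply: (@continuous_comp _ _ _ (fun s => b - s) (fun y : R => y `^ (- (3 / 4)))).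
    by apply: cvgB; [exact: cvg_cst|exact: cvg_id].
  apply/differentiable_continuous/derivable1_diffP; exact: derivable_powR.
rewrite (@continuous_FTC2 _ f F 0 t t0).
- have -> : ((F t)%:E - (F 0)%:E = (4 * b `^ 4^-1 - 4 * eta `^ 4^-1)%:E)%E.
    rewrite -EFinB /F subr0 (_ : b - t = eta); last by rewrite /b; ring.
    by congr EFin; ring.
  rewrite lee_fin; apply: (@le_trans _ _ (4 * b `^ 4^-1)).
    by rewrite gerBl mulr_ge0// powR_ge0.
  apply: (@le_trans _ _ (4 * (16 * t) `^ 4^-1)).
    rewrite ler_wpM2l//; apply: ge0_ler_powR; rewrite ?nnegrE//.
    + by rewrite /b addr_ge0// ltW.
    + by rewrite mulr_ge0// ltW.
    + by rewrite /b; lra.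
  rewrite powRM ?(ltW t0)// mulrA ler_wpM2r ?powR_ge0//.
  have -> : 16 = 2 ^+ 4 :> R by rewrite -natrX.
  by rewrite -powR_mulrn// -powRrM divff// powRr1//; lra.
- apply: continuous_in_subspaceT => s; rewrite inE/= in_itv/= => /andP[_ st].
  exact: cf.
- split.
  + by move=> s; rewrite in_itv/= => /andP[_ /ltW st]; have [] := dF s st.
  + by apply: cvg_at_right_filter; apply: cF; exact: ltW.
  + by apply: cvg_at_left_filter; exact: cF.
- move=> s; rewrite in_itv/= => /andP[_ /ltW st]; rewrite derive1E.
  by have [] := dF s st.
Qed.

Lemma measurable_singular t : measurable_fun setT (singular t : mR -> mR).
Proof.
apply: measurable_fun_ifT => //.
  apply: measurable_and; apply: measurable_fun_ltr => //.
apply: (measurableT_comp (@measurable_powR R (- (3 / 4)))).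
exact: measurable_funB.
Qed.

(** The singularity is shifted to t + t/(n+1), where the fundamental theorem of calculus applies on
    the closed interval, and Fatou's lemma removes the shift. The generous 8 = 4 * 2 comes from t +
    eta <= 16 t and 16^(1/4) = 2. *)
Lemma integral_singular_le t : 0 < t ->
  (\int[leb]_s (singular t s)%:E <= (8 * t `^ 4^-1)%:E)%E.
Proof.
move=> t0.
pose g n s : R := if (0 < s) && (s < t) then (t + t / n.+1%:R - s) `^ (- (3 / 4)) else 0.
have eta0 n : 0 < t / n.+1%:R by rewrite divr_gt0.
have mg n : measurable_fun setT (g n : mR -> mR).
  apply: measurable_fun_ifT => //.
    by apply: measurable_and; apply: measurable_fun_ltr.
  apply: (measurableT_comp (@measurable_powR R (- (3 / 4)))).
  exact: measurable_funB.
apply: (@fatou_le _ _ _ leb g).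
- exact: mg.
- by move=> n s; rewrite /g; case: ifP => // _; exact: powR_ge0.
- move=> s; rewrite /g /singular; case: ifPn => [/andP[s0 st]|_]; last exact: cvg_cst.
  have ts : t - s \in `]0, +oo[ by rewrite in_itv/= subr_gt0 st.
  apply: (cvg_comp (fun n : nat => t + t / n.+1%:R - s) (fun y : R => y `^ (- (3 / 4)))); last first.
    have cc : {for t - s, continuous (fun y : R => y `^ (- (3 / 4)))}.
      apply/differentiable_continuous/derivable1_diffP; exact: derivable_powR.
    exact: cc.
  have -> : t - s = t + 0 - s by rewrite addr0.
  apply: cvgB; last exact: cvg_cst.
  apply: cvgD; first exact: cvg_cst.
  by rewrite -(mulr0 t); apply: cvgMl_tmp; exact: cvg_harmonic.
- move=> n; apply: le_trans (integral_shifted t0 (eta0 n) _); last first.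
    by rewrite ler_pdivrMr// ler_peMr ?(ltW t0)// ler1n.
  rewrite [leRHS]integral_mkcond; apply: le_integralT.
  + by apply/measurable_EFinP; exact: mg.
  + apply/(measurable_restrictT _ _).1 => //; apply/measurable_EFinP.
    apply: measurable_funTS.
    apply: (measurableT_comp (@measurable_powR R (- (3 / 4)))).
    exact: measurable_funB.
  + by move=> s; rewrite lee_fin /g; case: ifP => // _; exact: powR_ge0.
  + move=> s; rewrite /g patchE; case: ifPn => [/andP[s0 st]|_].
      by rewrite mem_set//= in_itv/= !ltW.
    by case: ifPn => // _; rewrite lee_fin powR_ge0.
Qed.

Lemma singular_sqrt t s : 0 < s < t -> t <= 1 -> (Num.sqrt (t - s))^-1 <= singular t s.
Proof.
move=> /andP[s0 st] t1; rewrite /singular s0 st/=.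
have r0 : 0 < t - s by rewrite subr_gt0.
have r1 : t - s <= 1 by lra.
rewrite -(powR12_sqrt (ltW r0)) -powRN.
rewrite /powR gt_eqF//= ler_expR; have := ln_le0 r1; lra.
Qed.

(** Uses e^(-z) <= z^(-1/4) at z = gam (t - s), a consequence of ln z < z. *)
Lemma singular_weighted gam t s : 0 < gam -> 0 < s < t ->
  expR (- (gam * (t - s))) / Num.sqrt (t - s) <= gam `^ (- 4^-1) * singular t s.
Proof.
move=> g0 /andP[s0 st]; rewrite /singular s0 st/=.
have r0 : 0 < t - s by rewrite subr_gt0.
move: (t - s) r0 => r r0; have gr : 0 < gam * r by rewrite mulr_gt0.
have e1 : expR (- (gam * r)) <= (gam * r) `^ (- 4^-1).
  rewrite /powR gt_eqF//= ler_expR.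
  have h := ln_sublinear gr.
  have [l|/ltW l] := leP 0 (ln (gam * r)); lra.
apply: (@le_trans _ _ ((gam * r) `^ (- 4^-1) * r `^ (- 2^-1))).
  by rewrite -(powR12_sqrt (ltW r0)) -powRN ler_wpM2r ?powR_ge0//.
rewrite powRM ?(ltW g0) ?(ltW r0)// -mulrA ler_wpM2l ?powR_ge0//.
rewrite -powRD; last by rewrite (gt_eqF r0) implybT.
by rewrite (_ : - 4^-1 - 2^-1 = - (3 / 4) :> R)//; field.
Qed.

End singular_integral.

Section product_sigma_finite.
Context {R : realType} {d1 d2} {T1 : measurableType d1} {T2 : measurableType d2}.
Variables (m1 : {sigma_finite_measure set T1 -> \bar R}) (m2 : {sigma_finite_measure set T2 -> \bar R}).

Lemma product_measure1_sigma_finite : sigma_finite setT (m1 \x m2)%E.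
Proof.
have /sigma_finiteP[F [TF ndF Foo]] := sigma_finiteT m1.
have /sigma_finiteP[G [TG ndG Goo]] := sigma_finiteT m2.
exists (fun k => F k `*` G k).
  apply/esym; rewrite -subTset => -[x y] _.
  have [i _ Fi] : (\bigcup_k F k) x by rewrite -TF.
  have [j _ Gj] : (\bigcup_k G k) y by rewrite -TG.
  by exists (maxn i j) => //; split;
    [exact: (subsetPset _ _ (ndF _ _ (leq_maxl i j)))|exact: (subsetPset _ _ (ndG _ _ (leq_maxr i j)))].
move=> k; have [mF Fk] := Foo k; have [mG Gk] := Goo k; split; first exact: measurableX.
by rewrite product_measure1E// lte_mul_pinfty// ge0_fin_numE.
Qed.

Definition sigma_finite_product : {sigma_finite_measure set (T1 * T2)%type -> \bar R} :=
  HB.pack (m1 \x m2)%E (Measure_isSigmaFinite.Build _ _ _ (m1 \x m2)%E product_measure1_sigma_finite).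

End product_sigma_finite.

Section duhamel_operator.
Context {R : realType} {d} {T : measurableType d} (m : {sigma_finite_measure set T -> \bar R}).
Local Notation mR := (measurableTypeR R).
Local Notation leb := (@lebesgue_measure R).
Local Notation Z := (mR * T)%type.
Local Notation mZ := (sigma_finite_product (@lebesgue_measure R) m).
Variables (D : T -> R) (K : R -> T -> T -> R) (A : nat) (CK : R).
Hypothesis reg : regularizing m D K A CK.
Variable p : R.
Hypothesis p1 : 1 < p.
Implicit Types (r t s c : R) (x y : T) (z : Z) (G : Z -> R).

Definition window r t s : R := if (r < s) && (s < t) then 1 else 0.

Lemma measurable_window r t : measurable_fun setT (window r t : mR -> mR).
Proof. by apply: measurable_fun_ifT => //; apply: measurable_and; apply: measurable_fun_ltr. Qed.

Lemma window_ge0 r t s : 0 <= window r t s. Proof. by rewrite /window; case: ifP. Qed.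

Lemma integral_window r t : r <= t -> (\int[leb]_s (window r t s)%:E = (t - r)%:E)%E.
Proof.
move=> rt; have -> : (\int[leb]_s (window r t s)%:E = \int[leb]_s (\1_(`]r, t[ : set mR) s)%:E)%E.
  apply: eq_integral => s _; rewrite /window indicE; congr (_%:E).
  case: ifPn => h; first by rewrite mem_set//= in_itv.
  by rewrite memNset//= in_itv/= => h'; rewrite h' in h.
rewrite integral_indic//= setIT lebesgue_measure_itv/= lte_fin.
by move: rt; rewrite le_eqVlt => /predU1P[->|->]//; rewrite ltxx subrr.
Qed.

Definition wker r t x z : R := if r < z.1 then K (t - z.1) x z.2 else 0.

(** A single space-time integral: for 0 <= t - r <= 1 its kernel has mass at most 1, so Jensen
    applies to it directly. The parameter r discards the times up to r. *)
Definition duhamel r G t x : R := (\int[mZ]_z (wker r t x z * G z))%R.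

Lemma wker_ge0 r t x z : 0 <= wker r t x z.
Proof. by rewrite /wker; case: ifP => // _; exact: (reg_K0 reg). Qed.

Lemma wkerE r t x z : wker r t x z = window r t z.1 * K (t - z.1) x z.2.
Proof.
rewrite /wker /window; case: ifPn => /= _; last by rewrite mul0r.
case: ifPn; first by rewrite mul1r.
by rewrite -leNgt => tz; rewrite mul0r (reg_Kneg reg)// subr_le0.
Qed.

Lemma measurable_wker r :
  measurable_fun setT (fun q : (mR * T) * Z => wker r q.1.1 q.1.2 q.2).
Proof.
apply: measurable_fun_ifT.
- by apply: measurable_fun_ltr; mfun.
- have m' : measurable_fun setT (fun q : (mR * T) * Z =>
      ((q.1.1 - q.2.1, (q.1.2, q.2.2)) : mR * (T * T))).
    by apply: measurable_fun_pair; [apply: measurable_funB; mfun|mfun].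
  exact: (measurableT_comp (reg_mK reg) m').
- exact: measurable_cst.
Qed.

Lemma measurable_wker_tx r t x : measurable_fun setT (wker r t x).
Proof.
have m' : measurable_fun setT (fun z : Z => (((t, x) : mR * T), z)) by mfun.
exact: (measurableT_comp (measurable_wker r) m').
Qed.

Lemma measurable_wker_t r t : measurable_fun setT (fun q : T * Z => wker r t q.1 q.2).
Proof.
have m' : measurable_fun setT (fun q : T * Z => (((t, q.1) : mR * T), q.2)) by mfun.
exact: (measurableT_comp (measurable_wker r) m').
Qed.

Lemma measurable_duhamel r G : measurable_fun setT G ->
  measurable_fun setT (fun q : mR * T => duhamel r G q.1 q.2).
Proof.
move=> mG; rewrite /duhamel; apply: (measurable_Rintegral_param mZ
  (F := fun q : (mR * T) * Z => wker r q.1.1 q.1.2 q.2 * G q.2)).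
by apply: measurable_funM; [exact: measurable_wker|mfun].
Qed.

Lemma measurable_duhamel_t r G t : measurable_fun setT G -> measurable_fun setT (duhamel r G t).
Proof.
move=> mG; have m' : measurable_fun setT (fun x : T => ((t, x) : mR * T)) by mfun.
exact: (measurableT_comp (measurable_duhamel r mG) m').
Qed.

Lemma tonelliZ (H : Z -> R) : measurable_fun setT H -> (forall z, 0 <= H z) ->
  (\int[mZ]_z (H z)%:E = \int[leb]_s \int[m]_y (H (s, y))%:E)%E.
Proof.
move=> mH H0; apply: (@fubini_tonelli1 _ _ _ _ _ leb m (EFin \o H)).
  exact/measurable_EFinP.
by move=> z; rewrite /= lee_fin.
Qed.

Lemma wker_integral_le r t x G (psi : R -> R) : measurable_fun setT G ->
  (forall z, 0 <= G z) -> measurable_fun setT (psi : mR -> mR) -> (forall s, 0 <= psi s) ->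
  (forall s, r < s < t -> (\int[m]_y (K (t - s) x y * G (s, y))%:E <= (psi s)%:E)%E) ->
  (\int[mZ]_z (wker r t x z * G z)%:E <= \int[leb]_s (psi s)%:E)%E.
Proof.
move=> mG G0 mpsi psi0 h; have mw := measurable_wker_tx r t x.
have mH : measurable_fun setT (fun z => wker r t x z * G z) by mfun.
have H0 z : 0 <= wker r t x z * G z by rewrite mulr_ge0// wker_ge0.
rewrite (tonelliZ mH H0); apply: le_integralT.
- apply: (measurable_fun_fubini_tonelli_F (fun z : Z => (wker r t x z * G z)%:E)).
    exact/measurable_EFinP.
  by move=> z; rewrite lee_fin.
- exact/measurable_EFinP.
- by move=> s; apply: integral_ge0 => y _; rewrite lee_fin.
- move=> s; have [rst|nrst] := boolP ((r < s) && (s < t)).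
    by apply: le_trans (h s rst); under eq_integral do rewrite wkerE /window/= rst mul1r.
  under eq_integral do rewrite wkerE /window/= (negbTE nrst) !mul0r.
  by rewrite integral0 lee_fin.
Qed.

Lemma wker_mass r t x : 0 <= t - r <= 1 -> (\int[mZ]_z (wker r t x z)%:E <= 1)%E.
Proof.
move=> /andP[tr0 tr1].
have mc : measurable_fun setT (fun _ : Z => 1 : R) by exact: measurable_cst.
have := @wker_integral_le r t x (fun=> 1) (window r t) mc (fun=> ler01) (measurable_window r t)
  (window_ge0 r t).
under eq_integral do rewrite mulr1.
move=> h; apply: le_trans (h _) _.
  move=> s rst; under eq_integral do rewrite mulr1.
  by rewrite /window rst; exact: (reg_K1 reg).
by rewrite integral_window ?lee_fin// -subr_ge0.
Qed.

(** After Jensen on space-time, integrating first in x and using the symmetry of K leaves the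
    integral of |G|^p over the times between r and t. *)
Lemma duhamel_pow r t G (Q : R) : 0 <= t - r <= 1 -> measurable_fun setT G -> 0 <= Q ->
  (forall s, r < s < t -> (\int[m]_y (`|G (s, y)| `^ p)%R%:E <= Q%:E)%E) ->
  (\int[m]_x (`|duhamel r G t x| `^ p)%R%:E <= ((t - r) * Q)%:E)%E.
Proof.
move=> tr01 mG Q0 hQ; have /andP[tr0 tr1] := tr01.
have mP : measurable_fun setT (fun z => `|G z| `^ p) by exact: measurable_powp.
have mw := measurable_wker_t r t.
have mF : measurable_fun setT (fun q : T * Z => (wker r t q.1 q.2 * (`|G q.2| `^ p))%:E).
  by apply/measurable_EFinP; apply: measurable_funM => //; apply: (measurableT_comp mP); mfun.
have F0 (q : T * Z) : (0 <= (wker r t q.1 q.2 * (`|G q.2| `^ p))%:E)%E.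
  by rewrite lee_fin mulr_ge0 ?wker_ge0// powR_ge0.
apply: (@le_trans _ _ (\int[m]_x \int[mZ]_z (wker r t x z * (`|G z| `^ p))%R%:E)%E).
  apply: le_integralT.
  - apply/measurable_EFinP; apply: measurable_powp; exact: measurable_duhamel_t.
  - exact: (measurable_fun_fubini_tonelli_F _ mF).
  - by move=> x; rewrite lee_fin powR_ge0.
  - move=> x; have mwx := measurable_wker_tx r t x; apply: (jensen_pow p1) => //.
    + exact: wker_ge0.
    + exact: wker_mass.
    + have mf : measurable_fun setT (fun z => wker r t x z * G z) by mfun.
      apply: le_trans (normr_Rintegral_le_measurable mZ mf) _.
      rewrite le_eqVlt; apply/orP; left; apply/eqP; apply: eq_integral => z _.
      by rewrite normrM (ger0_norm (wker_ge0 _ _ _ _)).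
rewrite (fubini_tonelli (m1 := m) (m2 := mZ) _ mF F0).
have mW : measurable_fun setT (fun z : Z => window r t z.1 * (`|G z| `^ p)).
  apply: measurable_funM => //; apply: (measurableT_comp (measurable_window r t)); mfun.
have W0 z : 0 <= window r t z.1 * (`|G z| `^ p) by rewrite mulr_ge0 ?window_ge0// powR_ge0.
apply: (@le_trans _ _ (\int[mZ]_z (window r t z.1 * (`|G z| `^ p))%:E)%E).
  apply: le_integralT.
  - exact: (measurable_fun_fubini_tonelli_G _ mF).
  - exact/measurable_EFinP.
  - by move=> z; apply: integral_ge0 => x _; exact: (F0 (x, z)).
  - move=> z; rewrite /=; under eq_integral do rewrite wkerE -mulrAC EFinM.
    have mKz : measurable_fun setT (fun x => (K (t - z.1) x z.2)%:E).
      by have mK := regular_mK reg (t - z.1); mfun.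
    rewrite integralZT//; last by move=> x; rewrite lee_fin (reg_K0 reg).
    rewrite -[leRHS]mule1 lee_wpmul2l ?lee_fin//.
    by under eq_integral do rewrite (reg_KC reg); exact: (reg_K1 reg).
have rt : r <= t by rewrite -subr_ge0.
rewrite (tonelliZ mW W0) mulrC EFinM -(integral_window rt).
rewrite -integralZT//; last 2 first.
- by apply/measurable_EFinP; exact: measurable_window.
- by move=> s; rewrite lee_fin window_ge0.
apply: le_integralT.
- by apply: (measurable_fun_fubini_tonelli_F (fun z : Z => (window r t z.1 * (`|G z| `^ p))%:E));
    [exact/measurable_EFinP|move=> z; rewrite lee_fin].
- by apply: emeasurable_funM => //; apply/measurable_EFinP; exact: measurable_window.
- by move=> s; apply: integral_ge0 => y _; rewrite lee_fin; exact: (W0 (s, y)).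
- move=> s; rewrite /window/=; case: ifPn => rst.
    by under eq_integral do rewrite mul1r; rewrite mule1; exact: hQ.
  by under eq_integral do rewrite mul0r; rewrite integral0 mule0.
Qed.

End duhamel_operator.

(** * Existence and uniqueness of mild solutions *)

Section picard_iteration.
Context {R : realType} {d} {T : measurableType d} (m : {sigma_finite_measure set T -> \bar R}).
Local Notation mR := (measurableTypeR R).
Local Notation leb := (@lebesgue_measure R).
Local Notation Z := (mR * T)%type.
Local Notation mZ := (sigma_finite_product (@lebesgue_measure R) m).
Variables (D : T -> R) (K : R -> T -> T -> R) (A : nat) (CK : R).
Hypothesis reg : regularizing m D K A CK.
Variable p : R.
Hypothesis p1 : 1 < p.
Variables (f : R -> R) (C lam : R).
Hypotheses (f0 : f 0 = 0) (C0 : 0 < C) (lam0 : 0 < lam).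
Hypothesis flip : forall u v : R, `|f u - f v| <=
    C * `|u - v| * (expR (lam * (`|u| `^ p)) + expR (lam * (`|v| `^ p))).
Variable u0 : T -> R.
Hypothesis mu0 : measurable_fun setT u0.
Implicit Types (t s c : R) (x y : T) (z : Z) (G w : Z -> R).

Let p0 : 0 < p. Proof. exact: lt_trans ltr01 p1. Qed.
Let mf : measurable_fun setT f := measurable_nonlin p1 C0 lam0 flip.

(** The flow of the initial datum as a function on space-time; it vanishes for times <= 0, which
    Duhamel integrals from 0 do not see. *)
Definition free_flow z : R := kapply m (K z.1) u0 z.2.
Definition nlin w z : R := f (free_flow z + w z).

Lemma measurable_free : measurable_fun setT free_flow.
Proof.
rewrite /free_flow; apply: (measurable_Rintegral_param m (F := fun q : Z * T => K q.1.1 q.1.2 q.2 * u0 q.2)).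
apply: measurable_funM; last by mfun.
have m' : measurable_fun setT (fun q : Z * T => ((q.1.1, (q.1.2, q.2)) : mR * (T * T))) by mfun.
exact: (measurableT_comp (reg_mK reg) m').
Qed.

Lemma measurable_section (G : Z -> R) s : measurable_fun setT G ->
  measurable_fun setT (fun y : T => G (s, y)).
Proof.
move=> mG; have m' : measurable_fun setT (fun y : T => ((s, y) : Z)) by mfun.
exact: (measurableT_comp mG m').
Qed.

Lemma measurable_nlin w : measurable_fun setT w -> measurable_fun setT (nlin w).
Proof. by move=> mw; apply: (measurableT_comp mf); apply: measurable_funD => //; exact: measurable_free. Qed.

Let a := (lam + 1) * 2 `^ p.
Let a0 : 0 <= a. Proof. by rewrite mulr_ge0 ?powR_ge0// addr_ge0// ltW. Qed.
Let C1 := 2 * C * expR a.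
Let C10 : 0 <= C1. Proof. by rewrite !mulr_ge0 ?expR_ge0// ltW. Qed.

Variable B : R.
Hypothesis hB : (gauge_int m p ((2 * A)%:R * a) u0 <= B%:E)%E.

Let B0 : 0 <= B.
Proof. by rewrite -lee_fin; apply: le_trans hB; apply: gauge_int_ge0; rewrite mulr_ge0. Qed.

Let M := 2 + CK * B.
Let M0 : 0 <= M. Proof. by rewrite addr_ge0// mulr_ge0// ltW// (reg_C0 reg). Qed.

Lemma free_bound t x : 0 < t <= 1 ->
  (\int[mZ]_z (wker K 0 t x z * (1 + gauge p a (free_flow z)))%:E <= (M * (8 * t `^ 4^-1))%:E)%E.
Proof.
move=> /andP[t0 t1].
have mg : measurable_fun setT (fun z => 1 + gauge p a (free_flow z)).
  by apply: measurable_funD => //; apply: measurable_gauge; exact: measurable_free.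
have g0 z : 0 <= 1 + gauge p a (free_flow z) by rewrite addr_ge0// gauge_ge0.
have ms : measurable_fun setT (fun s => M * singular t s : mR).
  by apply: measurable_funM => //; exact: measurable_singular.
have s0 s : 0 <= M * singular t s by rewrite mulr_ge0// singular_ge0.
have h : (\int[mZ]_z (wker K 0 t x z * (1 + gauge p a (free_flow z)))%:E <=
    \int[leb]_s (M * singular t s)%:E)%E.
  refine (@wker_integral_le _ _ _ m D K A CK reg 0 t x (fun z => 1 + gauge p a (free_flow z)) (fun s => M * singular t s) mg g0 ms s0 _) => s /andP[s_gt0 st].
  apply: (@le_trans _ _ (M / Num.sqrt (t - s))%:E); last first.
    by rewrite lee_fin ler_wpM2l// singular_sqrt// s_gt0.
  refine (@smoothing_gauge _ _ _ m D K A CK reg p (t - s) x a (fun y => free_flow (s, y)) B _ _ _ _).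
  - by apply/andP; split; lra.
  - by apply: measurable_section; exact: measurable_free.
  - exact: a0.
  - by apply: le_trans hB; apply: (gauge_int_semigroup reg p1) => //; rewrite mulr_ge0.
apply: le_trans h _; under eq_integral do rewrite EFinM.
rewrite integralZT//; last 2 first.
- by apply/measurable_EFinP; exact: measurable_singular.
- by move=> s; rewrite lee_fin singular_ge0.
by rewrite EFinM lee_wpmul2l// integral_singular_le.
Qed.

Variable T0 : R.
Hypotheses (T00 : 0 < T0) (T01 : T0 <= 1).

Lemma wker_nonpos t x z : t <= 0 -> wker K 0 t x z = 0.
Proof.
move=> t0; rewrite (wkerE reg) /window; case: ifP => [/andP[h1 h2]|]; last by rewrite mul0r.
by have := lt_trans h1 h2; rewrite ltNge t0.
Qed.

Lemma free_bound_T0 t x : t <= T0 ->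
  (\int[mZ]_z (wker K 0 t x z * (1 + gauge p a (free_flow z)))%:E <= (M * (8 * T0 `^ 4^-1))%:E)%E.
Proof.
move=> tT; have [t0|t0] := leP t 0.
  under eq_integral do rewrite wker_nonpos// mul0r.
  by rewrite integral0 lee_fin !mulr_ge0// powR_ge0.
apply: le_trans (free_bound x _) _; first by rewrite t0 (le_trans tT).
rewrite lee_fin ler_wpM2l// ler_wpM2l//; apply: ge0_ler_powR; rewrite ?nnegrE// ltW//.
Qed.

Lemma duhamel_dominated G c t x : measurable_fun setT G -> 0 <= c -> t <= T0 ->
  (forall z, `|G z| <= c * (1 + gauge p a (free_flow z))) ->
  mZ.-integrable setT (EFin \o (fun z => wker K 0 t x z * G z)) /\
  `|duhamel m K 0 G t x| <= c * (M * (8 * T0 `^ 4^-1)).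
Proof.
move=> mG c0 tT hG; have mw := measurable_wker_tx reg 0 t x.
have mg : measurable_fun setT (fun z => wker K 0 t x z * (1 + gauge p a (free_flow z))).
  apply: measurable_funM => //.
  by apply: measurable_funD => //; apply: measurable_gauge; exact: measurable_free.
have mwG : measurable_fun setT (fun z => wker K 0 t x z * G z) by mfun.
have w0 z := wker_ge0 reg 0 t x z.
have g0 z : 0 <= wker K 0 t x z * (1 + gauge p a (free_flow z)).
  by rewrite mulr_ge0// addr_ge0// gauge_ge0.
have pw z : `|wker K 0 t x z * G z| <= c * (wker K 0 t x z * (1 + gauge p a (free_flow z))).
  by rewrite normrM (ger0_norm (w0 z)) mulrCA ler_wpM2l.
have le1 : (\int[mZ]_z (`|wker K 0 t x z * G z|)%:E <= (c * (M * (8 * T0 `^ 4^-1)))%:E)%E.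
  apply: (@le_trans _ _ (\int[mZ]_z (c%:E * (wker K 0 t x z * (1 + gauge p a (free_flow z)))%:E))%E).
    apply: le_integralT.
    - by apply/measurable_EFinP; exact: (measurableT_comp (@normr_measurable _ setT) mwG).
    - by apply: emeasurable_funM => //; exact/measurable_EFinP.
    - by move=> z; rewrite lee_fin.
    - by move=> z; rewrite -EFinM lee_fin.
  rewrite integralZT//; last by exact/measurable_EFinP.
  by rewrite EFinM lee_wpmul2l// free_bound_T0.
split.
  by apply/(integrableR mZ); split => //; apply: le_lt_trans le1 _; rewrite ltry.
by rewrite -lee_fin; apply: le_trans (normr_Rintegral_le_measurable mZ mwG) le1.
Qed.

Hypothesis T0_small : C1 * (M * (8 * T0 `^ 4^-1)) <= 1 / 2.

Definition small w := measurable_fun setT w /\ forall z, `|w z| <= 1.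
(** Set to 0 after T0, so that the bound defining [small] is preserved at all times. *)
Definition step w z : R := if z.1 <= T0 then duhamel m K 0 (nlin w) z.1 z.2 else 0.

Lemma nlin_le w z : `|w z| <= 1 -> `|nlin w z| <= C1 * (1 + gauge p a (free_flow z)).
Proof.
move=> wz; have z1 : `|0 : R| <= 1 by rewrite normr0.
by have [] := nonlin_local_lip p1 f0 C0 lam0 flip (free_flow z) wz z1.
Qed.

Lemma small_step w : small w -> small (step w).
Proof.
move=> [mw w1]; have mn := measurable_nlin mw; split.
  apply: measurable_fun_ifT => //; last exact: (measurable_duhamel reg).
  by apply: measurable_fun_ler; mfun.
move=> z; rewrite /step; case: ifP => [zT|_]; last by rewrite normr0.
have [_] := duhamel_dominated z.2 mn C10 zT (fun z => nlin_le (w1 z)).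
by move=> h; apply: le_trans h (le_trans T0_small _); lra.
Qed.

(** On the unit ball around the free flow the Lipschitz constant of f is a fixed multiple of 1 +
    gauge(U), whose Duhamel integral is made small by [T0_small]. *)
Lemma step_contract w w' e : small w -> small w' -> 0 <= e ->
  (forall z, `|w z - w' z| <= e) -> forall z, `|step w z - step w' z| <= e / 2.
Proof.
move=> [mw w1] [mw' w1'] e0 ww z; rewrite /step; case: ifP => [zT|_]; last by rewrite subrr normr0 divr_ge0.
have mn := measurable_nlin mw; have mn' := measurable_nlin mw'.
have [i1 _] := duhamel_dominated z.2 mn C10 zT (fun z => nlin_le (w1 z)).
have [i2 _] := duhamel_dominated z.2 mn' C10 zT (fun z => nlin_le (w1' z)).
have -> : duhamel m K 0 (nlin w) z.1 z.2 - duhamel m K 0 (nlin w') z.1 z.2 =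
    duhamel m K 0 (fun q => nlin w q - nlin w' q) z.1 z.2.
  rewrite /duhamel -RintegralB//; apply: eq_Rintegral => q _; by rewrite mulrBr.
have md : measurable_fun setT (fun q => nlin w q - nlin w' q) by exact: measurable_funB.
have eC : 0 <= e * C1 by rewrite mulr_ge0.
have hd q : `|nlin w q - nlin w' q| <= e * C1 * (1 + gauge p a (free_flow q)).
  have [h _] := nonlin_local_lip p1 f0 C0 lam0 flip (free_flow q) (w1 q) (w1' q).
  apply: le_trans h _; rewrite -/a -/C1 mulrCA mulrA ler_wpM2r ?addr_ge0 ?gauge_ge0//.
  by rewrite ler_wpM2r.
have [_ h] := duhamel_dominated z.2 md eC zT hd.
apply: le_trans h _; rewrite -mulrA; apply: le_trans (ler_wpM2l e0 T0_small) _.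
by rewrite mul1r.
Qed.

Fixpoint picard (n : nat) : Z -> R := if n is n'.+1 then step (picard n') else fun=> 0.

Lemma small_picard n : small (picard n).
Proof.
elim: n => [|n IH]; last exact: small_step.
by split; [exact: measurable_cst|move=> z; rewrite normr0].
Qed.

Lemma picard_diff n z : `|picard n.+1 z - picard n z| <= (1 / 2) ^+ n.
Proof.
elim: n z => [|n IH] z.
  by rewrite expr0 /= subr0; have [_] := small_picard 1; exact.
have e0 : 0 <= (1 / 2 : R) ^+ n by rewrite exprn_ge0.
have := @step_contract (picard n.+1) (picard n) _ (small_picard _) (small_picard _) e0 IH z.
by rewrite exprSr; move=> h; apply: le_trans h _; rewrite mul1r.
Qed.

Lemma picard_cvg z : cvgn (fun n => picard n z).
Proof.
have -> : (fun n => picard n z) = series (fun k => picard k.+1 z - picard k z).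
  by apply/funext => n; rewrite /series/= telescope_sumr// subr0.
apply: normed_cvg; apply: (@series_le_cvg _ _ (geometric 1 (1 / 2))).
- by move=> n; exact: normr_ge0.
- by move=> n; rewrite /geometric/= mul1r exprn_ge0.
- by move=> n; rewrite /geometric/= mul1r; exact: picard_diff.
- by apply: is_cvg_geometric_series; rewrite ger0_norm; lra.
Qed.

Definition picard_lim z : R := limn (fun n => picard n z).

Lemma small_picard_lim : small picard_lim.
Proof.
split.
  apply: (@measurable_fun_cvg _ _ _ _ (fun n z => picard n z)).
    by move=> n; have [] := small_picard n.
  by move=> z _; exact: picard_cvg.
move=> z; have c := @picard_cvg z.
rewrite -lim_norm//; apply: limr_le; first exact: is_cvg_norm.
by apply: nearW => n; have [_] := small_picard n; exact.
Qed.

Lemma picard_lim_fix t x : t <= T0 -> picard_lim (t, x) = duhamel m K 0 (nlin picard_lim) t x.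
Proof.
move=> tT; have [ml l1] := small_picard_lim.
have mdom : measurable_fun setT (fun z => C1 * (1 + gauge p a (free_flow z))).
  apply: measurable_funM => //; apply: measurable_funD => //.
  by apply: measurable_gauge; exact: measurable_free.
have dom0 z : 0 <= C1 * (1 + gauge p a (free_flow z)) by rewrite mulr_ge0// addr_ge0// gauge_ge0.
have ndom z : `|C1 * (1 + gauge p a (free_flow z))| <= C1 * (1 + gauge p a (free_flow z)) by rewrite ger0_norm.
have [iB _] := duhamel_dominated x mdom C10 tT ndom.
have mw := measurable_wker_tx reg 0 t x.
have c : (fun n => duhamel m K 0 (nlin (picard n)) t x) @ \oo --> duhamel m K 0 (nlin picard_lim) t x.
  apply: (dominated_Rintegral _ _ _ iB).
  - by move=> n; have [mn _] := small_picard n; have := measurable_nlin mn; exact: measurable_funM.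
  - exact: measurable_funM mw (measurable_nlin ml).
  - move=> z; apply: cvgMl_tmp; rewrite /nlin.
    apply: (cvg_comp (fun n => free_flow z + picard n z) f).
      by apply: cvgD; [exact: cvg_cst|exact: picard_cvg].
    exact: (nonlin_continuous p1 C0 lam0 flip).
  - move=> n z; rewrite normrM (ger0_norm (wker_ge0 reg _ _ _ _)) ler_wpM2l ?(wker_ge0 reg)//.
    by apply: nlin_le; have [_] := small_picard n; exact.
have c2 : (fun n => picard n.+1 (t, x)) @ \oo --> picard_lim (t, x).
  by have := @picard_cvg (t, x); rewrite -(cvg_shiftS (fun n => picard n (t, x))).
apply: (cvg_unique _ c2) => //=; move: c; rewrite /step/= tT; exact.
Qed.

Variable Q : R.
Hypotheses (Q0 : 0 <= Q) (TQ : T0 * Q <= 1).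
Hypothesis hQ : forall w s, small w -> (\int[m]_y (`|w (s, y)| `^ p)%R%:E <= 1)%E ->
  (\int[m]_y (`|nlin w (s, y)| `^ p)%R%:E <= Q%:E)%E.

(** The second invariant: the sup bound alone gives no integrability. The input bound yields Q for
    the nonlinearity, and [TQ] brings the Duhamel integral back below 1. *)
Lemma picard_pow n s : (\int[m]_y (`|picard n (s, y)| `^ p)%R%:E <= 1)%E.
Proof.
have z0 : (\int[m]_y (`|0 : R| `^ p)%R%:E <= 1)%E.
  by under eq_integral do rewrite normr0 powR0 ?gt_eqF//; rewrite integral0.
elim: n s => [|n IH] s //=; rewrite /step/=.
have [sT|sT] := boolP (s <= T0); last exact: z0.
have [s0|s0] := leP s 0.
  apply: le_trans z0; rewrite le_eqVlt; apply/orP; left; apply/eqP; apply: eq_integral => y _.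
  rewrite /duhamel; under eq_Rintegral do rewrite wker_nonpos// mul0r.
  by rewrite Rintegral_cst// mul0r.
have [mn _] := small_picard n; have mN := measurable_nlin mn.
have s01 : 0 <= s - 0 <= 1 by rewrite subr0 ltW//= (le_trans sT).
apply: le_trans (duhamel_pow reg p1 s01 mN Q0 _) _.
  by move=> r _; apply: hQ; [exact: small_picard|exact: IH].
by rewrite subr0 lee_fin; apply: le_trans TQ; rewrite ler_wpM2r.
Qed.

Lemma picard_lim_pow s : (\int[m]_y (`|picard_lim (s, y)| `^ p)%R%:E <= 1)%E.
Proof.
apply: (@fatou_le _ _ _ m (fun n y => `|picard n (s, y)| `^ p)).
- by move=> n; apply: measurable_powp; apply: measurable_section; have [] := small_picard n.
- by move=> n y; exact: powR_ge0.
- move=> y; have c : (fun n => `|picard n (s, y)|) @ \oo --> `|picard_lim (s, y)|.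
    by apply: cvg_norm; exact: picard_cvg.
  (* Continuity of the power is taken from differentiability, available away from 0; at 0 the bound
     |v|^p <= |v| for |v| <= 1 does the work. *)
  have [l0|l0] := eqVneq (picard_lim (s, y)) 0.
    rewrite l0 normr0 powR0 ?gt_eqF//; rewrite l0 normr0 in c.
    apply: (squeeze_cvgr _ (cvg_cst (0 : R)) c); near=> n.
    rewrite powR_ge0/=; have [_ /(_ (s, y)) pn1] := small_picard n.
    by have := pow_le_norm p1 pn1; rewrite powR1 mul1r.
  apply: (cvg_comp _ (fun v : R => v `^ p) c).
  have cc : {for `|picard_lim (s, y)|, continuous (fun v : R => v `^ p)}.
    apply/differentiable_continuous/derivable1_diffP; apply: derivable_powR.
    by rewrite in_itv/= normr_gt0 l0.
  exact: cc.
- by move=> n; exact: picard_pow.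
Unshelve. all: by end_near. Qed.

End picard_iteration.

Lemma integral_le3 {R : realType} {d} {T : measurableType d} (m : {measure set T -> \bar R})
    (F D a b : T -> R) (c w cD S : R) :
  measurable_fun setT F -> measurable_fun setT D -> measurable_fun setT a -> measurable_fun setT b ->
  (forall x, 0 <= F x) -> (forall x, 0 <= D x) -> (forall x, 0 <= a x) -> (forall x, 0 <= b x) ->
  0 <= c -> 0 <= w -> (forall x, F x <= c * D x + (w * a x + w * b x)) ->
  (\int[m]_x (D x)%:E <= cD%:E)%E -> (\int[m]_x (a x)%:E <= S%:E)%E ->
  (\int[m]_x (b x)%:E <= S%:E)%E ->
  (\int[m]_x (F x)%:E <= (c * cD + (w * S + w * S))%:E)%E.
Proof.
move=> mF mD ma mb F0 D0 a0 b0 c0 w0 FB hD ha hb.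
have mE (g : T -> R) : measurable_fun setT g -> measurable_fun setT (fun x => (g x)%:E).
  by move=> mg; exact/measurable_EFinP.
have ED0 x : (0 <= (D x)%:E)%E by rewrite lee_fin.
have Ea0 x : (0 <= (a x)%:E)%E by rewrite lee_fin.
have Eb0 x : (0 <= (b x)%:E)%E by rewrite lee_fin.
have m1 : measurable_fun setT (fun x => (c%:E * (D x)%:E)%E) by apply: emeasurable_funM => //; exact: mE.
have m2 : measurable_fun setT (fun x => (w%:E * (a x)%:E)%E) by apply: emeasurable_funM => //; exact: mE.
have m3 : measurable_fun setT (fun x => (w%:E * (b x)%:E)%E) by apply: emeasurable_funM => //; exact: mE.
have n1 x : (0 <= c%:E * (D x)%:E)%E by rewrite mule_ge0.
have n2 x : (0 <= w%:E * (a x)%:E)%E by rewrite mule_ge0.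
have n3 x : (0 <= w%:E * (b x)%:E)%E by rewrite mule_ge0.
have n4 x : (0 <= w%:E * (a x)%:E + w%:E * (b x)%:E)%E by rewrite adde_ge0.
apply: (@le_trans _ _ (\int[m]_x (c%:E * (D x)%:E + (w%:E * (a x)%:E + w%:E * (b x)%:E)))%E).
  apply: le_integralT; [exact: mE| |by move=> x; rewrite lee_fin|].
    by apply: emeasurable_funD => //; exact: emeasurable_funD.
  by move=> x; rewrite -!EFinM -!EFinD lee_fin.
rewrite (integralDT m m1 (emeasurable_funD m2 m3) n1 n4) (integralDT m m2 m3 n2 n3).
rewrite (integralZT m (mE _ mD) ED0 c0) (integralZT m (mE _ ma) Ea0 w0) (integralZT m (mE _ mb) Eb0 w0).
rewrite !EFinD !EFinM; apply: leeD; first exact: lee_wpmul2l.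
by apply: leeD; exact: lee_wpmul2l.
Qed.

(** * Continuity in time of the Duhamel term in L^p *)

Section duhamel_continuity.
Context {R : realType} {d} {T : measurableType d} (m : {sigma_finite_measure set T -> \bar R}).
Local Notation mR := (measurableTypeR R).
Local Notation leb := (@lebesgue_measure R).
Local Notation Z := (mR * T)%type.
Local Notation mZ := (sigma_finite_product (@lebesgue_measure R) m).
Variables (D : T -> R) (K : R -> T -> T -> R) (A : nat) (CK : R).
Hypothesis reg : regularizing m D K A CK.
Variable p : R.
Hypothesis p1 : 1 < p.

Let p0 : 0 < p. Proof. exact: lt_trans ltr01 p1. Qed.

Lemma powD_le (x y : R) : `|x + y| `^ p <= 2 `^ p * `|x| `^ p + 2 `^ p * `|y| `^ p.
Proof.
rewrite -!powRM//; have [xy|/ltW yx] := leP `|x| `|y|.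
  rewrite -[leLHS]add0r lerD ?powR_ge0//; apply: ge0_ler_powR; rewrite ?nnegrE ?(ltW p0)//.
  by apply: le_trans (ler_normD _ _) _; lra.
rewrite -[leLHS]addr0 lerD ?powR_ge0//; apply: ge0_ler_powR; rewrite ?nnegrE ?(ltW p0)//.
by apply: le_trans (ler_normD _ _) _; lra.
Qed.

Variables (G : Z -> R) (Q T0 : R).
Hypotheses (mG : measurable_fun setT G) (Q0 : 0 <= Q) (T00 : 0 < T0) (T01 : T0 <= 1).
Hypothesis GQ : forall s, 0 < s -> (\int[m]_y (`|G (s, y)| `^ p)%R%:E <= Q%:E)%E.
Hypothesis iG : forall t x, t <= T0 -> mZ.-integrable setT (EFin \o (fun z => wker K 0 t x z * G z)).

Let cD := fine (\int[m]_x (D x)%:E)%E.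
Let mD := regular_mD reg.
Let D0 x : 0 <= D x. Proof. exact: regular_D_ge0 reg x. Qed.

Let cDE : (\int[m]_x (D x)%:E = cD%:E)%E.
Proof.
have [_ lD] := (integrableR m D).1 (reg_iD reg).
rewrite /cD fineK// ge0_fin_numE; last by apply: integral_ge0 => x _; rewrite lee_fin.
by under eq_integral do rewrite -[D _]ger0_norm//.
Qed.

Let cD0 : 0 <= cD. Proof. by rewrite fine_ge0//; apply: integral_ge0 => x _; rewrite lee_fin. Qed.

Let N := T0 * (cD + Q).

(** Since D <= 1 and |G| <= 1 + |G|^p, the product D|G| is at most D + |G|^p. *)
Let weighted_mass : (\int[mZ]_z (window 0 T0 z.1 * (D z.2 * `|G z|))%:E <= N%:E)%E.
Proof.
have mDG : measurable_fun setT (fun z : Z => D z.2 * `|G z|).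
  apply: measurable_funM; first by mfun.
  exact: (measurableT_comp (@normr_measurable _ setT) mG).
have mH : measurable_fun setT (fun z : Z => window 0 T0 z.1 * (D z.2 * `|G z|)).
  apply: measurable_funM => //; apply: (measurableT_comp (measurable_window 0 T0)); mfun.
have H0 z : 0 <= window 0 T0 z.1 * (D z.2 * `|G z|).
  by rewrite mulr_ge0 ?window_ge0// mulr_ge0.
rewrite (tonelliZ m mH H0).
apply: (@le_trans _ _ (\int[leb]_s ((cD + Q)%:E * (window 0 T0 s)%:E))%E); last first.
  rewrite integralZT.
  - by rewrite (integral_window (ltW T00)) -EFinM subr0 mulrC.
  - by apply/measurable_EFinP; exact: measurable_window.
  - by move=> s; rewrite lee_fin window_ge0.
  - exact: addr_ge0.
have mw : measurable_fun setT (fun s : mR => (window 0 T0 s)%:E).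
  by apply/measurable_EFinP; exact: measurable_window.
apply: le_integralT.
- apply: (measurable_fun_fubini_tonelli_F (fun z : Z => (window 0 T0 z.1 * (D z.2 * `|G z|))%:E)).
    exact/measurable_EFinP.
  by move=> z; rewrite lee_fin.
- exact: emeasurable_funM.
- by move=> s; apply: integral_ge0 => y _; rewrite lee_fin; exact: (H0 (s, y)).
- move=> s; rewrite /window/=; case: ifPn => [/andP[s0 sT]|_]; last first.
    by under eq_integral do rewrite mul0r; rewrite integral0 mule0.
  rewrite mule1; under eq_integral do rewrite mul1r.
  have mGs : measurable_fun setT (fun y => G (s, y)).
    have m' : measurable_fun setT (fun y : T => ((s, y) : Z)) by mfun.
    exact: (measurableT_comp mG m').
  have mGp := measurable_powp p mGs.
  have mED : measurable_fun setT (fun y => (D y)%:E) by mfun.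
  have mEG : measurable_fun setT (fun y => (`|G (s, y)| `^ p)%R%:E) by exact/measurable_EFinP.
  apply: (@le_trans _ _ (\int[m]_y ((D y)%:E + (`|G (s, y)| `^ p)%R%:E))%E).
    apply: le_integralT.
    + apply/measurable_EFinP; apply: measurable_funM => //.
      exact: (measurableT_comp (@normr_measurable _ setT) mGs).
    + exact: emeasurable_funD.
    + by move=> y; rewrite lee_fin mulr_ge0.
    + move=> y; rewrite -EFinD lee_fin.
      have := norm_le_pow p1 (G (s, y)); have := reg_D1 reg y; have := D0 y.
      have := normr_ge0 (G (s, y)); have := powR_ge0 `|G (s, y)| p.
      by nra.
  rewrite integralDT; [|exact: mED|exact: mEG|by move=> y; rewrite lee_fin|by move=> y; rewrite lee_fin powR_ge0].
  by rewrite cDE EFinD leeD2l// GQ.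
Qed.

Let N0 : 0 <= N. Proof. by rewrite mulr_ge0 ?addr_ge0// ltW. Qed.

(** The part of the kernel at old times s <= r, to be used with t - s bounded below, where the
    kernel is Lipschitz in t. *)
Let low r t x (z : Z) : R := if (0 < z.1) && (z.1 <= r) then K (t - z.1) x z.2 else 0.

Let lowE r t x z : 0 <= r -> wker K 0 t x z = low r t x z + wker K r t x z.
Proof.
move=> r0; rewrite /wker /low; have [s0|s0] /= := ltP 0 z.1; last first.
  by rewrite ltNge (le_trans s0 r0)/= addr0.
by have [sr|sr] := leP z.1 r; rewrite ?addr0 ?add0r.
Qed.

Let mlow r t x : measurable_fun setT (low r t x).
Proof.
apply: measurable_fun_ifT => //.
  by apply: measurable_and; [apply: measurable_fun_ltr|apply: measurable_fun_ler]; mfun.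
have m' : measurable_fun setT (fun z : Z => ((t - z.1, (x, z.2)) : mR * (T * T))).
  by apply: measurable_fun_pair; [apply: measurable_funB; mfun|mfun].
exact: (measurableT_comp (reg_mK reg) m').
Qed.

Let mEn (g : Z -> R) : measurable_fun setT g -> measurable_fun setT (fun z => `|g z|).
Proof. by move=> mg; exact: (measurableT_comp (@normr_measurable _ setT) mg). Qed.

Let i_le (k : Z -> R) t x : measurable_fun setT k -> t <= T0 ->
  (forall z, 0 <= k z <= wker K 0 t x z) -> mZ.-integrable setT (EFin \o (fun z => k z * G z)).
Proof.
move=> mk tT kw.
apply: (integrable_le (g := fun z => `|wker K 0 t x z * G z|)).
- exact: measurable_funM.
- move=> z; have /andP[k0 kl] := kw z.
  by rewrite !normrM ler_wpM2r// !ger0_norm// (le_trans k0).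
- exact: integrable_norm (iG x tT).
Qed.

Lemma duhamel_low_diff eta C r t t' x : 0 < eta -> 0 <= C -> 0 <= r -> t <= T0 -> t' <= T0 ->
  (0 < r -> r <= t - eta /\ r <= t' - eta) ->
  (forall s s' x y, eta <= s -> eta <= s' -> `|K s x y - K s' x y| <= C * `|s - s'| * (D x * D y)) ->
  `|duhamel m K 0 G t x - duhamel m K 0 G t' x -
    (duhamel m K r G t x - duhamel m K r G t' x)| <= C * `|t - t'| * N * D x.
Proof.
move=> eta0 C0 r0 tT tT' hr hC.
have w0 r' t'' z := wker_ge0 reg r' t'' x z.
have low0 t'' z : 0 <= low r t'' x z by rewrite /low; case: ifP => // _; exact: (reg_K0 reg).
have il t'' : t'' <= T0 -> mZ.-integrable setT (EFin \o (fun z => low r t'' x z * G z)).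
  move=> h; apply: (i_le (t := t'') (x := x) (mlow r t'' x) h) => z.
  by rewrite low0 (lowE t'' x z r0) lerDl w0.
have iw t'' : t'' <= T0 -> mZ.-integrable setT (EFin \o (fun z => wker K r t'' x z * G z)).
  move=> h; apply: (i_le (t := t'') (x := x) (measurable_wker_tx reg r t'' x) h) => z.
  by rewrite w0 (lowE t'' x z r0) lerDr low0.
have dE t'' : t'' <= T0 -> duhamel m K 0 G t'' x =
    (\int[mZ]_z (low r t'' x z * G z))%R + duhamel m K r G t'' x.
  move=> h; rewrite /duhamel -RintegralD//; [|exact: il|exact: iw].
  by apply: eq_Rintegral => z _; rewrite (lowE t'' x z r0) mulrDl.
rewrite (dE t tT) (dE t' tT').
set a := duhamel _ _ r _ _ _; set b := duhamel _ _ r _ _ _.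
have -> : (\int[mZ]_z (low r t x z * G z))%R + a - ((\int[mZ]_z (low r t' x z * G z))%R + b) - (a - b) =
  (\int[mZ]_z (low r t x z * G z))%R - (\int[mZ]_z (low r t' x z * G z))%R by ring.
rewrite -RintegralB//; [|exact: il|exact: il].
have mlG : measurable_fun setT (fun z => low r t x z * G z - low r t' x z * G z).
  by apply: measurable_funB; apply: measurable_funM => //; exact: mlow.
rewrite -lee_fin; apply: le_trans (normr_Rintegral_le_measurable mZ mlG) _.
have c0 : 0 <= C * `|t - t'| * D x by rewrite !mulr_ge0.
have mWt : measurable_fun setT (fun z : Z => window 0 T0 z.1 * (D z.2 * `|G z|)).
  apply: measurable_funM; first by apply: (measurableT_comp (measurable_window 0 T0)); mfun.
  by apply: measurable_funM; [mfun|exact: mEn].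
apply: (@le_trans _ _ (\int[mZ]_z ((C * `|t - t'| * D x)%:E * (window 0 T0 z.1 * (D z.2 * `|G z|))%:E))%E).
  apply: le_integralT.
  - by apply/measurable_EFinP; exact: mEn.
  - by apply: emeasurable_funM => //; exact/measurable_EFinP.
  - by move=> z; rewrite lee_fin.
  - move=> z; rewrite -EFinM lee_fin -mulrBl normrM mulrA mulrA ler_wpM2r// /low /window.
    case: ifPn => [/andP[s0 sr]|_]; last first.
      by rewrite subrr normr0 !mulr_ge0// window_ge0.
    have [h1 h2] := hr (lt_le_trans s0 sr).
    have -> : (0 < z.1) && (z.1 < T0) by rewrite s0/=; lra.
    have h : `|K (t - z.1) x z.2 - K (t' - z.1) x z.2| <=
        C * `|(t - z.1) - (t' - z.1)| * (D x * D z.2) by apply: hC; lra.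
    apply: le_trans h _; have -> : t - z.1 - (t' - z.1) = t - t' by ring.
    by rewrite le_eqVlt; apply/orP; left; apply/eqP => /=; ring.
rewrite integralZT//; last 2 first.
- exact/measurable_EFinP.
- by move=> z; rewrite lee_fin mulr_ge0 ?window_ge0// mulr_ge0.
apply: (@le_trans _ _ ((C * `|t - t'| * D x)%:E * N%:E)%E).
  by apply: lee_wpmul2l; [rewrite lee_fin|exact: weighted_mass].
by rewrite -EFinM lee_fin mulrAC.
Qed.

(** The past is cut slightly before both times. The old part varies in a Lipschitz way with t; each
    recent part lasts at most 2 eta, so [duhamel_pow] makes it O(eta). *)
Lemma duhamel_Lp_continuous t e : 0 <= t <= T0 -> 0 < e ->
  exists2 delta, 0 < delta & forall t', 0 <= t' <= T0 -> `|t' - t| < delta ->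
    (\int[m]_x (`|duhamel m K 0 G t' x - duhamel m K 0 G t x| `^ p)%R%:E <= e%:E)%E.
Proof.
move=> /andP[t0 tT] e0; have [tp tp0 tpE] : exists2 tp : R, 0 < tp & tp = 2 `^ p by exists (2 `^ p) => //; exact: powR_gt0.
have [W W0 WE] : exists2 W : R, 0 < W & W = tp * tp by exists (tp * tp) => //; exact: mulr_gt0.
(* The first bound keeps the recent interval shorter than 1. The second makes the two recent parts,
   W * 2 eta Q each, at most e/2 together; W carries one factor 2^p for each use of [powD_le]. *)
pose eta := Num.min (1 / 2) (e / (8 * W * (Q + 1))).
have Q1 : 0 < Q + 1 by rewrite ltr_wpDl.
have eta0 : 0 < eta by rewrite lt_min !divr_gt0// !mulr_gt0.
have eta2 : eta <= 1 / 2 by rewrite ge_min lexx.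
have etaQ : 4 * W * Q * eta <= e / 2.
  have h : eta <= e / (8 * W * (Q + 1)) by rewrite ge_min lexx orbT.
  rewrite ler_pdivlMr ?mulr_gt0// in h.
  have h2 : 0 <= W * eta by rewrite mulr_ge0// ltW.
  nra.
have [C [C0 hC]] := reg_lip reg eta0.
have H0 : 0 <= C * N by rewrite mulr_ge0.
have CN1 : 0 < C * N + 1 by rewrite ltr_wpDl.
have cD1 : 0 < cD + 1 by rewrite ltr_wpDl.
(* In order: the times stay within eta, the old difference is at most 1 so that its p-th power is
   below itself, and its integral is at most e/2. *)
pose delta := Num.min eta (Num.min (1 / (C * N + 1)) (e / 2 / (tp * (C * N + 1) * (cD + 1)))).
exists delta; first by rewrite lt_min eta0/= lt_min !divr_gt0 ?mulr_gt0.
move=> t' /andP[t'0 t'T]; rewrite lt_min => /andP[d1]; rewrite lt_min => /andP[d2 d3].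
pose r := Num.max 0 (Num.min t t' - eta).
have r0 : 0 <= r by rewrite le_max lexx.
have tt : t' - eta <= t /\ t - eta <= t'.
  by move: d1; rewrite ltr_norml => /andP[? ?]; split; lra.
have rt : r <= t /\ r <= t'.
  by rewrite !ge_max t0 t'0/= !lerBlDr !ge_min; split; apply/orP; [left|right]; rewrite lerDl ltW.
have tr : t - r <= 2 * eta /\ t' - r <= 2 * eta.
  have : Num.min t t' - eta <= r by rewrite le_max lexx orbT.
  by case: (leP t t') => ? ?; case: tt => ? ?; split; lra.
have hr : 0 < r -> r <= t' - eta /\ r <= t - eta.
  rewrite lt_max ltxx/= => mn0.
  have rE : r = Num.min t t' - eta by apply: max_r; exact: ltW.
  by rewrite rE !lerD2r !ge_min !lexx orbT.
have mp r' t'' := measurable_duhamel_t reg r' t'' mG.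
have [kap kapD] : exists kap : R, kap = C * `|t' - t| * N by exists (C * `|t' - t| * N).
have kap0 : 0 <= kap by rewrite kapD; apply: mulr_ge0 => //; exact: mulr_ge0.
have kapE : kap = `|t' - t| * (C * N) by rewrite kapD; ring.
have kap1 : kap <= 1.
  rewrite kapE; move: d2; rewrite ltr_pdivlMr// => h; have := normr_ge0 (t' - t); nra.
have kap2 : tp * kap * cD <= e / 2.
  move: d3; rewrite ltr_pdivlMr ?mulr_gt0// => h; rewrite kapE.
  have := normr_ge0 (t' - t); move: (`|t' - t|) h => q h q0.
  have h1 : q * (C * N) <= q * (C * N + 1) by rewrite ler_wpM2l// lerDl.
  have h2 : tp * (q * (C * N)) * cD <= tp * (q * (C * N + 1)) * (cD + 1).
    apply: ler_pM => //; last by rewrite lerDl.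
      by apply: mulr_ge0; [exact: ltW|exact: mulr_ge0].
    by rewrite ler_wpM2l// ltW.
  lra.
have pw x : `|duhamel m K 0 G t' x - duhamel m K 0 G t x| `^ p <=
   tp * kap * D x + (W * `|duhamel m K r G t' x| `^ p + W * `|duhamel m K r G t x| `^ p).
  pose P := duhamel m K 0 G t' x - duhamel m K 0 G t x - (duhamel m K r G t' x - duhamel m K r G t x).
  have PD : `|P| <= kap * D x by rewrite kapD; exact: (duhamel_low_diff x eta0 C0 r0 t'T tT hr hC).
  have kD1 : kap * D x <= 1 by apply: mulr_ile1 => //; exact: (reg_D1 reg x).
  have -> : duhamel m K 0 G t' x - duhamel m K 0 G t x =
    P + (duhamel m K r G t' x - duhamel m K r G t x) by rewrite /P; ring.
  apply: le_trans (powD_le _ _) _; rewrite -tpE; apply: lerD.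
    rewrite -mulrA ler_wpM2l ?(ltW tp0)//; apply: (le_trans _ PD).
    by have := pow_le_norm p1 (le_trans PD kD1); rewrite powR1 mul1r.
  move: (duhamel m K r G t' x) (duhamel m K r G t x) => u v.
  have h := powD_le u (- v); rewrite normrN -tpE in h; rewrite WE.
  by have := ler_wpM2l (ltW tp0) h; lra.
have bnd t'' : 0 <= t'' - r -> t'' - r <= 2 * eta ->
    (\int[m]_x (`|duhamel m K r G t'' x| `^ p)%R%:E <= (2 * eta * Q)%:E)%E.
  move=> h0 h1; have h01 : 0 <= t'' - r <= 1 by rewrite h0/=; lra.
  apply: le_trans (duhamel_pow reg p1 h01 mG Q0 _) _.
    by move=> s /andP[rs _]; apply: GQ; exact: le_lt_trans rs.
  by rewrite lee_fin ler_wpM2r.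
have [tr1 tr2] := tr; have [rt1 rt2] := rt.
have b1 := bnd t; have b2 := bnd t'.
have mP r' t'' : measurable_fun setT (fun x => `|duhamel m K r' G t'' x| `^ p).
  by apply: measurable_powp.
apply: le_trans (integral_le3 (c := tp * kap) (w := W) (cD := cD) (S := 2 * eta * Q) _ mD (mP r t') (mP r t) _ _ _ _ _ _ pw _ _ _) _.
- by apply: measurable_powp; exact: measurable_funB.
- by move=> x; exact: powR_ge0.
- exact: D0.
- by move=> x; exact: powR_ge0.
- by move=> x; exact: powR_ge0.
- by apply: mulr_ge0 => //; exact: ltW.
- exact: ltW.
- by rewrite cDE.
- by apply: b2; rewrite ?subr_ge0.
- by apply: b1; rewrite ?subr_ge0.
- rewrite lee_fin; have := lerD kap2 etaQ; rewrite -splitr; apply: le_trans.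
  by rewrite le_eqVlt; apply/orP; left; apply/eqP; ring.
Qed.

End duhamel_continuity.

Section interior_integral.
Context {R : realType}.
Local Notation leb := (@lebesgue_measure R).

(** Passes from the open interval, where the integrand is given by a kernel, to the closed one of
    the mild formulation; the values of H at the endpoints are arbitrary. *)
Lemma interior_integral (H F : R -> R) t : leb.-integrable setT (EFin \o F) ->
  (forall s, F s = if (0 < s) && (s < t) then H s else 0) ->
  leb.-integrable `[0, t] (EFin \o H) /\ (\int[leb]_(s in `[0%R, t]) H s)%R = (\int[leb]_s F s)%R.
Proof.
move=> iF FE; have [mF lF] := (integrableR leb F).1 iF.
have HF s : s \in [set` `]0%R, t[] -> F s = H s.
  by rewrite inE/= in_itv/= => h; rewrite FE h.
have mH : measurable_fun `]0, t[ H.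
  apply: (eq_measurable_fun F) => //; exact: measurable_funTS mF.
have mHc : measurable_fun `[0, t] H.
  have [t0|t0] := ltP 0 t.
    by apply/measurable_fun_itv_bndo_bndcP/measurable_fun_itv_obnd_cbndP.
  have [->|tn] := eqVneq t 0; first by rewrite set_itv1; exact: measurable_fun_set1.
  by rewrite set_itv_ge ?bnd_simp -?ltNge ?lt_neqAle ?tn//; exact: measurable_fun_set0.
have out (psi : R -> \bar R) : (forall s, F s = 0 -> psi s = 0%E) ->
    (\int[leb]_s psi s = \int[leb]_(s in `]0%R, t[) psi s)%E.
  move=> hp; rewrite [RHS]integral_mkcond; apply: eq_integral => s _; rewrite patchE.
  case: ifPn => // hs; apply: hp; rewrite FE; case: ifPn => // h.
  by move: hs; rewrite notin_setE/= in_itv/= h.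
split.
  apply/integrableP; split; first exact/measurable_EFinP.
  have mn : measurable_fun `]0, t[ (fun s => (`|H s|)%:E).
    by apply/measurable_EFinP; exact: (measurableT_comp (@normr_measurable _ setT)).
  rewrite /= (integral_itv_bndoo _ _ mn).
  have -> : (\int[leb]_(s in `]0%R, t[) (`|H s|)%:E = \int[leb]_(s in `]0%R, t[) (`|F s|)%:E)%E.
    by apply: eq_integral => s hs; rewrite HF.
  by rewrite -out// => s ->; rewrite normr0.
rewrite /Rintegral; congr fine.
have mh : measurable_fun `]0, t[ (fun s => (H s)%:E) by exact/measurable_EFinP.
rewrite (integral_itv_bndoo _ _ mh) (out (fun s => (F s)%:E)); last by move=> s ->.
by apply: eq_integral => s hs; rewrite HF.
Qed.

End interior_integral.

(** * Existence *)

Section mild_existence.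
Context {R : realType} {d} {T : measurableType d} (m : {sigma_finite_measure set T -> \bar R}).
Local Notation mR := (measurableTypeR R).
Local Notation leb := (@lebesgue_measure R).
Local Notation Z := (mR * T)%type.
Local Notation mZ := (sigma_finite_product (@lebesgue_measure R) m).
Variables (D : T -> R) (K : R -> T -> T -> R) (A : nat) (CK : R).
Hypothesis reg : regularizing m D K A CK.
Variable p : R.
Hypothesis p1 : 1 < p.
Variables (f : R -> R) (C lam : R).
Hypotheses (f0 : f 0 = 0) (C0 : 0 < C) (lam0 : 0 < lam).
Hypothesis flip : forall u v : R, `|f u - f v| <=
    C * `|u - v| * (expR (lam * (`|u| `^ p)) + expR (lam * (`|v| `^ p))).

Let p0 : 0 < p. Proof. exact: lt_trans ltr01 p1. Qed.
Let mf : measurable_fun setT f := measurable_nonlin p1 C0 lam0 flip.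

Lemma integrable_gauge b (g : T -> R) : 0 <= b -> measurable_fun setT g ->
  (gauge_int m p b g < +oo)%E -> m.-integrable setT (EFin \o (fun x => gauge p b (g x))).
Proof.
rewrite gauge_intE => b0 mg lg; apply/integrableR; split; first exact: measurable_gauge.
by under eq_integral do rewrite ger0_norm ?gauge_ge0//.
Qed.

Lemma integrable_weight_nonlin (v : T -> R) : measurable_fun setT v ->
  (gauge_int m p (lam + 1) v < +oo)%E ->
  m.-integrable setT (EFin \o (fun y => D y * (f \o v) y)).
Proof.
move=> mv lv; have l1 : 0 <= lam + 1 by rewrite addr_ge0// ltW.
have ig := integrable_gauge l1 mv lv; have mD := regular_mD reg.
have mfv : measurable_fun setT (f \o v) by exact: measurableT_comp.
apply: (integrable_le (g := fun y => 2 * C * (D y + gauge p (lam + 1) (v y)))).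
- exact: measurable_funM.
- move=> y; have Dy := regular_D_ge0 reg y; rewrite normrM (ger0_norm Dy).
  have c0 : 0 <= 2 * C by rewrite mulr_ge0// ltW.
  apply: le_trans (ler_wpM2l Dy (nonlin_le p1 f0 C0 lam0 flip (v y))) _.
  rewrite mulrCA ler_wpM2l//; have := gauge_ge0 p (v y) l1; have := reg_D1 reg y.
  by move: (gauge _ _ _) => g; nra.
- rewrite (_ : _ \o _ = (fun y => (2 * C)%:E * ((D y)%:E + (gauge p (lam + 1) (v y))%:E))%E); last first.
    by apply/funext => y /=; rewrite -EFinD -EFinM.
  apply: integrableZl => //; exact: (integrableD measurableT (reg_iD reg) ig).
Qed.

(** The integrand is prescribed on ]0, t[ only: at s = t the spectral propagator is the identity
    while the kernel is 0. *)
Definition mild_at (u0 : T -> R) (u : R -> T -> R) t x := exists H : R -> R,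
  [/\ forall s, 0 < s < t -> H s = kapply m (K (t - s)) (f \o u s) x,
      leb.-integrable `[0, t] (EFin \o H) &
      u t x = heat m K t u0 x + (\int[leb]_(s in `[0%R, t]) H s)%R].

Definition in_gauge (g : T -> R) := measurable_fun setT g /\
  forall b, 0 < b -> (gauge_int m p b g < +oo)%E.

(** Continuity in the Luxemburg norm: a gauge integral at most 1 with parameter b means norm at most
    b^(-1/p), so the fixed threshold 1 with all b > 0 expresses smallness. *)
Definition gauge_continuous (T0 : R) (u : R -> T -> R) :=
  forall t b, 0 <= t <= T0 -> 0 < b -> exists2 delta, 0 < delta &
    forall s, 0 <= s <= T0 -> `|s - t| < delta ->
    (gauge_int m p b (fun x => (u s x - u t x)%R) <= 1)%E.

Lemma gauge_int_pow_le b (g : T -> R) M : 0 <= b -> measurable_fun setT g ->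
  (forall x, `|g x| <= M) ->
  (gauge_int m p b g <= (b * expR (b * M `^ p))%:E * \int[m]_x (`|g x| `^ p)%R%:E)%E.
Proof.
move=> b0 mg gM; have mp : measurable_fun setT (fun x => (`|g x| `^ p)%R%:E).
  by apply/measurable_EFinP; exact: measurable_powp.
rewrite -integralZT; [|exact: mp|by move=> x; rewrite lee_fin powR_ge0|by rewrite mulr_ge0// expR_ge0].
rewrite gauge_intE; apply: le_integralT.
- by apply/measurable_EFinP; exact: measurable_gauge.
- exact: emeasurable_funM.
- by move=> x; rewrite lee_fin gauge_ge0.
- by move=> x; rewrite -EFinM lee_fin; exact: gauge_le_pow.
Qed.

(** Quantifying over H lets the caller supply the spectral integrand, whatever its values at the
    endpoints. *)
Theorem mild_existence (u0 : T -> R) : in_gauge u0 -> exists2 T0, 0 < T0 <= 1 &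
  exists u : R -> T -> R, [/\ forall t, 0 <= t <= T0 -> in_gauge (u t),
    gauge_continuous T0 u &
    forall t x (H : R -> R), 0 <= t <= T0 ->
      (forall s, 0 < s < t -> H s = kapply m (K (t - s)) (f \o u s) x) ->
      leb.-integrable `[0, t] (EFin \o H) /\
      u t x = heat m K t u0 x + (\int[leb]_(s in `[0%R, t]) H s)%R].
Proof.
move=> [mu0 lu0].
have tp0 : 0 < 2 `^ p :> R by exact: powR_gt0.
have finE b : 0 < b -> exists2 B, 0 <= B & (gauge_int m p b u0 <= B%:E)%E.
  move=> b0; have g0 : (0 <= gauge_int m p b u0)%E by apply: gauge_int_ge0; exact: ltW.
  exists (fine (gauge_int m p b u0)); first exact: fine_ge0.
  by rewrite fineK// ge0_fin_numE// lu0.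
pose a := (lam + 1) * 2 `^ p; have a0 : 0 < a by rewrite mulr_gt0// addr_gt0.
have A2 : 0 < (2 * A)%:R :> R by rewrite ltr0n muln_gt0 (reg_A0 reg).
have [B B0 hB] := finE ((2 * A)%:R * a) (mulr_gt0 A2 a0).
pose b := (1 + p * lam) * 2 `^ p.
have b0 : 0 < b by rewrite mulr_gt0// addr_gt0// mulr_gt0.
have [E E0 hE] := finE b b0.
pose C1 := 2 * C * expR a; pose M := 2 + CK * B.
have C10 : 0 < C1 by rewrite !mulr_gt0// expR_gt0.
have M0 : 0 < M by rewrite ltr_pwDl// mulr_ge0// ltW// (reg_C0 reg).
(* Bounds the integral of |f(U + w)|^p: E comes from U, the other summand from |w| <= 1 together
   with the integral of |w|^p being at most 1. *)
pose Q := (2 * C) `^ p * (E + b * expR (b * 1 `^ p)).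
have Q0 : 0 <= Q by rewrite mulr_ge0 ?powR_ge0// addr_ge0// mulr_ge0 ?expR_ge0// ltW.
(* If T0^(1/4) <= kap, the constant C1 * M * 8 * T0^(1/4) is at most 1/2. *)
pose kap := (C1 * (M * 16))^-1.
have kap0 : 0 < kap by rewrite invr_gt0 mulr_gt0// mulr_gt0.
(* The three bounds serve the smoothing estimate, the contraction in sup norm and the invariant on
   the integral of |w|^p. *)
pose T0 := Num.min 1 (Num.min (kap ^+ 4) (Q + 1)^-1).
have Q1 : 0 < Q + 1 by rewrite ltr_wpDl.
have T00 : 0 < T0 by rewrite lt_min ltr01/= lt_min exprn_gt0// invr_gt0 Q1.
have T01 : T0 <= 1 by rewrite ge_min lexx.
have Tk : T0 `^ 4^-1 <= kap.
  have h : T0 <= kap ^+ 4 by rewrite !ge_min lexx orbT.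
  apply: (@le_trans _ _ ((kap ^+ 4) `^ 4^-1)).
    by apply: ge0_ler_powR; rewrite ?nnegrE ?exprn_ge0 ?(ltW T00) ?(ltW kap0).
  by rewrite -powR_mulrn ?(ltW kap0)// -powRrM divff// powRr1// ltW.
have T0_small : C1 * (M * (8 * T0 `^ 4^-1)) <= 1 / 2.
  have h : C1 * (M * (8 * T0 `^ 4^-1)) <= C1 * (M * (8 * kap)).
    by rewrite !ler_wpM2l// ltW.
  apply: le_trans h _; rewrite le_eqVlt; apply/orP; left; apply/eqP; rewrite /kap.
  by field; rewrite !gt_eqF.
have TQ : T0 * Q <= 1.
  have h : T0 <= (Q + 1)^-1 by rewrite !ge_min lexx !orbT.
  apply: le_trans (ler_wpM2r Q0 h) _; rewrite mulrC ler_pdivrMr// mul1r; lra.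
pose U := free_flow m K u0; pose nl := nlin m K f u0.
have mU : measurable_fun setT U by exact: (measurable_free reg mu0).
have mUs s : measurable_fun setT (fun y => U (s, y)) by exact: measurable_section.
have hQ w s : small w -> (\int[m]_y (`|w (s, y)| `^ p)%R%:E <= 1)%E ->
    (\int[m]_y (`|nl w (s, y)| `^ p)%R%:E <= Q%:E)%E.
  move=> [mw w1] lw; have mws : measurable_fun setT (fun y => w (s, y)) by exact: measurable_section.
  have mUw : measurable_fun setT (fun y => U (s, y) + w (s, y)) by exact: measurable_funD.
  have c0 : 0 <= (2 * C) `^ p by exact: powR_ge0.
  have pl0 : 0 <= 1 + p * lam by rewrite addr_ge0// mulr_ge0// ltW.
  apply: (@le_trans _ _ (((2 * C) `^ p)%:E * gauge_int m p (1 + p * lam) (fun y => (U (s, y) + w (s, y))%R))%E).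
    have mg : measurable_fun setT (fun y => (gauge p (1 + p * lam) (U (s, y) + w (s, y)))%:E).
      by apply/measurable_EFinP; exact: (measurable_gauge p (1 + p * lam) mUw).
    rewrite gauge_intE -integralZT//; last by move=> y; rewrite lee_fin gauge_ge0.
    apply: le_integralT.
    - apply/measurable_EFinP; apply: measurable_powp.
      exact: (measurableT_comp mf mUw).
    - exact: emeasurable_funM.
    - by move=> y; rewrite lee_fin powR_ge0.
    - by move=> y; rewrite -EFinM lee_fin; exact: (nonlin_pow_le p1 f0 C0 lam0 flip).
  rewrite /Q EFinM; apply: lee_wpmul2l; first by rewrite lee_fin.
  apply: le_trans (gauge_intD m p1 pl0 (mUs s) mws) _; rewrite -/b EFinD; apply: leeD.
    by apply: le_trans hE; apply: (gauge_int_semigroup reg p1 _ (ltW b0) mu0).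
  apply: le_trans (gauge_int_pow_le (ltW b0) mws (fun y => w1 (s, y))) _.
  rewrite -[leRHS]mule1; apply: lee_wpmul2l => //.
  by rewrite lee_fin mulr_ge0 ?expR_ge0// ltW.
pose w := picard_lim m K f u0 T0.
have sw : small w := small_picard_lim reg p1 f0 C0 lam0 flip mu0 hB T00 T01 T0_small.
have [mw w1] := sw.
have wE t x : t <= T0 -> w (t, x) = duhamel m K 0 (nl w) t x.
  exact: (picard_lim_fix reg p1 f0 C0 lam0 flip mu0 hB T00 T01 T0_small x).
have wp s : (\int[m]_y (`|w (s, y)| `^ p)%R%:E <= 1)%E.
  exact: (picard_lim_pow reg p1 f0 C0 lam0 flip mu0 hB T00 T01 T0_small Q0 TQ hQ s).
have mws s : measurable_fun setT (fun y => w (s, y)) by exact: measurable_section.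
have mnl : measurable_fun setT (nl w) by exact: (measurable_nlin reg p1 C0 lam0 flip mu0 mw).
have iw t x : t <= T0 -> mZ.-integrable setT (EFin \o (fun z => wker K 0 t x z * nl w z)).
  move=> tT.
  have [] := @duhamel_dominated _ _ _ m D K A CK reg p p1 lam lam0 u0 mu0 B hB T0 T00 T01
    (nl w) C1 t x mnl (ltW C10) tT _ => //.
  by move=> z; apply: nlin_le => //; exact: w1.
pose u t x := heat m K t u0 x + w (t, x).
have mut t : measurable_fun setT (u t).
  by apply: measurable_funD => //; exact: (measurable_heat reg).
have w_gauge t c : 0 <= c -> (gauge_int m p c (fun y => w (t, y)) < +oo)%E.
  move=> c0; apply: le_lt_trans (gauge_int_pow_le c0 (mws t) (fun y => w1 (t, y))) _.
  apply: (@le_lt_trans _ _ ((c * expR (c * 1 `^ p))%:E * 1)%E); last by rewrite mule1 ltry.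
  by apply: lee_wpmul2l => //; rewrite lee_fin mulr_ge0// expR_ge0.
have ug t : in_gauge (u t).
  split=> // c c0; have mh := measurable_heat reg t mu0.
  apply: le_lt_trans (gauge_intD m p1 (ltW c0) mh (mws t)) _.
  have c2 : 0 < c * 2 `^ p by rewrite mulr_gt0.
  apply: lte_add_pinfty; last by apply: w_gauge; exact: ltW.
  by apply: le_lt_trans (gauge_int_heat reg p1 t (ltW c2) mu0) (lu0 _ c2).
exists T0; first by rewrite T00.
exists u; split => //.
- move=> t c /andP[t0 tT] c0; pose e : R := 1; have e0 : 0 < e by exact: ltr01.
  have c2 : 0 < c * 2 `^ p by rewrite mulr_gt0.
  have e2 : 0 < e / 2 by rewrite divr_gt0.
  pose W := c * 2 `^ p * expR (c * 2 `^ p * 2 `^ p).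
  have W0 : 0 < W by rewrite mulr_gt0// expR_gt0.
  have [d1 d10 hd1] := heat_gauge_int_continuous reg p1 mu0 lu0 c2 t0 e2.
  have GQ s : 0 < s -> (\int[m]_y (`|nl w (s, y)| `^ p)%R%:E <= Q%:E)%E.
    by move=> _; exact: hQ.
  have tt : 0 <= t <= T0 by rewrite t0.
  have eW : 0 < e / 2 / W by rewrite divr_gt0.
  have [d2 d20 hd2] := duhamel_Lp_continuous reg p1 mnl Q0 T00 GQ iw tt eW.
  exists (Num.min d1 d2); first by rewrite lt_min d10.
  move=> s /andP[s0 sT]; rewrite lt_min => /andP[sd1 sd2].
  have mh t' := measurable_heat reg t' mu0.
  have m1 : measurable_fun setT (fun x => heat m K s u0 x - heat m K t u0 x) by exact: measurable_funB.
  have m2 : measurable_fun setT (fun x => w (s, x) - w (t, x)) by exact: measurable_funB.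
  have -> : (fun x => u s x - u t x) = (fun x => (heat m K s u0 x - heat m K t u0 x) + (w (s, x) - w (t, x))).
    by apply/funext => x; rewrite /u; ring.
  apply: le_trans (gauge_intD m p1 (ltW c0) m1 m2) _.
  rewrite -[leRHS]/(e%:E) (splitr e) EFinD; apply: leeD; first exact: hd1.
  have w2 x : `|w (s, x) - w (t, x)| <= 2.
    by apply: le_trans (ler_normB _ _) _; have := w1 (s, x); have := w1 (t, x); lra.
  apply: le_trans (gauge_int_pow_le (ltW c2) m2 w2) _.
  have hd : (\int[m]_x (`|w (s, x) - w (t, x)| `^ p)%R%:E <= (e / 2 / W)%:E)%E.
    under eq_integral do rewrite !wE//.
    by apply: hd2 => //; rewrite s0.
  apply: (@le_trans _ _ (W%:E * (e / 2 / W)%:E)%E).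
    by apply: lee_wpmul2l => //; rewrite lee_fin ltW.
  by rewrite -EFinM lee_fin mulrC divfK// gt_eqF.
- move=> t x H /andP[t0 tT] HE.
  have iz := iw t x tT.
  have usE s y : 0 < s -> nl w (s, y) = (f \o u s) y.
    by move=> s0; rewrite /nl /nlin /u /heat /= gt_eqF.
  (* The space integral at time s; Fubini gives its integrability in time and identifies its
     integral with [duhamel]. *)
  pose F s := (\int[m]_y (wker K 0 t x (s, y) * nl w (s, y)))%R.
  have FE s : F s = if (0 < s) && (s < t) then H s else 0.
    rewrite /F; case: ifPn => [/andP[s0 st]|nst].
      rewrite HE ?s0// /kapply; apply: eq_Rintegral => y _.
      by rewrite (wkerE reg) /window s0 st/= mul1r usE.
    under eq_Rintegral do rewrite (wkerE reg) /window/= (negbTE nst) !mul0r.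
    by rewrite Rintegral_cst// mul0r.
  have inner s : m.-integrable setT (EFin \o (fun y => wker K 0 t x (s, y) * nl w (s, y))).
    have [s0|s0] := ltP 0 s; last first.
      rewrite (_ : _ \o _ = cst 0%E); first exact: integrable0.
      by apply/funext => y /=; rewrite /wker/= ltNge s0/= mul0r.
    rewrite (_ : _ \o _ = EFin \o (fun y => K (t - s) x y * (f \o u s) y)); last first.
      by apply/funext => y /=; rewrite /wker/= s0 usE.
    apply: (integrable_semigroup reg).
      by apply: integrable_weight_nonlin => //; have [_] := ug s; apply; rewrite addr_gt0.
    exact: measurableT_comp.
  have EF s : fubini_F m (EFin \o (fun z => wker K 0 t x z * nl w z)) s = (F s)%:E.
    by rewrite /F EFin_Rintegral.
  have iF : leb.-integrable setT (EFin \o F).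
    have := @integrable_fubini_F _ _ _ _ _ leb m _ iz.
    by congr (leb.-integrable setT _); apply/funext => s /=; rewrite EF.
  have [iH ->] := interior_integral iF FE; split => //.
  rewrite /u wE//; congr (_ + _); rewrite /duhamel /Rintegral; congr fine.
  transitivity (\int[leb]_s fubini_F m (EFin \o (fun z => (wker K 0 t x z * nl w z)%R)) s)%E.
    by apply/esym; exact: (@integral12_prod_meas1 _ _ _ _ _ leb m _ iz).
  by apply: eq_integral => s _; exact: EF.
Qed.

End mild_existence.

Lemma interior_singular_bound {R : realType} (H : R -> R) (t c : R) : 0 < t -> 0 <= c ->
  (@lebesgue_measure R).-integrable `[0, t] (EFin \o H) ->
  (forall s, 0 < s < t -> `|H s| <= c * singular t s) ->
  `|(\int[@lebesgue_measure R]_(s in `[0%R, t]) H s)%R| <= c * (8 * t `^ 4^-1).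
Proof.
move=> t0 c0 iH hH.
have ms := @measurable_singular R t.
have mH : measurable_fun `[0, t] H by case/integrableP: iH => /measurable_EFinP.
have mHo : measurable_fun `]0, t[ H.
  by apply: measurable_funS mH => //; apply: subset_itv; rewrite bnd_simp.
have mn : measurable_fun `]0, t[ (fun s => (`|H s|)%:E).
  by apply/measurable_EFinP; exact: (measurableT_comp (@normr_measurable _ setT)).
have mcs : measurable_fun setT (fun s : measurableTypeR R => (c%:E * (singular t s)%:E)%E).
  by apply: emeasurable_funM => //; exact/measurable_EFinP.
have cs0 s : (0 <= c%:E * (singular t s)%:E)%E.
  by rewrite mule_ge0 ?lee_fin// singular_ge0.
rewrite -lee_fin EFin_normr_Rintegral//.
apply: le_trans (le_abse_integral _ _ _) _ => //; first by case/integrableP: iH.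
rewrite (integral_itv_bndoo _ _ mn).
apply: (@le_trans _ _ (\int[@lebesgue_measure R]_(s in `]0%R, t[) (c%:E * (singular t s)%:E))%E).
  apply: ge0_le_integral => //; first exact: measurable_funTS.
apply: (@le_trans _ _ (\int[@lebesgue_measure R]_s (c%:E * (singular t s)%:E))%E).
  by apply: ge0_subset_integral.
rewrite integralZT; [| |by move=> s; rewrite lee_fin singular_ge0|exact: c0].
  by rewrite EFinM lee_wpmul2l// integral_singular_le.
exact/measurable_EFinP.
Qed.

(** * Uniqueness *)

Section mild_uniqueness.
Context {R : realType} {d} {T : measurableType d} (m : {sigma_finite_measure set T -> \bar R}).
Local Notation mR := (measurableTypeR R).
Local Notation leb := (@lebesgue_measure R).
Variables (D : T -> R) (K : R -> T -> T -> R) (A : nat) (CK : R).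
Hypothesis reg : regularizing m D K A CK.
Variable p : R.
Hypothesis p1 : 1 < p.
Variables (f : R -> R) (C lam : R).
Hypotheses (f0 : f 0 = 0) (C0 : 0 < C) (lam0 : 0 < lam).
Hypothesis flip : forall u v : R, `|f u - f v| <=
    C * `|u - v| * (expR (lam * (`|u| `^ p)) + expR (lam * (`|v| `^ p))).
Variable T0 : R.
Hypothesis T01 : T0 <= 1.

Let mf : measurable_fun setT f := measurable_nonlin p1 C0 lam0 flip.

(** Near t, continuity bounds the integral by 1 plus its value at t with parameter b 2^p;
    compactness of [0, T0] makes the bound uniform. *)
Lemma gauge_sup (v : R -> T -> R) b : 0 < b ->
  (forall t, 0 <= t <= T0 -> in_gauge m p (v t)) -> gauge_continuous m p T0 v ->
  exists2 B, 0 <= B & forall t, 0 <= t <= T0 -> (gauge_int m p b (v t) <= B%:E)%E.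
Proof.
move=> b0 vg vc; have b2 : 0 < b * 2 `^ p by rewrite mulr_gt0// powR_gt0.
have cov : near_covering `[0, T0] by apply/compact_near_coveringP; exact: segment_compact.
pose P (n : nat) (t : R) := 0 <= t <= T0 -> (gauge_int m p b (v t) <= n%:R%:E)%E.
have [N _ hN] : \forall n \near \oo, `[0, T0] `<=` P n.
  apply: cov => t; rewrite /= in_itv/= => t0T.
  have [delta d0 hd] := vc t _ t0T b2.
  have [mvt lvt] := vg t t0T.
  pose M := fine (gauge_int m p (b * 2 `^ p) (v t)).
  have ME : (gauge_int m p (b * 2 `^ p) (v t) = M%:E)%E.
    by rewrite /M fineK// ge0_fin_numE; [exact: lvt|apply: gauge_int_ge0; exact: ltW].
  have [N _ hN] := nbhs_infty_ger (1 + M).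
  exists (ball t delta, [set n | (N <= n)%N]); first by split; [exact: nbhsx_ballx|exists N].
  move=> [s n] /= [ts Nn] sT; have [mvs _] := vg s sT.
  have sd : `|s - t| < delta by move: ts; rewrite /ball/= distrC.
  have -> : v s = (fun x => (v s x - v t x) + v t x) by apply/funext => x; rewrite subrK.
  have md : measurable_fun setT (fun x => v s x - v t x) by exact: measurable_funB.
  apply: le_trans (gauge_intD m p1 (ltW b0) md mvt) _.
  apply: (@le_trans _ _ (1 + M%:E)%E); first by rewrite ME leeD2r// hd.
  by rewrite -EFinD lee_fin; exact: hN.
exists N%:R => // t t0T; apply: (hN N) => //=.
Qed.

Lemma nonlin_smoothing q (v : T -> R) B t x : 0 < t <= 1 -> q = lam + 1 -> measurable_fun setT v ->
  (gauge_int m p ((2 * A)%:R * q) v <= B%:E)%E ->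
  (\int[m]_y (K t x y * (1 + gauge p q (v y)))%:E <= ((2 + CK * B) / Num.sqrt t)%:E)%E.
Proof.
by move=> t01 qE mv vB; apply: (smoothing_gauge reg x t01 mv _ vB); rewrite qE addr_ge0// ltW.
Qed.

Lemma kapply_nonlin_le (v : T -> R) B t x : 0 < t <= 1 -> measurable_fun setT v ->
  (gauge_int m p ((2 * A)%:R * (lam + 1)) v <= B%:E)%E ->
  `|kapply m (K t) (f \o v) x| <= 2 * C * ((2 + CK * B) / Num.sqrt t).
Proof.
move=> t01 mv vB; have mfv : measurable_fun setT (f \o v) by exact: measurableT_comp.
have c0 : 0 <= 2 * C by rewrite mulr_ge0// ltW.
have l0 : 0 <= lam + 1 by rewrite addr_ge0// ltW.
have mKx := regular_mKx reg t x; have K0 := reg_K0 reg t x.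
have mg := measurable_gauge p (lam + 1) mv.
have mKg : measurable_fun setT (fun y => K t x y * (1 + gauge p (lam + 1) (v y))).
  by apply: measurable_funM => //; exact: measurable_funD.
rewrite -lee_fin; apply: le_trans (kapply_norm_le reg t x mfv) _.
apply: (@le_trans _ _ (\int[m]_y ((2 * C)%:E * (K t x y * (1 + gauge p (lam + 1) (v y)))%:E))%E).
  apply: le_integralT.
  - apply/measurable_EFinP; apply: measurable_funM => //.
    exact: (measurableT_comp (@normr_measurable _ setT)).
  - by apply: emeasurable_funM => //; exact/measurable_EFinP.
  - by move=> y; rewrite lee_fin mulr_ge0.
  - move=> y; rewrite -EFinM lee_fin mulrCA ler_wpM2l//.
    exact: (nonlin_le p1 f0 C0 lam0 flip).
rewrite integralZT; [| |by move=> y; rewrite lee_fin mulr_ge0// addr_ge0// gauge_ge0|exact: c0].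
  by rewrite [leRHS]EFinM lee_wpmul2l// nonlin_smoothing.
exact/measurable_EFinP.
Qed.

Lemma kapply_nonlin_diff (v u : T -> R) B t x Delta : 0 < t <= 1 -> in_gauge m p v -> in_gauge m p u ->
  (gauge_int m p ((2 * A)%:R * (lam + 1)) v <= B%:E)%E ->
  (gauge_int m p ((2 * A)%:R * (lam + 1)) u <= B%:E)%E -> 0 <= Delta ->
  {ae m, forall y, `|v y - u y| <= Delta} ->
  `|kapply m (K t) (f \o v) x - kapply m (K t) (f \o u) x| <=
    2 * C * ((2 + CK * B) / Num.sqrt t) * Delta.
Proof.
move=> t01 [mv lv] [mu lu] vB uB D0 vu.
have mfv : measurable_fun setT (f \o v) by exact: measurableT_comp.
have mfu : measurable_fun setT (f \o u) by exact: measurableT_comp.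
have l0 : 0 < lam + 1 by rewrite addr_gt0.
have iv := integrable_weight_nonlin reg p1 f0 C0 lam0 flip mv (lv _ l0).
have iu := integrable_weight_nonlin reg p1 f0 C0 lam0 flip mu (lu _ l0).
rewrite -(semigroupB reg t x iv mfv iu mfu).
have md : measurable_fun setT (fun y => (f \o v) y - (f \o u) y) by exact: measurable_funB.
have mKx := regular_mKx reg t x; have K0 := reg_K0 reg t x.
have mgv := measurable_gauge p (lam + 1) mv; have mgu := measurable_gauge p (lam + 1) mu.
have g0 z : 0 <= gauge p (lam + 1) z by rewrite gauge_ge0// ltW.
pose gv y := K t x y * (1 + gauge p (lam + 1) (v y)).
pose gu y := K t x y * (1 + gauge p (lam + 1) (u y)).
have mEv : measurable_fun setT (fun y => (gv y)%:E).
  by apply/measurable_EFinP; apply: measurable_funM => //; exact: measurable_funD.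
have mEu : measurable_fun setT (fun y => (gu y)%:E).
  by apply/measurable_EFinP; apply: measurable_funM => //; exact: measurable_funD.
have gv0 y : (0 <= (gv y)%:E)%E by rewrite lee_fin mulr_ge0// addr_ge0.
have gu0 y : (0 <= (gu y)%:E)%E by rewrite lee_fin mulr_ge0// addr_ge0.
have c0 : 0 <= C * Delta by rewrite mulr_ge0// ltW.
rewrite -lee_fin; apply: le_trans (kapply_norm_le reg t x md) _.
apply: (@le_trans _ _ (\int[m]_y ((C * Delta)%:E * ((gv y)%:E + (gu y)%:E)))%E).
  apply: ae_ge0_le_integral => //.
  - by move=> y _; rewrite lee_fin mulr_ge0.
  - apply/measurable_EFinP; apply: measurable_funM => //.
    exact: (measurableT_comp (@normr_measurable _ setT) md).
  - by move=> y _; rewrite mule_ge0// adde_ge0.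
  - by apply: emeasurable_funM => //; exact: emeasurable_funD.
  - apply: filterS vu => y vuy _; rewrite -EFinD -EFinM lee_fin.
    have key z : expR (lam * `|z| `^ p) <= 1 + gauge p (lam + 1) z.
      rewrite gaugeE addrC subrK ler_expR ler_wpM2r ?powR_ge0//; lra.
    have h : `|f (v y) - f (u y)| <= C * Delta * ((1 + gauge p (lam + 1) (v y)) + (1 + gauge p (lam + 1) (u y))).
      apply: le_trans (flip _ _) _; apply: ler_pM; rewrite ?mulr_ge0 ?(ltW C0)//.
      - by rewrite ler_wpM2l// ltW.
      - by rewrite lerD.
    apply: le_trans (ler_wpM2l (K0 y) h) _; rewrite /gv /gu le_eqVlt; apply/orP; left; apply/eqP; ring.
rewrite integralZT; [|exact: emeasurable_funD|by move=> y; rewrite adde_ge0|exact: c0].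
rewrite (integralDT m mEv mEu gv0 gu0).
pose S := (2 + CK * B) / Num.sqrt t.
apply: (@le_trans _ _ ((C * Delta)%:E * (S%:E + S%:E))%E).
  by apply: lee_wpmul2l => //; apply: leeD; exact: nonlin_smoothing.
by rewrite -EFinD -EFinM lee_fin /S le_eqVlt; apply/orP; left; apply/eqP; ring.
Qed.

Variables (u0 : T -> R) (v u : R -> T -> R).
Hypotheses (vg : forall t, 0 <= t <= T0 -> in_gauge m p (v t)) (vc : gauge_continuous m p T0 v).
Hypotheses (ug : forall t, 0 <= t <= T0 -> in_gauge m p (u t)) (uc : gauge_continuous m p T0 u).
Hypothesis vmild : forall t, 0 <= t <= T0 -> {ae m, forall x, mild_at m K f u0 v t x}.
Hypothesis umild : forall t, 0 <= t <= T0 -> {ae m, forall x, mild_at m K f u0 u t x}.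

(** Instead of a supremum of |v - u| over time and almost every point, a bound A0 2^(-n) e^(gam s)
    is improved step by step: the case n = 0 is the smoothing estimate for each solution, and the
    induction step is the weighted contraction. *)
Theorem mild_uniqueness t : 0 <= t <= T0 -> {ae m, forall x, v t x = u t x}.
Proof.
have q0 : 0 < (2 * A)%:R * (lam + 1).
  by rewrite mulr_gt0// ?addr_gt0// ltr0n muln_gt0 (reg_A0 reg).
have [B1 B10 hB1] := gauge_sup q0 vg vc; have [B2 B20 hB2] := gauge_sup q0 ug uc.
pose B := Num.max B1 B2.
have vB s : 0 <= s <= T0 -> (gauge_int m p ((2 * A)%:R * (lam + 1)) (v s) <= B%:E)%E.
  by move=> sT; apply: le_trans (hB1 s sT) _; rewrite lee_fin le_max lexx.
have uB s : 0 <= s <= T0 -> (gauge_int m p ((2 * A)%:R * (lam + 1)) (u s) <= B%:E)%E.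
  by move=> sT; apply: le_trans (hB2 s sT) _; rewrite lee_fin le_max lexx orbT.
have B0 : 0 <= B by rewrite le_max B10.
have [S S0 SE] : exists2 S : R, 0 < S & S = 2 * C * (2 + CK * B).
  exists (2 * C * (2 + CK * B)) => //; rewrite !mulr_gt0// ltr_pwDl// mulr_ge0// ltW//.
  exact: reg_C0 reg.
have SsE r : 2 * C * ((2 + CK * B) / Num.sqrt r) = S / Num.sqrt r by rewrite SE mulrA.
(* Then gam^(-1/4) S = 1/16, and the integral of the singular kernel, at most 8, leaves the ratio
   1/2. *)
pose gam := (16 * S) ^+ 4.
have S16 : 0 < 16 * S by rewrite mulr_gt0.
have gam0 : 0 < gam by rewrite exprn_gt0.
have gamE : gam `^ (- 4^-1) = (16 * S)^-1.
  by rewrite powRN /gam -powR_mulrn ?ltW// -powRrM divff// powRr1// ltW.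
(* Twice the bound 8 S on the Duhamel integral of either solution. *)
pose A0 := 16 * S.
have tq s : 0 < s <= T0 -> s `^ 4^-1 <= 1.
  move=> /andP[s0 sT]; have e1 : (1 : R) `^ 4^-1 = 1 by rewrite powR1.
  rewrite -[leRHS]e1.
  by apply: ge0_ler_powR; rewrite ?nnegrE ?(ltW s0)//; exact: le_trans sT T01.
have inT s r : 0 < r < s -> 0 <= s <= T0 -> 0 <= r <= T0 /\ 0 < s - r <= 1.
  move=> /andP[r0 rs] /andP[s0 sT]; rewrite (ltW r0) subr_gt0 rs (ltW (lt_le_trans rs sT)).
  by split=> //; have h := T01; rewrite /= lerBlDr; apply: le_trans sT (le_trans h _); rewrite lerDl ltW.
have main n : forall s, 0 <= s <= T0 ->
    {ae m, forall x, `|v s x - u s x| <= A0 * (1 / 2) ^+ n * expR (gam * s)}.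
  elim: n => [|n IH] s sT; have vs := vmild sT; have us := umild sT; have /andP[s0 sT'] := sT.
    apply: filterS2 vs us => x [H [HE iH ->]] [H' [HE' iH' ->]].
    have E1 : 1 <= expR (gam * s) by rewrite -expR0 ler_expR mulr_ge0// ltW.
    rewrite expr0 mulr1 /A0.
    have -> : heat m K s u0 x + (\int[leb]_(r in `[0%R, s]) H r)%R -
      (heat m K s u0 x + (\int[leb]_(r in `[0%R, s]) H' r)%R) =
      (\int[leb]_(r in `[0%R, s]) H r)%R - (\int[leb]_(r in `[0%R, s]) H' r)%R by ring.
    have [->|sn0] := eqVneq s 0.
      by rewrite set_itv1 !Rintegral_set1 subrr normr0 mulr_ge0 ?expR_ge0// ltW.
    have sp : 0 < s by rewrite lt_neqAle eq_sym sn0.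
    have bnd (w : R -> T -> R) (G : R -> R) : (forall r, 0 <= r <= T0 -> in_gauge m p (w r)) ->
        (forall r, 0 <= r <= T0 -> (gauge_int m p ((2 * A)%:R * (lam + 1)) (w r) <= B%:E)%E) ->
        (forall r, 0 < r < s -> G r = kapply m (K (s - r)) (f \o w r) x) ->
        leb.-integrable `[0, s] (EFin \o G) -> `|(\int[leb]_(r in `[0%R, s]) G r)%R| <= S * 8.
      move=> wg wB GE iG.
      have h r : 0 < r < s -> `|G r| <= S * singular s r.
        move=> rs; have [rT sr] := inT s r rs sT; have [mw _] := wg r rT; rewrite GE//.
        apply: le_trans (kapply_nonlin_le x sr mw (wB r rT)) _; rewrite SsE.
        by rewrite ler_wpM2l ?(ltW S0)//; apply: singular_sqrt => //; exact: le_trans sT' T01.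
      apply: le_trans (interior_singular_bound sp (ltW S0) iG h) _.
      by rewrite ler_wpM2l ?(ltW S0)// -[leRHS]mulr1 ler_wpM2l// tq// sp.
    have h1 := bnd v H vg vB HE iH; have h2 := bnd u H' ug uB HE' iH'.
    apply: le_trans (ler_normB _ _) _; nra.
  apply: filterS2 vs us => x [H [HE iH ->]] [H' [HE' iH' ->]].
  have -> : heat m K s u0 x + (\int[leb]_(r in `[0%R, s]) H r)%R -
      (heat m K s u0 x + (\int[leb]_(r in `[0%R, s]) H' r)%R) =
      (\int[leb]_(r in `[0%R, s]) H r)%R - (\int[leb]_(r in `[0%R, s]) H' r)%R by ring.
  have [E E0 EE] : exists2 E : R, 0 <= E & E = A0 * (1 / 2) ^+ n * expR (gam * s).
    exists (A0 * (1 / 2) ^+ n * expR (gam * s)) => //.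
    by rewrite !mulr_ge0 ?exprn_ge0 ?expR_ge0 ?(ltW S0).
  have -> : A0 * (1 / 2) ^+ n.+1 * expR (gam * s) = E / 2 by rewrite EE exprSr; field.
  have [->|sn0] := eqVneq s 0.
    by rewrite set_itv1 !Rintegral_set1 subrr normr0 divr_ge0.
  have sp : 0 < s by rewrite lt_neqAle eq_sym sn0.
  have iHH : leb.-integrable `[0, s] (EFin \o (fun r => H r - H' r)).
    rewrite (_ : _ \o _ = (fun r => (H r)%:E - (H' r)%:E)%E); last first.
      by apply/funext => r /=; rewrite EFinB.
    exact: integrableB.
  rewrite -RintegralB//.
  have c0 : 0 <= E / 16 by rewrite divr_ge0.
  have h r : 0 < r < s -> `|H r - H' r| <= E / 16 * singular s r.
    move=> rs; have [rT sr] := inT s r rs sT; have /andP[r0 r_s] := rs.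
    rewrite HE// HE'//.
    have D0 : 0 <= A0 * (1 / 2) ^+ n * expR (gam * r).
      by rewrite !mulr_ge0 ?exprn_ge0 ?expR_ge0 ?(ltW S0).
    apply: le_trans (kapply_nonlin_diff x sr (vg rT) (ug rT) (vB r rT) (uB r rT) D0 (IH r rT)) _.
    (* Moves the weight from r to s; the leftover exponential meets the singularity in
       [singular_weighted]. *)
    rewrite SsE; have -> : expR (gam * r) = expR (gam * s) * expR (- (gam * (s - r))).
      by rewrite -expRD; congr expR; ring.
    have -> : S / Num.sqrt (s - r) * (A0 * (1 / 2) ^+ n * (expR (gam * s) * expR (- (gam * (s - r))))) =
      S * E * (expR (- (gam * (s - r))) / Num.sqrt (s - r)) by rewrite EE; ring.
    apply: le_trans (ler_wpM2l (mulr_ge0 (ltW S0) E0) (singular_weighted gam0 rs)) _.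
    rewrite gamE mulrA ler_wpM2r ?singular_ge0// le_eqVlt; apply/orP; left; apply/eqP.
    by field; rewrite gt_eqF.
  apply: le_trans (interior_singular_bound sp c0 iHH h) _.
  have := tq s; rewrite sp sT' => /(_ isT) sq.
  have -> : E / 16 * (8 * s `^ 4^-1) = E / 2 * s `^ 4^-1 by field.
  by rewrite ler_piMr// divr_ge0.
(* At a fixed time only countably many null sets occur, one for each n. *)
move=> tT; have := ae_foralln (fun n => main n t tT).
apply: filterS => x hx; apply/eqP; rewrite -subr_eq0 -normr_le0.
have c : (fun n => A0 * (1 / 2) ^+ n * expR (gam * t)) @ \oo --> (0 : R).
  rewrite -(mul0r (expR (gam * t))) -(mulr0 A0); apply: cvgMr_tmp; apply: cvgMl_tmp.
  by apply: cvg_expr; rewrite ger0_norm; lra.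
rewrite -(cvg_lim (@Rhausdorff R) c); apply: limr_ge; first by apply/cvg_ex; exists 0.
exact: nearW.
Qed.

End mild_uniqueness.

(** * The fractional Hermite equation *)

Section concrete_spaces.
Context {R : realType} {d : nat}.
Local Notation mR := (measurableTypeR R).
Local Notation Rd := (d.-tuple mR).
Local Notation mu := (@lebesgue_tuple R d).
Implicit Types (x y : Rd) (t s a b : R) (g w : Rd -> R).

Lemma regularizing_fker (beta : R) : (1 <= d)%N -> 0 < beta <= 1 ->
  exists A CK, regularizing mu (@decay R d) (fker beta) A CK.
Proof.
move=> d1 b01; have [A [C [A0 C0 kle]]] := @fker_le R d beta d1 b01.
exists A, C; apply: Regularizing => //.
- by move=> x; exact: decay_gt0.
- by move=> x; exact: decay_le1.
- exact: integrable_decay.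
- exact: (measurable_fker d1 b01).
- by move=> t x y; exact: (fker_ge0 d1 b01).
- by move=> t x y; exact: fkerC.
- by move=> t x; exact: (fker_mass d1 b01).
- by move=> t x y t0; rewrite /fker ltNge t0.
- by move=> delta D0; exact: (fker_lip d1 b01 D0).
- by move=> g ig e e0; exact: (fker_L1_continuous d1 b01 ig e0).
Qed.

(** Argues on simple functions, with no measurability assumption: the sets in [L1loc] come with
    compactness of their image rather than with measurability. *)
Lemma ge0_le_integral_subset (D : set Rd) (f g : Rd -> \bar R) :
  (forall x, D x -> 0 <= f x)%E -> (forall x, 0 <= g x)%E ->
  (forall x, D x -> f x <= g x)%E -> (\int[mu]_(x in D) f x <= \int[mu]_x g x)%E.
Proof.
move=> f0 g0 fg; rewrite ge0_integralE// ge0_integralTE//.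
apply: ge_ereal_sup => _ [h /= hf <-]; apply: ereal_sup_ubound; exists h => //= x.
apply: le_trans (hf x) _; rewrite patchE; case: ifPn => [|_]; last exact: g0.
by rewrite inE => /fg.
Qed.

(** Each coordinate is a continuous function on the compact image, hence bounded, which keeps the
    weight away from 0. *)
Lemma compact_decay (K : set Rd) :
  compact [set \row_(i < d) (tnth x i : R) | x in K] ->
  exists2 c : R, 0 < c & forall x, K x -> 1 <= c * decay x.
Proof.
move=> cK.
have hi (i : 'I_d) : exists2 M : R, 0 < M & forall x, K x -> `|tnth x i : R| <= M.
  have : compact ((fun M : 'rV[R]_d => M ord0 i) @` [set \row_(i < d) (tnth x i : R) | x in K]).
    apply: continuous_compact => //; apply: continuous_subspaceT.
    by move=> M; exact: coord_continuous.
  move=> /(@compact_bounded R R^o) /pinfty_ex_gt0[M M0 hM]; exists M => // x Kx.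
  by apply: (hM (tnth x i)); exists (\row_i (tnth x i : R)); [exists x|rewrite mxE].
have /choice[M hM] : forall i : 'I_d, exists M : R, 0 < M /\ forall x, K x -> `|tnth x i : R| <= M.
  by move=> i; have [M M0 h] := hi i; exists M.
exists (\prod_(i < d) (1 + M i ^+ 2)) => [|x Kx].
  by apply: prodr_gt0 => i _; have := sqr_ge0 (M i); lra.
rewrite /decay -big_split/=.
apply: (@le_trans _ _ (\prod_(i < d) (1 : R))); first by rewrite big1_eq.
apply: ler_prod => i _; rewrite ler01/=.
have h := sqr_ge0 (tnth x i : R).
rewrite ler_pdivlMr ?mul1r ?lerD2l; last by lra.
by rewrite -real_normK ?num_real// lerXn2r ?nnegrE ?(ltW (hM i).1)//; exact: (hM i).2.
Qed.

Variable p : R.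
Hypothesis p1 : 1 < p.

Lemma gauge_int_expR a g :
  gauge_int mu p a g = (\int[mu]_x (expR (a * (`|g x| `^ p)) - 1)%:E)%E.
Proof. by rewrite gauge_intE; apply: eq_integral => x _; rewrite gaugeE. Qed.

Lemma in_gauge_L1loc g : in_gauge mu p g -> L1loc g.
Proof.
move=> [mg hg]; split => // K /compact_decay[c c0 hc].
apply/integrableP; split; first by apply/measurable_EFinP; exact: measurable_funTS.
have md := @measurable_decay R d.
have mgg := measurable_gauge p 1 mg.
apply: (@le_lt_trans _ _ (\int[mu]_x (c%:E * (decay x)%:E + (gauge p 1 (g x))%:E))%E).
  apply: ge0_le_integral_subset => x.
  - by move=> _; rewrite abse_ge0.
  - by rewrite -EFinM -EFinD lee_fin addr_ge0 ?gauge_ge0// mulr_ge0 ?(ltW c0)// ltW// decay_gt0.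
  - move=> Kx /=; rewrite -EFinM -EFinD lee_fin.
    by apply: (le_trans (norm_le_pow p1 (g x))); apply: lerD; [exact: hc|exact: pow_le_gauge].
rewrite integralDT; [|..].
- rewrite integralZT; [|by apply/measurable_EFinP| |exact: ltW].
  + rewrite lte_add_pinfty//; last by rewrite -gauge_intE; exact: hg.
    rewrite lte_mul_pinfty ?lee_fin ?(ltW c0)//.
    exact: integral_decay_lty.
  + by move=> x; rewrite lee_fin ltW// decay_gt0.
- by apply: emeasurable_funM => //; apply/measurable_EFinP.
- by apply/measurable_EFinP.
- by move=> x; rewrite -EFinM lee_fin mulr_ge0 ?(ltW c0)// ltW// decay_gt0.
- by move=> x; rewrite lee_fin gauge_ge0.
Qed.

Lemma expLp0E g : expLp0 p g <-> in_gauge mu p g.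
Proof.
split=> [[[mg _] h]|h].
  by split=> // b b0; rewrite gauge_int_expR; exact: h.
split; first exact: in_gauge_L1loc.
by move=> a a0; rewrite -gauge_int_expR; exact: h.2.
Qed.

Lemma luxemburg_norm_ge0 w : (0 <= luxemburg_norm p w)%E.
Proof. by apply: le_ereal_inf_tmp => _ [m /= [m0 _] <-]; rewrite lee_fin ltW. Qed.

Lemma gauge_int_luxemburg (m : R) w :
  (\int[mu]_x (expR ((`|w x| `^ p) / (m `^ p)) - 1)%:E = gauge_int mu p (m `^ p)^-1 w)%E.
Proof. by rewrite gauge_int_expR; apply: eq_integral => x _; rewrite mulrC. Qed.

Lemma luxemburg_norm_le (m : R) w : 0 < m ->
  (gauge_int mu p (m `^ p)^-1 w <= 1)%E -> (luxemburg_norm p w <= m%:E)%E.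
Proof.
by move=> m0 h; apply: ereal_inf_lbound; exists m => //; split => //; rewrite gauge_int_luxemburg.
Qed.

(** A strict inequality yields an admissible constant below m, so the question of attaining the
    infimum does not arise. *)
Lemma luxemburg_norm_lt (m : R) w : 0 < m -> measurable_fun setT w ->
  (luxemburg_norm p w < m%:E)%E -> (gauge_int mu p (m `^ p)^-1 w <= 1)%E.
Proof.
move=> m0 mw /ereal_inf_lt[_ [k /= [k0 hk] <-]]; rewrite lte_fin => km.
apply: le_trans hk; rewrite gauge_int_luxemburg !gauge_intE.
have p0 : 0 < p := lt_trans ltr01 p1.
have pm0 (c : R) : 0 < c -> 0 < c `^ p by move=> ?; exact: powR_gt0.
apply: le_integralT => [||x|x].
- by apply/measurable_EFinP; exact: measurable_gauge.
- by apply/measurable_EFinP; exact: measurable_gauge.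
- by rewrite lee_fin gauge_ge0// invr_ge0 ltW// pm0.
- rewrite lee_fin; apply: gauge_lel.
  rewrite lef_pV2 ?posrE ?pm0//; apply: ge0_ler_powR; rewrite ?nnegrE ?(ltW p0) ?(ltW k0) ?(ltW m0)//.
  exact: ltW.
Qed.

Lemma continuous_expLp0E (T : R) (u : R -> Rd -> R) : 0 < T ->
  continuous_expLp0 p T u <->
  (forall t, 0 <= t <= T -> in_gauge mu p (u t)) /\ gauge_continuous mu p T u.
Proof.
move=> T0; have itv s : (s \in `[0, T]) = (0 <= s <= T) by rewrite in_itv.
have PF t : 0 <= t <= T -> ProperFilter (within `[0, T] (nbhs t)).
  by move=> tT; apply: within_nbhs_proper; apply: subset_closure; rewrite /= itv.
split=> [[h1 h2]|[h1 h2]].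
  have ug t : 0 <= t <= T -> in_gauge mu p (u t) by rewrite -itv => /h1/expLp0E.
  split=> // t b tT b0; have FF := PF t tT.
  have p0 : 0 < p := lt_trans ltr01 p1.
  (* The norm level whose gauge parameter is b; half of it is used below to obtain the strict
     inequality. *)
  pose m : R := b^-1 `^ p^-1.
  have m0 : 0 < m by rewrite powR_gt0// invr_gt0.
  have mb : (m `^ p)^-1 = b.
    by rewrite /m -powRrM mulVf ?gt_eqF// powRr1 ?invrK// invr_ge0 ltW.
  have tI : t \in `[0, T] by rewrite itv.
  have m2 : 0 < m / 2 by rewrite divr_gt0.
  have := (cvge0P (fun s => luxemburg_norm_ge0 (u s \- u t))).2 (h2 t tI) _ m2.
  rewrite near_withinE => /(_ FF) H; have [e /= e0 he] := (nbhs_ballP _ _).1 H; exists e => // s sT st.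
  rewrite -mb; apply: luxemburg_norm_lt => //.
    by apply: measurable_funB; [have [] := ug _ sT|have [] := ug _ tT].
  apply: (@le_lt_trans _ _ (m / 2)%:E).
    by apply: (he s); [rewrite -ball_normE /= distrC|rewrite /= itv].
  by rewrite lte_fin; lra.
split=> [t|t]; rewrite itv => tT; first by apply/expLp0E; exact: h1.
have FF := PF t tT.
apply: (cvge0P (fun s => luxemburg_norm_ge0 (u s \- u t))).1 => e e0.
have c0 : 0 < (e `^ p)^-1 by rewrite invr_gt0 powR_gt0.
have [delta D0 hD] := h2 t _ tT c0.
rewrite near_withinE; apply/nbhs_ballP; exists delta => //= s st; rewrite itv => sT.
by apply: luxemburg_norm_le => //; apply: hD => //; rewrite distrC.
Qed.

End concrete_spaces.

Theorem theorem1p1 (R : realType) (d : nat) (beta p : R) (f : R -> R)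
    (C lambda : R) (u0 : d.-tuple (measurableTypeR R) -> R) :
  (1 <= d)%N -> 0 < beta -> beta <= 1 -> 1 < p ->
  f 0 = 0 -> 0 < C -> 0 < lambda ->
  (forall u v : R, `|f u - f v| <=
    C * `|u - v| *
    (expR (lambda * (`|u| `^ p)) + expR (lambda * (`|v| `^ p)))) ->
  expLp0 p u0 ->
  exists T : R, 0 < T /\
    exists u : R -> d.-tuple (measurableTypeR R) -> R,
      mild_solution beta p f u0 T u /\
      forall v : R -> d.-tuple (measurableTypeR R) -> R,
        mild_solution beta p f u0 T v ->
        forall t : R, t \in `[0, T] ->
          {ae lebesgue_tuple d, forall x, v t x = u t x}.
Proof.
move=> d1 b0 b1 p1 f0 C0 lam0 flip /(expLp0E p1) u0g.
have b01 : 0 < beta <= 1 by rewrite b0.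
have [A [CK reg]] := @regularizing_fker R d beta d1 b01.
have heat0 t x : 0 <= t ->
    hermite_heat beta t u0 x = heat (lebesgue_tuple d) (fker beta) t u0 x.
  rewrite le_eqVlt => /predU1P[<-|t0]; first by rewrite /hermite_heat /heat eqxx.
  rewrite /heat gt_eqF//; apply: (hermite_heatE d1 b0 _ t0); last exact: u0g.1.
  by apply: (integrable_weight reg p1 u0g.1); exact: u0g.2.
have heatf g t x : in_gauge (lebesgue_tuple d) p g -> 0 < t ->
    hermite_heat beta t (f \o g) x = kapply (lebesgue_tuple d) (fker beta t) (f \o g) x.
  move=> [mg hg] t0; apply: (hermite_heatE d1 b0 _ t0).
    apply: (integrable_weight_nonlin reg p1 f0 C0 lam0 flip mg); apply: hg.
    by rewrite addr_gt0.
  apply: (measurableT_comp (measurable_nonlin p1 C0 lam0 flip)); exact: mg.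
have [T /andP[T0 T1] [u [ug uc umild]]] := mild_existence reg p1 f0 C0 lam0 flip u0g.
have itv s : (s \in `[0, T]) = (0 <= s <= T) by rewrite in_itv.
have sT s t : t \in `[0, T] -> 0 < s < t -> 0 <= s <= T.
  rewrite itv => /andP[_ tT] /andP[s0 st]; rewrite (ltW s0)/=.
  exact: le_trans (ltW st) tT.
have ulm : mild_solution beta p f u0 T u.
  split; first by apply/(continuous_expLp0E p1 _ T0).
  move=> t tT; apply: aeW => x; have /andP[t0 _] : 0 <= t <= T by rewrite -itv.
  rewrite (heat0 _ _ t0); apply: umild; first by rewrite -itv.
  move=> s st; have /andP[_ st'] := st.
  by apply: heatf; [exact: ug (sT _ _ tT st)|rewrite subr_gt0].
have mild w : mild_solution beta p f u0 T w -> (forall t, 0 <= t <= T -> in_gauge (lebesgue_tuple d) p (w t)) ->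
    forall t, 0 <= t <= T -> {ae lebesgue_tuple d, forall x, mild_at (lebesgue_tuple d) (fker beta) f u0 w t x}.
  move=> [_ h] wg t tT; have tI : t \in `[0, T] by rewrite itv.
  have /andP[t0 _] := tT.
  apply: filterS (h t tI) => x [iH wE].
  (* The spectral integrand itself serves as H; it agrees with the kernel for s < t. *)
  exists (fun s => hermite_heat beta (t - s) (f \o w s) x); split => //.
    move=> s st; have /andP[_ st'] := st.
    by apply: heatf; [exact: wg (sT _ _ tI st)|rewrite subr_gt0].
  by rewrite wE (heat0 _ _ t0).
exists T; split => //; exists u; split => // v vm t; rewrite itv => tT.
have [vg vc] := (continuous_expLp0E p1 v T0).1 vm.1.
exact: (mild_uniqueness reg p1 f0 C0 lam0 flip T1 vg vc ug uc (mild v vm vg) (mild u ulm ug) tT).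
Qed.
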